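(* Let $k\geq 3$, $g\geq 1$, and let $\mu=(a_{1},\dots,a_{n})$ be a (possibly empty) tuple of nonzero integers with $\sum a_i=k(2g-2)$ and $a_{i}>-k$ for all $i$. The stratum $\Omega^{k}\mathcal{M}_{g}(\mu)$ parametrizing primitive $k$-differentials of type $\mu$ is empty if and only if $g=1$ and either $\mu=(1,-1)$ (up to order) or $\mu=\emptyset$.
   Context: A $k$-differential on a compact connected Riemann surface $X$ of genus $g$ is a nonzero meromorphic section $\xi$ of $K_X^{\otimes k}$. It is primitive if it is not a power $\eta^{k/d}$ of a $d$-differential $\eta$ with $d<k$, $d\mid k$. It is of type $\mu$ if the orders of its zeros and poles are exactly the entries of $\mu$ (with multiplicity). $\Omega^k\mathcal{M}_g(\mu)$ is the set of isomorphism classes of pairs $(X,\xi)$ with $X$ of genus $g$ and $\xi$ primitive of type $\mu$. *)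

(* Defs.v *)
From HB Require Import structures.
From mathcomp Require Import all_boot all_order all_algebra.
From mathcomp Require Import complex.
From mathcomp Require Import all_classical all_reals all_analysis.

Set Implicit Arguments.
Unset Strict Implicit.
Unset Printing Implicit Defensive.

Import numFieldNormedType.Exports.
Import Order.TTheory GRing.Theory Num.Theory.

Local Open Scope classical_set_scope.
Local Open Scope ring_scope.

(* Packing R[i] as a numFieldType is what gives it the norm topology. *)
Definition Cplx (R : realType) : numFieldType := R[i].

(* Differentiability below is over the field of complex numbers, that is,
   complex differentiability. *)
Definition holomorphic_at (R : realType) (f : Cplx R -> Cplx R) (z : Cplx R)
    : Prop :=
  \forall w \near z, derivable f w 1.

(* A nonzero germ of a meromorphic function has order n at p. The equation is
   required at p itself too: since 0^-1 = 0, it makes f p = 0 when n < 0 (the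
   conventional value at a pole), and f holomorphic at p when 0 <= n. *)
Definition has_order_at (R : realType) (f : Cplx R -> Cplx R) (p : Cplx R)
    (n : int) : Prop :=
  exists h : Cplx R -> Cplx R,
    [/\ holomorphic_at h p, h p != 0
      & \forall z \near p, f z = h z * (z - p) ^ n].

Definition meromorphic_at (R : realType) (f : Cplx R -> Cplx R) (p : Cplx R)
    : Prop :=
  (exists n : int, has_order_at f p n) \/ (\forall z \near p, f z = 0).

(* A homeomorphism from an open subset of X onto an open subset of the complex
   plane; cmap and cinv are irrelevant outside cdom and its image. *)
Record chart (R : realType) (X : topologicalType) : Type := Chart {
  cdom : set X;
  cmap : X -> Cplx R;
  cinv : Cplx R -> X;
  cdom_open : open cdom;
  cimg_open : open (cmap @` cdom);
  cmapK : forall x, cdom x -> cinv (cmap x) = x;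
  cmap_continuous : forall x, cdom x -> {for x, continuous cmap};
  cinv_continuous : forall x, cdom x -> {for cmap x, continuous cinv}
}.

Definition local_rep (R : realType) (X Y : topologicalType)
    (c : chart R X) (f : X -> Y) (d : chart R Y) : Cplx R -> Cplx R :=
  fun z => cmap d (f (cinv c z)).

Record compactRiemannSurface (R : realType) : Type := CompactRiemannSurface {
  points :> topologicalType;
  chart_index : Type;
  atlas : chart_index -> chart R points;
  atlas_cover : forall x, exists i, cdom (atlas i) x;
  atlas_compat : forall i j x, cdom (atlas i) x -> cdom (atlas j) x ->
    holomorphic_at (local_rep (atlas i) id (atlas j)) (cmap (atlas i) x);
  surface_nonempty : [set: points] !=set0;
  surface_hausdorff : hausdorff_space points;
  surface_compact : compact [set: points];
  surface_connected : connected [set: points]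
}.

(* A meromorphic section of the k-th power of the canonical bundle, written
   coef i (z) dz^k in the chart i. The zero section is included. *)
Record kDifferential (R : realType) (k : nat) (X : compactRiemannSurface R)
    : Type := KDifferential {
  coef : chart_index X -> Cplx R -> Cplx R;
  coef_meromorphic : forall i x, cdom (atlas i) x ->
    meromorphic_at (coef i) (cmap (atlas i) x);
  coef_change : forall i j x, cdom (atlas i) x -> cdom (atlas j) x ->
    coef i (cmap (atlas i) x) =
      coef j (cmap (atlas j) x) *
      (derive1 (local_rep (atlas i) id (atlas j)) (cmap (atlas i) x)) ^+ k
}.

Definition kdiff_nonzero (R : realType) (k : nat) (X : compactRiemannSurface R)
    (xi : kDifferential k X) : Prop :=
  exists i x, cdom (atlas i) x /\ coef xi i (cmap (atlas i) x) != 0.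

Definition kdiff_holomorphic (R : realType) (k : nat)
    (X : compactRiemannSurface R) (xi : kDifferential k X) : Prop :=
  forall i x, cdom (atlas i) x -> holomorphic_at (coef xi i) (cmap (atlas i) x).

(* g is the dimension of the space of holomorphic 1-differentials on X, i.e.
   this space has a basis with g elements. *)
Definition has_genus (R : realType) (X : compactRiemannSurface R) (g : nat)
    : Prop :=
  exists b : 'I_g -> kDifferential 1 X,
    (forall l, kdiff_holomorphic (b l)) /\
    (forall w : kDifferential 1 X, kdiff_holomorphic w ->
      exists! c : 'rV[Cplx R]_g,
        forall i x, cdom (atlas i) x ->
          coef w i (cmap (atlas i) x) =
            \sum_(l < g) c ord0 l * coef (b l) i (cmap (atlas i) x)).

Definition kdiff_is_power (R : realType) (k d : nat)
    (X : compactRiemannSurface R) (xi : kDifferential k X)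
    (eta : kDifferential d X) : Prop :=
  forall i x, cdom (atlas i) x ->
    coef xi i (cmap (atlas i) x) = coef eta i (cmap (atlas i) x) ^+ (k %/ d).

Definition kdiff_primitive (R : realType) (k : nat)
    (X : compactRiemannSurface R) (xi : kDifferential k X) : Prop :=
  forall (d : nat) (eta : kDifferential d X),
    (d < k)%N -> (d %| k)%N -> ~ kdiff_is_power xi eta.

Definition kdiff_order (R : realType) (k : nat) (X : compactRiemannSurface R)
    (xi : kDifferential k X) (x : X) (m : int) : Prop :=
  exists2 i, cdom (atlas i) x & has_order_at (coef xi i) (cmap (atlas i) x) m.

Definition kdiff_type (R : realType) (k n : nat) (X : compactRiemannSurface R)
    (xi : kDifferential k X) (mu : n.-tuple int) : Prop :=
  exists p : 'I_n -> X,
    [/\ injective p,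
        forall l, kdiff_order xi (p l) (tnth mu l)
      & forall x m, kdiff_order xi x m -> m != 0 -> exists l, x = p l].

Record kPair (R : realType) (k : nat) : Type := KPair {
  pair_surface : compactRiemannSurface R;
  pair_diff : kDifferential k pair_surface
}.

Definition holomorphic_map (R : realType) (X Y : compactRiemannSurface R)
    (f : X -> Y) : Prop :=
  continuous f /\
  forall i j x, cdom (atlas i) x -> cdom (atlas j) (f x) ->
    holomorphic_at (local_rep (atlas i) f (atlas j)) (cmap (atlas i) x).

Definition is_pullback (R : realType) (k : nat) (X Y : compactRiemannSurface R)
    (f : X -> Y) (eta : kDifferential k Y) (xi : kDifferential k X) : Prop :=
  forall i j x, cdom (atlas i) x -> cdom (atlas j) (f x) ->
    coef xi i (cmap (atlas i) x) =
      coef eta j (cmap (atlas j) (f x)) *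
      (derive1 (local_rep (atlas i) f (atlas j)) (cmap (atlas i) x)) ^+ k.

Definition kpair_iso (R : realType) (k : nat) (P Q : kPair R k) : Prop :=
  exists (f : pair_surface P -> pair_surface Q)
         (f' : pair_surface Q -> pair_surface P),
    [/\ cancel f f', cancel f' f, holomorphic_map f, holomorphic_map f'
      & is_pullback f (pair_diff Q) (pair_diff P)].

(* The elements of the stratum are isomorphism classes of pairs, a class being
   given as a predicate on pairs. The type "set" of the library lives in a
   universe too small for kPair, hence the plain predicates. *)
Definition is_iso_class_of (R : realType) (k : nat) (P : kPair R k)
    (A : kPair R k -> Prop) : Prop :=
  forall Q : kPair R k, A Q <-> kpair_iso P Q.

Definition stratum (R : realType) (k g n : nat) (mu : n.-tuple int)
    (A : kPair R k -> Prop) : Prop :=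
  exists P : kPair R k,
    [/\ has_genus (pair_surface P) g,
        kdiff_nonzero (pair_diff P),
        kdiff_primitive (pair_diff P),
        kdiff_type (pair_diff P) mu
      & is_iso_class_of P A].

Definition stratum_empty (R : realType) (k g n : nat) (mu : n.-tuple int)
    : Prop :=
  forall A : kPair R k -> Prop, ~ stratum g mu A.

(* Submission.v *)
Require Import Defs.
From HB Require Import structures.
From mathcomp Require Import all_boot all_order all_algebra.
From mathcomp Require Import complex ring lra zify.
From mathcomp Require Import all_classical all_reals all_analysis.
Set Implicit Arguments.
Unset Strict Implicit.
Unset Printing Implicit Defensive.
Import numFieldNormedType.Exports.
Import Order.TTheory GRing.Theory Num.Theory.
Local Open Scope classical_set_scope.
Local Open Scope ring_scope.

                                                                                       
                                                                         
                                                                                          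
                                                                                        
                                                                                          
                                                                                    
                                                                                          
                                                                                          
                                                                                             
                                
                                                                                          
                                                                                          
                                                                    

                                  

(** Non-emptiness comes from an explicit k-differential on a hyperelliptic curve y^2 = f(x), where f
    has 2g+1 distinct real roots, so that there is one point at infinity. The form dx/y has no zero
    or pole except a zero of order 2g-2 at infinity. Outside the two exceptional types, sum |a_i| =
    2(g+d) with d > 0 ([order_budget]). Suppose that A^2 - lam prod (x - x_i)^|a_i| = B^2 f with deg
    A = g+d and deg B < d. The product is then the norm of A + By, so A + By vanishes to order |a_i|
    at one of the two points above each x_i, and nowhere else at finite distance. Dividing by the
    factors (x - x_i)^|a_i| with a_i < 0 trades such a zero for a pole of the same order at the
    conjugate point. The quotient times (dx/y)^k has order a_i at one point above each x_i, and
    order 0 at infinity because sum a_i = k(2g-2) ([kdiff_construction]).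

    The polynomials come from a weighted Chebyshev problem on [0,1]. The monic Q of degree d that
    alternates between the two signs of eps sqrt(P)/W at d+1 nodes ([equioscillation]) makes (WQ)^2
    - eps^2 P vanish at 0 and 1 and doubly at the inner nodes. The choice of W and P forces 2g
    further real roots, and the degree leaves room for nothing else. Inverting x sends the root 0 to
    infinity ([alternation_polys]).

    For primitivity, consider a segment between two neighbouring real branch points on which B^2 f <
    0 and A changes sign. Its preimage is a closed loop on the curve, and along it A + By = A + is
    and A - is winds once around 0; hence it has no continuous m-th root with m > 1
    ([band_contradiction], [primitive_of_band]).

    The genus of the curve is computed by splitting a function into its even and odd parts under y
    -> -y. Both descend to entire functions of x, to which Liouville's theorem applies
    ([hyp_function_polynomial], [hyp_genus]); the same lemma gives connectedness.

    For emptiness let g = 1, let w be a nonzero holomorphic form and put f = w^k/xi. If xi has no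
    zeros and poles, f is constant, and xi is a k-th power ([no_order_free]). If the type is (1,-1),
    f has one simple pole Q, and df/w satisfies a Riccati equation df/w = -(f-u)(f-u')/r with
    constant coefficients. Uniqueness for differential equations shows that f omits the value u, so
    1/(f-u) is holomorphic on the surface and vanishes at Q; being constant, it is 0, which is
    absurd ([no_simple_pole]).

    The complex analysis behind this (Goursat, Cauchy's formula, removable singularities, the
    maximum principle, Liouville) is developed from dyadic trapezoidal sums. *)

(** * Modulus, real and imaginary parts, and the topology of the complex plane *)

Section Modulus.
Variable R : realType.
Local Notation C := (Cplx R).
Implicit Types (x y r e d : R) (z w : C).

(** The norm of [Cplx R] takes values in [Cplx R] itself; [cabs] is its real-valued form, so that
    estimates live in an ordered field. *)
Definition cabs z : R := Normc.normc z.
Definition cofr x : C := Complex x 0.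
Definition cI : C := Complex 0 1.
Definition cRe z : R := complex.Re z.
Definition cIm z : R := complex.Im z.

Lemma normCE z : `|z| = cofr (cabs z) :> C.
Proof. by case: z. Qed.

Lemma cofr0 : cofr 0 = 0. Proof. by []. Qed.
Lemma cofr1 : cofr 1 = 1. Proof. by []. Qed.
Lemma cofrD x y : cofr (x + y) = cofr x + cofr y.
Proof. exact: (rmorphD (real_complex R)). Qed.
Lemma cofrN x : cofr (- x) = - cofr x.
Proof. exact: (rmorphN (real_complex R)). Qed.
Lemma cofrB x y : cofr (x - y) = cofr x - cofr y.
Proof. exact: (rmorphB (real_complex R)). Qed.
Lemma cofrM x y : cofr (x * y) = cofr x * cofr y.
Proof. exact: (rmorphM (real_complex R)). Qed.
Lemma cofrV x : cofr x^-1 = (cofr x)^-1.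
Proof. exact: (fmorphV (real_complex R)). Qed.
Lemma cofrX x n : cofr (x ^+ n) = cofr x ^+ n.
Proof. exact: (rmorphXn (real_complex R)). Qed.
Lemma cofr_nat n : cofr n%:R = n%:R.
Proof. exact: (rmorph_nat (real_complex R)). Qed.
Lemma cofr_inj : injective cofr. Proof. by move=> x y []. Qed.
Lemma cofr_le x y : (cofr x <= cofr y) = (x <= y). Proof. exact: lecR. Qed.
Lemma cofr_lt x y : (cofr x < cofr y) = (x < y). Proof. exact: ltcR. Qed.

Lemma cabs_ge0 z : 0 <= cabs z.
Proof. by rewrite -cofr_le -normCE normr_ge0. Qed.
Lemma cabs0 : cabs 0 = 0. Proof. by apply: cofr_inj; rewrite -normCE normr0. Qed.
Lemma cabs1 : cabs 1 = 1. Proof. by apply: cofr_inj; rewrite -normCE normr1. Qed.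
Lemma cabsN z : cabs (- z) = cabs z.
Proof. by apply: cofr_inj; rewrite -!normCE normrN. Qed.
Lemma cabsM z w : cabs (z * w) = cabs z * cabs w.
Proof. exact: Normc.normcM. Qed.
Lemma cabsV z : cabs z^-1 = (cabs z)^-1.
Proof. exact: Normc.normcV. Qed.
Lemma cabsX z n : cabs (z ^+ n) = cabs z ^+ n.
Proof. by apply: cofr_inj; rewrite cofrX -!normCE normrX. Qed.
Lemma cabsB z w : cabs (z - w) = cabs (w - z).
Proof. by rewrite -cabsN opprB. Qed.
Lemma cabsD z w : cabs (z + w) <= cabs z + cabs w.
Proof. by rewrite -cofr_le cofrD -!normCE ler_normD. Qed.
Lemma cabs_eq0 z : (cabs z == 0) = (z == 0).
Proof. by rewrite -[RHS]normr_eq0 normCE -cofr0 (inj_eq cofr_inj). Qed.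
Lemma cabs_gt0 z : (0 < cabs z) = (z != 0).
Proof. by rewrite lt_neqAle cabs_ge0 andbT eq_sym cabs_eq0. Qed.
Lemma cabs_cofr x : cabs (cofr x) = `|x|.
Proof. by rewrite /cabs /= expr0n addr0 sqrtr_sqr. Qed.
Lemma cabsDl z w : cabs z - cabs w <= cabs (z + w).
Proof. by rewrite lerBlDr; have := cabsD (z + w) (- w); rewrite addrK cabsN. Qed.
Lemma cabs_nat n : cabs n%:R = n%:R.
Proof. by rewrite -cofr_nat cabs_cofr ger0_norm. Qed.
Lemma cabs_triangle z w u : cabs (z - w) <= cabs (z - u) + cabs (u - w).
Proof. by rewrite -{1}(subrK u z) -addrA cabsD. Qed.

Lemma cRe_le z : `|cRe z| <= cabs z.
Proof. by rewrite -cofr_le -normCE; exact: normc_ge_Re. Qed.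
Lemma cIm_le z : `|cIm z| <= cabs z.
Proof.
rewrite /cabs /cIm; case: z => a b /=; rewrite -sqrtr_sqr ler_wsqrtr //.
by rewrite lerDr sqr_ge0.
Qed.
Lemma cabs_le z : cabs z <= `|cRe z| + `|cIm z|.
Proof.
case: z => a b; rewrite /cabs /=.
rewrite -[leRHS]ger0_norm ?addr_ge0 // -sqrtr_sqr ler_wsqrtr //.
rewrite sqrrD !real_normK ?num_real // [leRHS]addrAC lerDl.
by rewrite mulrn_wge0 // mulr_ge0.
Qed.
Lemma cReD z w : cRe (z + w) = cRe z + cRe w. Proof. by case: z; case: w. Qed.
Lemma cImD z w : cIm (z + w) = cIm z + cIm w. Proof. by case: z; case: w. Qed.
Lemma cReN z : cRe (- z) = - cRe z. Proof. by case: z. Qed.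
Lemma cImN z : cIm (- z) = - cIm z. Proof. by case: z. Qed.
Lemma cReM z w : cRe (z * w) = cRe z * cRe w - cIm z * cIm w.
Proof. by case: z; case: w. Qed.
Lemma cImM z w : cIm (z * w) = cRe z * cIm w + cIm z * cRe w.
Proof. by case: z; case: w. Qed.
Lemma complex_eq z w : cRe z = cRe w -> cIm z = cIm w -> z = w.
Proof. by case: z => a b; case: w => c d; rewrite /cRe /cIm /= => -> ->. Qed.

Lemma cabs_sqr z : cabs z ^+ 2 = cRe z ^+ 2 + cIm z ^+ 2.
Proof. by case: z => a b; rewrite /cabs /= sqr_sqrtr // addr_ge0 // sqr_ge0. Qed.

(** Balls have complex radii, but a positive complex number is real, so real radii give the same
    neighbourhoods. *)
Lemma nbhsCP z (A : set C) :
  nbhs z A <-> exists2 r, 0 < r & forall w, cabs (w - z) < r -> A w.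
Proof.
split.
  move=> /nbhs_ballP [e /= e0 H]; exists (cRe e).
    by move: e0; case: (e) => a b; rewrite ltcE => /andP[].
  move=> w wz; apply: H; rewrite /ball /= -normrN opprB normCE.
  suff -> : e = cofr (cRe e) by rewrite cofr_lt.
  by move: e0; case: (e) => a b; rewrite ltcE /= => /andP[/eqP -> _].
move=> [r r0 H]; apply/nbhs_ballP; exists (cofr r); first by rewrite /= cofr_lt.
by move=> w; rewrite /ball /= => h; apply: H; rewrite -cofr_lt -normCE -normrN opprB.
Qed.

Lemma continuousCP (T : topologicalType) (f : T -> C) (t : T) :
  {for t, continuous f} <->
  forall e, 0 < e -> nbhs t (fun u => cabs (f u - f t) < e).
Proof.
split=> [H e e0|H A].
  by apply: (H (fun w => cabs (w - f t) < e)); apply/nbhsCP; exists e.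
by move=> /nbhsCP [r r0 hA]; apply: filterS (H r r0) => u; exact: hA.
Qed.

End Modulus.
Arguments cI {R}.

(** * Complex derivatives with explicit error terms *)

Section Derivative.
Variable R : realType.
Local Notation C := (Cplx R).
Implicit Types (e d : R) (z w h l : C) (f g : C -> C).

(** The difference quotient with the denominator cleared: h = 0 is allowed, and the estimate
    composes well. *)
Definition has_cderiv f z l := forall e, 0 < e -> exists2 d, 0 < d &
  forall h, cabs h < d -> cabs (f (z + h) - f z - l * h) <= e * cabs h.

Definition ccont f z := forall e, 0 < e -> exists2 d, 0 < d &
  forall h, cabs h < d -> cabs (f (z + h) - f z) < e.

Lemma ccontP f z : ccont f z <-> {for z, continuous f}.
Proof.
split=> H.
  apply/continuousCP => e e0; have [d d0 hd] := H e e0.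
  apply/nbhsCP; exists d => // w wz.
  by have := hd _ wz; rewrite [z + _]addrC subrK.
move=> e e0; have /continuousCP /(_ e e0) /nbhsCP [d d0 hd] := H.
by exists d => // h hh; apply: hd; rewrite addrC addKr.
Qed.

Lemma derivable_diff_quot f z : derivable f z 1 =
  cvg ((fun h => h^-1 * (f (h + z) - f z)) @ (0 : C)^').
Proof.
rewrite /derivable; set u := (X in X @ _); set v := (X in _ = cvg (X @ _)).
suff -> : u = v by [].
by apply/funext => h; rewrite /u /v /GRing.scale /= mulr1.
Qed.

Lemma has_cderiv_cvg f z l : has_cderiv f z l <->
  (fun h => h^-1 * (f (h + z) - f z)) @ (0 : C)^' --> l.
Proof.
split=> H.
  move=> A /nbhsCP [r r0 hA].
  have [d d0 hd] := H (r / 2) ltac:(by rewrite divr_gt0).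
  apply/nbhsCP; exists d => // h; rewrite subr0 => hh h0; apply: hA.
  have -> : h^-1 * (f (h + z) - f z) - l = h^-1 * (f (z + h) - f z - l * h).
    by rewrite (addrC h z); field.
  rewrite cabsM cabsV; have hp : 0 < cabs h by rewrite cabs_gt0.
  rewrite mulrC ltr_pdivrMr //; apply: (le_lt_trans (hd h hh)).
  by rewrite ltr_pM2r // ltr_pdivrMr // ltr_pMr // ltr1n.
move=> e e0.
have /nbhsCP [d d0 hd] := H (fun w => cabs (w - l) < e)
   ltac:(by apply/nbhsCP; exists e).
exists d => // h hh; have [->|h0] := eqVneq h 0.
  by rewrite mulr0 subr0 addr0 subrr cabs0 mulr0.
have {hd} := hd h; rewrite subr0 => /(_ hh h0) /ltW.
have -> : f (z + h) - f z - l * h = (h^-1 * (f (h + z) - f z) - l) * h.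
  by rewrite (addrC h z); field.
by rewrite cabsM => ?; rewrite ler_wpM2r // cabs_ge0.
Qed.

Lemma has_cderivP f z l : has_cderiv f z l <-> derivable f z 1 /\ derive1 f z = l.
Proof.
split=> [/has_cderiv_cvg H|[H1 H2]].
  split; first by rewrite derivable_diff_quot; apply/cvg_ex; exists l.
  rewrite /derive1; apply: cvg_lim => //.
by apply/has_cderiv_cvg; rewrite -H2; rewrite derivable_diff_quot in H1.
Qed.

Lemma derivableCP f z : derivable f z 1 <-> exists l, has_cderiv f z l.
Proof.
split=> [H|[l /has_cderivP[]//]].
by exists (derive1 f z); apply/has_cderivP.
Qed.

Lemma has_cderiv_derive1 f z l : has_cderiv f z l -> derive1 f z = l.
Proof. by case/has_cderivP. Qed.

Lemma has_cderiv_uniq f z l l' : has_cderiv f z l -> has_cderiv f z l' -> l = l'.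
Proof. by move=> /has_cderivP[_ <-] /has_cderivP[_ <-]. Qed.

Lemma has_cderiv_near f g z l : (\forall w \near z, f w = g w) ->
  has_cderiv f z l -> has_cderiv g z l.
Proof.
move=> /nbhsCP [r r0 fg] H e e0; have [d d0 hd] := H e e0.
exists (Num.min d r); first by rewrite lt_min d0.
move=> h; rewrite lt_min => /andP[h1 h2].
by rewrite -!fg ?subrr ?cabs0 //; [exact: hd|rewrite addrC addKr].
Qed.

Lemma has_cderiv_ext f g z l : (forall w, f w = g w) ->
  has_cderiv f z l -> has_cderiv g z l.
Proof. by move=> /funext ->. Qed.

Lemma has_cderiv_eq f z l l' : has_cderiv f z l -> l = l' -> has_cderiv f z l'.
Proof. by move=> ? <-. Qed.

Lemma has_cderiv_bound f z l : has_cderiv f z l -> exists2 d, 0 < d &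
  forall h, cabs h < d -> cabs (f (z + h) - f z) <= (cabs l + 1) * cabs h.
Proof.
move=> /(_ 1 ltr01)[d d0 hd]; exists d => // h /hd; rewrite mul1r => H.
rewrite -(subrK (l * h) (f _ - f _)) (le_trans (cabsD _ _)) // mulrDl addrC.
by rewrite cabsM mul1r lerD.
Qed.

Lemma has_cderiv_ccont f z l : has_cderiv f z l -> ccont f z.
Proof.
move=> /has_cderiv_bound [d d0 hd] e e0.
have k0 : 0 < cabs l + 1 by rewrite ltr_wpDl // cabs_ge0.
exists (Num.min d (e / (cabs l + 1))); first by rewrite lt_min d0 divr_gt0.
move=> h; rewrite lt_min => /andP[/hd h1 h2]; apply: le_lt_trans h1 _.
by rewrite mulrC -ltr_pdivlMr.
Qed.

Lemma has_cderiv_cst c z : has_cderiv (fun=> c) z 0.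
Proof.
move=> e e0; exists 1 => // h _; rewrite subrr mul0r subr0 cabs0.
by rewrite mulr_ge0 ?cabs_ge0 // ltW.
Qed.

Lemma has_cderiv_id z : has_cderiv id z 1.
Proof.
move=> e e0; exists 1 => // h _; rewrite mul1r (addrC z) addrK subrr cabs0.
by rewrite mulr_ge0 ?cabs_ge0 // ltW.
Qed.

Lemma has_cderivD f g z l m : has_cderiv f z l -> has_cderiv g z m ->
  has_cderiv (fun w => f w + g w) z (l + m).
Proof.
move=> Hf Hg e e0; have e2 : 0 < e / 2 by rewrite divr_gt0.
have [d1 d10 h1] := Hf _ e2; have [d2 d20 h2] := Hg _ e2.
exists (Num.min d1 d2); first by rewrite lt_min d10.
move=> h; rewrite lt_min => /andP[/h1 {}h1 /h2 {}h2].
rewrite (_ : _ - _ = (f (z + h) - f z - l * h) + (g (z + h) - g z - m * h)); last by ring.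
rewrite (le_trans (cabsD _ _)) //; lra.
Qed.

Lemma has_cderiv_comp f g z l m : has_cderiv f z l -> has_cderiv g (f z) m ->
  has_cderiv (fun w => g (f w)) z (m * l).
Proof.
move=> Hf Hg e e0; have [d1 d10 h1] := has_cderiv_bound Hf.
set K := cabs l + 1; have K0 : 0 < K by rewrite ltr_wpDl // cabs_ge0.
set L := cabs m + 1; have L0 : 0 < L by rewrite ltr_wpDl // cabs_ge0.
have [d2 d20 h2] := Hf (e / (2 * L)) ltac:(by rewrite divr_gt0 // mulr_gt0).
have [d3 d30 h3] := Hg (e / (2 * K)) ltac:(by rewrite divr_gt0 // mulr_gt0).
exists (Num.min d1 (Num.min d2 (d3 / K))).
  by rewrite !lt_min d10 d20 divr_gt0.
move=> h; rewrite !lt_min => /and3P[/h1 {}h1 /h2 {}h2 h4].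
set k := f (z + h) - f z in h1 h2; rewrite -/K in h1.
have kd : cabs k < d3 by rewrite (le_lt_trans h1) // mulrC -ltr_pdivlMr.
have := h3 k kd; rewrite /k [f z + _]addrC subrK -/k => {}h3.
rewrite (_ : _ - _ = (g (f (z + h)) - g (f z) - m * k) + m * (k - l * h)); last by ring.
rewrite (le_trans (cabsD _ _)) // cabsM.
have a1 : e / (2 * K) * cabs k <= e / 2 * cabs h.
  rewrite (le_trans (ler_wpM2l _ h1)) //; first by rewrite ltW // divr_gt0 // mulr_gt0.
  by rewrite le_eqVlt; apply/orP; left; apply/eqP; field; rewrite gt_eqF.
have a2 : cabs m * cabs (k - l * h) <= e / 2 * cabs h.
  rewrite (@le_trans _ _ (L * (e / (2 * L) * cabs h))) //.
    by rewrite ler_pM ?cabs_ge0 // /L; lra.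
  by rewrite le_eqVlt; apply/orP; left; apply/eqP; field; rewrite gt_eqF.
lra.
Qed.

Lemma has_cderiv_sqr z : has_cderiv (fun w => w * w) z (z + z).
Proof.
move=> e e0; exists e => // h he.
rewrite (_ : _ - _ = h * h); last by ring.
by rewrite cabsM ler_wpM2r ?cabs_ge0 // ltW.
Qed.

Lemma has_cderivZ a f z l : has_cderiv f z l -> has_cderiv (fun w => a * f w) z (a * l).
Proof.
move=> Hf; apply: (@has_cderiv_comp f (fun w => a * w)) => // e e0; exists 1 => // h _.
rewrite (_ : _ - _ = 0); last by ring.
by rewrite cabs0 mulr_ge0 ?cabs_ge0 // ltW.
Qed.

Lemma has_cderivN f z l : has_cderiv f z l -> has_cderiv (fun w => - f w) z (- l).
Proof.
move=> /(has_cderivZ (-1)); rewrite mulN1r; apply: has_cderiv_ext => w.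
by rewrite mulN1r.
Qed.

Lemma has_cderivB f g z l m : has_cderiv f z l -> has_cderiv g z m ->
  has_cderiv (fun w => f w - g w) z (l - m).
Proof. by move=> Hf Hg; apply: has_cderivD => //; apply: has_cderivN. Qed.

                                                                                
(** Polarisation: 4fg = (f+g)^2 - (f-g)^2 reduces products to the chain rule and the derivative of
    the square. *)
Lemma has_cderivM f g z l m : has_cderiv f z l -> has_cderiv g z m ->
  has_cderiv (fun w => f w * g w) z (l * g z + f z * m).
Proof.
move=> Hf Hg.
have H1 := has_cderiv_comp (has_cderivD Hf Hg) (has_cderiv_sqr _).
have H2 := has_cderiv_comp (has_cderivB Hf Hg) (has_cderiv_sqr _).
have := has_cderivZ (4%:R^-1) (has_cderivB H1 H2) => /= H.
apply: has_cderiv_eq.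
  by apply: has_cderiv_ext H => w /=; field.
by field.
Qed.

Lemma has_cderiv_inv z : z != 0 -> has_cderiv (fun w => w^-1) z (- (z^-1 * z^-1)).
Proof.
move=> z0 e e0; have a0 : 0 < cabs z by rewrite cabs_gt0.
set a := cabs z in a0.
exists (Num.min (a / 2) (e * (a * a * a) / 2)).
  by rewrite lt_min !divr_gt0 // !mulr_gt0.
move=> h; rewrite lt_min => /andP[h1 h2].
have b : a / 2 <= cabs (z + h) by have := cabsDl z h; rewrite -/a; lra.
have b0 : 0 < cabs (z + h) by rewrite (lt_le_trans _ b) // divr_gt0.
have zh : z + h != 0 by rewrite -cabs_gt0.
have -> : (z + h)^-1 - z^-1 - - (z^-1 * z^-1) * h = h * h * (z^-1 * z^-1 * (z + h)^-1).
  by field; rewrite zh z0.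
rewrite !cabsM !cabsV -/a mulrC mulrA ler_wpM2r ?cabs_ge0 //.
have -> : a^-1 / a / cabs (z + h) * cabs h = cabs h / (a * a * cabs (z + h)).
  by field; rewrite !gt_eqF.
rewrite ler_pdivrMr ?mulr_gt0 // (le_trans (ltW h2)) //.
have -> : e * (a * a * a) / 2 = e * (a * a * (a / 2)) by field.
by rewrite ler_pM2l // ler_pM2l // mulr_gt0.
Qed.

Lemma has_cderivV f z l : f z != 0 -> has_cderiv f z l ->
  has_cderiv (fun w => (f w)^-1) z (- ((f z)^-1 * (f z)^-1) * l).
Proof. by move=> fz Hf; apply: has_cderiv_comp => //; apply: has_cderiv_inv. Qed.

End Derivative.

                                

(** * Dyadic bisection of the unit square *)

Section Cousin.
Variable R : realType.
Local Notation hf m := ((2^-1 : R) ^+ m).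

Lemma half_pow_gt0 m : 0 < hf m. Proof. by rewrite exprn_gt0 // invr_gt0. Qed.
Lemma half_powS m : hf m.+1 = hf m / 2. Proof. by rewrite exprSr. Qed.

Lemma half_pow_small (e : R) : 0 < e -> exists m0, forall m, (m0 <= m)%N -> hf m < e.
Proof.
move=> e0; exists (Num.truncn e^-1).+1 => m hm.
rewrite exprVn invf_plt ?posrE ?exprn_gt0 //.
apply: lt_le_trans (truncnS_gt _) _.
rewrite -natrX ler_nat (leq_trans hm) // ltnW // ltn_expl //.
Qed.

Lemma nested_dyadic (s : nat -> R) : (forall n, s n <= s n.+1 <= s n + hf n.+1) ->
  exists x, forall n, s n <= x <= s n + hf n.
Proof.
move=> H.
have mono n m : (n <= m)%N -> s n <= s m.
  elim: m => [|m IH]; first by rewrite leqn0 => /eqP ->.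
  rewrite leq_eqVlt => /orP[/eqP -> //|]; rewrite ltnS => /IH h.
  by rewrite (le_trans h) //; case/andP: (H m).
have up n m : (n <= m)%N -> s m + hf m <= s n + hf n.
  elim: m => [|m IH]; first by rewrite leqn0 => /eqP ->.
  rewrite leq_eqVlt => /orP[/eqP -> //|]; rewrite ltnS => /IH h.
  rewrite (le_trans _ h) //; case/andP: (H m) => _; rewrite half_powS.
  by lra.
have bd n m : s m <= s n + hf n.
  have [nm|/ltnW mn] := leqP n m.
    by rewrite (le_trans _ (up _ _ nm)) // lerDl ltW // half_pow_gt0.
  by rewrite (le_trans (mono _ _ mn)) // lerDl ltW // half_pow_gt0.
exists (sup (range s)) => n; apply/andP; split.
  apply: ub_le_sup; last by exists n.
  by exists (s 0%N + hf 0) => _ [m _ <-].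
by apply: ge_sup; [exists (s 0%N), 0%N|move=> _ [m _ <-]].
Qed.

(** If the unit square were bad, some quarter of it would be bad, and so on; the nested bad squares
    shrink to a point, where the local hypothesis contradicts badness. Properties that ignore one
    coordinate give compactness of the unit interval. *)
Lemma cousin2 (P : nat -> R -> R -> Prop) :
  (forall m s t, P m.+1 s t -> P m.+1 (s + hf m.+1) t -> P m.+1 s (t + hf m.+1) ->
     P m.+1 (s + hf m.+1) (t + hf m.+1) -> P m s t) ->
  (forall s t, 0 <= s <= 1 -> 0 <= t <= 1 -> exists m0, forall m, (m0 <= m)%N ->
     forall s' t', 0 <= s' -> 0 <= t' -> s' + hf m <= 1 -> t' + hf m <= 1 ->
     s' <= s <= s' + hf m -> t' <= t <= t' + hf m -> P m s' t') ->
  P 0%N 0 0.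
Proof.
move=> Padd Ploc; apply: contrapT => nP.
have step (x : nat * R * R) : exists y : nat * R * R, ~ P x.1.1 x.1.2 x.2 ->
    [/\ ~ P y.1.1 y.1.2 y.2, y.1.1 = x.1.1.+1,
     x.1.2 <= y.1.2 <= x.1.2 + hf x.1.1.+1 & x.2 <= y.2 <= x.2 + hf x.1.1.+1].
  have h0 := half_pow_gt0 x.1.1.+1; case: x h0 => [[m s] t] /= h0.
  have [Q1|] := pselect (P m.+1 s t); last first.
    by move=> h; exists (m.+1, s, t) => _; split => //=; lra.
  have [Q2|] := pselect (P m.+1 (s + hf m.+1) t); last first.
    by move=> h; exists (m.+1, s + hf m.+1, t) => _; split => //=; lra.
  have [Q3|] := pselect (P m.+1 s (t + hf m.+1)); last first.
    by move=> h; exists (m.+1, s, t + hf m.+1) => _; split => //=; lra.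
  have [Q4|] := pselect (P m.+1 (s + hf m.+1) (t + hf m.+1)); last first.
    by move=> h; exists (m.+1, s + hf m.+1, t + hf m.+1) => _; split => //=; lra.
  (* All four quarters are good, so the square is good, against the premise; the witness is
     arbitrary. *)
  by exists (m, s, t) => /(_ (Padd _ _ _ Q1 Q2 Q3 Q4)).
have [F HF] := boolp.choice step.
pose x n := iter n F (0%N, 0, 0).
have xE n : [/\ ~ P (x n).1.1 (x n).1.2 (x n).2, (x n).1.1 = n,
    0 <= (x n).1.2 /\ (x n).1.2 + hf n <= 1 & 0 <= (x n).2 /\ (x n).2 + hf n <= 1].
  elim: n => [|n [h1 h2 [h3 h3'] [h4 h4']]]; first by split => //=; rewrite expr0; lra.
  have [k1 k2 k3 k4] := HF _ h1; rewrite h2 in k3 k4.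
  by split => //=; rewrite -/(x n) ?k2 ?h2 //; have := half_powS n; lra.
have xS n := HF _ (let: And4 h _ _ _ := xE n in h).
have [s sE] := @nested_dyadic (fun n => (x n).1.2)
  ltac:(by move=> n; have [_ _] := xS n; have [_ -> _ _] := xE n).
have [t tE] := @nested_dyadic (fun n => (x n).2)
  ltac:(by move=> n; have [_ _ _] := xS n; have [_ -> _ _] := xE n).
have [m0 Hm] := Ploc s t ltac:(by have := sE 0%N; rewrite /= expr0; lra)
  ltac:(by have := tE 0%N; rewrite /= expr0; lra).
have [h1 h2 [h3 h3'] [h4 h4']] := xE m0; apply: h1; rewrite h2; exact: Hm.
Qed.

End Cousin.

(** * Trapezoidal means on segments and Goursat's theorem *)

Section Goursat.
Variable R : realType.
Local Notation C := (Cplx R).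
Local Notation hf m := ((2^-1 : R) ^+ m).
Local Notation hc m := ((2^-1 : C) ^+ m).
Implicit Types (f g : C -> C) (p u v o z : C).

Definition ctends (a : nat -> C) (l : C) :=
  forall e : R, 0 < e -> exists N, forall n, (N <= n)%N -> cabs (a n - l) <= e.

Lemma ctendsD a b l m : ctends a l -> ctends b m -> ctends (fun n => a n + b n) (l + m).
Proof.
move=> H H' e e0; have [N hN] := H _ (divr_gt0 e0 (ltr0Sn _ 1)).
have [N' hN'] := H' _ (divr_gt0 e0 (ltr0Sn _ 1)).
exists (maxn N N') => n; rewrite geq_max => /andP[/hN h1 /hN' h2].
rewrite (_ : _ - _ = (a n - l) + (b n - m)); last by ring.
by rewrite (le_trans (cabsD _ _)) //; lra.
Qed.

Lemma ctendsZ c a l : ctends a l -> ctends (fun n => c * a n) (c * l).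
Proof.
move=> H e e0; have k0 : 0 < cabs c + 1 by rewrite ltr_wpDl // cabs_ge0.
have [N hN] := H (e / (cabs c + 1)) (divr_gt0 e0 k0); exists N => n /hN h.
rewrite -mulrBr cabsM; apply: (@le_trans _ _ ((cabs c + 1) * cabs (a n - l))).
  by rewrite ler_wpM2r ?cabs_ge0 // lerDl.
by rewrite mulrC -ler_pdivlMr.
Qed.

Lemma ctendsN a l : ctends a l -> ctends (fun n => - a n) (- l).
Proof. by move=> H e /H[N h]; exists N => n /h; rewrite -opprD cabsN. Qed.

Lemma ctendsB a b l m : ctends a l -> ctends b m -> ctends (fun n => a n - b n) (l - m).
Proof. by move=> h1 h2; apply: ctendsD => //; apply: ctendsN. Qed.

Lemma ctends_ext a b l : a =1 b -> ctends a l -> ctends b l.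
Proof. by move=> /funext ->. Qed.

Lemma ctends_le a l (K : R) : ctends a l -> (exists N, forall n, (N <= n)%N -> cabs (a n) <= K) -> cabs l <= K.
Proof.
move=> H [N0 HK]; apply/ler_addgt0Pl => e e0; have [N hN] := H e e0.
have := hN (maxn N0 N) (leq_maxr _ _); have := HK (maxn N0 N) (leq_maxl _ _).
set b := a _ => h1 h2; rewrite -(subrK b l) (le_trans (cabsD _ _)) //.
by rewrite cabsB; lra.
Qed.

                                                                          
(** The trapezoidal rule with 2^n pieces for the mean of g over the segment from p to p + v. Line
    integrals enter only through these sums and their limits. *)
Fixpoint segmean g n p v : C :=
  if n is m.+1 then (segmean g m p (v / 2) + segmean g m (p + v / 2) (v / 2)) / 2
  else (g p + g (p + v)) / 2.

Lemma segmeanD f g n p v :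
  segmean (fun z => f z + g z) n p v = segmean f n p v + segmean g n p v.
Proof.
by elim: n p v => [|n IH] p v /=; rewrite ?IH; field.
Qed.

Lemma segmeanZ c g n p v : segmean (fun z => c * g z) n p v = c * segmean g n p v.
Proof. by elim: n p v => [|n IH] p v /=; rewrite ?IH; field. Qed.

Lemma segmean_ext f g n p v : f =1 g -> segmean f n p v = segmean g n p v.
Proof. by move=> /funext ->. Qed.

Lemma segmean_affine a b n p v :
  segmean (fun z => a + b * z) n p v = a + b * (p + v / 2).
Proof. by elim: n p v => [|n IH] p v /=; rewrite ?IH; field. Qed.

Lemma segmean_bound (P : C -> Prop) g (K : R) n p v :
  (forall z w, P z -> P w -> P ((z + w) / 2)) -> (forall z, P z -> cabs (g z) <= K) ->
  P p -> P (p + v) -> cabs (segmean g n p v) <= K.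
Proof.
move=> Pm PK; elim: n p v => [|n IH] p v Pp Pv /=.
  have h1 := PK _ Pp; have h2 := PK _ Pv.
  rewrite cabsM cabsV (cabs_nat _ 2) ler_pdivrMr // (le_trans (cabsD _ _)) //; lra.
have Pc : P (p + v / 2).
  by have := Pm _ _ Pp Pv; congr P; field.
have h1 := IH p (v / 2) Pp Pc.
have h2 := IH (p + v / 2) (v / 2) Pc ltac:(by rewrite -addrA -splitr).
rewrite cabsM cabsV (cabs_nat _ 2) ler_pdivrMr // (le_trans (cabsD _ _)) //; lra.
Qed.

Lemma segmean_shift g n p v q : segmean (fun z => g (z + q)) n p v = segmean g n (p + q) v.
Proof.
by elim: n p v => [|n IH] p v /=; rewrite ?IH addrAC.
Qed.

(** The approximate contour integral around the parallelogram at o with sides u and v. *)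
Definition parsum g n o u v := u * segmean g n o u + v * segmean g n (o + u) v
  - u * segmean g n (o + v) u - v * segmean g n o v.

(** The sums over the inner sides of the four quarters cancel. *)
Lemma parsumS g n o u v : parsum g n.+1 o u v =
  parsum g n o (u / 2) (v / 2) + parsum g n (o + u / 2) (u / 2) (v / 2)
  + parsum g n (o + v / 2) (u / 2) (v / 2)
  + parsum g n (o + u / 2 + v / 2) (u / 2) (v / 2).
Proof.
rewrite /parsum /=.
have -> : o + u / 2 + u / 2 = o + u by rewrite -addrA -splitr.
have -> : o + u / 2 + v / 2 + u / 2 = o + u + v / 2 by field.
have -> : o + v / 2 + v / 2 = o + v by rewrite -addrA -splitr.
have -> : o + u / 2 + v / 2 + v / 2 = o + v + u / 2 by field.
have -> : o + v / 2 + u / 2 = o + u / 2 + v / 2 by rewrite addrAC.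
by field.
Qed.

Lemma ball_midpoint z0 (r : R) z w : cabs (z - z0) <= r -> cabs (w - z0) <= r ->
  cabs ((z + w) / 2 - z0) <= r.
Proof.
move=> h1 h2; rewrite (_ : _ - _ = ((z - z0) + (w - z0)) / 2); last by field.
rewrite cabsM cabsV (cabs_nat _ 2) ler_pdivrMr // (le_trans (cabsD _ _)) //; lra.
Qed.

(** The trapezoidal rule is exact on affine functions, whose contour sum is 0; only the error term
    of g contributes. *)
Lemma parsum_local g z0 l (r e : R) n o u v :
  (forall z, cabs (z - z0) <= r -> cabs (g z - g z0 - l * (z - z0)) <= e) ->
  cabs (o - z0) <= r -> cabs (o + u - z0) <= r -> cabs (o + v - z0) <= r ->
  cabs (o + u + v - z0) <= r ->
  cabs (parsum g n o u v) <= 2 * (cabs u + cabs v) * e.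
Proof.
move=> H h1 h2 h3 h4.
pose q z := g z - g z0 - l * (z - z0).
have gE : g =1 (fun z => ((g z0 - l * z0) + l * z) + q z).
  by move=> z; rewrite /q; ring.
have -> : parsum g n o u v = parsum q n o u v.
  have E p w : segmean g n p w = (g z0 - l * z0) + l * (p + w / 2) + segmean q n p w.
    by rewrite (segmean_ext _ _ _ gE) segmeanD segmean_affine.
  by rewrite /parsum !E; field.
have b p w : cabs (p - z0) <= r -> cabs (p + w - z0) <= r -> cabs (segmean q n p w) <= e.
  move=> k1 k2; apply: (@segmean_bound (fun z => cabs (z - z0) <= r)) => //.
  by move=> z w'; apply: ball_midpoint.
have h4' : cabs (o + v + u - z0) <= r by rewrite (addrAC o).
have T a x : cabs x <= e -> cabs (a * x) <= cabs a * e.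
  by move=> ?; rewrite cabsM ler_wpM2l // cabs_ge0.
have := T u _ (b o u h1 h2); have := T v _ (b (o + u) v h2 h4).
have := T u _ (b (o + v) u h3 h4').
have := T v _ (b o v h1 h3); rewrite /parsum.
set A := v * _; set B := u * _; set D := v * _; set E := u * _ => k1 k2 k3 k4.
rewrite (le_trans (cabsD _ _)) // cabsN.
have := cabsD (E + D) (- B); have := cabsD E D; rewrite cabsN; lra.
Qed.

(** A bound proportional to the area adds up over quarters, and by [parsum_local] it holds for small
    parallelograms near any point where g is differentiable; [cousin2] globalises it. *)
Lemma goursat g o u v :
  (forall s t : R, 0 <= s <= 1 -> 0 <= t <= 1 ->
     exists l, has_cderiv g (o + cofr s * u + cofr t * v) l) ->
  ctends (fun n => parsum g n o u v) 0.
Proof.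
move=> Hd c c0; set K := cabs u + cabs v.
pose at_ (s t : R) : C := o + cofr s * u + cofr t * v.
pose P m s t := exists N, forall n, (N <= n)%N ->
  cabs (parsum g n (at_ s t) (hc m * u) (hc m * v)) <= c * (hf m) ^+ 2.
suff: P 0%N 0 0.
  case=> N H; exists N => n /H.
  by rewrite /at_ !expr0 expr1n mulr1 !mul1r !cofr0 !mul0r !addr0 subr0.
have cofr_hf m : cofr (hf m) = hc m by rewrite cofrX cofrV cofr_nat.
apply: cousin2 => [m s t [N1 H1] [N2 H2] [N3 H3] [N4 H4]|s t hs ht].
  exists (N1 + N2 + N3 + N4).+1 => -[//|n]; rewrite ltnS => hn.
  have := H1 n ltac:(by lia); have := H2 n ltac:(by lia).
  have := H3 n ltac:(by lia); have := H4 n ltac:(by lia).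
  rewrite parsumS /at_.
  have Eh w : hc m.+1 * w = hc m * w / 2 by rewrite exprSr mulrAC.
  rewrite !cofrD !cofr_hf !mulrDl !Eh (half_powS R m).
  have -> : o + (cofr s * u + hc m * u / 2) + cofr t * v = o + cofr s * u + cofr t * v + hc m * u / 2 by ring.
  have -> : o + cofr s * u + (cofr t * v + hc m * v / 2) = o + cofr s * u + cofr t * v + hc m * v / 2 by ring.
  have -> : o + (cofr s * u + hc m * u / 2) + (cofr t * v + hc m * v / 2) = o + cofr s * u + cofr t * v + hc m * u / 2 + hc m * v / 2 by ring.
  set X1 := parsum _ _ _ _ _; set X2 := parsum _ _ _ _ _.
  set X3 := parsum _ _ _ _ _; set X4 := parsum _ _ _ _ _ => k1 k2 k3 k4.
  have := cabsD (X4 + X3 + X2) X1; have := cabsD (X4 + X3) X2; have := cabsD X4 X3.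
  have E : c * (hf m / 2) ^+ 2 = c * hf m ^+ 2 / 4 by field.
  rewrite E in k1 k2 k3 k4; lra.
have [l Hl] := Hd s t hs ht; set z0 := _ + cofr t * v in Hl.
have K0 : 0 <= K by rewrite addr_ge0 // cabs_ge0.
(* At scale h, [parsum_local] gives the bound 2(hK)(e hK), which this choice keeps below c h^2. *)
pose e := c / (2 * (K + 1) * (K + 1)).
have e0 : 0 < e by rewrite divr_gt0 // !mulr_gt0 // ltr_wpDl.
have [d d0 hd] := Hl e e0.
have [m0 hm0] := @half_pow_small R (d / (K + 1)) ltac:(by rewrite divr_gt0 // ltr_wpDl).
exists m0 => m /hm0 hm s' t' _ _ _ _ hs' ht'; exists 0%N => n _.
set h := hf m in hm hs' ht'; have h0 : 0 < h by rewrite half_pow_gt0.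
have inb a b : `|a| <= h -> `|b| <= h -> cabs (cofr a * u + cofr b * v) <= h * K.
  move=> ha hb; rewrite (le_trans (cabsD _ _)) // !cabsM !cabs_cofr mulrDr.
  by rewrite lerD // ler_wpM2r // cabs_ge0.
have T a b w : w - z0 = cofr a * u + cofr b * v -> `|a| <= h -> `|b| <= h ->
  cabs (w - z0) <= h * K by move=> ->; apply: inb.
have HL := @parsum_local g z0 l (h * K) (e * (h * K)) n (at_ s' t') (hc m * u) (hc m * v).
apply: (le_trans (HL _ _ _ _ _)).
- move=> z hz; have zd : cabs (z - z0) < d.
    apply: (le_lt_trans hz); move: hm; rewrite ltr_pdivlMr ?ltr_wpDl //.
    by apply: le_lt_trans; rewrite ler_wpM2l ?(ltW h0) // lerDl.
  have := hd _ zd; rewrite [z0 + _]addrC subrK => /le_trans; apply.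
  by rewrite ler_wpM2l // ltW.
- by apply: (T (s' - s) (t' - t)); rewrite ?/at_ ?/z0 ?cofrB ?ler_norml; [ring|lra|lra].
- by apply: (T (s' + h - s) (t' - t)); rewrite ?/at_ ?/z0 ?cofrB ?cofrD ?cofr_hf ?ler_norml; [ring|lra|lra].
- by apply: (T (s' - s) (t' + h - t)); rewrite ?/at_ ?/z0 ?cofrB ?cofrD ?cofr_hf ?ler_norml; [ring|lra|lra].
- by apply: (T (s' + h - s) (t' + h - t)); rewrite ?/at_ ?/z0 ?cofrB ?cofrD ?cofr_hf ?ler_norml; [ring|lra|lra].
rewrite !cabsM -!cofr_hf !cabs_cofr -/h gtr0_norm // -mulrDr -/K.
have -> : 2 * (h * K) * (e * (h * K)) = e * (2 * K * K) * h ^+ 2 by ring.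
rewrite ler_wpM2r ?sqr_ge0 // /e mulrAC ler_pdivrMr ?mulr_gt0 ?ltr_wpDl //.
by rewrite ler_pM2l //; nra.
Qed.

End Goursat.

(** * The complex exponential *)

Section ComplexExponential.
Variable R : realType.
Local Notation C := (Cplx R).

Lemma is_derive_eps (f : R -> R) (x l : R) : is_derive x 1 f l ->
  forall e, 0 < e -> exists2 d, 0 < d &
    forall h, `|h| < d -> `|f (x + h) - f x - l * h| <= e * `|h|.
Proof.
move=> [df dl] e e0.
have H : (fun h : R => h^-1 *: (f (h *: 1 + x) - f x)) @ 0^' --> l.
  by move: dl; rewrite /derive => <-.
have [d d0 hd] := (proj1 (nbhs_ballP _ _) (proj1 (cvgrPdist_le _ _) H e e0)).
exists d => // h hh; have [->|h0] := eqVneq h 0.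
  by rewrite addr0 subrr mulr0 subr0 normr0 mulr0.
have := hd h; rewrite /ball /= sub0r normrN => /(_ hh h0).
have -> : f (x + h) - f x - l * h = - ((l - h^-1 *: (f (h *: 1 + x) - f x)) * h).
  by rewrite /GRing.scale /= mulr1 (addrC h x); field.
by rewrite normrN normrM => ?; rewrite ler_wpM2r.
Qed.

Definition cexp (z : C) : C := cofr (expR (cRe z)) * Complex (cos (cIm z)) (sin (cIm z)).

Lemma cexpD z w : cexp (z + w) = cexp z * cexp w.
Proof.
rewrite /cexp cReD cImD expRD cosD sinD cofrM.
have -> : Complex (cos (cIm z) * cos (cIm w) - sin (cIm z) * sin (cIm w))
   (sin (cIm z) * cos (cIm w) + cos (cIm z) * sin (cIm w)) =
  (Complex (cos (cIm z)) (sin (cIm z)) : C) * Complex (cos (cIm w)) (sin (cIm w)).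
  by apply: complex_eq; rewrite ?cReM ?cImM //= addrC.
by ring.
Qed.

Lemma cabs_cexp z : cabs (cexp z) = expR (cRe z).
Proof.
rewrite /cexp cabsM cabs_cofr ger0_norm ?expR_ge0 // /cabs /= cos2Dsin2 sqrtr1.
by rewrite mulr1.
Qed.

Lemma cexp_neq0 z : cexp z != 0.
Proof. by rewrite -cabs_gt0 cabs_cexp expR_gt0. Qed.

Definition twopii : C := cI * cofr (2 * pi).

Lemma cRe_twopii : cRe twopii = 0 :> R.
Proof. by rewrite /twopii cReM /cRe /cIm /= mul0r mulr0 subr0. Qed.
Lemma cIm_twopii : cIm twopii = 2 * pi :> R.
Proof. by rewrite /twopii cImM /cRe /cIm /= mul0r mul1r add0r. Qed.
Lemma cRe_cofrM (x : R) z : cRe (cofr x * z) = x * cRe z.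
Proof. by rewrite cReM /= mul0r subr0. Qed.
Lemma cIm_cofrM (x : R) z : cIm (cofr x * z) = x * cIm z.
Proof. by rewrite cImM /= mul0r addr0. Qed.

Lemma twopii_neq0 : twopii != 0.
Proof.
rewrite mulf_neq0 //; first by apply/eqP => -[/eqP]; rewrite oner_eq0.
by rewrite -cabs_gt0 cabs_cofr normr_gt0 mulf_neq0 // gt_eqF // pi_gt0.
Qed.

Lemma cexpD2pi z : cexp (z + twopii) = cexp z.
Proof.
rewrite cexpD -[RHS]mulr1; congr (_ * _); rewrite /cexp cRe_twopii cIm_twopii.
by rewrite expR0 cofr1 mul1r mulr_natl cos2pi sin2pi.
Qed.

Lemma cexp_polar z : z != 0 -> exists2 t, 0 <= t <= 1 &
  z = cexp (cofr (ln (cabs z)) + cofr t * twopii).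
Proof.
move=> z0; have az : 0 < cabs z by rewrite cabs_gt0.
pose x := cRe z / cabs z; pose y := cIm z / cabs z.
have xy : x ^+ 2 + y ^+ 2 = 1.
  by rewrite !expr_div_n -mulrDl -cabs_sqr divff // expf_neq0 // gt_eqF.
have x1 : -1 <= x <= 1.
  by apply/andP; split; have := sqr_ge0 y; nra.
have [th th0 [Ec Es]] : exists2 th, 0 <= th <= 2 * pi & cos th = x /\ sin th = y.
  have p0 := @pi_ge0 R.
  have ys : y = Num.sqrt (1 - x ^+ 2) \/ y = - Num.sqrt (1 - x ^+ 2).
    rewrite -xy addrC addKr sqrtr_sqr.
    by case: (ler0P y) => h; rewrite ?opprK; [right|left].
  case: ys => Ey; [exists (acos x)|exists (2 * pi - acos x)].
  - by rewrite acos_ge0 // (le_trans (acos_lepi x1)) //; lra.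
  - by rewrite Ey acosK ?sin_acos ?in_itv.
  - by have := acos_ge0 x1; have := acos_lepi x1; lra.
  - rewrite mulr_natl cosB sinB cos2pi sin2pi !mul0r addr0 !mul1r sub0r.
    by rewrite Ey acosK ?sin_acos ?in_itv.
have tp : 0 < 2 * pi :> R by rewrite mulr_gt0 // pi_gt0.
exists (th / (2 * pi)).
  by case/andP: th0 => h1 h2; rewrite divr_ge0 ?(ltW tp) //= ler_pdivrMr // mul1r.
rewrite /cexp !(cReD, cImD, cRe_cofrM, cIm_cofrM) cRe_twopii cIm_twopii mulr0 addr0.
rewrite [cRe _]/= [cIm (cofr _)]/= add0r.
rewrite divfK ?gt_eqF //.
rewrite lnK ?posrE // Ec Es.
apply: complex_eq; rewrite ?cReM ?cImM /cRe /cIm /= -/(cRe z) -/(cIm z) /x /y.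
  by field; rewrite gt_eqF.
by field; rewrite gt_eqF.
Qed.

(** The addition formula reduces this to the point 0, where the first-order expansions of the real
    exp, cos and sin are combined. *)
Lemma has_cderiv_cexp z : has_cderiv cexp z (cexp z).
Proof.
suff H0 : has_cderiv cexp 0 1.
  move=> e e0; have [d d0 hd] := H0 (e / cabs (cexp z)) ltac:(by rewrite divr_gt0 // cabs_gt0 cexp_neq0).
  exists d => // h /hd; rewrite add0r mul1r.
  have -> : cexp 0 = 1.
    by apply: (mulfI (cexp_neq0 0)); rewrite -cexpD mulr1 add0r.
  rewrite cexpD (_ : cexp z * cexp h - cexp z - cexp z * h = cexp z * (cexp h - 1 - h)); last by ring.
  by rewrite mulrAC ler_pdivlMr ?cabs_gt0 ?cexp_neq0 // cabsM mulrC.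
(* The real and imaginary errors found below add up to at most 9 e1 |h|, which 1/16 absorbs. *)
move=> e e0; pose e1 := Num.min (e / 16) 1.
have e10 : 0 < e1 by rewrite lt_min ltr01 andbT divr_gt0.
have [d1 d10 h1] := is_derive_eps (is_derive_expR 0) e10.
have [d2 d20 h2] := is_derive_eps (is_derive_cos 0) e10.
have [d3 d30 h3] := is_derive_eps (is_derive_sin 0) e10.
exists (Num.min (Num.min d1 e1) (Num.min 1 (Num.min d2 d3))).
  by rewrite lt_min [X in X && _]lt_min d10 e10 !lt_min d20 d30 ltr01.
move=> h; rewrite lt_min => /andP[]; rewrite lt_min => /andP[k1 k1'].
rewrite lt_min => /andP[k2]; rewrite lt_min => /andP[k3 k4].
have ha := cRe_le h; have hb := cIm_le h; set a := cRe h in ha; set b := cIm h in hb.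
have {h1} := h1 a (le_lt_trans ha k1); rewrite expR0 add0r mul1r => h1.
have {h2} := h2 b (le_lt_trans hb k3); rewrite add0r sin0 oppr0 mul0r subr0 cos0 => h2.
have {h3} := h3 b (le_lt_trans hb k4); rewrite add0r sin0 cos0 mul1r subr0 => h3.
rewrite mul1r add0r; apply: (le_trans (cabs_le _)).
have e1e : e1 <= e / 16 by rewrite ge_min lexx.
have e11 : e1 <= 1 by rewrite ge_min lexx orbT.
have c0 := cabs_ge0 h.
set E := expR a in h1 *; set c := cabs h in k1 k1' k2 k3 k4 ha hb c0 *.
have Eb : `|E - 1| <= 2 * c.
  have := ler_normD (E - 1 - a) a; rewrite subrK.
  have : e1 * `|a| <= `|a| by rewrite ler_piMl.
  by lra.
have En : `|E| <= 3.
  by have := ler_normD (E - 1) 1; rewrite subrK normr1; lra.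
have F1 : e1 * `|a| <= e1 * c by rewrite ler_wpM2l // ltW.
have F2 : e1 * `|b| <= e1 * c by rewrite ler_wpM2l // ltW.
have F3 : e1 * c <= e / 16 * c by rewrite ler_wpM2r.
have cc : c * c <= e1 * c by rewrite ler_wpM2r // ltW.
have -> : cRe (cexp h - cexp 0 - h) = (E - 1 - a) + E * (cos b - 1).
  rewrite !cReD !cReN /cexp !cReM /cRe /= -/a -/b expR0 cos0 /E /a /b /cRe /cIm; ring.
have -> : cIm (cexp h - cexp 0 - h) = E * (sin b - b) + (E - 1) * b.
  rewrite !cImD !cImN /cexp !cImM /cIm /= -/a -/b expR0 sin0 /E /a /b /cRe /cIm; ring.
have G1 : `|E * (cos b - 1)| <= 3 * (e1 * c).
  by rewrite normrM ler_pM // (le_trans h2).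
have G2 : `|E * (sin b - b)| <= 3 * (e1 * c).
  by rewrite normrM ler_pM // (le_trans h3).
have G3 : `|(E - 1) * b| <= 2 * (c * c).
  by rewrite normrM mulrA ler_pM.
have := ler_normD (E - 1 - a) (E * (cos b - 1)).
have := ler_normD (E * (sin b - b)) ((E - 1) * b).
have : 0 <= e * c by rewrite mulr_ge0 // ltW.
lra.
Qed.

End ComplexExponential.

                           

(** * Means over circles *)

Section CircleMean.
Variable R : realType.
Local Notation C := (Cplx R).
Local Notation hf m := ((2^-1 : R) ^+ m).
Local Notation tpi := (@twopii R).
Implicit Types (f g : C -> C) (a z w : C) (rho e d : R).

Lemma ccont_comp f g z : ccont f z -> ccont g (f z) -> ccont (fun w => g (f w)) z.
Proof.
move=> Hf Hg e e0; have [d d0 hd] := Hg e e0; have [d' d'0 hd'] := Hf d d0.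
exists d' => // h /hd' /hd; rewrite [f z + _]addrC subrK; exact.
Qed.

(** Logarithmic coordinates: the circle of radius exp(rho) about a is the image of a vertical
    segment of length 2 pi, so concentric circles become opposite sides of a rectangle. *)
Definition cmean f a rho n : C := segmean (fun z => f (a + cexp z)) n (cofr rho) tpi.

Lemma on_circle a rho (t : R) :
  cabs (a + cexp (cofr rho + cofr t * tpi) - a) = expR rho.
Proof.
by rewrite addrAC subrr add0r cabs_cexp cReD cRe_cofrM cRe_twopii mulr0 addr0.
Qed.

Lemma cmeanD f g a rho n :
  cmean (fun z => f z + g z) a rho n = cmean f a rho n + cmean g a rho n.
Proof. exact: segmeanD. Qed.

Lemma cmeanZ c f a rho n : cmean (fun z => c * f z) a rho n = c * cmean f a rho n.
Proof. exact: segmeanZ. Qed.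

Lemma cmeanB f g a rho n :
  cmean (fun z => f z - g z) a rho n = cmean f a rho n - cmean g a rho n.
Proof.
rewrite -mulN1r -cmeanZ -cmeanD; congr (cmean _ a rho n).
by apply/funext => z; rewrite mulN1r.
Qed.

Lemma cmean_cst c a rho n : cmean (fun=> c) a rho n = c.
Proof.
rewrite -[RHS]addr0 -[X in c + X](mul0r (cofr rho + tpi / 2)) -(segmean_affine _ _ n).
by congr segmean; apply/funext => z; rewrite mul0r addr0.
Qed.

Lemma segmean_bound_t g n (p v : C) (K : R) :
  (forall t : R, 0 <= t <= 1 -> cabs (g (p + cofr t * v)) <= K) ->
  cabs (segmean g n p v) <= K.
Proof.
move=> H; apply: (@segmean_bound _ (fun z => exists2 t : R, 0 <= t <= 1 & z = p + cofr t * v)).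
- move=> z w [t ht ->] [s hs ->]; exists ((t + s) / 2); first lra.
  by rewrite cofrM cofrV cofrD cofr_nat; field.
- by move=> z [t ht ->]; exact: H.
- by exists 0; rewrite ?lexx ?ler01 // cofr0 mul0r addr0.
- by exists 1; rewrite ?lexx ?ler01 // cofr1 mul1r.
Qed.

Lemma cmean_bound f a rho n K :
  (forall z, cabs (z - a) = expR rho -> cabs (f z) <= K) -> cabs (cmean f a rho n) <= K.
Proof. by move=> H; apply: segmean_bound_t => t _; apply: H; exact: on_circle. Qed.

Lemma cmean_eq_on f g a rho n :
  (forall z, cabs (z - a) = expR rho -> f z = g z) -> cmean f a rho n = cmean g a rho n.
Proof.
move=> H; apply/eqP; rewrite -subr_eq0 -cmeanB -cabs_eq0; apply/eqP/le_anti.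
rewrite cabs_ge0 andbT; apply: cmean_bound => z /H ->.
by rewrite subrr cabs0.
Qed.

(** Goursat on the rectangle of logarithms: by periodicity the horizontal sides cancel, leaving the
    difference of the two circle means. *)
Lemma cmean_annulus f a rho1 rho2 : rho1 <= rho2 ->
  (forall z, expR rho1 <= cabs (z - a) <= expR rho2 -> exists l, has_cderiv f z l) ->
  ctends (fun n => cmean f a rho2 n - cmean f a rho1 n) 0.
Proof.
move=> h12 Hd; pose g z := f (a + cexp z).
have H : ctends (fun n => parsum g n (cofr rho1) (cofr (rho2 - rho1)) tpi) 0.
  apply: goursat => s t hs ht; set z := _ + cofr t * tpi.
  have [|l Hl] := Hd (a + cexp z).
    rewrite addrAC subrr add0r cabs_cexp !ler_expR.
    rewrite /z !cReD !cRe_cofrM cRe_twopii mulr0 addr0 /cRe /=.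
    by apply/andP; split; nra.
  exists (l * cexp z); rewrite /g; apply: (@has_cderiv_comp _ (fun z => a + cexp z) f) => //.
  apply: has_cderiv_eq; last exact: (add0r (cexp z)).
  by apply: has_cderivD; [exact: has_cderiv_cst|exact: has_cderiv_cexp].
have gp : (fun z => g (z + tpi)) = g.
  by apply/funext => z; rewrite /g cexpD2pi.
have E n : parsum g n (cofr rho1) (cofr (rho2 - rho1)) tpi =
    tpi * (cmean f a rho2 n - cmean f a rho1 n).
  rewrite /parsum -[segmean g n (_ + tpi) _]segmean_shift gp /cmean -/g.
  by rewrite -cofrD [rho1 + _]addrC subrK; ring.
have := ctendsZ tpi^-1 H; rewrite mulr0; apply: ctends_ext => n.
by rewrite E mulrA mulVf ?mul1r // twopii_neq0.
Qed.

(** This allows passing over a circle on which f is only known to be continuous: uniform continuity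
    there bounds the jump of the mean, uniformly in n. *)
Lemma cmean_cross f a rho0 e : 0 < e ->
  (forall z, cabs (z - a) = expR rho0 -> ccont f z) ->
  exists2 d, 0 < d & forall d' n, 0 <= d' <= d ->
    cabs (cmean f a (rho0 + d') n - cmean f a (rho0 - d') n) <= e.
Proof.
move=> e0 Hc; pose g z := f (a + cexp z).
pose zt t := cofr rho0 + cofr t * tpi.
have gc t : ccont g (zt t).
  rewrite /g; apply: (@ccont_comp (fun z => a + cexp z) f); last first.
    by apply: Hc; exact: on_circle.
  apply: has_cderiv_ccont; apply: has_cderivD; first exact: has_cderiv_cst.
  exact: has_cderiv_cexp.
(* [cousin2] with the first coordinate ignored serves as compactness of the parameter interval. *)
pose P (m : nat) (s t : R) := exists2 d, 0 < d & forall t' d', t <= t' <= t + hf m ->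
  0 <= d' <= d -> cabs (g (zt t' + cofr d') - g (zt t' - cofr d')) <= e.
have [d d0 hd] : P 0%N 0 0.
  apply: cousin2 => [m s t [d1 d10 H1] _ [d2 d20 H2] _|s t hs ht].
    exists (Num.min d1 d2); first by rewrite lt_min d10.
    move=> t' d' ht' /andP[hd']; rewrite le_min => /andP[k1 k2].
    have := half_powS R m => E.
    have [tt|tt] := leP t' (t + hf m.+1); [apply: H1|apply: H2]; lra.
  have e2 : 0 < e / 2 by rewrite divr_gt0.
  have [d d0 hd] := gc t _ e2; set K := cabs tpi.
  have K0 : 0 <= K := cabs_ge0 _.
  have [m0 hm] := @half_pow_small R (d / 2 / (K + 1)) ltac:(by rewrite !divr_gt0 // ltr_wpDl).
  exists m0 => m /hm {}hm s' t' _ _ _ _ _ ht'; exists (d / 3); first by rewrite divr_gt0.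
  move=> t2 d' ht2 hd'.
  have hh : hf m * K < d / 2.
    move: hm; rewrite ltr_pdivlMr ?ltr_wpDl //; have := half_pow_gt0 R m; nra.
  have near2 x : `|x| = d' -> cabs (g (zt t2 + cofr x) - g (zt t)) < e / 2.
    move=> hx; have -> : zt t2 + cofr x = zt t + (cofr (t2 - t) * tpi + cofr x).
      by rewrite /zt cofrB; ring.
    apply: hd; rewrite (le_lt_trans (cabsD _ _)) // cabsM !cabs_cofr hx.
    have : `|t2 - t| * K <= hf m * K.
      by rewrite ler_wpM2r // ler_norml; lra.
    rewrite -/K; lra.
  have h1 := near2 d' ltac:(rewrite ger0_norm; lra).
  have := near2 (- d') ltac:(by rewrite normrN ger0_norm; lra).
  rewrite cofrN => h2.
  rewrite (le_trans (cabs_triangle _ _ (g (zt t)))) // (cabsB (g (zt t))).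
  by rewrite ltW //; lra.
exists d => // d' n hd'.
have E x : cmean f a (rho0 + x) n = segmean (fun z => g (z + cofr x)) n (cofr rho0) tpi.
  by rewrite segmean_shift -cofrD.
rewrite !E -mulN1r -segmeanZ -segmeanD; apply: segmean_bound_t => t ht.
by rewrite mulN1r cofrN; apply: hd => //; rewrite expr0 add0r.
Qed.

Lemma cmean_center f a e : 0 < e -> ccont f a -> exists rho, forall rho' n,
  rho' <= rho -> cabs (cmean f a rho' n - f a) <= e.
Proof.
move=> e0 /(_ e e0)[d d0 hd]; exists (ln (d / 2)) => rho' n hr.
rewrite -(cmean_cst (f a) a rho' n) -cmeanB; apply: cmean_bound => z hz.
rewrite -(subrK a z) [_ + a]addrC; apply/ltW/hd; rewrite hz.
have : expR rho' <= d / 2 by rewrite -[leRHS]lnK ?ler_expR // posrE divr_gt0.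
by lra.
Qed.

                                                                 
(** The circle is shrunk towards a. Its mean does not change over annuli that avoid the circle
    through w, changes arbitrarily little across that circle, and tends to f a at the centre. The
    exceptional point w is there for difference quotients based at w. *)
Lemma mean_value f a w rho :
  (forall z, cabs (z - a) <= expR rho -> ccont f z) ->
  (forall z, cabs (z - a) <= expR rho -> z != a -> z != w -> exists l, has_cderiv f z l) ->
  cabs (w - a) < expR rho -> ctends (cmean f a rho) (f a).
Proof.
move=> Hc Hd hw e e0.
have a0 : cabs (a - a) <= expR rho by rewrite subrr cabs0 expR_ge0.
have e4 : 0 < e / 4 by rewrite divr_gt0.
(* The logarithmic radius of the circle through w; for w = a no circle is exceptional, and any value
   below rho serves. *)
pose rho0 := if w == a then rho - 1 else ln (cabs (w - a)).
have r0 : rho0 < rho.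
  rewrite /rho0; case: (eqVneq w a) => [_|wa]; first by lra.
  by rewrite -ltr_expR lnK // posrE cabs_gt0 subr_eq0.
have Hd' z r : cabs (z - a) = expR r -> r <= rho -> r != rho0 -> exists l, has_cderiv f z l.
  move=> zr hr rr; apply: Hd; first by rewrite zr ler_expR.
    by rewrite -subr_eq0 -cabs_gt0 zr expR_gt0.
  apply: contra rr => /eqP zw; rewrite /rho0; case: (eqVneq w a) => wa.
    by have := expR_gt0 r; rewrite -zr zw wa subrr cabs0 ltxx.
  by rewrite -zw zr expRK.
have ann r1 r2 : r1 <= r2 -> r2 <= rho -> (r2 < rho0) || (rho0 < r1) ->
    ctends (fun n => cmean f a r2 n - cmean f a r1 n) 0.
  move=> h12 h2 h; apply: cmean_annulus => // z /andP[z1 z2].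
  have z0 : 0 < cabs (z - a) := lt_le_trans (expR_gt0 _) z1.
  have zE : cabs (z - a) = expR (ln (cabs (z - a))) by rewrite lnK.
  rewrite zE !ler_expR in z1 z2.
  apply: (Hd' z _ zE); first exact: le_trans z2 h2.
  by case/orP: h => h; [rewrite lt_eqF //; apply: le_lt_trans z2 h|rewrite gt_eqF // (lt_le_trans h)].
have [d d0 hd] := @cmean_cross f a rho0 _ e4 (fun z hz => Hc z ltac:(by rewrite hz ler_expR ltW)).
have [r1 hr1] := cmean_center e4 (Hc a a0).
pose d' := Num.min d (rho - rho0).
have d'0 : 0 < d' by rewrite lt_min d0 subr_gt0.
have d'd : d' <= d by rewrite ge_min lexx.
have d'r : d' <= rho - rho0 by rewrite ge_min lexx orbT.
pose r2 := Num.min r1 (rho0 - d').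
have r21 : r2 <= r1 by rewrite ge_min lexx.
have r22 : r2 <= rho0 - d' by rewrite ge_min lexx orbT.
have [N1 H1] := ann (rho0 + d') rho ltac:(lra) (lexx _) ltac:(apply/orP; right; lra) _ e4.
have [N2 H2] := ann r2 (rho0 - d') r22 ltac:(lra) ltac:(apply/orP; left; lra) _ e4.
exists (N1 + N2)%N => n hn.
have := H1 n (leq_trans (leq_addr _ _) hn); have := H2 n (leq_trans (leq_addl _ _) hn); have := hr1 r2 n r21.
have := hd d' n ltac:(lra); rewrite !subr0.
set A := cmean _ _ _ _; set B := cmean _ _ _ _; set D := cmean _ _ _ _; set E := cmean _ _ _ _ => k1 k2 k3 k4.
rewrite (_ : E - f a = (E - A) + (A - B) + (B - D) + (D - f a)); last by ring.
have := cabsD (E - A + (A - B) + (B - D)) (D - f a).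
have := cabsD (E - A + (A - B)) (B - D); have := cabsD (E - A) (A - B); lra.
Qed.

(** The limit does not depend on the radius as long as w stays inside, and for large radii
    (z-a)/(z-w) - 1 = (w-a)/(z-w) is small on the circle. *)
Lemma cmean_kernel a w rho : cabs (w - a) < expR rho ->
  ctends (cmean (fun z => (z - a) / (z - w)) a rho) 1.
Proof.
move=> hw e e0; set b := cabs (w - a) in hw.
have b0 : 0 <= b := cabs_ge0 _.
have e2 : 0 < e / 2 by rewrite divr_gt0.
pose big := Num.max (expR rho) (b + b / (e / 2)).
have big0 : 0 < big by rewrite lt_max expR_gt0.
have hr : rho <= ln big by rewrite -ler_expR lnK ?posrE // le_max lexx.
have [z hz|N HN] := @cmean_annulus (fun z => (z - a) / (z - w)) a rho (ln big) hr _ _ e2.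
  have zw : z - w != 0.
    rewrite subr_eq0; apply/negP => /eqP zw; move: hz; rewrite zw -/b.
    by case/andP; rewrite leNgt hw.
  exists (1 * (z - w)^-1 + (z - a) * (- ((z - w)^-1 * (z - w)^-1) * 1)).
  have H c : has_cderiv (fun z => z - c) z 1.
    by rewrite -[X in has_cderiv _ _ X]subr0; apply: has_cderivB;
      [exact: has_cderiv_id|exact: has_cderiv_cst].
  by apply: has_cderivM => //; apply: (@has_cderivV _ (fun z => z - w)).
exists N => n /HN; rewrite subr0; set A := cmean _ _ _ _; set B := cmean _ _ _ _ => k.
have kA : cabs (A - 1) <= e / 2.
  rewrite /A -(cmean_cst 1 a (ln big) n) -cmeanB; apply: cmean_bound => z.
  rewrite lnK ?posrE // => zb.
  have lb : big - b <= cabs (z - w).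
    rewrite -zb (_ : z - w = (z - a) + - (w - a)); last by ring.
    by have := cabsDl (z - a) (- (w - a)); rewrite cabsN.
  have [b1|b1] := eqVneq b 0.
    have -> : w = a by apply/eqP; rewrite -subr_eq0 -cabs_eq0 -/b b1.
    by rewrite divff ?subrr ?cabs0 ?ltW // -cabs_gt0 zb.
  have bp : 0 < b by rewrite lt_def b1.
  have h : b / (e / 2) <= big - b by rewrite lerBrDl le_max lexx orbT.
  have zw : 0 < cabs (z - w).
    by apply: lt_le_trans lb; apply: lt_le_trans h; rewrite divr_gt0.
  have -> : (z - a) / (z - w) - 1 = (w - a) / (z - w).
    by field; rewrite -cabs_gt0.
  rewrite cabsM cabsV -/b ler_pdivrMr //.
  by move: (le_trans h lb); rewrite ler_pdivrMr // mulrC.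
have := cabs_triangle B 1 A; rewrite (cabsB B A); lra.
Qed.

End CircleMean.

                           

(** * Cauchy's formula and regularity *)

Section Cauchy.
Variable R : realType.
Local Notation C := (Cplx R).
Local Notation hf m := ((2^-1 : R) ^+ m).
Local Notation tpi := (@twopii R).
Implicit Types (f g : C -> C) (a z w h : C) (rho r e d : R).

Lemma ccontM f g z : ccont f z -> ccont g z -> ccont (fun w => f w * g w) z.
Proof.
move=> Hf Hg e e0; set F := cabs (f z) + 1; set G := cabs (g z) + 1.
have F0 : 0 < F by rewrite ltr_wpDl // cabs_ge0.
have G0 : 0 < G by rewrite ltr_wpDl // cabs_ge0.
have [d1 d10 h1] := Hf _ (divr_gt0 (divr_gt0 e0 (ltr0Sn _ 1)) G0).
have [d2 d20 h2] := Hg _ (divr_gt0 (divr_gt0 e0 (ltr0Sn _ 1)) F0).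
have [d3 d30 h3] := Hg _ ltr01.
exists (Num.min d1 (Num.min d2 d3)); first by rewrite !lt_min d10 d20.
move=> h; rewrite !lt_min => /and3P[/h1 k1 /h2 k2 /h3 k3].
rewrite (_ : _ - _ = (f (z + h) - f z) * g (z + h) + f z * (g (z + h) - g z)); last by ring.
apply: le_lt_trans (cabsD _ _) _; rewrite !cabsM.
have gG : cabs (g (z + h)) <= G.
  by have := cabsD (g (z + h) - g z) (g z); rewrite subrK /G; lra.
have fF : cabs (f z) <= F by rewrite /F; lra.
move: k1 k2; rewrite !ltr_pdivlMr // => k1 k2.
have p1 : cabs (f (z + h) - f z) * cabs (g (z + h)) <= cabs (f (z + h) - f z) * G.
  by rewrite ler_wpM2l ?cabs_ge0.
have p2 : cabs (f z) * cabs (g (z + h) - g z) <= F * cabs (g (z + h) - g z).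
  by rewrite ler_wpM2r ?cabs_ge0.
lra.
Qed.

Lemma circle_bounded f a rho : (forall z, cabs (z - a) = expR rho -> ccont f z) ->
  exists K, forall z, cabs (z - a) = expR rho -> cabs (f z) <= K.
Proof.
move=> Hc; pose g (t : R) := f (a + cexp (cofr rho + cofr t * tpi)).
pose P (m : nat) (s t : R) := exists K, forall t', t <= t' <= t + hf m -> cabs (g t') <= K.
have [K HK] : P 0%N 0 0.
  apply: cousin2 => [m s t [K1 H1] _ [K2 H2] _|s t hs ht].
    exists (Num.max K1 K2) => t' ht'; have := half_powS R m => E.
    rewrite le_max; have [tt|tt] := leP t' (t + hf m.+1); apply/orP.
      by left; apply: H1; lra.
    by right; apply: H2; lra.
  have gc : ccont (fun z : C => f (a + cexp z)) (cofr rho + cofr t * tpi).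
    apply: (@ccont_comp _ (fun z => a + cexp z) f); last by apply: Hc; exact: on_circle.
    apply: has_cderiv_ccont; apply: has_cderivD; first exact: has_cderiv_cst.
    exact: has_cderiv_cexp.
  have [d d0 hd] := gc _ ltr01; set K := cabs tpi.
  have K0 : 0 <= K := cabs_ge0 _.
  have [m0 hm] := @half_pow_small R (d / (K + 1)) ltac:(by rewrite divr_gt0 // ltr_wpDl).
  exists m0 => m /hm {}hm s' t' _ _ _ _ _ ht'; exists (cabs (g t) + 1) => t2 ht2.
  have := hd (cofr (t2 - t) * tpi); rewrite -addrA -mulrDl -cofrD [t + _]addrC subrK.
  rewrite cabsM cabs_cofr -/K => H.
  have {}H : cabs (g t2 - g t) < 1.
    apply: H; apply: (@le_lt_trans _ _ (hf m * K)).
      by rewrite ler_wpM2r // ler_norml; lra.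
    move: hm; rewrite ltr_pdivlMr ?ltr_wpDl //; have := half_pow_gt0 R m; nra.
  have := cabsD (g t2 - g t) (g t); rewrite subrK; lra.
exists K => z hz; have z0 : z - a != 0 by rewrite -cabs_gt0 hz expR_gt0.
have [t ht zt] := cexp_polar z0.
have -> : z = a + cexp (cofr rho + cofr t * tpi).
  by move: zt; rewrite hz expRK => <-; rewrite [a + _]addrC subrK.
by apply: HK; rewrite add0r expr0.
Qed.

Lemma real_cauchy_cvg (b : nat -> R) :
  (forall e, 0 < e -> exists N, forall n, (N <= n)%N -> `|b n - b N| <= e) ->
  exists l, forall e, 0 < e -> exists N, forall n, (N <= n)%N -> `|b n - l| <= e.
Proof.
move=> H; pose S := [set x | exists N, forall n, (N <= n)%N -> x <= b n].
have key e N : (forall n, (N <= n)%N -> `|b n - b N| <= e) ->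
    S (b N - e) /\ ubound S (b N + e).
  move=> hN; split.
    by exists N => n /hN; rewrite ler_norml; lra.
  move=> x [M hM]; have := hM (maxn N M) (leq_maxr _ _).
  have := hN (maxn N M) (leq_maxl _ _); rewrite ler_norml; lra.
exists (sup S) => e e0; have e2 : 0 < e / 2 by rewrite divr_gt0.
have [N hN] := H _ e2; have [h1 h2] := key _ _ hN.
have l1 : b N - e / 2 <= sup S by apply: ub_le_sup => //; exists (b N + e / 2).
have l2 : sup S <= b N + e / 2 by apply: ge_sup => //; exists (b N - e / 2).
by exists N => n /hN; rewrite !ler_norml; lra.
Qed.

Lemma ctends_cauchy (b : nat -> C) :
  (forall e, 0 < e -> exists N, forall n, (N <= n)%N -> cabs (b n - b N) <= e) ->
  exists l, ctends b l.
Proof.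
move=> H.
have [x hx] : exists l, forall e, 0 < e -> exists N, forall n, (N <= n)%N -> `|cRe (b n) - l| <= e.
  apply: real_cauchy_cvg => e /H[N hN]; exists N => n /hN; apply: le_trans.
  by rewrite -cReN -cReD cRe_le.
have [y hy] : exists l, forall e, 0 < e -> exists N, forall n, (N <= n)%N -> `|cIm (b n) - l| <= e.
  apply: real_cauchy_cvg => e /H[N hN]; exists N => n /hN; apply: le_trans.
  by rewrite -cImN -cImD cIm_le.
exists (Complex x y) => e e0; have e2 : 0 < e / 2 by rewrite divr_gt0.
have [N1 h1] := hx _ e2; have [N2 h2] := hy _ e2.
exists (N1 + N2)%N => n hn; apply: le_trans (cabs_le _) _.
have := h1 n (leq_trans (leq_addr _ _) hn); have := h2 n (leq_trans (leq_addl _ _) hn).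
rewrite cReD cImD cReN cImN /=; lra.
Qed.

(** Think of [B n] as the derivative of [A n], with a second-order remainder uniform in n. Then
    [B n w] is uniformly close to difference quotients of [A n], which converge; so it is Cauchy,
    and the remainder bound passes to the limit. *)
Lemma taylor_limit a r (K : R) (A B : nat -> C -> C) (alpha : C -> C) :
  0 <= K ->
  (forall n w h, cabs (w - a) < r -> cabs (w + h - a) < r ->
     cabs (A n (w + h) - A n w - h * B n w) <= K * cabs h ^+ 2) ->
  (forall w, cabs (w - a) < r -> ctends (A ^~ w) (alpha w)) ->
  exists beta : C -> C, forall w, cabs (w - a) < r -> ctends (B ^~ w) (beta w) /\
    forall h, cabs (w + h - a) < r ->
      cabs (alpha (w + h) - alpha w - h * beta w) <= K * cabs h ^+ 2.
Proof.
move=> K0 HT HA.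
have Blim w : cabs (w - a) < r -> exists l, ctends (B ^~ w) l.
  move=> hw; apply: ctends_cauchy => e e0.
  (* A real increment that keeps w + h0 in the disc and makes the remainder K h0^2 at most h0 e /
     4. *)
  pose h0 : R := Num.min ((r - cabs (w - a)) / 2) (e / 4 / (K + 1)).
  have k1 : 0 < K + 1 by rewrite ltr_wpDl.
  have h00 : 0 < h0 by rewrite lt_min !divr_gt0 // subr_gt0.
  have h01 : h0 <= (r - cabs (w - a)) / 2 by rewrite ge_min lexx.
  have h02 : h0 * (K + 1) <= e / 4 by rewrite -ler_pdivlMr // ge_min lexx orbT.
  have hn0 : cofr h0 != 0 by rewrite -cabs_gt0 cabs_cofr normr_gt0 gt_eqF.
  have hc : cabs (cofr h0) = h0 by rewrite cabs_cofr gtr0_norm.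
  have whr : cabs (w + cofr h0 - a) < r.
    by rewrite addrAC; have := cabsD (w - a) (cofr h0); rewrite hc; lra.
  have e4 : 0 < h0 * e / 4 / 2 by rewrite !divr_gt0 // mulr_gt0.
  have [N1 H1] := HA _ whr _ e4; have [N2 H2] := HA _ hw _ e4.
  exists (N1 + N2)%N => n hn; set N := (N1 + N2)%N.
  have := H1 n (leq_trans (leq_addr _ _) hn); have := H1 N (leq_addr _ _).
  have := H2 n (leq_trans (leq_addl _ _) hn); have := H2 N (leq_addl _ _).
  have := HT n w _ hw whr; have := HT N w _ hw whr; rewrite hc.
  set An := A n w; set AN := A N w; set An' := A n _; set AN' := A N _ => q1 q2 q3 q4 q5 q6.
  have : h0 * cabs (B n w - B N w) <= h0 * e.
    rewrite -[X in X * _]hc -cabsM.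
    rewrite (_ : cofr h0 * _ = - (An' - An - cofr h0 * B n w) + (AN' - AN - cofr h0 * B N w)
       + ((An' - alpha (w + cofr h0)) + - (AN' - alpha (w + cofr h0)))
       + (- (An - alpha w) + (AN - alpha w))); last by ring.
    set X1 := An' - An - _ in q2 *; set X2 := AN' - AN - _ in q1 *.
    set X3 := An' - _ in q6 *; set X4 := AN' - _ in q5 *.
    set X5 := An - _ in q4 *; set X6 := AN - _ in q3 *.
    have := cabsD (- X1 + X2 + (X3 - X4)) (- X5 + X6).
    have := cabsD (- X1 + X2) (X3 - X4); have := cabsD (- X1) X2.
    have := cabsD X3 (- X4); have := cabsD (- X5) X6; rewrite !cabsN.
    have : K * h0 ^+ 2 <= h0 * (e / 4).
      rewrite expr2 mulrA mulrC ler_pM2l //; nra.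
    have : 0 < h0 * e by rewrite mulr_gt0.
    lra.
  by rewrite ler_pM2l.
have step w : exists l, cabs (w - a) < r -> ctends (B ^~ w) l.
  have [hw|hw] := pselect (cabs (w - a) < r); last by exists 0.
  by have [l hl] := Blim w hw; exists l.
have [beta Hb] := boolp.choice step.
exists beta => w hw; split; first exact: Hb.
move=> h hh; apply: (@ctends_le _ (fun n => A n (w + h) - A n w - h * B n w)).
  by apply: ctendsB; [apply: ctendsB; apply: HA|apply: ctendsZ; exact: Hb].
by exists 0%N => n _; exact: HT.
Qed.

Lemma taylor_cderiv (alpha beta : C -> C) a r (K : R) w : 0 <= K -> cabs (w - a) < r ->
  (forall h, cabs (w + h - a) < r ->
      cabs (alpha (w + h) - alpha w - h * beta w) <= K * cabs h ^+ 2) ->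
  has_cderiv alpha w (beta w).
Proof.
move=> K0 hw H e e0; have k1 : 0 < K + 1 by rewrite ltr_wpDl.
exists (Num.min (r - cabs (w - a)) (e / (K + 1))).
  by rewrite lt_min subr_gt0 hw divr_gt0.
move=> h; rewrite lt_min => /andP[h1 h2]; rewrite [beta w * h]mulrC.
apply: (le_trans (H h _)).
  by rewrite addrAC; have := cabsD (w - a) h; lra.
rewrite expr2 mulrA ler_wpM2r ?cabs_ge0 //.
move: h2; rewrite ltr_pdivlMr //; have := cabs_ge0 h; nra.
Qed.

Section CauchyDisc.
Variables (f : C -> C) (a : C) (rho : R).
Hypothesis Hc : forall z, cabs (z - a) <= expR rho -> ccont f z.
Hypothesis Hd : forall z, cabs (z - a) <= expR rho -> z != a -> exists l, has_cderiv f z l.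

Let L (phi : C -> C) n := cmean phi a rho n.

Lemma has_cderiv_shift c z : has_cderiv (fun z => z - c) z 1.
Proof.
rewrite -[X in has_cderiv _ _ X]subr0; apply: has_cderivB; first exact: has_cderiv_id.
exact: has_cderiv_cst.
Qed.

(** For w distinct from a, [mean_value] is applied to (z-a)(f z - f w)/(z-w), which vanishes at a;
    adding f w times the kernel gives the formula. At the centre a the function f is only assumed
    continuous, and this is what removable singularities will rest on. *)
Lemma cauchy_formula w : cabs (w - a) < expR rho ->
  ctends (L (fun z => (z - a) * f z / (z - w))) (f w).
Proof.
move=> hw; have [wa|wa] := eqVneq w a.
  have : ctends (L f) (f a).
    by apply: (@mean_value _ _ _ a) => //; [move=> z h1 h2 _; exact: Hd|rewrite subrr cabs0 expR_gt0].
  rewrite wa; apply: ctends_ext => n; apply: cmean_eq_on => z hz.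
  have z0 : z - a != 0 by rewrite -cabs_gt0 hz expR_gt0.
  by field.
have [l Hl] := Hd (ltW hw) wa.
pose g z := (z - a) * (if z == w then l else (f z - f w) / (z - w)).
have gd z : cabs (z - a) <= expR rho -> z != a -> z != w -> exists l, has_cderiv g z l.
  move=> hz za zw; have [m Hm] := Hd hz za.
  have zw0 : z - w != 0 by rewrite subr_eq0.
  eexists; apply: (@has_cderiv_near _ (fun z => (z - a) * ((f z - f w) / (z - w)))); last first.
    apply: has_cderivM; first exact: has_cderiv_shift.
    apply: has_cderivM; first by apply: has_cderivB Hm (has_cderiv_cst _ _).
    by apply: (@has_cderivV _ (fun z => z - w)) => //; exact: has_cderiv_shift.
  apply/nbhsCP; exists (cabs (z - w)); first by rewrite cabs_gt0.
  move=> y hy; rewrite /g ifN //; apply: contraTneq hy => ->.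
  by rewrite -leNgt cabsB.
have gc z : cabs (z - a) <= expR rho -> ccont g z.
  (* Near a only continuity of f is available: the quotient stays bounded and the factor z - a tends
     to 0. *)
  move=> hz; have [za|za] := eqVneq z a.
    move=> e e0; subst z.
    have wa0 : 0 < cabs (w - a) by rewrite cabs_gt0 subr_eq0.
    have fc := Hc hz; set K := (2 * (cabs (f a - f w) + 1) / cabs (w - a)).
    have K0 : 0 < K by rewrite divr_gt0 // mulr_gt0 // ltr_wpDl // cabs_ge0.
    have [d d0 hd] := fc 1 ltr01.
    exists (Num.min d (Num.min (cabs (w - a) / 2) (e / K))).
      by rewrite lt_min d0 lt_min (divr_gt0 wa0 (ltr0Sn _ 1)) (divr_gt0 e0 K0).
    move=> h; rewrite !lt_min => /and3P[h1 h2 h3].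
    have whl : cabs (w - a) / 2 <= cabs (a + h - w).
      rewrite (_ : a + h - w = - (w - a - h)) ?cabsN; last by ring.
      by have := cabsDl (w - a) (- h); rewrite cabsN; lra.
    have whn : a + h - w != 0 by rewrite -cabs_gt0 (lt_le_trans _ whl) // divr_gt0.
    rewrite /g subrr mul0r subr0 ifN; last by rewrite -subr_eq0.
    rewrite addrAC subrr add0r !cabsM cabsV.
    have fb : cabs (f (a + h) - f w) <= cabs (f a - f w) + 1.
      have := hd h h1; have := cabs_triangle (f (a + h)) (f w) (f a); lra.
    have : cabs (f (a + h) - f w) / cabs (a + h - w) <= K.
      rewrite ler_pdivrMr ?cabs_gt0 // (le_trans fb) //.
      have q : 0 < cabs (f a - f w) + 1 by rewrite ltr_wpDl // cabs_ge0.
      rewrite [leLHS](_ : _ = K * (cabs (w - a) / 2)) ?ler_pM2l //.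
      by rewrite /K; field; rewrite gt_eqF.
    move: h3; rewrite ltr_pdivlMr // => h3 q.
    by apply: le_lt_trans h3; rewrite ler_wpM2l ?cabs_ge0.
  have [zw|zw] := eqVneq z w; last first.
    by have [m /has_cderiv_ccont] := gd z hz za zw.
  subst z => e e0.
  pose q z := if z == w then l else (f z - f w) / (z - w).
  have qc : ccont q w.
    move=> e1 e10; have [d d0 hd] := Hl (e1 / 2) ltac:(by rewrite divr_gt0).
    exists d => // h hh; rewrite /q eqxx; case: eqVneq => [_|hw0].
      by rewrite subrr cabs0.
    have h0 : h != 0 by apply: contra hw0 => /eqP ->; rewrite addr0.
    have -> : (f (w + h) - f w) / (w + h - w) - l = (f (w + h) - f w - l * h) / h.
      have -> : w + h - w = h by ring.
      by field.
    rewrite cabsM cabsV ltr_pdivrMr ?cabs_gt0 //; apply: le_lt_trans (hd h hh) _.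
    by rewrite ltr_pM2r ?cabs_gt0 // ltr_pdivrMr // ltr_pMr // ltr1n.
  exact: (ccontM (has_cderiv_ccont (has_cderiv_shift a w)) qc).
have H1 : ctends (L g) (g a) by apply: (@mean_value _ _ _ w).
have H2 := ctendsZ (f w) (cmean_kernel hw).
have := ctendsD H1 H2; rewrite {2}/g subrr mul0r add0r mulr1; apply: ctends_ext => n.
rewrite /L -cmeanZ -cmeanD; apply: cmean_eq_on => z hz.
have zw : z != w by apply: contraTneq hw => <-; rewrite hz ltxx.
by rewrite /g ifN //; field; rewrite subr_eq0.
Qed.

(** Differentiation under the integral: the powers of 1/(z-w) have second-order expansions in w with
    uniform remainders for w in the half disc, so [taylor_limit] applies first to A0, A1 and then to
    A1, A2. *)
Lemma cauchy_regularity : exists f1 f2 : C -> C, exists2 K : R, 0 <= K &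
  forall w, cabs (w - a) < expR rho / 2 ->
  [/\ has_cderiv f w (f1 w), has_cderiv f1 w (f2 w) &
    forall h, cabs (w + h - a) < expR rho / 2 ->
      cabs (f (w + h) - f w - h * f1 w) <= K * cabs h ^+ 2].
Proof.
have HcB z : cabs (z - a) = expR rho -> ccont f z by move=> hz; apply: Hc; rewrite hz.
have [B HB] := circle_bounded HcB.
set r := expR rho in HB *; have r0 : 0 < r := expR_gt0 _.
pose F z := (z - a) * f z.
pose A0 n w := L (fun z => F z * (z - w)^-1) n.
pose A1 n w := L (fun z => F z * ((z - w)^-1) ^+ 2) n.
pose A2 n w := L (fun z => F z * (2 * (z - w)^-1 ^+ 3)) n.
have B0 : 0 <= `|B| by [].
have HB' z : cabs (z - a) = r -> cabs (F z) <= r * `|B|.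
  by move=> hz; rewrite cabsM hz ler_wpM2l ?(ltW r0) // (le_trans (HB z hz)) // ler_norm.
have far z w : cabs (z - a) = r -> cabs (w - a) < r / 2 -> r / 2 <= cabs (z - w).
  move=> hz hw; rewrite (_ : z - w = (z - a) - (w - a)); last by ring.
  have := cabsDl (z - a) (- (w - a)); rewrite cabsN; lra.
(* An upper bound of 1/|z-w| for z on the circle and w in the half disc. *)
pose k := (r / 2)^-1.
have k0 : 0 < k by rewrite invr_gt0 divr_gt0.
have vk z w : cabs (z - a) = r -> cabs (w - a) < r / 2 -> (z - w != 0) * (cabs (z - w)^-1 <= k).
  move=> hz hw; have h := far z w hz hw; have p : 0 < cabs (z - w).
    by apply: lt_le_trans h; rewrite divr_gt0.
  by split; [rewrite -cabs_gt0|rewrite cabsV lef_pV2 ?posrE // divr_gt0].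
pose K0 := r * `|B| * k ^+ 3; pose K1 := r * `|B| * (3 * k ^+ 4).
have T0 n w h : cabs (w - a) < r / 2 -> cabs (w + h - a) < r / 2 ->
     cabs (A0 n (w + h) - A0 n w - h * A1 n w) <= K0 * cabs h ^+ 2.
  move=> hw hh; rewrite /A0 /A1 /L -cmeanZ -!cmeanB; apply: cmean_bound => z hz.
  have [v0 vl] := vk z w hz hw; have [v0' vl'] := vk z _ hz hh.
  have -> : F z * (z - (w + h))^-1 - F z * (z - w)^-1 - h * (F z * (z - w)^-1 ^+ 2)
     = F z * (((z - w)^-1) ^+ 2 * (z - (w + h))^-1) * h ^+ 2.
    by field; rewrite v0 /= v0'.
  rewrite cabsM (cabsX h) ler_wpM2r ?exprn_ge0 ?cabs_ge0 // /K0.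
  rewrite (cabsM (F z)) ler_pM ?cabs_ge0 //; first exact: HB'.
  rewrite cabsM cabsX [k ^+ 3]exprSr ler_pM ?exprn_ge0 ?cabs_ge0 //.
  by rewrite lerXn2r ?nnegrE ?cabs_ge0 // ltW.
have T1 n w h : cabs (w - a) < r / 2 -> cabs (w + h - a) < r / 2 ->
     cabs (A1 n (w + h) - A1 n w - h * A2 n w) <= K1 * cabs h ^+ 2.
  move=> hw hh; rewrite /A2 /A1 /L -cmeanZ -!cmeanB; apply: cmean_bound => z hz.
  have [v0 vl] := vk z w hz hw; have [v0' vl'] := vk z _ hz hh.
  set u := (z - w)^-1 in vl *; set u' := (z - (w + h))^-1 in vl' *.
  have -> : F z * u' ^+ 2 - F z * u ^+ 2 - h * (F z * (2 * u ^+ 3))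
     = F z * (u ^+ 2 * u' ^+ 2 + 2 * (u ^+ 3 * u')) * h ^+ 2.
    by rewrite /u /u'; field; rewrite v0 /= v0'.
  rewrite cabsM (cabsX h) ler_wpM2r ?exprn_ge0 ?cabs_ge0 // /K1.
  rewrite (cabsM (F z)) ler_pM ?cabs_ge0 //; first exact: HB'.
  apply: le_trans (cabsD _ _) _.
  rewrite (cabsM (u ^+ 2)) (cabsM 2) (cabsM (u ^+ 3)) !cabsX (cabs_nat _ 2).
  have u0 := cabs_ge0 u; have u0' := cabs_ge0 u'.
  have p1 : cabs u ^+ 2 * cabs u' ^+ 2 <= k ^+ 2 * k ^+ 2.
    by rewrite ler_pM ?exprn_ge0 // lerXn2r ?nnegrE // ltW.
  have p2 : cabs u ^+ 3 * cabs u' <= k ^+ 3 * k.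
    by rewrite ler_pM ?exprn_ge0 // lerXn2r ?nnegrE // ltW.
  have e1 : k ^+ 2 * k ^+ 2 = k ^+ 4 by ring.
  have e2 : k ^+ 3 * k = k ^+ 4 by ring.
  by rewrite e1 in p1; rewrite e2 in p2; lra.
have L0 w : cabs (w - a) < r / 2 -> ctends (A0 ^~ w) (f w).
  by move=> hw; apply: cauchy_formula; rewrite -/r; lra.
have K00 : 0 <= K0 by rewrite !mulr_ge0 ?exprn_ge0 // ltW.
have K10 : 0 <= K1 by rewrite !mulr_ge0 ?exprn_ge0 // ltW.
have [f1 H1] := taylor_limit K00 T0 L0.
have [f2 H2] := taylor_limit K10 T1 (fun w hw => (H1 w hw).1).
exists f1, f2, K0 => // w hw; split.
- exact: taylor_cderiv K00 hw (H1 w hw).2.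
- exact: taylor_cderiv K10 hw (H2 w hw).2.
- exact: (H1 w hw).2.
Qed.

End CauchyDisc.
End Cauchy.

                                              

(** * Holomorphic functions: closure properties, removable singularities, maximum principle,
    Liouville *)

Section Holomorphic.
Variable R : realType.
Local Notation C := (Cplx R).
Local Notation hf m := ((2^-1 : R) ^+ m).
Local Notation tpi := (@twopii R).
Implicit Types (f g : C -> C) (a z w h : C) (rho r e d : R).

Lemma holomorphic_atP f a : holomorphic_at f a <->
  exists2 r, 0 < r & forall w, cabs (w - a) < r -> exists l, has_cderiv f w l.
Proof.
split=> [/nbhsCP [r r0 H]|[r r0 H]].
  by exists r => // w /H /derivableCP.
by apply/nbhsCP; exists r => // w /H /derivableCP.
Qed.

Lemma holomorphic_at_cderiv f a : holomorphic_at f a -> has_cderiv f a (derive1 f a).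
Proof.
move=> /holomorphic_atP [r r0 /(_ a)]; rewrite subrr cabs0 => /(_ r0) [l H].
by rewrite (has_cderiv_derive1 H).
Qed.

Lemma holomorphic_at_ccont f a : holomorphic_at f a -> ccont f a.
Proof. by move=> /holomorphic_at_cderiv /has_cderiv_ccont. Qed.

Lemma near_and (P Q : C -> Prop) a : (\forall z \near a, P z) -> (\forall z \near a, Q z) ->
  \forall z \near a, P z /\ Q z.
Proof. by move=> H1 H2; apply: filterI. Qed.

Lemma near_at (P : C -> Prop) a : (\forall z \near a, P z) -> P a.
Proof. exact: nbhs_singleton. Qed.

Lemma near_all (P : C -> Prop) a : (forall z, P z) -> \forall z \near a, P z.
Proof. by move=> H; apply/nbhsCP; exists 1. Qed.

Lemma near_imp (P Q : C -> Prop) a : (forall z, P z -> Q z) ->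
  (\forall z \near a, P z) -> \forall z \near a, Q z.
Proof. by move=> PQ; apply: filterS. Qed.

Lemma near_near (P : C -> Prop) a : (\forall z \near a, P z) ->
  \forall z \near a, \forall w \near z, P w.
Proof.
move=> /nbhsCP[r r0 H]; apply/nbhsCP; exists r => // z hz; apply/nbhsCP.
exists (r - cabs (z - a)); first by rewrite subr_gt0.
by move=> w hw; apply: H; have := cabs_triangle w a z; lra.
Qed.

Lemma near_ccont f a (P : C -> Prop) : ccont f a -> (\forall w \near f a, P w) ->
  \forall z \near a, P (f z).
Proof.
move=> Hf /nbhsCP[r r0 H]; have [d d0 hd] := Hf r r0; apply/nbhsCP; exists d => // z /hd.
by rewrite [a + _]addrC subrK; exact: H.
Qed.

Lemma near_neq a b : a != b -> \forall z \near a, z != b.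
Proof.
move=> ab; apply/nbhsCP; exists (cabs (a - b)); first by rewrite cabs_gt0 subr_eq0.
by move=> w; apply: contraTneq => ->; rewrite cabsB ltxx.
Qed.

Lemma near_neq0 f a : ccont f a -> f a != 0 -> \forall z \near a, f z != 0.
Proof. by move=> Hf /near_neq; exact: (@near_ccont f a (fun w => w != 0)). Qed.

Lemma holomorphic_at_near f a : holomorphic_at f a -> \forall z \near a, holomorphic_at f z.
Proof. exact: near_near. Qed.

Lemma holomorphic_at_eq f g a : (\forall z \near a, f z = g z) ->
  holomorphic_at f a -> holomorphic_at g a.
Proof.
move=> H1 H2; have H := near_and (near_near H1) (holomorphic_at_near H2).
apply: near_imp H => z [h1 h2].
by apply/derivableCP; exists (derive1 f z); apply: has_cderiv_near h1 _; exact: holomorphic_at_cderiv.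
Qed.

Lemma holomorphic_lift2 (op : (C -> C) -> (C -> C) -> C -> C) f g a :
  (forall z l m, has_cderiv f z l -> has_cderiv g z m -> exists k, has_cderiv (op f g) z k) ->
  holomorphic_at f a -> holomorphic_at g a -> holomorphic_at (op f g) a.
Proof.
move=> H Hf Hg; have := near_and (holomorphic_at_near Hf) (holomorphic_at_near Hg).
apply: near_imp => z [h1 h2]; apply/derivableCP.
exact: H (holomorphic_at_cderiv h1) (holomorphic_at_cderiv h2).
Qed.

Lemma holomorphic_atD f g a : holomorphic_at f a -> holomorphic_at g a ->
  holomorphic_at (fun z => f z + g z) a.
Proof.
apply: (@holomorphic_lift2 (fun f g z => f z + g z)) => z l m h1 h2.
by exists (l + m); exact: has_cderivD.
Qed.

Lemma holomorphic_atB f g a : holomorphic_at f a -> holomorphic_at g a ->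
  holomorphic_at (fun z => f z - g z) a.
Proof.
apply: (@holomorphic_lift2 (fun f g z => f z - g z)) => z l m h1 h2.
by exists (l - m); exact: has_cderivB.
Qed.

Lemma holomorphic_atM f g a : holomorphic_at f a -> holomorphic_at g a ->
  holomorphic_at (fun z => f z * g z) a.
Proof.
apply: (@holomorphic_lift2 (fun f g z => f z * g z)) => z l m h1 h2.
by eexists; exact: has_cderivM h1 h2.
Qed.

Lemma holomorphic_at_cst (c : C) a : holomorphic_at (fun=> c) a.
Proof. by apply/holomorphic_atP; exists 1 => // w _; exists 0; exact: has_cderiv_cst. Qed.

Lemma holomorphic_at_id a : holomorphic_at (fun z => z) a.
Proof. by apply/holomorphic_atP; exists 1 => // w _; exists 1; exact: has_cderiv_id. Qed.

Lemma holomorphic_at_comp f g a : holomorphic_at f a -> holomorphic_at g (f a) ->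
  holomorphic_at (fun z => g (f z)) a.
Proof.
move=> Hf Hg.
have := near_and (holomorphic_at_near Hf)
  (@near_ccont f a _ (holomorphic_at_ccont Hf) (holomorphic_at_near Hg)).
apply: near_imp => z [h1 h2]; apply/derivableCP; eexists.
by apply: has_cderiv_comp; apply: holomorphic_at_cderiv.
Qed.

Lemma holomorphic_at_inv a : a != 0 -> holomorphic_at (fun z => z^-1) a.
Proof.
move=> /near_neq; apply: near_imp => z z0; apply/derivableCP; eexists.
exact: has_cderiv_inv.
Qed.

Lemma holomorphic_atV f a : f a != 0 -> holomorphic_at f a ->
  holomorphic_at (fun z => (f z)^-1) a.
Proof. by move=> f0 Hf; apply: (holomorphic_at_comp Hf); exact: holomorphic_at_inv. Qed.

Lemma holomorphic_atX f a n : holomorphic_at f a -> holomorphic_at (fun z => f z ^+ n) a.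
Proof.
move=> Hf; elim: n => [|n IH]; first exact: holomorphic_at_cst.
apply: holomorphic_at_eq (holomorphic_atM Hf IH).
by apply: near_all => z; rewrite exprS.
Qed.

Lemma holomorphic_at_horner (p : {poly C}) a : holomorphic_at (fun z => p.[z]) a.
Proof.
elim/poly_ind: p => [|p c IH].
  by apply: holomorphic_at_eq (holomorphic_at_cst 0 a); apply: near_all => z; rewrite horner0.
apply: holomorphic_at_eq (holomorphic_atD (holomorphic_atM IH (holomorphic_at_id a)) (holomorphic_at_cst c a)).
by apply: near_all => z; rewrite hornerMXaddC.
Qed.

Lemma holomorphic_at_prod (I : Type) (s : seq I) (F : I -> C -> C) a :
  (forall i, holomorphic_at (F i) a) -> holomorphic_at (fun z => \prod_(i <- s) F i z) a.
Proof.
move=> H; elim: s => [|i s IH].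
  by apply: holomorphic_at_eq (holomorphic_at_cst 1 a); apply: near_all => z; rewrite big_nil.
by apply: holomorphic_at_eq (holomorphic_atM (H i) IH); apply: near_all => z; rewrite big_cons.
Qed.

Lemma regularity f a r : 0 < r -> ccont f a ->
  (forall w, cabs (w - a) < r -> w != a -> exists l, has_cderiv f w l) ->
  exists f1 f2 : C -> C, exists d, exists2 K : R, 0 < d & 
  0 <= K /\ forall w, cabs (w - a) < d ->
  [/\ has_cderiv f w (f1 w), has_cderiv f1 w (f2 w) &
    forall h, cabs (w + h - a) < d ->
      cabs (f (w + h) - f w - h * f1 w) <= K * cabs h ^+ 2].
Proof.
move=> r0 fc Hd; pose rho := ln (r / 2).
have rE : expR rho = r / 2 by rewrite lnK // posrE divr_gt0.
have H1 z : cabs (z - a) <= expR rho -> z != a -> exists l, has_cderiv f z l.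
  by rewrite rE => hz; apply: Hd; lra.
have H2 z : cabs (z - a) <= expR rho -> ccont f z.
  move=> hz; have [->//|za] := eqVneq z a.
  by have [l /has_cderiv_ccont] := H1 z hz za.
have [f1 [f2 [K K0 H]]] := cauchy_regularity H2 H1.
exists f1, f2, (expR rho / 2), K; first by rewrite divr_gt0 // expR_gt0.
by split.
Qed.

(** [regularity] assumes only continuity at the centre, and its conclusion includes the centre. *)
Lemma removable f a : ccont f a -> (\forall z \near a, z != a -> derivable f z 1) ->
  holomorphic_at f a.
Proof.
move=> fc /nbhsCP[r r0 H].
have [w hw wa|f1 [f2 [d [K d0 [K0 HH]]]]] := @regularity f a r r0 fc.
  by apply/derivableCP; exact: H.
by apply/holomorphic_atP; exists d => // w /HH[? _ _]; exists (f1 w).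
Qed.

Lemma holomorphic_regularity f a : holomorphic_at f a ->
  exists d, exists2 K : R, 0 < d & 0 <= K /\ forall w, cabs (w - a) < d ->
    (exists l, has_cderiv (derive1 f) w l) /\
    forall h, cabs (w + h - a) < d ->
      cabs (f (w + h) - f w - h * derive1 f w) <= K * cabs h ^+ 2.
Proof.
move=> Hf; have fc := holomorphic_at_ccont Hf; move/holomorphic_atP: Hf => [r r0 H].
have [w hw _|f1 [f2 [d [K d0 [K0 HH]]]]] := @regularity f a r r0 fc; first exact: H.
exists d, K => //; split => // w hw; have [h1 h2 h3] := HH w hw; split; last first.
  by rewrite (has_cderiv_derive1 h1).
exists (f2 w); apply: has_cderiv_near h2; apply/nbhsCP.
exists (d - cabs (w - a)); first by rewrite subr_gt0.
move=> z hz; have [|h4 _ _] := HH z; last by rewrite (has_cderiv_derive1 h4).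
by have := cabs_triangle z a w; lra.
Qed.

Lemma holomorphic_at_derive1 f a : holomorphic_at f a -> holomorphic_at (derive1 f) a.
Proof.
move=> /holomorphic_regularity [d [K d0 [_ H]]].
by apply/holomorphic_atP; exists d => // w /H[].
Qed.

Lemma cRe_half z w : cRe ((z + w) / 2) = (cRe z + cRe w) / 2.
Proof. by rewrite mulrC -(cofr_nat R 2) -cofrV cRe_cofrM cReD mulrC. Qed.

Lemma segmean_lower g n (p v : C) (c : R) :
  (forall t : R, 0 <= t <= 1 -> c <= cRe (g (p + cofr t * v))) ->
  c <= cRe (segmean g n p v).
Proof.
elim: n p v => [|n IH] p v H /=.
  have h0 := H 0; have h1 := H 1; rewrite cofr0 mul0r addr0 in h0; rewrite cofr1 mul1r in h1.
  by rewrite cRe_half; lra.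
have h1 := IH p (v / 2); have h2 := IH (p + v / 2) (v / 2).
have e t : p + cofr t * (v / 2) = p + cofr (t / 2) * v.
  by rewrite cofrM cofrV cofr_nat; ring.
have e' t : p + v / 2 + cofr t * (v / 2) = p + cofr (2^-1 + t / 2) * v.
  by rewrite cofrD cofrM !cofrV cofr_nat; ring.
rewrite cRe_half.
have k1 := h1 ltac:(by move=> t ht; rewrite e; apply: H; lra).
have k2 := h2 ltac:(by move=> t ht; rewrite e'; apply: H; lra).
lra.
Qed.

(** Halving m times towards t0 isolates a piece of relative length 2^-m on which the real part is at
    least c; the other pieces contribute nonnegatively. *)
Lemma segmean_lower_local g n m (p v : C) (c t0 : R) : 0 <= t0 <= 1 -> 0 <= c ->
  (forall t : R, 0 <= t <= 1 -> 0 <= cRe (g (p + cofr t * v))) ->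
  (forall t : R, 0 <= t <= 1 -> `|t - t0| <= hf m -> c <= cRe (g (p + cofr t * v))) ->
  c * hf m <= cRe (segmean g (m + n) p v).
Proof.
move=> ht0 c0; elim: m p v t0 ht0 => [|m IH] p v t0 ht0 H0 Hc.
  rewrite expr0 mulr1 in Hc *; apply: segmean_lower => t ht; apply: Hc => //.
  by rewrite ler_norml; lra.
have e t : p + cofr t * (v / 2) = p + cofr (t / 2) * v.
  by rewrite cofrM cofrV cofr_nat; ring.
have e' t : p + v / 2 + cofr t * (v / 2) = p + cofr (2^-1 + t / 2) * v.
  by rewrite cofrD cofrM !cofrV cofr_nat; ring.
rewrite addSn /= cRe_half.
have E := half_powS R m.
have k1 : 0 <= cRe (segmean g (m + n) p (v / 2)).
  by apply: segmean_lower => t ht; rewrite e; apply: H0; lra.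
have k2 : 0 <= cRe (segmean g (m + n) (p + v / 2) (v / 2)).
  by apply: segmean_lower => t ht; rewrite e'; apply: H0; lra.
rewrite E.
have [h|h] := leP t0 (2^-1).
  have := IH p (v / 2) (2 * t0) ltac:(lra).
  move=> /(_ ltac:(by move=> t ht; rewrite e; apply: H0; lra)) K.
  have {}K : c * hf m <= cRe (segmean g (m + n) p (v / 2)).
    by apply: K => t ht; rewrite ler_norml => ht2; rewrite e; apply: Hc; rewrite ?ler_norml ?E; lra.
  by lra.
have := IH (p + v / 2) (v / 2) (2 * t0 - 1) ltac:(lra).
move=> /(_ ltac:(by move=> t ht; rewrite e'; apply: H0; lra)) K.
have {}K : c * hf m <= cRe (segmean g (m + n) (p + v / 2) (v / 2)).
  by apply: K => t ht; rewrite ler_norml => ht2; rewrite e'; apply: Hc; rewrite ?ler_norml ?E; lra.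
by lra.
Qed.

(** If f z differs from f a, then 1 - f / f a has nonnegative real part on the circle through z and
    positive real part at z. Its means are then bounded below by a positive constant, whereas the
    mean value property makes them tend to 0. *)
Lemma strong_maximum f a : holomorphic_at f a ->
  (\forall z \near a, cabs (f z) <= cabs (f a)) -> \forall z \near a, f z = f a.
Proof.
move=> /holomorphic_atP[r1 r10 Hd] /nbhsCP[r2 r20 Hm].
have [fa|fa] := eqVneq (f a) 0.
  apply/nbhsCP; exists r2 => // z /Hm; rewrite fa cabs0 => h.
  by apply/eqP; rewrite -cabs_eq0; apply/eqP/le_anti; rewrite h cabs_ge0.
have fa0 : 0 < cabs (f a) by rewrite cabs_gt0.
apply/nbhsCP; exists (Num.min r1 r2); first by rewrite lt_min r10.
move=> z; rewrite lt_min => /andP[hz1 hz2].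
have [->//|za] := eqVneq z a.
have za0 : z - a != 0 by rewrite subr_eq0.
set rho := ln (cabs (z - a)).
have rE : expR rho = cabs (z - a) by rewrite lnK // posrE cabs_gt0.
have [t0 ht0 zt] := cexp_polar za0; rewrite -/rho in zt.
pose u z := f z / f a.
have ud y : cabs (y - a) <= expR rho -> exists l, has_cderiv u y l.
  rewrite rE => hy; have [|l Hl] := Hd y; first exact: le_lt_trans hz1.
  exists ((f a)^-1 * l); apply: has_cderiv_ext (has_cderivZ _ Hl) => x.
  by rewrite /u mulrC.
have MV : ctends (cmean u a rho) 1.
  rewrite -(divff fa); apply: (@mean_value _ _ _ a).
  - by move=> y /ud[l /has_cderiv_ccont].
  - by move=> y hy _ _; exact: ud.
  - by rewrite subrr cabs0 expR_gt0.
have u1 y : cabs (y - a) < r2 -> cabs (u y) <= 1.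
  by move=> hy; rewrite /u cabsM cabsV ler_pdivrMr // mul1r; exact: Hm.
apply/eqP; apply: contrapT => /negP fz.
have uz : u z != 1.
  by apply: contra fz => /eqP h; rewrite -[f z](divfK fa) -/(u z) h mul1r.
pose q y := 1 - u y.
have q0 y : cabs (y - a) = expR rho -> 0 <= cRe (q y).
  rewrite rE => hy; have := u1 y ltac:(by rewrite hy).
  by have := cRe_le (u y); rewrite cReD cReN /= ler_norml; lra.
(* A number of modulus at most 1 and real part 1 is 1. *)
have qz : 0 < cRe (q z).
  have := u1 z hz2; have := cabs_sqr (u z); have := cabs_ge0 (u z) => h0 h1 h2.
  rewrite cReD cReN /= subr_gt0 lt_neqAle; apply/andP; split.
    apply: contra uz => /eqP e; apply/eqP; apply: complex_eq => //.
    apply/eqP; rewrite -sqrf_eq0; apply/eqP/le_anti; rewrite sqr_ge0 andbT.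
    by rewrite e in h1; have := exprn_ile1 2 h0 h2; lra.
  by have := cRe_le (u z); rewrite ler_norml; lra.
set c := cRe (q z) / 2; have c0 : 0 < c by rewrite divr_gt0.
pose gg y := q (a + cexp y).
have gc : ccont gg (cofr rho + cofr t0 * tpi).
  apply: (@ccont_comp _ (fun y => a + cexp y) q).
    apply: has_cderiv_ccont; apply: has_cderivD; first exact: has_cderiv_cst.
    exact: has_cderiv_cexp.
  have [l Hl] := ud (a + cexp (cofr rho + cofr t0 * tpi)) ltac:(by rewrite on_circle).
  by apply: has_cderiv_ccont; apply: has_cderivB Hl; exact: has_cderiv_cst.
have zE : a + cexp (cofr rho + cofr t0 * tpi) = z by rewrite -zt [a + _]addrC subrK.
have [d d0 hd] := gc c c0.
set K := cabs tpi; have K0 : 0 <= K := cabs_ge0 _.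
have [m hm] := @half_pow_small R (d / (K + 1)) ltac:(by rewrite divr_gt0 // ltr_wpDl).
have {}hm := hm m (leqnn _).
have LB n : c * hf m <= cRe (cmean q a rho (m + n)).
  apply: (@segmean_lower_local _ _ _ _ _ _ t0) => //; first exact: ltW.
    by move=> t ht; apply: q0; exact: on_circle.
  move=> t ht tt; have := hd (cofr (t - t0) * tpi).
  have -> : cofr rho + cofr t0 * tpi + cofr (t - t0) * tpi = cofr rho + cofr t * tpi.
    by rewrite cofrB; ring.
  rewrite cabsM cabs_cofr -/K => h.
  have {}h : cabs (gg (cofr rho + cofr t * tpi) - q z) < c.
    rewrite -zE; apply: h; apply: (@le_lt_trans _ _ (hf m * K)); first by rewrite ler_wpM2r.
    by move: hm; rewrite ltr_pdivlMr ?ltr_wpDl //; have := half_pow_gt0 R m; nra.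
  have := cRe_le (gg (cofr rho + cofr t * tpi) - q z); rewrite cReD cReN ler_norml.
  have e2 : cRe (q z) = 2 * c by rewrite /c; field.
  rewrite e2 /gg; lra.
have k0 : 0 < c * hf m / 2 by rewrite divr_gt0 // mulr_gt0 // half_pow_gt0.
have [N HN] := MV _ k0; have := HN (m + N)%N (leq_addl _ _); have := LB N.
rewrite /q cmeanB cmean_cst cReD cReN => h1 h2.
have := cRe_le (cmean u a rho (m + N) - 1); rewrite cReD cReN ler_norml.
lra.
Qed.

(** The mean value property over circles of growing radius. *)
Lemma entire_decay f K R0 : (forall z, exists l, has_cderiv f z l) ->
  (forall z, R0 <= cabs z -> cabs (f z) * cabs z <= K) -> forall a, f a = 0.
Proof.
move=> Hd Hb a; apply/eqP; rewrite -cabs_eq0; apply/eqP/le_anti.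
rewrite cabs_ge0 andbT; apply/ler_addgt0Pl => e e0; rewrite addr0.
pose r := 1 + `|R0| + cabs a + `|K| / e.
have ke : 0 <= `|K| / e by rewrite divr_ge0 // ltW.
have r0 : 0 < r by have := cabs_ge0 a; have := normr_ge0 R0; rewrite /r; lra.
have rE : expR (ln r) = r by rewrite lnK.
have MV : ctends (cmean f a (ln r)) (f a).
  apply: (@mean_value _ _ _ a).
  - by move=> y _; have [l /has_cderiv_ccont] := Hd y.
  - by move=> y _ _ _; exact: Hd.
  - by rewrite subrr cabs0 rE.
apply: ctends_le MV _; exists 0%N => n _; apply: cmean_bound => z; rewrite rE => hz.
have zr : r - cabs a <= cabs z.
  by rewrite -hz; have := cabsD (z - a) a; have := cabsD z (- a); rewrite cabsN; lra.
have z1 : R0 <= cabs z by have := ler_norm R0; rewrite /r in zr; lra.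
have z0 : 0 < cabs z by have := normr_ge0 R0; rewrite /r in zr; lra.
have := Hb z z1; rewrite -ler_pdivlMr // => /le_trans; apply.
rewrite ler_pdivrMr // mulrC -ler_pdivrMr //.
have := ler_norm K; rewrite -(ler_pM2r (_ : 0 < e^-1)) ?invr_gt0 // => h.
by have := normr_ge0 R0; rewrite /r in zr; lra.
Qed.

Lemma divided_difference f : (forall z, exists l, has_cderiv f z l) ->
  exists2 f1 : C -> C, (forall z, exists l, has_cderiv f1 z l) &
    forall z, f z = f1 z * z + f 0.
Proof.
move=> Hd; have [l0 Hl0] := Hd 0.
pose f1 z := if z == 0 then l0 else (f z - f 0) / z.
have f1d z : z != 0 -> exists l, has_cderiv f1 z l.
  move=> z0; have [l Hl] := Hd z; eexists.
  apply: (@has_cderiv_near _ (fun z => (f z - f 0) / z)); last first.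
    by apply: has_cderivM; [exact: has_cderivB Hl (has_cderiv_cst _ _)|exact: has_cderiv_inv].
  by apply: near_imp (near_neq z0) => w w0; rewrite /f1 ifN.
exists f1; last first.
  by move=> z; rewrite /f1; case: eqVneq => [->|z0]; rewrite ?mulr0 ?add0r // divfK // subrK.
move=> z; have [->|z0] := eqVneq z 0; last exact: f1d.
suff H : holomorphic_at f1 0 by eexists; exact: holomorphic_at_cderiv.
apply: removable; last by apply: near_all => w w0; apply/derivableCP; exact: f1d.
move=> e1 e10; have [d d0 hd] := Hl0 (e1 / 2) ltac:(by rewrite divr_gt0).
exists d => // h hh; rewrite /f1 eqxx add0r; case: eqVneq => [_|h0]; first by rewrite subrr cabs0.
have := hd h hh; rewrite add0r => hd2.
have -> : (f h - f 0) / h - l0 = (f h - f 0 - l0 * h) / h by field.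
rewrite cabsM cabsV ltr_pdivrMr ?cabs_gt0 //; apply: le_lt_trans hd2 _.
by rewrite ltr_pM2r ?cabs_gt0 // ltr_pdivrMr // ltr_pMr // ltr1n.
Qed.

(** Induction on d through [divided_difference]: (f z - f 0)/z is entire and grows one degree more
    slowly, and for d = 0 it decays, so it vanishes by [entire_decay]. *)
Lemma liouville f (d : nat) K R0 : (forall z, exists l, has_cderiv f z l) ->
  (forall z, R0 <= cabs z -> cabs (f z) <= K * cabs z ^+ d) ->
  exists2 p : {poly C}, (size p <= d.+1)%N & forall z, f z = p.[z].
Proof.
elim: d f K R0 => [|d IH] f K R0 Hd Hb; have [f1 f1e f1E] := divided_difference Hd;
  have f1b z : cabs (f1 z) * cabs z <= cabs (f z) + cabs (f 0)
    by rewrite -cabsM -(addrK (f 0) (f1 z * z)) -f1E (le_trans (cabsD _ _)) // cabsN.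
  have f10 : forall a, f1 a = 0.
    apply: (@entire_decay f1 (K + cabs (f 0)) R0 f1e) => z hz.
    apply: (le_trans (f1b z)); rewrite lerD2r -[K]mulr1 -(expr0 (cabs z)).
    exact: Hb.
  exists (f 0)%:P; first by rewrite size_polyC; case: (_ != 0).
  by move=> z; rewrite hornerC f1E f10 mul0r add0r.
have [z hz|p sp pE] := IH f1 (`|K| + cabs (f 0)) (1 + `|R0|) f1e.
  have z1 : 1 <= cabs z by have := normr_ge0 R0; lra.
  have z0 : 0 < cabs z by lra.
  rewrite -(ler_pM2r z0) (le_trans (f1b z)) // mulrDl mulrDl lerD //.
    have := Hb z ltac:(by have := ler_norm R0; lra) => /le_trans; apply.
    by rewrite exprSr mulrA ler_wpM2r ?(ltW z0) // ler_wpM2r ?exprn_ge0 ?ler_norm // ltW.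
  rewrite -mulrA -exprSr ler_peMr ?cabs_ge0 //; exact: exprn_ege1.
exists (p * 'X + (f 0)%:P).
  rewrite size_MXaddC; case: ifP => // _; exact: leq_trans sp _.
by move=> z; rewrite hornerMXaddC f1E pE.
Qed.

End Holomorphic.

                                  

(** * The principal square root on the right half plane *)

Section PrincipalSqrt.
Variable R : realType.
Local Notation C := (Cplx R).
Implicit Types (z w : C).

Definition csqrt z : C := sqrtc z.

Lemma csqrtK z : csqrt z ^+ 2 = z. Proof. exact: sqr_sqrtc. Qed.

Definition psqrt z : C := if 0 <= cRe (csqrt z) then csqrt z else - csqrt z.

Lemma psqrtK z : psqrt z ^+ 2 = z.
Proof. by rewrite /psqrt; case: ifP => _; rewrite ?sqrrN csqrtK. Qed.

Lemma psqrt_Re z : 0 < cRe z -> 0 < cRe (psqrt z).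
Proof.
move=> z0; have s0 : cRe (csqrt z) != 0.
  apply: contraTneq z0 => h; rewrite -leNgt -(csqrtK z) expr2 cReM h mul0r sub0r.
  by rewrite oppr_le0 -expr2 sqr_ge0.
rewrite /psqrt; case: ifPn => h; first by rewrite lt_def s0.
by rewrite cReN oppr_gt0 ltNge.
Qed.

Lemma psqrt_uniq z w : w ^+ 2 = z -> 0 < cRe z -> 0 < cRe w -> w = psqrt z.
Proof.
move=> wz z0 w0; have := psqrt_Re z0; have : (w - psqrt z) * (w + psqrt z) = 0.
  by rewrite -subr_sqr wz psqrtK subrr.
move/eqP; rewrite mulf_eq0 subr_eq0 => /orP[/eqP //|]; rewrite addr_eq0 => /eqP wE.
by move: w0; rewrite wE cReN => w0 w1; have := addr_gt0 w0 w1; rewrite addNr ltxx.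
Qed.

Lemma psqrt1 : psqrt 1 = 1.
Proof. by apply/esym/psqrt_uniq; rewrite ?expr1n //= ltr01. Qed.

Lemma psqrt_neq0 z : 0 < cRe z -> psqrt z != 0.
Proof. by move=> /psqrt_Re; apply: contraTneq => ->; rewrite ltxx. Qed.

Lemma near_Re_gt0 (f : C -> C) z : ccont f z -> 0 < cRe (f z) -> \forall w \near z, 0 < cRe (f w).
Proof.
move=> fc f0; apply: (@near_ccont _ f z (fun w => 0 < cRe w)) => //.
apply/nbhsCP; exists (cRe (f z)) => // w hw.
by have := cRe_le (w - f z); rewrite cReD cReN ler_norml; lra.
Qed.

                                                                          
(** For the roots p and q of z and z + h one has q - p = h/(p+q), and positivity of the real parts
    keeps p + q away from 0. *)
Lemma holomorphic_psqrt z : 0 < cRe z -> holomorphic_at psqrt z.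
Proof.
move=> z0; have H : \forall w \near z, 0 < cRe w.
  by apply: (@near_Re_gt0 (fun w => w)) => //; exact: has_cderiv_ccont (has_cderiv_id z).
apply: near_imp H => {}z {}z0; apply/derivableCP; exists ((2 * psqrt z)^-1).
have k0 := psqrt_Re z0; set k := cRe (psqrt z) in k0.
have p0 := psqrt_neq0 z0.
move=> e e0.
have [d d0 hd] : exists2 d, 0 < d & forall h, cabs h < d -> 0 < cRe (z + h).
  have [|d d0 hd] := proj1 (nbhsCP z _) (@near_Re_gt0 (fun w => w) z _ z0).
    exact: has_cderiv_ccont (has_cderiv_id z).
  by exists d => // h hh; apply: hd; rewrite addrC addKr.
pose d2 := Num.min d (e * (2 * k ^+ 3)).
exists d2; first by rewrite lt_min d0 !mulr_gt0 // exprn_gt0.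
move=> h; rewrite lt_min => /andP[h1 h2].
have q0 := psqrt_Re (hd h h1); set p := psqrt z in p0 *; set q := psqrt (z + h) in q0 *.
have kp : k <= cabs p by have := cRe_le p; rewrite -/k ler_norml; lra.
have kpq : k <= cabs (p + q).
  by have := cRe_le (p + q); rewrite cReD -/k ler_norml; lra.
have kpq0 : p + q != 0 by rewrite -cabs_gt0; lra.
have hE : h = (q - p) * (p + q).
  have -> : (q - p) * (p + q) = q ^+ 2 - p ^+ 2 by ring.
  by rewrite /q /p !psqrtK; ring.
have qp : q - p = h / (p + q) by rewrite {1}hE mulfK.
have E : q - p - (2 * p)^-1 * h = - (h * h) / (2 * p * (p + q) ^+ 2).
  have -> : q - p - (2 * p)^-1 * h = - h * (q - p) / (2 * p * (p + q)).
    by rewrite qp; field: hE; rewrite p0 kpq0.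
  by rewrite qp; field; rewrite p0 kpq0.
rewrite E mulNr cabsN (cabsM (h * h)) cabsM cabsV (cabsM (2 * p)) (cabsM 2) cabsX (cabs_nat _ 2).
rewrite ler_pdivrMr; last first.
  by rewrite !mulr_gt0 ?exprn_gt0 //; lra.
have : 2 * k ^+ 3 <= 2 * cabs p * cabs (p + q) ^+ 2.
  rewrite -mulrA ler_pM2l // exprS ler_pM ?exprn_ge0 // ?(ltW k0) //.
  by rewrite lerXn2r ?nnegrE ?cabs_ge0 // ltW.
have := cabs_ge0 h; move: h2; set X := 2 * cabs p * _ => h2 h3 h4.
have : cabs h <= e * X by apply: (le_trans (ltW h2)); rewrite ler_wpM2l // ltW.
by move=> h5; rewrite [e * _ * _]mulrAC mulrC ler_wpM2r.
Qed.

End PrincipalSqrt.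

(** * Continuous complex functions on a topological space *)

Section TopCont.
Variables (R : realType) (T : topologicalType).
Local Notation C := (Cplx R).
Implicit Types (a b : T -> C) (t : T).

Definition tcont a t := forall e : R, 0 < e -> nbhs t (fun u => cabs (a u - a t) < e).

Lemma tcontP a t : tcont a t <-> {for t, continuous a}.
Proof. by split => /continuousCP. Qed.

Lemma tcont_comp a (g : C -> C) t : tcont a t -> ccont g (a t) -> tcont (fun u => g (a u)) t.
Proof.
move=> Ha Hg e e0; have [d d0 hd] := Hg e e0; apply: filterS (Ha d d0) => u /hd.
by rewrite [a t + _]addrC subrK.
Qed.

Lemma tcontD a b t : tcont a t -> tcont b t -> tcont (fun u => a u + b u) t.
Proof.
move=> Ha Hb e e0; have e2 : 0 < e / 2 by rewrite divr_gt0.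
apply: filterS2 (Ha _ e2) (Hb _ e2) => u h1 h2.
rewrite (_ : _ - _ = (a u - a t) + (b u - b t)); last by ring.
by apply: le_lt_trans (cabsD _ _) _; lra.
Qed.

Lemma tcontB a b t : tcont a t -> tcont b t -> tcont (fun u => a u - b u) t.
Proof.
move=> Ha Hb; apply: tcontD => //; apply: (@tcont_comp b (fun z => - z)) => //.
exact: has_cderiv_ccont (has_cderivN (has_cderiv_id _)).
Qed.

Lemma tcontM a b t : tcont a t -> tcont b t -> tcont (fun u => a u * b u) t.
Proof.
move=> Ha Hb.
have sq c : tcont c t -> tcont (fun u => c u * c u) t.
  by move=> Hc; apply: (@tcont_comp c (fun z => z * z)) => //; exact: has_cderiv_ccont (has_cderiv_sqr _).
have := tcontB (sq _ (tcontD Ha Hb)) (sq _ (tcontB Ha Hb)).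
move=> /(@tcont_comp _ (fun z => 4^-1 * z)) H.
have -> : (fun u => a u * b u) = (fun u => 4^-1 * ((a u + b u) * (a u + b u) - (a u - b u) * (a u - b u))).
  by apply/funext => u; field.
by apply: H; exact: has_cderiv_ccont (has_cderivZ _ (has_cderiv_id _)).
Qed.

End TopCont.

                                

(** * The branch polynomial and its companions *)

Section RootPoly.
Variables (R : realType) (es : seq (Cplx R)).
Local Notation C := (Cplx R).
Implicit Types (x y z w s : C).

Definition hf : {poly C} := \prod_(e <- es) ('X - e%:P).
Definition hcof (e : C) : {poly C} := \prod_(z <- rem e es) ('X - z%:P).
(** The reciprocal polynomial of [hf], equal to 1 at 0; it describes f near infinity. *)
Definition hrev : {poly C} := \prod_(e <- es) (1 - e *: 'X).

Lemma hf_eq0 x : (hf.[x] == 0) = (x \in es).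
Proof. by rewrite -[_ == 0]/(root hf x) root_prod_XsubC. Qed.

Lemma hcofE e x : e \in es -> hf.[x] = (x - e) * (hcof e).[x].
Proof. by move=> ee; rewrite /hf (big_rem e ee) /= hornerM hornerXsubC. Qed.

Lemma hcof_neq0 e : uniq es -> (hcof e).[e] != 0.
Proof.
move=> ue; rewrite -[_ == 0]/(root (hcof e) e) root_prod_XsubC mem_rem_uniq //.
by rewrite inE eqxx.
Qed.

Lemma hrevE x : x != 0 -> hf.[x] = x ^+ size es * hrev.[x^-1].
Proof.
move=> x0; rewrite !horner_prod; elim: es => [|e s IH]; first by rewrite !big_nil mulr1.
rewrite !big_cons IH; have -> : x ^+ size (e :: s) = x * x ^+ size s by exact: exprS.
have -> : ('X - e%:P).[x] = x * (1 - e *: 'X).[x^-1].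
  by rewrite hornerXsubC hornerD hornerN hornerZ hornerX hornerC mulrBr mulr1 mulrCA mulfV // mulr1.
exact: mulrACA.
Qed.

Lemma hrev0 : hrev.[0] = 1.
Proof. by rewrite horner_prod big1 // => e _; rewrite !hornerE subr0. Qed.

End RootPoly.

                                                                         
(** The affine curve y^2 = f(x) with one point [None] added, which is its point at infinity when f
    has odd degree. *)
Definition hyp (R : realType) (es : seq (Cplx R)) : Type :=
  option {p : Cplx R * Cplx R | p.2 ^+ 2 == (hf es).[p.1]}.
HB.instance Definition _ (R : realType) (es : seq (Cplx R)) := Choice.on (hyp es).

(** * Topology of the curve *)

Section HypTopology.
Variables (R : realType) (es : seq (Cplx R)).
Local Notation C := (Cplx R).
Local Notation X := (hyp es).
Local Notation f := (hf es).
Implicit Types (x y z w s : C) (p q : X).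

Definition pt x y : X := insub (x, y).
Definition hx p : C := if p is Some u then (val u).1 else 0.
Definition hy p : C := if p is Some u then (val u).2 else 0.

Lemma hyE p : p <> None -> hy p ^+ 2 = f.[hx p].
Proof. by case: p => // u _; apply/eqP; exact: (valP u). Qed.

Lemma ptK p : p <> None -> pt (hx p) (hy p) = p.
Proof. by case: p => // u _; rewrite /pt /= -surjective_pairing valK. Qed.

Variant pt_spec x y : X -> Type :=
  PtSpec p of p <> None & hx p = x & hy p = y : pt_spec x y p.

Lemma ptP x y : y ^+ 2 = f.[x] -> pt_spec x y (pt x y).
Proof.
move=> /eqP h; rewrite /pt; case: insubP => [u _ uE|]; last by rewrite h.
by constructor => //=; rewrite uE.
Qed.

Lemma hx_pt x y : y ^+ 2 = f.[x] -> hx (pt x y) = x. Proof. by case/ptP. Qed.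
Lemma hy_pt x y : y ^+ 2 = f.[x] -> hy (pt x y) = y. Proof. by case/ptP. Qed.
Lemma pt_fin x y : y ^+ 2 = f.[x] -> pt x y <> None. Proof. by case/ptP. Qed.

Lemma hyp_ext p q : p <> None -> q <> None -> hx p = hx q -> hy p = hy q -> p = q.
Proof. by move=> p0 q0 h1 h2; rewrite -(ptK p0) -(ptK q0) h1 h2. Qed.

(** At infinity only x is required to be large: on the curve a bounded x forces a bounded y. *)
Definition hnbhs p (A : set X) : Prop :=
  if p is Some u then exists2 e : R, 0 < e &
      forall q, q <> None -> cabs (hx q - hx p) < e -> cabs (hy q - hy p) < e -> A q
  else A None /\ exists r : R, forall q, q <> None -> r < cabs (hx q) -> A q.

Lemma hnbhs_filter p : ProperFilter (hnbhs p).
Proof.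
case: p => [u|].
  split; first by move=> [e e0 /(_ (Some u))]; rewrite /= !subrr cabs0; apply.
  split; first by exists 1.
    move=> A B [e e0 HA] [d d0 HB]; exists (Num.min e d); first by rewrite lt_min e0.
    by move=> q q0; rewrite !lt_min => /andP[h1 h2] /andP[h3 h4]; split; [apply: HA|apply: HB].
  by move=> A B AB [e e0 HA]; exists e => // q q0 h1 h2; apply/AB/HA.
split; first by case.
split; first by split => //; exists 0.
  move=> A B [A0 [r HA]] [B0 [r' HB]]; split => //; exists (Num.max r r') => q q0.
  by rewrite gt_max => /andP[h1 h2]; split; [apply: HA|apply: HB].
by move=> A B AB [A0 [r HA]]; split; [exact: AB|exists r => q q0 h; apply/AB/HA].
Qed.

Lemma hnbhs_singleton p A : hnbhs p A -> A p.
Proof.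
case: p => [u [e e0 H]|[]//]; apply: H => //; by rewrite subrr cabs0.
Qed.

Lemma hnbhs_nbhs p A : hnbhs p A -> hnbhs p (hnbhs^~ A).
Proof.
case: p => [u [e e0 H]|[A0 [r H]]].
  exists e => // -[v|//] _ h1 h2.
  exists (Num.min (e - cabs (hx (Some v) - hx (Some u))) (e - cabs (hy (Some v) - hy (Some u)))).
    by rewrite lt_min !subr_gt0 h1.
  move=> q q0; rewrite !lt_min => /andP[k1 k2] /andP[k3 k4]; apply: H => //.
    by have := cabs_triangle (hx q) (hx (Some u)) (hx (Some v)); lra.
  by have := cabs_triangle (hy q) (hy (Some u)) (hy (Some v)); lra.
split; first by split => //; exists r.
exists r => -[v|//] _ h1; exists (cabs (hx (Some v)) - r); first by rewrite subr_gt0.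
move=> q q0 k1 _; apply: H => //.
by have := cabsD (hx q) (hx (Some v) - hx q); rewrite [hx q + _]addrC subrK cabsB; lra.
Qed.

HB.instance Definition _ := hasNbhs.Build X hnbhs.
HB.instance Definition _ := @Nbhs_isNbhsTopological.Build X
  hnbhs_filter hnbhs_singleton hnbhs_nbhs.

Lemma nbhs_finP p (A : set X) : p <> None -> nbhs p A <-> exists2 e : R, 0 < e &
      forall q, q <> None -> cabs (hx q - hx p) < e -> cabs (hy q - hy p) < e -> A q.
Proof. by case: p. Qed.

Lemma nbhs_infP (A : set X) : nbhs (None : X) A <->
  A None /\ exists r : R, forall q, q <> None -> r < cabs (hx q) -> A q.
Proof. by []. Qed.

Lemma near_fin p : p <> None -> nbhs p [set q | q <> None].
Proof. by move=> p0; apply/nbhs_finP => //; exists 1. Qed.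

Lemma tcont_hx p : p <> None -> tcont hx p.
Proof.
by move=> p0 e e0; apply/nbhs_finP => //; exists e => // q q0 h _.
Qed.

Lemma tcont_hy p : p <> None -> tcont hy p.
Proof.
by move=> p0 e e0; apply/nbhs_finP => //; exists e => // q q0 _ h.
Qed.

Lemma hyp_hausdorff : hausdorff_space X.
Proof.
have sep p q : p <> None -> q <> None -> p <> q -> exists A B, [/\ nbhs p A, nbhs q B & A `&` B = set0].
  move=> p0 q0 pq.
  pose d := cabs (hx p - hx q) + cabs (hy p - hy q).
  have d0 : 0 < d.
    rewrite lt_def addr_ge0 ?cabs_ge0 // andbT paddr_eq0 ?cabs_ge0 // !cabs_eq0 !subr_eq0.
    by apply/negP => /andP[/eqP h1 /eqP h2]; apply: pq; exact: hyp_ext.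
  pose N r : set X := [set z | z <> None /\ cabs (hx z - hx r) + cabs (hy z - hy r) < d / 2].
  have nN (r : X) : r <> None -> nbhs r (N r).
    move=> r0; apply/nbhs_finP => //; exists (d / 4); first by rewrite divr_gt0.
    by move=> z z0 h1 h2; split => //; lra.
  exists (N p), (N q); split; [exact: nN|exact: nN|].
  apply/seteqP; split => // z [[_ h1] [_ h2]] /=.
  have := cabs_triangle (hx p) (hx q) (hx z); have := cabs_triangle (hy p) (hy q) (hy z).
  rewrite (cabsB (hx p) (hx z)) (cabsB (hy p) (hy z)) => k1 k2.
  have : d < d by rewrite {1}/d; lra.
  by rewrite ltxx.
have sep0 p : p <> None -> exists A B, [/\ nbhs p A, nbhs (None : X) B & A `&` B = set0].
  move=> p0; exists [set z | z <> None /\ cabs (hx z - hx p) < 1].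
  exists [set z | z <> None -> cabs (hx p) + 1 < cabs (hx z)]; split.
  - by apply/nbhs_finP => //; exists 1.
  - by split => //; exists (cabs (hx p) + 1) => q q0 h _.
  - apply/seteqP; split => // z [[z0 h1] /(_ z0) h2] /=.
    have := cabsD (hx z - hx p) (hx p); rewrite subrK => h3.
    have : cabs (hx z) < cabs (hx z) by lra.
    by rewrite ltxx.
move=> p q clpq; apply: contrapT => pq.
have [A [B [nA nB AB]]] : exists A B, [/\ nbhs p A, nbhs q B & A `&` B = set0].
  have [p0|p0] := pselect (p = None); have [q0|q0] := pselect (q = None).
  - by case: pq; rewrite p0 q0.
  - by have [A [B [h1 h2 h3]]] := sep0 q q0; exists B, A; rewrite p0 setIC.
  - by rewrite q0; exact: sep0.
  - exact: sep.
by have [z] := clpq A B nA nB; rewrite AB.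
Qed.

End HypTopology.

Section HypCompact.
Variables (R : realType) (es : seq (Cplx R)).
Local Notation C := (Cplx R).
Local Notation X := (hyp es).
Local Notation f := (hf es).

(** A filter that does not cluster at infinity contains a bounded set of finite points. Its real
    coordinates lie in a compact box of dimension four, and a cluster point there satisfies the
    equation of the curve by continuity. *)
Lemma hyp_compact : compact [set: X].
Proof.
move=> F FF _; have [cl|ncl] := pselect (cluster F (None : X)); first by exists None.
have [A [B [FA nB AB]]] : exists A B, [/\ F A, nbhs (None : X) B & A `&` B = set0].
  apply: contrapT => H; apply: ncl => A B FA nB; apply: contrapT => /set0P/negP/negPn/eqP h.
  by apply: H; exists A, B.
move: nB => /nbhs_infP[B0 [r HB]].
have Abd q : A q -> q <> None /\ cabs (hx q) <= r.
  move=> Aq; have q0 : q <> None.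
    by move=> q0; have : (A `&` B) None; [rewrite -q0 in B0 *; split; rewrite // -q0|rewrite AB].
  split => //; rewrite leNgt; apply/negP => /(HB q q0) Bq.
  by have : (A `&` B) q by []; rewrite AB.
have [K HK] : exists K, forall q, A q -> cabs (hy q) <= K.
  have [K HK] : exists K, forall x : C, cabs x <= r -> cabs f.[x] <= K.
    elim/poly_ind: (f) => [|p c [K HK]]; first by exists 0 => x _; rewrite horner0 cabs0.
    exists (`|K| * `|r| + cabs c) => x hx; rewrite hornerMXaddC.
    apply: le_trans (cabsD _ _) _; rewrite cabsM lerD2r ler_pM ?cabs_ge0 //.
      by apply: le_trans (HK x hx) (ler_norm _).
    by apply: le_trans hx (ler_norm _).
  exists (K + 1) => q /Abd [q0 /HK]; rewrite -hyE // cabsX; have := cabs_ge0 (hy q); nra.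
pose D := `|r| + `|K|.
have box q : A q -> [/\ `|cRe (hx q)| <= D, `|cIm (hx q)| <= D, `|cRe (hy q)| <= D & `|cIm (hy q)| <= D].
  move=> Aq; have [_ h1] := Abd q Aq; have h2 := HK q Aq.
  have rD : r <= D by rewrite /D; have := ler_norm r; have := normr_ge0 K; lra.
  have KD : K <= D by rewrite /D; have := ler_norm K; have := normr_ge0 r; lra.
  have k1 := cRe_le (hx q); have k2 := cIm_le (hx q).
  by have k3 := cRe_le (hy q); have k4 := cIm_le (hy q); split; lra.
pose I : set R := `[- D, D]%classic.
have cI : compact I by exact: segment_compact.
pose c4 := (I `*` I) `*` (I `*` I).
have cc4 : compact c4 by apply: compact_setX; apply: compact_setX.
pose e4 (q : X) : (R * R) * (R * R) := ((cRe (hx q), cIm (hx q)), (cRe (hy q), cIm (hy q))).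
have mI x : `|x| <= D -> I x by rewrite ler_norml => h; rewrite /I /= in_itv.
have c4F : (e4 @ F) c4.
  have sub : A `<=` e4 @^-1` c4.
    move=> q /box[h1 h2 h3 h4].
    exact: (conj (conj (mI _ h1) (mI _ h2)) (conj (mI _ h3) (mI _ h4))).
  exact: filterS sub FA.
have [[[a b] [a' b']] [_ cl4]] := cc4 (e4 @ F) _ c4F.
pose x0 : C := Complex a b; pose y0 : C := Complex a' b'.
have near4 (e : R) (G : set X) : 0 < e -> F G -> exists q, [/\ G q, A q, cabs (hx q - x0) < e & cabs (hy q - y0) < e].
  move=> e0 FG; have e4' : 0 < e / 4 by rewrite divr_gt0.
  pose N := (ball a (e / 4) `*` ball b (e / 4)) `*` (ball a' (e / 4) `*` ball b' (e / 4)).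
  have nN : nbhs ((a, b), (a', b')) N.
    exists (ball a (e / 4) `*` ball b (e / 4), ball a' (e / 4) `*` ball b' (e / 4)) => //.
    split; [exists (ball a (e / 4), ball b (e / 4))|exists (ball a' (e / 4), ball b' (e / 4))] => //;
      by split; apply: nbhsx_ballx.
  have FGA : (e4 @ F) (e4 @` (G `&` A)).
    have sub : G `&` A `<=` e4 @^-1` (e4 @` (G `&` A)) by move=> q Gq; exists q.
    exact: filterS sub (filterI FG FA).
  have [_ [[q [Gq Aq] <-] [[/= n1 n2] [/= n3 n4]]]] := cl4 _ _ FGA nN.
  have cl z (u v : R) : `|u - cRe z| < e / 4 -> `|v - cIm z| < e / 4 -> cabs (z - Complex u v) < e.
    move=> h1 h2; apply: le_lt_trans (cabs_le _) _; rewrite cReD cImD cReN cImN /=.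
    by rewrite distrC (distrC _ v); lra.
  by exists q; split => //; apply: cl.
have y0E : y0 ^+ 2 = f.[x0].
  apply/eqP; rewrite -subr_eq0; apply/eqP/eqP; apply: contraT => ne.
  have ng : 0 < cabs (y0 ^+ 2 - f.[x0]) by rewrite cabs_gt0.
  have e2 : 0 < cabs (y0 ^+ 2 - f.[x0]) / 2 by rewrite divr_gt0.
  have [d1 d10 h1] := holomorphic_at_ccont (holomorphic_at_horner f x0) e2.
  have [d2 d20 h2] := holomorphic_at_ccont (holomorphic_atX 2 (holomorphic_at_id y0)) e2.
  have [q [_ Aq k1 k2]] := near4 (Num.min d1 d2) setT ltac:(by rewrite lt_min d10) filterT.
  rewrite !lt_min in k1 k2; case/andP: k1 => k1 _; case/andP: k2 => _ k2.
  have := h1 _ k1; have := h2 _ k2; rewrite [y0 + _]addrC [x0 + _]addrC !subrK.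
  rewrite -hyE; last by have [] := Abd q Aq.
  move=> j1 j2; have := cabs_triangle (y0 ^+ 2) f.[x0] (hy q ^+ 2).
  rewrite (cabsB (y0 ^+ 2) (hy q ^+ 2)) => j3.
  have : cabs (y0 ^+ 2 - f.[x0]) < cabs (y0 ^+ 2 - f.[x0]) by lra.
  by rewrite ltxx.
exists (pt es x0 y0); split => // G N FG nN.
have p0 := pt_fin y0E; move/nbhs_finP: nN => /(_ p0) [e e0 HN].
have [q [Gq Aq h1 h2]] := near4 e G e0 FG.
exists q; split => //; apply: HN; first by have [] := Abd q Aq.
  by rewrite hx_pt.
by rewrite hy_pt.
Qed.

End HypCompact.

                                          

                                                                                         
                                                                                
                                                                                 
(** * Charts of the curve, one centred at each point *)

Section HypCharts.
Variables (R : realType) (es Z : seq (Cplx R)) (g : nat).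
Local Notation C := (Cplx R).
Local Notation X := (hyp es).
Local Notation f := (hf es).
Hypothesis es_uniq : uniq es.
Hypothesis es_size : size es = (2 * g).+1.
Hypothesis es_Z : {subset es <= Z}.
Implicit Types (x y z w s : C) (p q : X).

(** y^2 is [hq] near an ordinary point and (x - e) times [hq] near a branch point e; in both cases
    [hq] does not vanish at the centre. *)
Definition hq p : {poly C} := if hy p == 0 then hcof es (hx p) else f.

(** A holomorphic square root of [hq p] near the centre: a root of the central value times the
    principal root of a ratio close to 1. At an ordinary point it is the branch of y through p; at
    infinity it is a root of [hrev]. *)
Definition rt p x : C :=
  if p is Some _ then
    (if hy p == 0 then csqrt (hq p).[hx p] else hy p) * psqrt ((hq p).[x] / (hq p).[hx p])
  else psqrt (hrev es).[x].

(** The radius is small enough for the principal root to be holomorphic, and for the disc to meet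
    the finite list Z at most in its centre. Points above Z thus lie in a single chart, where no
    transition has to be checked. *)
Definition good_radius p (r : R) : Prop := 0 < r /\
  if p is Some _ then forall x, cabs (x - hx p) < r ->
      0 < cRe ((hq p).[x] / (hq p).[hx p]) /\ (x \in Z -> x = hx p)
  else forall w, cabs w < r -> 0 < cRe (hrev es).[w] /\ (w != 0 -> w^-1 \notin Z).

Lemma fin_branch p : p <> None -> hy p = 0 -> hx p \in es.
Proof. by move=> p0 y0; rewrite -hf_eq0 -hyE // y0 expr0n. Qed.

Lemma hq_neq0 p : p <> None -> (hq p).[hx p] != 0.
Proof.
move=> p0; rewrite /hq; case: (eqVneq (hy p) 0) => y0; first by apply: hcof_neq0 => //; exact: fin_branch.
by rewrite -hyE // expf_neq0.
Qed.

Lemma near_avoid (x : C) (s : seq C) : \forall z \near x, z \in s -> z = x.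
Proof.
elim: s => [|a s IH]; first exact: near_all.
have [<-|ax] := eqVneq x a.
  by apply: near_imp IH => z h; rewrite inE => /orP[/eqP//|].
by apply: filterS2 (near_neq ax) IH => z za h; rewrite inE (negbTE za) /=.
Qed.

Lemma good_radius_ex p : exists r, good_radius p r.
Proof.
case: p => [u|].
  set p := Some u : X; have p0 : p <> None by [].
  have c : ccont (fun x => (hq p).[x] / (hq p).[hx p]) (hx p).
    by apply: holomorphic_at_ccont; apply: holomorphic_atM;
      [exact: holomorphic_at_horner|exact: holomorphic_at_cst].
  have := near_and (near_Re_gt0 c _) (near_avoid (hx p) Z).
  rewrite divff ?hq_neq0 // => /(_ ltr01) /nbhsCP[r r0 H].
  by exists r; split => // x /H.
have c : ccont (fun x => (hrev es).[x]) 0 by apply: holomorphic_at_ccont; exact: holomorphic_at_horner.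
have := near_and (near_Re_gt0 c _) (near_avoid 0 [seq z^-1 | z <- Z]).
rewrite hrev0 => /(_ ltr01) /nbhsCP[r r0 H].
exists r; split => // w hw; have [|h1 h2] := H w; first by rewrite subr0.
split => // w0; apply: contra w0 => wZ; apply/eqP/h2/mapP.
by exists w^-1 => //; rewrite invrK.
Qed.

Definition chR p : R := sval (cid (good_radius_ex p)).
Lemma chR_good p : good_radius p (chR p). Proof. exact: svalP (cid _). Qed.
Lemma chR_gt0 p : 0 < chR p. Proof. by case: (chR_good p). Qed.

(** The parameter s is y/[rt] at a branch point, x at an ordinary point, and x^g [rt]/y at infinity,
    where x and y have poles of orders 2 and 2g+1. *)
Definition chX p s : C :=
  if p is Some _ then (if hy p == 0 then hx p + s ^+ 2 else s) else (s ^+ 2)^-1.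
Definition chY p s : C :=
  if p is Some _ then (if hy p == 0 then s * rt p (hx p + s ^+ 2) else rt p s)
  else (s ^+ (2 * g).+1)^-1 * rt p (s ^+ 2).
Definition chS p x y : C :=
  if p is Some _ then (if hy p == 0 then y / rt p x else x)
  else x ^+ g * rt p (x^-1) / y.
Definition chDisc p s : Prop :=
  if p is Some _ then (if hy p == 0 then cabs (s ^+ 2) < chR p else cabs (s - hx p) < chR p)
  else cabs (s ^+ 2) < chR p.
(** At an ordinary point the condition on y / [hy p] selects the sheet through p. *)
Definition chIn p x y : Prop :=
  if p is Some _ then
    (if hy p == 0 then is_true (cabs (x - hx p) < chR p)
     else cabs (x - hx p) < chR p /\ 0 < cRe (y / hy p))
  else x != 0 /\ cabs (x^-1) < chR p.
Definition dX p s : C :=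
  if p is Some _ then (if hy p == 0 then 2 * s else 1) else - 2 * (s ^+ 3)^-1.
(** The parameters of the chart that stand for finite points of the curve. *)
Definition regular p s : Prop := chDisc p s /\ (p <> None \/ s != 0).

Lemma rtE_fin p x : p <> None -> cabs (x - hx p) < chR p ->
  rt p x ^+ 2 = (hq p).[x] /\ rt p x != 0.
Proof.
case: p => // u _ hx0; set p := Some u : X in hx0 *.
have [_ /(_ x hx0)[h1 _]] := chR_good p; have q0 := hq_neq0 (p := p) ltac:(by []).
have k2 : (if hy p == 0 then csqrt (hq p).[hx p] else hy p) ^+ 2 = (hq p).[hx p].
  case: ifPn => y0; first exact: csqrtK.
  by rewrite hyE // /hq (negbTE y0).
have E : rt p x ^+ 2 = (hq p).[x].
  by rewrite /rt exprMn psqrtK k2 mulrC divfK.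
split => //; rewrite -sqrf_eq0 E; apply: contraTneq h1 => ->.
by rewrite mul0r ltxx.
Qed.

Lemma rtE_inf w : cabs w < chR (None : X) ->
  rt None w ^+ 2 = (hrev es).[w] /\ rt None w != 0.
Proof.
move=> hw; have [_ /(_ w hw)[h1 _]] := chR_good None.
by rewrite /rt psqrtK; split => //; exact: psqrt_neq0.
Qed.

Lemma rt_holo p x : (if p is Some _ then cabs (x - hx p) < chR p else cabs x < chR p) ->
  holomorphic_at (rt p) x.
Proof.
case: p => [u|] hx0; rewrite /rt.
  set p := Some u : X; have [_ /(_ x hx0)[h1 _]] := chR_good p.
  apply: holomorphic_atM; first exact: holomorphic_at_cst.
  apply: (@holomorphic_at_comp _ (fun x => (hq p).[x] / (hq p).[hx p])); last exact: holomorphic_psqrt.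
  by apply: holomorphic_atM; [exact: holomorphic_at_horner|exact: holomorphic_at_cst].
have [_ /(_ x hx0)[h1 _]] := chR_good (None : X).
by apply: holomorphic_at_comp; [exact: holomorphic_at_horner|exact: holomorphic_psqrt].
Qed.

Lemma chart_param p s : regular p s ->
  [/\ chY p s ^+ 2 = f.[chX p s], chIn p (chX p s) (chY p s) & chS p (chX p s) (chY p s) = s].
Proof.
case: p => [u|] [hs hs0].
  set p := Some u : X in hs *; have p0 : p <> None by [].
  rewrite /chDisc /chY /chX /chIn /chS -/p in hs *; case: ifPn hs => [/eqP y0|y0] hs.
    have hd : cabs (hx p + s ^+ 2 - hx p) < chR p by rewrite addrAC subrr add0r.
    have [r2 rn] := rtE_fin p0 hd; rewrite mulfK //; split => //.
    rewrite exprMn r2 /hq y0 eqxx (hcofE _ (fin_branch p0 y0)).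
    by congr (_ * _); rewrite addrAC subrr add0r.
  have [r2 rn] := rtE_fin p0 hs; split => //.
    by rewrite r2 /hq (negbTE y0).
  split => //; rewrite /rt -/p (negbTE y0) mulrAC divff // mul1r.
  by apply: psqrt_Re; have [_ /(_ s hs)[]] := chR_good p.
case: hs0 => // s0; rewrite /chDisc /chY /chX /chIn /chS in hs *.
have [r2 rn] := rtE_inf hs; have s20 : s ^+ 2 != 0 by rewrite expf_neq0.
split.
- rewrite exprMn r2 hrevE ?invr_eq0 // invrK es_size; congr (_ * _).
  by rewrite !exprVn -!exprM mulnC.
- by rewrite invr_eq0 invrK.
- rewrite invrK exprVn -exprM [s ^+ (2 * g).+1]exprSr; set r := rt _ _ in rn *; set a := s ^+ (2 * g).
  have a0 : a != 0 by rewrite expf_neq0.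
  by field; rewrite s0 a0 rn.
Qed.

Lemma chart_inv p x y : y ^+ 2 = f.[x] -> chIn p x y ->
  [/\ regular p (chS p x y), chX p (chS p x y) = x & chY p (chS p x y) = y].
Proof.
move=> yE; case: p => [u|] hin.
  set p := Some u : X in hin *; have p0 : p <> None by [].
  rewrite /regular /chDisc /chY /chX /chIn /chS -/p in hin *; case: ifPn hin => [/eqP y0|y0].
    move=> hin; have [r2 rn] := rtE_fin p0 hin.
    have E : (y / rt p x) ^+ 2 = x - hx p.
      rewrite expr_div_n r2 yE (hcofE _ (fin_branch p0 y0)) /hq y0 eqxx mulfK //.
      by move: rn; rewrite -sqrf_eq0 r2 /hq y0 eqxx.
    have E2 : hx p + (x - hx p) = x by rewrite addrC subrK.
    by rewrite E E2 divfK //; split => //; split => //; left.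
  move=> [hin hre]; have [r2 rn] := rtE_fin p0 hin.
  split => //; first by split => //; left.
  rewrite /rt -/p (negbTE y0) /hq (negbTE y0) -yE -hyE // -expr_div_n.
  have h1 : 0 < cRe ((y / hy p) ^+ 2).
    have [_ /(_ x hin)[]] := chR_good p.
    by rewrite /hq (negbTE y0) -yE -hyE // -expr_div_n.
  (* By the sheet condition y / [hy p] is the principal root of its square. *)
  by rewrite -(psqrt_uniq (erefl _) h1 hre) mulrC divfK.
rewrite /regular /chDisc /chY /chX /chIn /chS in hin *; case: hin => x0 hin.
have [r2 rn] := rtE_inf hin.
have yn : y != 0.
  rewrite -sqrf_eq0 yE hrevE // -r2 mulf_neq0 ?expf_neq0 //.
have E : (x ^+ g * rt None x^-1 / y) ^+ 2 = x^-1.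
  rewrite expr_div_n exprMn r2 yE hrevE // es_size -exprM mulnC exprS.
  rewrite -r2; set r := rt _ _ in rn *; set a := x ^+ (2 * g).
  have a0 : a != 0 by rewrite expf_neq0.
  by field; rewrite x0 a0 rn.
rewrite E invrK; split => //.
  by split => //; right; rewrite !mulf_neq0 ?expf_neq0 ?invr_eq0.
rewrite exprSr exprM E exprVn; set r := rt _ _ in rn *; set a := x ^+ g.
have a0 : a != 0 by rewrite expf_neq0.
by field; rewrite yn a0 rn.
Qed.

Lemma chX_deriv p s : p <> None \/ s != 0 -> has_cderiv (chX p) s (dX p s).
Proof.
case: p => [u|] h; rewrite /chX /dX.
  case: ifP => _; last exact: has_cderiv_id.
  apply: has_cderiv_eq; first apply: has_cderivD; first exact: has_cderiv_cst.
    by apply: has_cderiv_ext (has_cderiv_sqr s) => w; rewrite expr2.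
  by rewrite add0r mulr2n mulrDl mul1r.
case: h => // s0; apply: has_cderiv_eq.
  apply: (@has_cderivV _ (fun s => s ^+ 2)); first by rewrite expf_neq0.
  by apply: has_cderiv_ext (has_cderiv_sqr s) => w; rewrite expr2.
by rewrite /=; field.
Qed.

Lemma chX_holo p s : p <> None \/ s != 0 -> holomorphic_at (chX p) s.
Proof.
case: p => [u|] h; rewrite /chX.
  case: (hy _ == 0); last exact: holomorphic_at_id.
  by apply: holomorphic_atD; [exact: holomorphic_at_cst|apply: holomorphic_atX; exact: holomorphic_at_id].
case: h => // s0; apply: (@holomorphic_atV _ (fun s => s ^+ 2)); first by rewrite expf_neq0.
by apply: holomorphic_atX; exact: holomorphic_at_id.
Qed.

Lemma chY_holo p s : regular p s -> holomorphic_at (chY p) s.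
Proof.
have sq w : holomorphic_at (fun s : C => s ^+ 2) w by apply: holomorphic_atX; exact: holomorphic_at_id.
case: p => [u|] [hs h]; rewrite /chY /chDisc in hs *.
  set p := Some u : X in hs *; case: (hy p == 0) hs => hs.
    apply: holomorphic_atM; first exact: holomorphic_at_id.
    apply: (@holomorphic_at_comp _ (fun s => hx p + s ^+ 2)).
      by apply: holomorphic_atD; [exact: holomorphic_at_cst|exact: sq].
    by apply: rt_holo; rewrite /p /= -/p addrAC subrr add0r.
  exact: rt_holo.
case: h => // s0; apply: holomorphic_atM.
  apply: (@holomorphic_atV _ (fun s => s ^+ (2 * g).+1)); first by rewrite expf_neq0.
  by apply: holomorphic_atX; exact: holomorphic_at_id.
by apply: (@holomorphic_at_comp _ (fun s => s ^+ 2)); [exact: sq|apply: rt_holo].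
Qed.

Lemma chS_holo p (a b : C -> C) s : b s ^+ 2 = f.[a s] -> chIn p (a s) (b s) ->
  holomorphic_at a s -> holomorphic_at b s -> holomorphic_at (fun s => chS p (a s) (b s)) s.
Proof.
case: p => [u|] bE hin ha hb; rewrite /chS /chIn in hin *.
  set p := Some u : X in hin *; case: (hy p == 0) hin => hin; last exact: ha.
  have [_ rn] := rtE_fin (p := p) ltac:(by []) hin.
  apply: (@holomorphic_atM _ b (fun s => (rt p (a s))^-1)); first exact: hb.
  apply: (@holomorphic_atV _ (fun s => rt p (a s))); first exact: rn.
  by apply: (@holomorphic_at_comp _ a (rt p)); [exact: ha|exact: rt_holo].
case: hin => x0 hin; have [r2 rn] := rtE_inf hin.
have b0 : b s != 0.
  by rewrite -sqrf_eq0 bE hrevE // -r2 mulf_neq0 ?expf_neq0.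
apply: (@holomorphic_atM _ (fun s => a s ^+ g * rt None (a s)^-1) (fun s => (b s)^-1)); last exact: (holomorphic_atV b0 hb).
apply: (@holomorphic_atM _ (fun s => a s ^+ g) (fun s => rt None (a s)^-1)); first exact: (holomorphic_atX g ha).
apply: (@holomorphic_at_comp _ (fun s => (a s)^-1) (rt None)); first exact: (holomorphic_atV x0 ha).
exact: rt_holo.
Qed.

(** The radius leaves only the x of the centre, and the sheet condition then fixes the sign of y. *)
Lemma chIn_marked p x y : y ^+ 2 = f.[x] -> chIn p x y -> x \in Z -> pt es x y = p.
Proof.
move=> yE hin xZ; case: p hin => [u|] hin; last first.
  case: hin => x0 hin; have [_ /(_ _ hin)[_]] := chR_good (None : X).
  by rewrite invr_eq0 invrK xZ => /(_ x0).
set p := Some u : X in hin *; have p0 : p <> None by [].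
have xE : x = hx p.
  rewrite /chIn -/p in hin; case: ifP hin => _ hin.
    by have [_ /(_ x hin)[_]] := chR_good p; apply.
  by case: hin => hin _; have [_ /(_ x hin)[_]] := chR_good p; apply.
apply: hyp_ext => //; rewrite ?hx_pt ?hy_pt //; first exact: pt_fin.
have y2 : y ^+ 2 = hy p ^+ 2 by rewrite yE hyE // xE.
move: hin; rewrite /chIn -/p; case: (eqVneq (hy p) 0) => [y0 _|y0 [_ hre]].
  by apply/eqP; rewrite y0 -sqrf_eq0 y2 y0 expr0n.
move/eqP: y2; rewrite eqf_sqr => /orP[/eqP//|/eqP yN].
by move: hre; rewrite yN mulNr divff // cReN /= oppr_gt0 ltr10.
Qed.

Lemma chIn_open p q : q <> None -> chIn p (hx q) (hy q) ->
  nbhs q [set r : X | r <> None /\ chIn p (hx r) (hy r)].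
Proof.
move=> q0 hin; have nf := near_fin q0.
have dist (c : C) (r : R) : cabs (hx q - c) < r -> nbhs q [set z : X | cabs (hx z - c) < r].
  move=> h; have h' : 0 < r - cabs (hx q - c) by rewrite subr_gt0.
  apply: filterS (tcont_hx q0 h') => z /= hz.
  by have := cabs_triangle (hx z) c (hx q); lra.
case: p hin => [u|] hin.
  set p := Some u : X in hin *; rewrite /chIn -/p in hin *; case: ifP hin => y0 hin.
    by apply: filterS2 nf (dist _ _ hin) => z.
  case: hin => h1 h2.
  have c : tcont (fun r : X => hy r / hy p) q.
    by apply: (@tcont_comp _ _ _ (fun z => z / hy p)); [exact: tcont_hy|
      apply: holomorphic_at_ccont; apply: holomorphic_atM; [exact: holomorphic_at_id|exact: holomorphic_at_cst]].
  apply: filterS3 nf (dist _ _ h1) (c _ h2) => z z0 hz hz2; split => //; split => //.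
  have := cRe_le (hy z / hy p - hy q / hy p); rewrite cReD cReN ler_norml; lra.
case: hin => x0 hin; rewrite /chIn.
have n1 : nbhs q [set z : X | hx z != 0].
  have h : 0 < cabs (hx q) by rewrite cabs_gt0.
  apply: filterS (tcont_hx q0 h) => z; apply: contraTneq => ->.
  by rewrite sub0r cabsN ltxx.
have c : tcont (fun r : X => (hx r)^-1) q.
  by apply: (@tcont_comp _ _ _ (fun z => z^-1)); [exact: tcont_hx|
    apply: holomorphic_at_ccont; exact: holomorphic_at_inv].
have h' : 0 < chR None - cabs (hx q)^-1 by rewrite subr_gt0.
apply: filterS3 nf n1 (c _ h') => z z0 hz hz2; split => //; split => //.
by have := cabsD ((hx z)^-1 - (hx q)^-1) (hx q)^-1; rewrite subrK; lra.
Qed.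

Lemma disc_open p s : chDisc p s -> \forall w \near s, chDisc p w.
Proof.
move=> hs.
have sq (r : R) : cabs (s ^+ 2) < r -> \forall w \near s, cabs (w ^+ 2) < r.
  move=> h; have h' : 0 < r - cabs (s ^+ 2) by rewrite subr_gt0.
  have [d d0 hd] := holomorphic_at_ccont (holomorphic_atX 2 (holomorphic_at_id s)) h'.
  apply/nbhsCP; exists d => // w hw; have := hd _ hw; rewrite [s + _]addrC subrK => k.
  by have := cabsD (w ^+ 2 - s ^+ 2) (s ^+ 2); rewrite subrK; lra.
case: p hs => [u|] hs; last exact: sq.
set p := Some u : X in hs *; rewrite /chDisc -/p in hs *; case: ifP hs => _ hs; first exact: sq.
apply/nbhsCP; exists (chR p - cabs (s - hx p)); first by rewrite subr_gt0.
move=> w hw; have := cabs_triangle w (hx p) s; rewrite /chDisc /=; lra.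
Qed.

Lemma regular_open p s : regular p s -> \forall w \near s, regular p w.
Proof.
move=> [hs h]; case: h => h.
  by apply: near_imp (disc_open hs) => w hw; split => //; left.
by apply: filterS2 (disc_open hs) (near_neq h) => w hw w0; split => //; right.
Qed.

Definition hdom p : set X := [set q | if q is Some _ then chIn p (hx q) (hy q) else p = None].
Definition hmap p q : C := if q is Some _ then chS p (hx q) (hy q) else 0.
Definition hinv p s : X := if p is Some _ then pt es (chX p s) (chY p s)
  else if s == 0 then None else pt es (chX p s) (chY p s).

Lemma hinv_regular p s : regular p s -> hinv p s = pt es (chX p s) (chY p s).
Proof. by case: p => [//|] [_ [//|s0]]; rewrite /hinv (negbTE s0). Qed.

Lemma hdom_fin p q : q <> None -> hdom p q = chIn p (hx q) (hy q).
Proof. by case: q. Qed.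

Lemma hmap_fin p q : q <> None -> hmap p q = chS p (hx q) (hy q).
Proof. by case: q. Qed.

Lemma hmap_regular p q : q <> None -> hdom p q -> regular p (hmap p q).
Proof. by move=> q0; rewrite hdom_fin // hmap_fin // => /(chart_inv (hyE q0))[]. Qed.

Lemma hmapK p q : hdom p q -> hinv p (hmap p q) = q.
Proof.
have [->|q0] := pselect (q = None); first by move=> ->; rewrite /hinv /= eqxx.
move=> hq0; rewrite hinv_regular; last exact: hmap_regular.
rewrite hmap_fin //; rewrite hdom_fin // in hq0.
by have [_ -> ->] := chart_inv (hyE q0) hq0; exact: ptK.
Qed.

Lemma hdom_hinv p s : regular p s -> [/\ hinv p s <> None, hdom p (hinv p s) & hmap p (hinv p s) = s].
Proof.
move=> hs; have [h1 h2 h3] := chart_param hs; have n := pt_fin h1.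
by rewrite hinv_regular // hdom_fin // hmap_fin // hx_pt // hy_pt.
Qed.

Lemma hdom_open p : open (hdom p).
Proof.
rewrite openE => q hq0; have [qN|qN] := pselect (q = None).
  subst q; rewrite /= in hq0; subst p; apply/nbhs_infP; split => //.
  exists ((chR None)^-1) => z z0 hz; have r0 := chR_gt0 (None : X).
  have zx : 0 < cabs (hx z) by apply: lt_trans hz; rewrite invr_gt0.
  rewrite hdom_fin //; split; first by rewrite -cabs_gt0.
  by rewrite cabsV -[chR _]invrK ltf_pV2 ?posrE ?invr_gt0.
rewrite hdom_fin // in hq0; apply: filterS (chIn_open qN hq0) => z [z0 hz].
by rewrite /= hdom_fin.
Qed.

Lemma himgE p s : (hmap p @` hdom p) s <-> chDisc p s.
Proof.
split=> [[q hq0 <-]|hs].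
  have [qN|qN] := pselect (q = None); last by have [] := hmap_regular qN hq0.
  by subst q; rewrite /= in hq0; subst p; rewrite /chDisc -[hmap None None]/(0 : C) expr0n cabs0 chR_gt0.
have [[pN s0]|h] := pselect (p = None /\ s = 0).
  by exists None; [|rewrite /= s0].
have rg : regular p s.
  by split=> //; case: (eqVneq s 0) => [s0|]; [left => pN; apply: h|right].
have [_ h2 h3] := hdom_hinv rg.
by exists (hinv p s).
Qed.

Lemma himg_open p : open (hmap p @` hdom p).
Proof.
rewrite openE => s /himgE hs; apply: near_imp (disc_open hs) => w.
by move=> hw; apply/himgE.
Qed.

Lemma tcont_rt p q : q <> None -> hdom p q ->
  (p <> None -> hy p = 0 -> tcont (fun r : X => (rt p (hx r))^-1) q) /\
  (p = None -> tcont (fun r : X => hx r ^+ g * rt p (hx r)^-1 / hy r) q).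
Proof.
move=> q0; rewrite hdom_fin // => hin; split => p0.
  move=> y0; case: p p0 y0 hin => // u _; set p := Some u : X => y0.
  rewrite /chIn -/p y0 eqxx => hin; have [_ rn] := rtE_fin (p := p) ltac:(by []) hin.
  apply: (@tcont_comp _ _ _ (fun x => (rt p x)^-1)); first exact: tcont_hx.
  by apply: holomorphic_at_ccont; apply: (@holomorphic_atV _ (rt p)) => //; exact: rt_holo.
subst p; case: hin => x0 hin; have [r2 rn] := rtE_inf hin.
have yn : hy q != 0.
  by rewrite -sqrf_eq0 hyE // hrevE // -r2 mulf_neq0 ?expf_neq0.
apply: tcontM; last first.
  apply: (@tcont_comp _ _ _ (fun z => z^-1)); first exact: tcont_hy.
  by apply: holomorphic_at_ccont; exact: holomorphic_at_inv.
apply: (@tcont_comp _ _ _ (fun x => x ^+ g * rt None x^-1)); first exact: tcont_hx.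
apply: holomorphic_at_ccont; apply: holomorphic_atM; first by apply: holomorphic_atX; exact: holomorphic_at_id.
by apply: (@holomorphic_at_comp _ (fun x => x^-1)); [exact: holomorphic_at_inv|exact: rt_holo].
Qed.

Lemma tcont_near (T : topologicalType) (a b : T -> C) t :
  nbhs t [set u | a u = b u] -> tcont a t -> tcont b t.
Proof.
move=> H Ha e e0; have Ht := nbhs_singleton H.
by apply: filterS2 H (Ha e e0) => u h1 h2; rewrite -h1 -Ht.
Qed.

Lemma hmap_continuous p q : hdom p q -> {for q, continuous (hmap p)}.
Proof.
move=> hq0; apply/tcontP; have [qN|qN] := pselect (q = None).
  subst q; rewrite /= in hq0; subst p => e e0.
  have r0 := chR_gt0 (None : X).
  have h0 : cabs (hmap None None - hmap None None) < e by rewrite subrr cabs0.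
  apply/nbhs_infP; split; first exact: h0.
  exists (Num.max ((chR None)^-1) (e ^+ 2)^-1) => z z0; rewrite gt_max => /andP[h1 h2].
  have zx : 0 < cabs (hx z) by apply: lt_trans h1; rewrite invr_gt0.
  have hin : chIn None (hx z) (hy z).
    split; first by rewrite -cabs_gt0.
    by rewrite cabsV -[chR _]invrK ltf_pV2 ?posrE ?invr_gt0.
  have [_ h3 _] := chart_inv (hyE z0) hin.
  rewrite hmap_fin // subr0; set s := chS _ _ _ in h3 *.
  have s2 : cabs s ^+ 2 = (cabs (hx z))^-1 by rewrite -cabsX -cabsV -h3 /chX invrK.
  have : cabs s ^+ 2 < e ^+ 2.
    by rewrite s2 -[e ^+ 2]invrK ltf_pV2 ?posrE ?invr_gt0 ?exprn_gt0.
  by rewrite ltr_pXn2r ?nnegrE ?cabs_ge0 ?(ltW e0).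
have [t1 t2] := tcont_rt qN hq0; have nf := near_fin qN.
case: p hq0 t1 t2 => [u|] hq0 t1 t2.
  set p := Some u : X in hq0 t1 t2 *; have [y0|y0] := eqVneq (hy p) 0.
    apply: (@tcont_near _ (fun r => hy r / rt p (hx r))).
      by apply: filterS nf => r r0; rewrite /= hmap_fin // /chS -/p y0 eqxx.
    by apply: tcontM; [exact: tcont_hy|exact: t1].
  apply: (@tcont_near X (fun r : X => hx r)); last exact: tcont_hx.
  by apply: filterS nf => r r0; rewrite /= hmap_fin // /chS -/p (negbTE y0).
apply: tcont_near (t2 (erefl _)).
by apply: filterS nf => r r0; rewrite /= hmap_fin.
Qed.

Lemma hinv_continuous p q : hdom p q -> {for hmap p q, continuous (hinv p)}.
Proof.
move=> hq0 A; rewrite /= hmapK // => nA; have [qN|qN] := pselect (q = None).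
  subst q; rewrite /= in hq0; subst p; move: nA => /nbhs_infP[A0 [r HA]].
  have r0 := chR_gt0 (None : X).
  have h1 : 0 < (`|r| + 1)^-1 by rewrite invr_gt0 ltr_wpDl.
  apply/nbhsCP; exists (Num.min 1 (Num.min (chR None) (`|r| + 1)^-1)).
    by rewrite !lt_min ltr01 r0.
  move=> s; rewrite subr0 !lt_min => /and3P[s1 s2 s3]; have E0 : hinv None 0 = None by rewrite /hinv eqxx.
  change (A (hinv None s)); have [->|s0] := eqVneq s 0; first by rewrite E0.
  have s2' : cabs s ^+ 2 <= cabs s by rewrite expr2 ler_piMr ?cabs_ge0 // ltW.
  have rg : regular None s by split; [rewrite /chDisc cabsX; lra|right].
  have [n1 _ _] := hdom_hinv rg; have [k1 _ _] := chart_param rg.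
  apply: HA => //; rewrite hinv_regular // hx_pt // /chX cabsV cabsX.
  have sp : 0 < cabs s ^+ 2 by rewrite exprn_gt0 // cabs_gt0.
  rewrite -[r]opprK; apply: (@lt_le_trans _ _ (`|r| + 1)).
    by have := ler_norm r; rewrite opprK; lra.
  by rewrite -[leLHS]invrK lef_pV2 ?posrE //; lra.
have rg := hmap_regular qN hq0; set s := hmap p q in rg *.
have [e e0 HA] := proj1 (nbhs_finP _ qN) nA.
have [hX hY] : chX p s = hx q /\ chY p s = hy q.
  by rewrite /s hmap_fin //; rewrite hdom_fin // in hq0; have [_ -> ->] := chart_inv (hyE qN) hq0.
have [d1 d10 H1] := holomorphic_at_ccont (chX_holo rg.2) e0.
have [d2 d20 H2] := holomorphic_at_ccont (chY_holo rg) e0.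
have n1 : \forall w \near s, cabs (w - s) < Num.min d1 d2.
  by apply/nbhsCP; exists (Num.min d1 d2) => //; rewrite lt_min d10.
apply: filterS2 n1 (regular_open rg) => w; rewrite lt_min => /andP[w1 w2] rw /=.
have [n _ _] := hdom_hinv rw; have [k1 _ _] := chart_param rw.
apply: HA => //; rewrite hinv_regular //.
  by rewrite hx_pt // -hX; have := H1 _ w1; rewrite [s + _]addrC subrK.
by rewrite hy_pt // -hY; have := H2 _ w2; rewrite [s + _]addrC subrK.
Qed.

Definition hchart p : chart R X := Chart (@hdom_open p) (@himg_open p) (@hmapK p)
  (@hmap_continuous p) (@hinv_continuous p).

Lemma hdom_center p : hdom p p.
Proof.
case: p => [u|//]; set p := Some u : X; rewrite hdom_fin // /chIn -/p.
case: (eqVneq (hy p) 0) => [_|y0]; rewrite subrr cabs0 ?chR_gt0 //; split => //.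
by rewrite divff //= ltr01.
Qed.

Lemma hcompat i j q : hdom i q -> hdom j q ->
  holomorphic_at (local_rep (hchart i) id (hchart j)) (hmap i q).
Proof.
move=> hi hj; rewrite /local_rep /=; have [qN|qN] := pselect (q = None).
  subst q; rewrite /= in hi hj; subst i j.
  apply: holomorphic_at_eq (holomorphic_at_id 0).
  have d0 : chDisc None 0 by rewrite /chDisc expr0n cabs0 chR_gt0.
  apply: near_imp (disc_open d0) => s hs; have [->|s0] := eqVneq s 0.
    by rewrite /hinv eqxx.
  by have [_ _ ->] := @hdom_hinv None s (conj hs (or_intror s0)).
have rg := hmap_regular qN hi; set s := hmap i q in rg *.
have [hX hY] : chX i s = hx q /\ chY i s = hy q.
  by rewrite /s hmap_fin //; rewrite hdom_fin // in hi; have [_ -> ->] := chart_inv (hyE qN) hi.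
apply: (@holomorphic_at_eq _ (fun w => chS j (chX i w) (chY i w))).
  apply: near_imp (regular_open rg) => w rw; have [n _ _] := hdom_hinv rw.
  have [k1 _ _] := chart_param rw.
  by rewrite hmap_fin // hinv_regular // hx_pt // hy_pt.
apply: chS_holo; rewrite ?hX ?hY.
- exact: hyE.
- by rewrite hdom_fin in hj.
- exact: chX_holo rg.2.
- exact: chY_holo.
Qed.

End HypCharts.

                                             

(** * Functions of moderate growth on the curve, and connectedness *)

Section HypFunctions.
Variables (R : realType) (es : seq (Cplx R)) (g : nat).
Local Notation C := (Cplx R).
Local Notation X := (hyp es).
Local Notation f := (hf es).
Hypothesis es_uniq : uniq es.
Hypothesis es_size : size es = (2 * g).+1.
Implicit Types (x y z w s : C) (p q : X).

Lemma hinv_ord p s : p <> None -> hy p != 0 -> hinv g p s = pt es s (rt p s).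
Proof. by case: p => // u _ y0; rewrite /hinv /chX /chY (negbTE y0). Qed.

Lemma rt_ord p s : p <> None -> hy p != 0 -> rt p s = hy p * psqrt (f.[s] / f.[hx p]).
Proof. by case: p => // u _ y0; rewrite /rt /hq (negbTE y0). Qed.

Lemma rt_ord_near p : p <> None -> hy p != 0 ->
  \forall s \near hx p, rt p s ^+ 2 = f.[s] /\ holomorphic_at (rt p) s.
Proof.
case: p => // u p0; set p := Some u : X => y0; apply/nbhsCP; exists (chR es es_uniq p).
  exact: chR_gt0.
move=> s hs; split; last exact: (rt_holo (p := p) hs).
by have [-> _] := rtE_fin p0 hs; rewrite /hq (negbTE y0).
Qed.

Lemma hf_growth : exists2 K : R, 1 <= K &
  forall x, 1 <= cabs x -> cabs f.[x] <= K * cabs x ^+ size es.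
Proof.
exists (\prod_(e <- es) (1 + cabs e)).
  elim: es => [|e s IH]; first by rewrite big_nil.
  rewrite big_cons /=; have := cabs_ge0 e; set P := \prod_(_ <- _) _ in IH *.
  by move=> h; rewrite mulrDl mul1r; have : 0 <= cabs e * P; [apply: mulr_ge0 => //; lra|lra].
move=> x x1; rewrite horner_prod; elim: es => [|e s IH].
  by rewrite !big_nil cabs1 mulr1.
rewrite !big_cons (cabsM _ _) exprS mulrACA; apply: ler_pM => //; try exact: cabs_ge0.
rewrite hornerXsubC; have := cabsD x (- e); rewrite cabsN => h; apply: le_trans h _.
have := cabs_ge0 e; have : cabs e <= cabs e * cabs x by rewrite ler_peMr // cabs_ge0.
by rewrite mulrDl mul1r; lra.
Qed.

Section PolynomialFunction.
Variables (phi : X -> C) (m : nat) (K R0 : R).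
Hypothesis mg : (m < g)%N.
Hypothesis phi_ord : forall p, p <> None -> hy p != 0 ->
  holomorphic_at (fun s => phi (hinv g p s)) (hx p).
Hypothesis phi_branch : forall p, p <> None -> hy p = 0 -> tcont phi p.
Hypothesis phi_growth : forall p, p <> None -> R0 <= cabs (hx p) ->
  cabs (phi p) <= K * cabs (hx p) ^+ m.

Let y_ x : C := csqrt f.[x].
Let yE x : y_ x ^+ 2 = f.[x]. Proof. exact: csqrtK. Qed.
Let yNE x : (- y_ x) ^+ 2 = f.[x]. Proof. by rewrite sqrrN. Qed.
(** The even part of phi under y -> -y, and y times twice its odd part. Both are unchanged when
    [y_ x] is replaced by its opposite, so the discontinuity of [csqrt] does no harm. *)
Let even x : C := (phi (pt es x (y_ x)) + phi (pt es x (- y_ x))) / 2.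
Let odd x : C := y_ x * (phi (pt es x (y_ x)) - phi (pt es x (- y_ x))).

(** Near x the root [y_] is a holomorphic branch up to a sign that may depend on the point and does
    not affect [even] and [odd]. *)
Let ordinary x : x \notin es -> holomorphic_at even x /\ holomorphic_at odd x.
Proof.
rewrite -hf_eq0 => fx; have y0 : y_ x != 0 by rewrite -sqrf_eq0 yE.
pose p := pt es x (y_ x); pose p' := pt es x (- y_ x).
have pn : p <> None := pt_fin (yE x); have pn' : p' <> None := pt_fin (yNE x).
have hxp : hx p = x by rewrite hx_pt. have hxp' : hx p' = x by rewrite hx_pt.
have hyp0 : hy p = y_ x by rewrite hy_pt. have hyp0' : hy p' = - y_ x by rewrite hy_pt.
have y1 : hy p != 0 by rewrite hyp0. have y1' : hy p' != 0 by rewrite hyp0' oppr_eq0.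
pose A s := phi (hinv g p s); pose B s := phi (hinv g p' s).
have hA : holomorphic_at A x by rewrite -hxp; exact: phi_ord.
have hB : holomorphic_at B x by rewrite -hxp'; exact: phi_ord.
have N : rt p' =1 (fun s => - rt p s).
  by move=> s; rewrite !rt_ord // hxp hxp' hyp0 hyp0' mulNr.
have near_x : \forall s \near x, rt p s ^+ 2 = f.[s] /\ holomorphic_at (rt p) s.
  by rewrite -hxp; exact: rt_ord_near.
have AE s : A s = phi (pt es s (rt p s)) by rewrite /A hinv_ord.
have BE s : B s = phi (pt es s (- rt p s)) by rewrite /B hinv_ord // N.
have sgn s : rt p s ^+ 2 = f.[s] -> y_ s = rt p s \/ y_ s = - rt p s.
  by rewrite -yE => /esym/eqP; rewrite eqf_sqr => /orP[] /eqP; [left|right].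
split.
  apply: (@holomorphic_at_eq _ (fun s => (A s + B s) * 2^-1)).
    apply: near_imp near_x => s [/sgn h _]; rewrite AE BE /even.
    by case: h => ->; rewrite ?opprK // [phi _ + _]addrC.
  by apply: holomorphic_atM; [exact: holomorphic_atD|exact: holomorphic_at_cst].
apply: (@holomorphic_at_eq _ (fun s => rt p s * (A s - B s))).
  apply: near_imp near_x => s [/sgn h _]; rewrite AE BE /odd.
  by case: h => ->; rewrite ?opprK // mulNr -mulrN opprB.
by apply: holomorphic_atM; [case: (near_at near_x)|exact: holomorphic_atB].
Qed.

Let branch_continuity x : x \in es -> forall e : R, 0 < e ->
  \forall s \near x, [/\ cabs (y_ s) < 1,
    cabs (phi (pt es s (y_ s)) - phi (pt es x 0)) < e &
    cabs (phi (pt es s (- y_ s)) - phi (pt es x 0)) < e].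
Proof.
rewrite -hf_eq0 => /eqP fx e e0; have y0 : (0 : C) ^+ 2 = f.[x] by rewrite fx expr0n.
have pn := pt_fin y0; have px := hx_pt y0; have py := hy_pt y0.
have [d d0 H] := proj1 (nbhs_finP _ pn) (phi_branch pn py e0).
pose r := Num.min 1 d; have r0 : 0 < r by rewrite lt_min ltr01.
have cf : ccont (fun s => f.[s]) x by apply: holomorphic_at_ccont; exact: holomorphic_at_horner.
have [t t0 ht] := cf _ (exprn_gt0 2 r0).
apply/nbhsCP; exists (Num.min d t); first by rewrite lt_min d0.
move=> s; rewrite lt_min => /andP[s1 s2].
have ys : cabs (y_ s) < r.
  have := ht _ s2; rewrite [x + _]addrC subrK fx subr0 -yE cabsX.
  by rewrite ltr_pXn2r ?nnegrE ?cabs_ge0 ?(ltW r0).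
have [ys1 ysd] : cabs (y_ s) < 1 /\ cabs (y_ s) < d.
  by move: ys; rewrite lt_min => /andP.
split => //; apply: H; rewrite ?px ?py ?(hx_pt (yE s)) ?(hx_pt (yNE s)) //.
- exact: pt_fin (yE s).
- by rewrite (hy_pt (yE s)) subr0.
- exact: pt_fin (yNE s).
- by rewrite (hy_pt (yNE s)) subr0 cabsN.
Qed.

Let y0_branch x : x \in es -> y_ x = 0.
Proof. by rewrite -hf_eq0 -yE sqrf_eq0 => /eqP. Qed.

Let branch_ccont x : x \in es -> ccont even x /\ ccont odd x.
Proof.
move=> xe; have y0 := y0_branch xe; pose c := phi (pt es x 0).
have E0 : even x = c by rewrite /even y0 oppr0 -/c; field.
have O0 : odd x = 0 by rewrite /odd y0 mul0r.
have two : cabs (2 : C) = 2 by exact: cabs_nat.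
split=> e e0.
  have /nbhsCP[d d0 H] := branch_continuity xe e0; exists d => // h hd.
  have [|_ h1 h2] := H (x + h); first by rewrite addrAC subrr add0r.
  rewrite E0 /even; set a := phi _ in h1 *; set b := phi _ in h2 *.
  have -> : (a + b) / 2 - c = ((a - c) + (b - c)) / 2 by field.
  rewrite (cabsM _ _) cabsV two ltr_pdivrMr //; have := cabsD (a - c) (b - c).
  by rewrite -/c in h1 h2; lra.
have e20 : 0 < e / 2 by rewrite divr_gt0.
have /nbhsCP[d d0 H] := branch_continuity xe e20; exists d => // h hd.
have [|h0 h1 h2] := H (x + h); first by rewrite addrAC subrr add0r.
rewrite O0 subr0 /odd; set a := phi _ in h1 *; set b := phi _ in h2 *.
rewrite (cabsM _ _); have := cabsB b (phi (pt es x 0)); have := cabs_triangle a b (phi (pt es x 0)).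
move=> h3 h4; have h5 : cabs (a - b) < e by lra.
apply: le_lt_trans h5; rewrite ler_piMl ?cabs_ge0 //; exact: ltW.
Qed.

Let nonbranch_near x : \forall s \near x, s != x -> s \notin es.
Proof.
by apply: near_imp (near_avoid x es) => s h; apply: contraNN => /h ->.
Qed.

Let entire x : (exists l, has_cderiv even x l) /\ (exists l, has_cderiv odd x l).
Proof.
suff [h1 h2] : holomorphic_at even x /\ holomorphic_at odd x.
  by split; eexists; exact: holomorphic_at_cderiv.
have [xe|/ordinary//] := boolP (x \in es); have [c1 c2] := branch_ccont xe.
by split; apply: removable => //; apply: near_imp (nonbranch_near x) => s h /h /ordinary[h1 h2];
  apply/derivableCP; eexists; [exact: holomorphic_at_cderiv h1|exact: holomorphic_at_cderiv h2].
Qed.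

Let phi_bounds x : Num.max 1 R0 <= cabs x -> [/\ 1 <= cabs x,
  cabs (phi (pt es x (y_ x))) <= `|K| * cabs x ^+ m & cabs (phi (pt es x (- y_ x))) <= `|K| * cabs x ^+ m].
Proof.
rewrite ge_max => /andP[x1 x0].
have KE : K * cabs x ^+ m <= `|K| * cabs x ^+ m.
  by rewrite ler_wpM2r ?ler_norm // exprn_ge0 ?cabs_ge0.
split => //; apply: le_trans KE.
  by have := @phi_growth _ (pt_fin (yE x)); rewrite (hx_pt (yE x)) => /(_ x0).
by have := @phi_growth _ (pt_fin (yNE x)); rewrite (hx_pt (yNE x)) => /(_ x0).
Qed.

(** The crude bound |y| <= M |x|^(g+1) makes [odd] a polynomial of degree at most m+g+1 <= 2g, and
    it vanishes at the 2g+1 branch points. *)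
Let odd_eq0 x : odd x = 0.
Proof.
have [M M1 HM] := hf_growth.
have [x0|q hq hE] := @liouville _ odd (m + g.+1) (2 * M * `|K|) (Num.max 1 R0) (fun z => (entire z).2).
  move=> /phi_bounds[x1 h1 h2]; rewrite /odd (cabsM _ _).
  have hy : cabs (y_ x0) <= M * cabs x0 ^+ g.+1.
    have M0 : 0 <= M by lra.
    have r0 : 0 <= M * cabs x0 ^+ g.+1 by rewrite mulr_ge0 // exprn_ge0 // cabs_ge0.
    rewrite -(@ler_pXn2r _ 2) ?nnegrE ?cabs_ge0 // -[cabs _ ^+ 2]cabsX yE.
    apply: le_trans (HM _ x1) _; rewrite es_size exprMn; apply: ler_pM; rewrite ?exprn_ge0 ?cabs_ge0 //.
      by rewrite expr2 ler_peMr.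
    by rewrite -exprM; apply: ler_weXn2l => //; clear; lia.
  have hd : cabs (phi (pt es x0 (y_ x0)) - phi (pt es x0 (- y_ x0))) <= 2 * (`|K| * cabs x0 ^+ m).
    have := cabsD (phi (pt es x0 (y_ x0))) (- phi (pt es x0 (- y_ x0))); rewrite cabsN; lra.
  apply: le_trans (ler_pM (cabs_ge0 _) (cabs_ge0 _) hy hd) _.
  by rewrite exprD; set a := cabs x0 ^+ g.+1; set b := cabs x0 ^+ m; rewrite le_eqVlt; apply/orP; left; apply/eqP; ring.
suff q0 : q = 0 by rewrite hE q0 horner0.
apply: (roots_geq_poly_eq0 (rs := es)) => //.
  by apply/allP => e ee; rewrite rootE -hE /odd (y0_branch ee) mul0r.
by apply: leq_trans hq _; rewrite es_size; clear -mg; lia.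
Qed.

                                                                                   
                                                                                    
(** Even and odd parts are entire, since they are continuous at the branch points; Liouville makes
    them polynomials, and the odd one has too many roots. Used with m = 0 for connectedness and with
    m = g-1 for the genus. *)
Lemma hyp_function_polynomial : exists2 q : {poly C}, (size q <= m.+1)%N &
  forall p, p <> None -> phi p = q.[hx p].
Proof.
have [x0|q hq hE] := @liouville _ even m `|K| (Num.max 1 R0) (fun z => (entire z).1).
  move=> /phi_bounds[x1 h1 h2]; rewrite /even (cabsM _ _) cabsV.
  have -> : cabs (2 : C) = 2 by exact: cabs_nat.
  rewrite ler_pdivrMr //; have := cabsD (phi (pt es x0 (y_ x0))) (phi (pt es x0 (- y_ x0))); lra.
exists q => // p p0; rewrite -hE /even.
have H : phi (pt es (hx p) (y_ (hx p))) = phi (pt es (hx p) (- y_ (hx p))).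
  have /eqP := odd_eq0 (hx p); rewrite /odd mulf_eq0 subr_eq0 => /orP[/eqP->|/eqP->//].
  by rewrite oppr0.
have : y_ (hx p) ^+ 2 = hy p ^+ 2 by rewrite yE hyE.
have E2 (a : C) : (a + a) / 2 = a by field.
move/eqP; rewrite eqf_sqr => /orP[] /eqP h.
  by rewrite -H E2 h ptK.
by rewrite H E2 h opprK ptK.
Qed.

End PolynomialFunction.

Hypothesis g_gt0 : (0 < g)%N.

Lemma hyp_nbhs_fin p (A : set X) : nbhs p A -> exists2 q, q <> None & A q.
Proof.
have [->|p0 /nbhs_singleton Ap] := pselect (p = None); last by exists p.
move=> /nbhs_infP[_ [r H]]; pose x : C := cofr (`|r| + 1).
have yE : csqrt f.[x] ^+ 2 = f.[x] by exact: csqrtK.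
exists (pt es x (csqrt f.[x])); first exact: pt_fin.
apply: H; first exact: pt_fin.
by rewrite hx_pt // cabs_cofr; have := ler_norm (`|r| + 1); have := ler_norm r; lra.
Qed.

(** The indicator of a clopen set is locally constant and bounded, hence a polynomial of degree 0 in
    x; finite points are dense, so it cannot take both values. *)
Lemma hyp_connected : connected [set: X].
Proof.
move=> B [b Bb] [U oU UE] [V cV VE]; rewrite setTI in UE; rewrite setTI in VE.
have oB : open B by rewrite UE.
have oC : open (~` B) by rewrite VE; exact: closed_openC.
apply/seteqP; split => // a _; apply: contrapT => nBa.
pose phi p : C := if `[< B p >] then 1 else 0.
have const p : nbhs p [set q | phi q = phi p].
  have [Bp|nBp] := pselect (B p).
    by apply: filterS (open_nbhs_nbhs (conj oB Bp)) => q Bq; rewrite /phi /= !asboolT.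
  by apply: filterS (open_nbhs_nbhs (conj oC nBp)) => q Bq; rewrite /phi /= !asboolF.
have [q hq hE] : exists2 q : {poly C}, (size q <= 1)%N & forall p, p <> None -> phi p = q.[hx p].
  apply: (@hyp_function_polynomial phi 0 1 0) => //.
  - move=> p p0 y0; apply: holomorphic_at_eq (holomorphic_at_cst (phi p) (hx p)).
    have hd := @hdom_center _ es es es_uniq p.
    have E : hmap g p p = hx p.
      by case: p p0 y0 hd => // u _ y0 _; rewrite /hmap /chS (negbTE y0).
    have nc : nbhs (hinv g p (hmap g p p)) [set q | phi q = phi p].
      by rewrite (hmapK es_size hd); exact: const.
    have h2 : {for hmap g p p, continuous (hinv g p)} := hinv_continuous es_size hd.
    by have := h2 _ nc; rewrite E; apply: near_imp => s /= ->.
  - move=> p p0 _ e e0; apply: filterS (const p) => z /= ->; by rewrite subrr cabs0.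
  - move=> p p0 _; rewrite expr0 mulr1 /phi; case: ifP => _; by rewrite ?cabs1 ?cabs0 ?ler01.
have const_q p r : p <> None -> r <> None -> phi p = phi r.
  by move=> p0 r0; rewrite !hE // (size1_polyC hq) !hornerC.
have [p1 n1 B1] := hyp_nbhs_fin (open_nbhs_nbhs (conj oB Bb)).
have [p2 n2 B2] := hyp_nbhs_fin (open_nbhs_nbhs (conj oC nBa)).
have := const_q _ _ n1 n2; rewrite /phi asboolT // asboolF // => /eqP.
by rewrite oner_eq0.
Qed.

End HypFunctions.

                                                 

(** * The Riemann surface, the form dx/y and its multiples *)

Section HypSurface.
Variables (R : realType) (es Z : seq (Cplx R)) (g : nat).
Local Notation C := (Cplx R).
Local Notation X := (hyp es).
Local Notation f := (hf es).
Hypothesis es_uniq : uniq es.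
Hypothesis es_size : size es = (2 * g).+1.
Hypothesis es_Z : {subset es <= Z}.
Hypothesis g_gt0 : (0 < g)%N.
Implicit Types (x y z w s : C) (p q : X).
Local Notation hdom := (hdom Z es_uniq).
Local Notation hmap := (hmap g).
Local Notation hinv := (hinv g).
Local Notation regular := (regular Z es_uniq).
Local Notation chDisc := (chDisc Z es_uniq).

Lemma hcover p : exists i : X, cdom (hchart Z es_uniq es_size i) p.
Proof. by exists p; exact: hdom_center. Qed.

Lemma hnonempty : [set: X] !=set0. Proof. by exists None. Qed.

Definition hsurf : compactRiemannSurface R :=
  @CompactRiemannSurface R (hyp es) (hyp es) (hchart Z es_uniq es_size)
    hcover (@hcompat R es Z g es_uniq es_size)
    hnonempty (@hyp_hausdorff R es) (@hyp_compact R es) (hyp_connected es_uniq es_size g_gt0).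

(** The coefficient of dx/y in the chart at p, simplified so that it is holomorphic at the centre
    too. At infinity dx = -2 s^-3 ds and y = s^-(2g+1) [rt], whence the zero of order 2g-2. *)
Definition dxy p s : C := if p is Some _ then
    (if hy p == 0 then 2 / rt p (hx p + s ^+ 2) else (rt p s)^-1)
  else - 2 * s ^+ (2 * g.-1) / rt p (s ^+ 2).

Lemma regular_disc p s : chDisc p s -> (p <> None \/ s != 0) -> regular p s.
Proof. by move=> h1 h2; split. Qed.

Lemma disc_rt p s : chDisc p s ->
  if p is Some _ then
    (if hy p == 0 then rt p (hx p + s ^+ 2) != 0 /\ holomorphic_at (rt p) (hx p + s ^+ 2)
     else rt p s != 0 /\ holomorphic_at (rt p) s)
  else rt p (s ^+ 2) != 0 /\ holomorphic_at (rt p) (s ^+ 2).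
Proof.
case: p => [u|]; last first.
  by move=> hs; have [_ h] := rtE_inf hs; split; [exact: h|exact: (rt_holo (p := None) hs)].
set p := Some u : X; have p0 : p <> None by [].
rewrite /chDisc -/p; case: ifP => _ hs.
  have hd : cabs (hx p + s ^+ 2 - hx p) < chR Z es_uniq p by rewrite addrAC subrr add0r.
  by have [_ h] := rtE_fin p0 hd; split; [exact: h|exact: (rt_holo (p := p) hd)].
by have [_ h] := rtE_fin p0 hs; split; [exact: h|exact: (rt_holo (p := p) hs)].
Qed.

Lemma sqr_holo (c : C) s : holomorphic_at (fun s : C => c + s ^+ 2) s.
Proof.
exact: (holomorphic_atD (holomorphic_at_cst c s) (holomorphic_atX 2 (holomorphic_at_id s))).
Qed.

Lemma rt_inf_holo s : chDisc None s -> rt (None : X) (s ^+ 2) != 0 /\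
  holomorphic_at (fun s => (rt (None : X) (s ^+ 2))^-1) s.
Proof.
move=> /disc_rt[h1 h2]; split; first exact: h1.
apply: (@holomorphic_atV _ (fun s => rt (None : X) (s ^+ 2))); first exact: h1.
apply: (@holomorphic_at_comp _ (fun s => s ^+ 2)); last exact: h2.
exact: (holomorphic_atX 2 (holomorphic_at_id s)).
Qed.

Lemma dxy_holo p s : chDisc p s -> holomorphic_at (dxy p) s.
Proof.
move=> hs; have := disc_rt hs; case: p hs => [u|] hs; last first.
  move=> _; have [_ h] := rt_inf_holo hs.
  rewrite /dxy; apply: holomorphic_atM; last exact: h.
  apply: holomorphic_atM; first exact: holomorphic_at_cst.
  exact: (holomorphic_atX _ (holomorphic_at_id s)).
rewrite /dxy; set p := Some u : X; case: (hy p == 0) => [[h1 h2]|[h1 h2]]; last exact: (holomorphic_atV h1 h2).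
apply: holomorphic_atM; first exact: holomorphic_at_cst.
apply: (@holomorphic_atV _ (fun s => rt p (hx p + s ^+ 2))); first exact: h1.
by apply: (@holomorphic_at_comp _ (fun s => hx p + s ^+ 2)); [exact: sqr_holo|exact: h2].
Qed.

Lemma dxy_neq0 p s : regular p s -> dxy p s != 0.
Proof.
move=> [/disc_rt hs h]; rewrite /dxy; case: p hs h => [u|].
  case: (hy _ == 0) => [[h1 _]|[h1 _]] _; last by rewrite invr_eq0.
  by rewrite mulf_neq0 ?invr_eq0 // pnatr_eq0.
move=> [h1 _] [//|s0]; rewrite !mulf_neq0 ?invr_eq0 // ?oppr_eq0 ?pnatr_eq0 //.
by rewrite expf_neq0.
Qed.

Lemma dxyE p s : regular p s -> chY g p s != 0 -> dxy p s = dX p s / chY g p s.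
Proof.
move=> [/disc_rt hs h]; rewrite /dxy /dX /chY; case: p hs h => [u|].
  case: (hy _ == 0) => [[h1 _]|[h1 _]] _; last by rewrite mul1r.
  rewrite mulf_eq0 negb_or => /andP[s0 _].
  by set r := rt _ _ in h1 *; field; rewrite s0 h1.
move=> [h1 _] [//|s0] _; set r := rt _ _ in h1 *.
have -> : s ^+ (2 * g).+1 = s ^+ (2 * g.-1) * s ^+ 3.
  by rewrite -exprD; congr (_ ^+ _); clear -g_gt0; lia.
set a := s ^+ (2 * g.-1); have a0 : a != 0 by rewrite expf_neq0.
by field; rewrite s0 a0 h1.
Qed.

Definition marked q : bool := if q is Some _ then hx q \in Z else true.

Lemma marked_fin q : q <> None -> marked q = (hx q \in Z). Proof. by case: q. Qed.

(** A marked point lies only in the chart centred at it, so compatibility conditions there reduce to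
    [trans_id]. *)
Lemma hdom_marked p q : hdom p q -> marked q -> q = p.
Proof.
have [->/= -> //|q0] := pselect (q = None); rewrite hdom_fin // => h.
by rewrite marked_fin // => hz; rewrite -(chIn_marked (hyE q0) h hz) ptK.
Qed.

Lemma hmap_disc p q : hdom p q -> chDisc p (hmap p q).
Proof. by move=> h; apply: (proj1 (himgE Z es_uniq es_size p (hmap p q))); exists q. Qed.

Lemma hinv_hmap_near p q : hdom p q -> \forall s \near hmap p q, hmap p (hinv p s) = s.
Proof.
move=> h; apply: near_imp (disc_open (hmap_disc h)) => s hs.
have [[-> ->]|h2] := pselect (p = None /\ s = 0); first by rewrite /hinv eqxx.
have rg : regular p s.
  by apply: regular_disc => //; case: (eqVneq s 0) => [s0|]; [left => pN; apply: h2|right].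
by have [_ _] := hdom_hinv es_size rg.
Qed.

Lemma hinv_near_dom p q : hdom p q -> forall A : set X, nbhs q A ->
  \forall s \near hmap p q, A (hinv p s).
Proof.
move=> h A nA; have c : {for hmap p q, continuous (hinv p)} := hinv_continuous es_size h.
by apply: c; rewrite (hmapK es_size h).
Qed.

Definition trans i j := local_rep (hchart Z es_uniq es_size i) id (hchart Z es_uniq es_size j).

Lemma trans_id p q : hdom p q -> derive1 (trans p p) (hmap p q) = 1.
Proof.
move=> h; apply: has_cderiv_derive1; apply: has_cderiv_near (has_cderiv_id _).
by apply: near_imp (hinv_hmap_near h) => s hs; rewrite /trans /local_rep /= hs.
Qed.

Lemma hmap_chX p q : q <> None -> hdom p q -> chX p (hmap p q) = hx q /\ chY g p (hmap p q) = hy q.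
Proof.
move=> q0; rewrite hdom_fin // hmap_fin // => h.
by have [_ -> ->] := chart_inv es_size (hyE q0) h.
Qed.

(** Branch points are marked; elsewhere the coefficient is x'(s)/y, and the chain rule for x
    applies. *)
Lemma dxy_trans i j q : q <> None -> hdom i q -> hdom j q ->
  dxy i (hmap i q) = dxy j (hmap j q) * derive1 (trans i j) (hmap i q).
Proof.
move=> q0 hi hj; have [y0|y0] := eqVneq (hy q) 0.
  have qZ : marked q by rewrite marked_fin //; apply: es_Z; exact: fin_branch.
  have ei := hdom_marked hi qZ; have ej := hdom_marked hj qZ.
  by move: hi; rewrite -ei -ej => hi; rewrite (trans_id hi) mulr1.
have ri := hmap_regular es_size q0 hi; have rj := hmap_regular es_size q0 hj.
have [xi yi] := hmap_chX q0 hi; have [xj yj] := hmap_chX q0 hj.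
rewrite (dxyE ri) ?yi // (dxyE rj) ?yj // mulrAC; congr (_ / _).
have hT := holomorphic_at_cderiv (hcompat es_size hi hj).
have TE : trans i j (hmap i q) = hmap j q by rewrite /trans /local_rep /= (hmapK es_size hi).
have hj2 : has_cderiv (chX j) (trans i j (hmap i q)) (dX j (hmap j q)).
  by rewrite TE; exact: chX_deriv rj.2.
apply: has_cderiv_uniq (chX_deriv ri.2) _; apply: has_cderiv_near (has_cderiv_comp hT hj2).
have nf := hinv_near_dom hi (near_fin q0).
have nj := hinv_near_dom hi (open_nbhs_nbhs (conj (@hdom_open _ es Z es_uniq j) hj)).
apply: filterS3 nf nj (regular_open ri) => s s0 sj si /=.
rewrite /trans /local_rep /=; have [-> _] := hmap_chX s0 sj.
have [k1 _ _] := chart_param es_size si.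
by rewrite (hinv_regular g si) hx_pt.
Qed.

                                                                                       
(** The coefficient of Phi(x,y) (dx/y)^k. At infinity x and y have poles, so the value v is supplied
    separately. *)
Definition hcoef (k : nat) (Phi : C -> C -> C) (v : C) p s : C :=
  if (p == None) && (s == 0) then v else Phi (chX p s) (chY g p s) * dxy p s ^+ k.

Lemma hcoef_fin k Phi v p q : q <> None -> hdom p q ->
  hcoef k Phi v p (hmap p q) = Phi (hx q) (hy q) * dxy p (hmap p q) ^+ k.
Proof.
move=> q0 h; have [hX hY] := hmap_chX q0 h.
rewrite /hcoef; case: ifP => [/andP[/eqP p0 /eqP s0]|_]; last by rewrite hX hY.
by have [_] := hmap_regular es_size q0 h; rewrite s0 p0 eqxx => -[].
Qed.

Lemma hcoef_change k Phi v (i j x : X) : hdom i x -> hdom j x ->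
  hcoef k Phi v i (hmap i x) = hcoef k Phi v j (hmap j x) * (derive1 (trans i j) (hmap i x)) ^+ k.
Proof.
move=> hi hj; have [x0|x0] := pselect (x = None).
  subst x; have ei := hdom_marked hi erefl; have ej := hdom_marked hj erefl.
  by move: hi; rewrite -ei -ej => hi; rewrite (trans_id hi) expr1n mulr1.
by rewrite !hcoef_fin // (dxy_trans x0 hi hj) exprMn mulrA.
Qed.

Definition hdiff k Phi v
  (mer : forall i x : X, hdom i x -> meromorphic_at (hcoef k Phi v i) (hmap i x)) :
  kDifferential k hsurf :=
  @KDifferential R k hsurf (hcoef k Phi v) mer (@hcoef_change k Phi v).

End HypSurface.

(** * Orders of germs *)

Section Orders.
Variable R : realType.
Local Notation C := (Cplx R).
Implicit Types (f h : C -> C) (a z : C).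

Lemma has_order0 f a : holomorphic_at f a -> f a != 0 -> has_order_at f a 0%N.
Proof.
by move=> Hf f0; exists f; split => //; apply: near_all => z; rewrite expr0z mulr1.
Qed.

Lemma has_order_near f h a n : (\forall z \near a, f z = h z) -> has_order_at f a n ->
  has_order_at h a n.
Proof.
move=> E [k [k1 k2 k3]]; exists k; split; [exact: k1|exact: k2|].
by apply: filterS2 E k3 => z <-.
Qed.

Lemma has_order_natM f h a (m n : nat) : has_order_at f a m -> has_order_at h a n ->
  has_order_at (fun z => f z * h z) a (m + n)%N.
Proof.
move=> [u [u1 u2 u3]] [v [v1 v2 v3]]; exists (fun z => u z * v z); split.
- exact: holomorphic_atM.
- by rewrite mulf_neq0.
- by apply: filterS2 u3 v3 => z -> ->; rewrite -!exprnP exprD mulrACA.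
Qed.

Lemma has_order_natX f a (m l : nat) : has_order_at f a m ->
  has_order_at (fun z => f z ^+ l) a (l * m)%N.
Proof.
move=> H; elim: l => [|l IH].
  by rewrite mul0n; apply: has_order0; [exact: holomorphic_at_cst|exact: oner_neq0].
rewrite mulSn; apply: has_order_near (has_order_natM H IH).
by apply: near_all => z; rewrite exprS.
Qed.

Lemma has_order_sub a : has_order_at (fun z => z - a) a 1%N.
Proof.
exists (fun=> 1); split; [exact: holomorphic_at_cst|exact: oner_neq0|].
by apply: near_all => z; rewrite mul1r expr1z.
Qed.

Lemma has_order_meromorphic f a n : has_order_at f a n -> meromorphic_at f a.
Proof. by left; exists n. Qed.

Lemma has_order_holomorphic h a (n : nat) : has_order_at h a n -> holomorphic_at h a.
Proof.
move=> [u [u1 _ u3]]; apply: (@holomorphic_at_eq _ (fun z => u z * (z - a) ^+ n)).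
  by apply: near_imp u3 => z ->.
apply: holomorphic_atM; first exact: u1.
apply: (holomorphic_atX n); exact: (holomorphic_atB (holomorphic_at_id a) (holomorphic_at_cst a a)).
Qed.

Lemma near_punctured a (P : C -> Prop) : (\forall z \near a, P z) -> exists2 z, z != a & P z.
Proof.
move=> /nbhsCP[r r0 H]; have r2 : 0 < r / 2 by rewrite divr_gt0.
have E : a + cofr (r / 2) - a = cofr (r / 2) by rewrite addrAC subrr add0r.
exists (a + cofr (r / 2)).
  by rewrite -subr_eq0 E -cabs_eq0 cabs_cofr normr_eq0 gt_eqF.
by apply: H; rewrite E cabs_cofr gtr0_norm // ltr_pdivrMr // mulrDr mulr1; lra.
Qed.

Lemma holomorphic_punctured_eq f h a : holomorphic_at f a -> holomorphic_at h a ->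
  (\forall z \near a, z != a -> f z = h z) -> f a = h a.
Proof.
move=> Hf Hh E; apply/eqP/contraT; rewrite -subr_eq0 => ne.
have := near_neq0 (holomorphic_at_ccont (holomorphic_atB Hf Hh)) ne.
move=> /(near_and E)/near_punctured[z za [/(_ za)->]].
by rewrite subrr eqxx.
Qed.

Lemma holomorphic_at_sum (I : Type) (s : seq I) (F : I -> C -> C) a :
  (forall i, holomorphic_at (F i) a) -> holomorphic_at (fun z => \sum_(i <- s) F i z) a.
Proof.
move=> H; elim: s => [|i s IH].
  by apply: holomorphic_at_eq (holomorphic_at_cst 0 a); apply: near_all => z; rewrite big_nil.
by apply: holomorphic_at_eq (holomorphic_atD (H i) IH); apply: near_all => z; rewrite big_cons.
Qed.

Lemma horner_eq0_poly (p : {poly C}) : (forall x, p.[x] = 0) -> p = 0.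
Proof.
move=> H; apply: (roots_geq_poly_eq0 (rs := [seq n%:R | n <- iota 0 (size p)])).
- by apply/allP => z _; rewrite rootE H.
- by rewrite map_inj_uniq ?iota_uniq //; exact: (mulrIn (oner_neq0 C)).
- by rewrite size_map size_iota.
Qed.

End Orders.

(** * The genus of the curve *)

Section HypGenus.
Variables (R : realType) (es Z : seq (Cplx R)) (g : nat).
Local Notation C := (Cplx R).
Local Notation X := (hyp es).
Local Notation f := (hf es).
Hypothesis es_uniq : uniq es.
Hypothesis es_size : size es = (2 * g).+1.
Hypothesis es_Z : {subset es <= Z}.
Hypothesis g_gt0 : (0 < g)%N.
Implicit Types (x y z w s : C) (p q : X).
Local Notation hdom := (hdom Z es_uniq).
Local Notation hmap := (hmap g).
Local Notation hinv := (hinv g).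
Local Notation regular := (regular Z es_uniq).
Local Notation chDisc := (chDisc Z es_uniq).
Local Notation dxy := (@dxy R es g).
Local Notation hcoef := (@hcoef R es g).
Local Notation S := (hsurf Z es_uniq es_size g_gt0).

Lemma hcoef_regular k Phi v p s : regular p s ->
  hcoef k Phi v p s = Phi (chX p s) (chY g p s) * dxy p s ^+ k.
Proof.
by rewrite /Submission.hcoef; case: ifP => // /andP[/eqP-> /eqP->] [_]; rewrite eqxx => -[].
Qed.

Lemma hcoef_near k Phi v p s : regular p s -> \forall w \near s,
  Phi (chX p w) (chY g p w) * dxy p w ^+ k = hcoef k Phi v p w.
Proof. by move=> /regular_open; apply: near_imp => w hw; rewrite hcoef_regular. Qed.

Lemma chX_order p s : regular p s -> exists n : nat, has_order_at (chX p) s n.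
Proof.
move=> rg; have [X0|X0] := eqVneq (chX p s) 0; last first.
  by exists 0%N; apply: has_order0 => //; apply: chX_holo; case: rg.
case: p rg X0 => [u|] rg; last first.
  by case: rg => _ [//|s0]; rewrite /chX => /eqP; rewrite invr_eq0 expf_eq0 (negbTE s0).
rewrite /chX; set p := Some u : X; case: (hy p == 0) => X0; last first.
  by exists 1%N; apply: has_order_near (has_order_sub s); apply: near_all => z; rewrite X0 subr0.
have e0 : hx p = - s ^+ 2 by apply/eqP; rewrite -addr_eq0 X0.
have fac (z : C) : (z - s) * (z + s) = hx p + z ^+ 2 by rewrite e0; ring.
have [s0|s0] := eqVneq s 0.
  exists 2%N; apply: has_order_near (has_order_natX 2 (has_order_sub s)).
  by apply: near_all => z; rewrite -fac s0 subr0 addr0 expr2.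
exists (1 + 0)%N; apply: has_order_near (has_order_natM (has_order_sub s) (has_order0 (f := fun z => z + s) _ _)).
- by apply: near_all => z; rewrite fac.
- exact: (holomorphic_atD (holomorphic_at_id s) (holomorphic_at_cst s s)).
- by rewrite -mulr2n mulrn_eq0 negb_or /=.
Qed.

(** The coefficient of x^l dx/y at infinity, nonzero (for l < g) only when l = g-1. *)
Definition infval (l : nat) : C := - 2 * 0 ^+ (2 * (g.-1 - l)).

Lemma rt_None0 : rt (None : X) 0 = 1.
Proof. by rewrite /rt hrev0 psqrt1. Qed.

Lemma form_infinity (l : nat) : (l < g)%N -> \forall s \near 0,
  - 2 * (rt (None : X) (s ^+ 2))^-1 * s ^+ (2 * (g.-1 - l)) = hcoef 1 (fun x _ => x ^+ l) (infval l) None s.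
Proof.
move=> lg; have d0 : chDisc None 0 by rewrite /Submission.chDisc expr0n cabs0 chR_gt0.
apply: near_imp (disc_open d0) => s hs; rewrite /Submission.hcoef eqxx andTb; case: (eqVneq s 0) => [->|s0].
  by rewrite [0 ^+ 2]expr0n rt_None0 invr1 mulr1.
rewrite expr1 /Submission.dxy /chX exprVn -exprM.
have -> : s ^+ (2 * g.-1) = s ^+ (2 * l) * s ^+ (2 * (g.-1 - l)).
  by rewrite -exprD; congr (_ ^+ _); clear -lg; lia.
set a := s ^+ (2 * l); have a0 : a != 0 by rewrite expf_neq0.
have r0 := (rt_inf_holo hs).1; set r := rt _ _ in r0 *; set b := s ^+ _.
by field; rewrite r0 a0.
Qed.

Lemma form_order (l : nat) : (l < g)%N -> forall i q : X, hdom i q ->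
  exists n : nat, has_order_at (hcoef 1 (fun x _ => x ^+ l) (infval l) i) (hmap i q) n.
Proof.
move=> lg i q hi; have [q0|q0] := pselect (q = None).
  subst q; rewrite -(hdom_marked hi (erefl : marked Z None)).
  exists (0 + 2 * (g.-1 - l) * 1)%N; apply: has_order_near (form_infinity lg) _.
  have d0 : chDisc None 0 by rewrite /Submission.chDisc expr0n cabs0 chR_gt0.
  have [r0 rh] := rt_inf_holo d0.
  apply: has_order_natM; last first.
    apply: has_order_near (has_order_natX _ (has_order_sub 0)).
    by apply: near_all => z; rewrite subr0.
  apply: has_order0; first exact: (holomorphic_atM (holomorphic_at_cst _ _) rh).
  by rewrite mulf_neq0 ?invr_eq0 ?oppr_eq0 ?pnatr_eq0.
have rg := hmap_regular es_size q0 hi; have [m hm] := chX_order rg.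
exists (l * m + 0)%N.
apply: has_order_near (hcoef_near 1 (fun x _ => x ^+ l) (infval l) rg) _.
apply: has_order_natM; first exact: has_order_natX.
apply: (@has_order_near _ (dxy i)); last (apply: has_order0; [exact: (dxy_holo g rg.1)|exact: (dxy_neq0 g rg)]).
by apply: near_all => z; rewrite expr1.
Qed.

Definition form (l : 'I_g) : kDifferential 1 S :=
  hdiff es_size es_Z g_gt0 (fun i q hi => let: ex_intro n hn := form_order (ltn_ord l) hi in has_order_meromorphic hn).

Lemma form_holo l : kdiff_holomorphic (form l).
Proof. by move=> i q hi; have [n] := form_order (ltn_ord l) hi; exact: has_order_holomorphic. Qed.

(** The function w/(dx/y)^k, read in the chart centred at the point; by [quotE] any other chart
    gives the same value at finite points. *)
Definition quot k (w : kDifferential k S) q := coef w q (hmap q q) / dxy q (hmap q q) ^+ k.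

Lemma quotE k (w : kDifferential k S) p q : q <> None -> hdom p q ->
  quot w q = coef w p (hmap p q) / dxy p (hmap p q) ^+ k.
Proof.
move=> q0 hp; have hq0 := hdom_center Z es_uniq q.
have rq := hmap_regular es_size q0 hq0; have rp := hmap_regular es_size q0 hp.
have nq := dxy_neq0 g rq; have np := dxy_neq0 g rp.
have E1 := dxy_trans es_size es_Z g_gt0 q0 hq0 hp.
have E2 := @coef_change _ _ _ w q p q hq0 hp.
rewrite /quot E2 -/(trans Z es_uniq es_size q p) /= E1 exprMn.
have T0 : derive1 (trans Z es_uniq es_size q p) (hmap q q) != 0.
  by apply: contra nq => /eqP T0; rewrite E1 T0 mulr0.
rewrite -/(Submission.hmap g p q); set c := coef w p _; set D := dxy p _ ^+ k.
have D0 : D != 0 by rewrite expf_neq0.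
move: T0; rewrite -/(Submission.hmap g q q); set T := (trans _ _ _ _ _)^`()%classic _ => T0.
have Tk0 : T ^+ k != 0 by rewrite expf_neq0.
by move: Tk0; set Tk := T ^+ k => Tk0; field; rewrite D0 Tk0.
Qed.

Section Coordinates.
Variable w : kDifferential 1 S.
Hypothesis w_holo : kdiff_holomorphic w.

Lemma quot_holo p q : q <> None -> hdom p q ->
  holomorphic_at (fun s => coef w p s / dxy p s) (hmap p q).
Proof.
move=> q0 hp; have rp := hmap_regular es_size q0 hp.
apply: holomorphic_atM; first exact: w_holo.
exact: (holomorphic_atV (dxy_neq0 g rp) (dxy_holo g rp.1)).
Qed.

(** Near infinity the coefficient of w is bounded, that of dx/y is -2 s^(2g-2)/[rt], and |s|^2 =
    1/|x|. *)
Lemma quot_growth : exists K R0 : R, forall p, p <> None -> R0 <= cabs (hx p) ->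
  cabs (quot w p) <= K * cabs (hx p) ^+ g.-1.
Proof.
have h0 := hdom_center Z es_uniq None.
pose F s := coef w None s * (rt (None : X) (s ^+ 2)).
have d0 : chDisc None 0 := hmap_disc es_size h0.
have [_ rh] := disc_rt d0.
have cF : ccont F 0.
  apply: holomorphic_at_ccont; apply: holomorphic_atM; first exact: (w_holo h0).
  apply: (@holomorphic_at_comp _ (fun s => s ^+ 2)); first exact: (holomorphic_atX 2 (holomorphic_at_id 0)).
  exact: rh.
have [d dp hd] := cF 1 ltr01; pose r := Num.min d (chR Z es_uniq None); pose r' := Num.min 1 r.
have r0 : 0 < r by rewrite lt_min dp chR_gt0.
have r'0 : 0 < r' by rewrite lt_min ltr01.
exists (cabs (F 0) + 1), (2 * (r' ^+ 2)^-1) => p p0 hp.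
have rp : (r' ^+ 2)^-1 < cabs (hx p).
  apply: lt_le_trans hp; have : 0 < (r' ^+ 2)^-1 by rewrite invr_gt0 exprn_gt0.
  by lra.
have xp : 0 < cabs (hx p) by apply: lt_trans rp; rewrite invr_gt0 exprn_gt0.
have xlt : (cabs (hx p))^-1 < r' ^+ 2.
  by rewrite -[r' ^+ 2]invrK ltf_pV2 ?posrE ?invr_gt0 ?exprn_gt0.
have r'1 : r' ^+ 2 <= r'.
  by rewrite expr2 ler_piMl ?(ltW r'0) // ge_min lexx.
have r'r : r' <= r by rewrite ge_min lexx orbT.
have rd : r <= d /\ r <= chR Z es_uniq (None : X) by rewrite !ge_min !lexx orbT.
have hin : hdom None p.
  rewrite hdom_fin //; split; first by rewrite -cabs_gt0.
  by rewrite cabsV; lra.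
have rg := hmap_regular es_size p0 hin; have [hX _] := hmap_chX es_size p0 hin.
rewrite (quotE w p0 hin) expr1; set s := Submission.hmap g None p in hX rg *.
have s0 : s != 0 by case: rg => _ [].
have s2 : cabs s ^+ 2 = (cabs (hx p))^-1 by rewrite -hX /chX cabsV invrK cabsX.
have sr : cabs s < r'.
  by rewrite -(@ltr_pXn2r _ 2) ?nnegrE ?cabs_ge0 ?(ltW r'0) // s2.
have Fs : cabs (F s) <= cabs (F 0) + 1.
  have := hd s; rewrite add0r => /(_ _) h; have := h ltac:(by lra) => h'.
  by have := cabsD (F s - F 0) (F 0); rewrite subrK; lra.
have -> : coef w None s / dxy None s = F s * (- 2 * s ^+ (2 * g.-1))^-1.
  rewrite /F /Submission.dxy; have [r1 _] := rt_inf_holo rg.1.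
  set rr := rt _ _ in r1 *; set a := s ^+ _; have a0 : a != 0 by rewrite expf_neq0.
  by field; rewrite a0 r1.
rewrite (cabsM (F s) _) cabsV (cabsM (- 2) _) cabsN cabsX exprM s2 exprVn invfM invrK.
have -> : cabs (2 : C) = 2 by exact: cabs_nat.
rewrite mulrA ler_wpM2r ?exprn_ge0 ?cabs_ge0 //.
by rewrite ler_pdivrMr //; have := cabs_ge0 (F 0); lra.
Qed.

Lemma coordinates : exists2 q : {poly C}, (size q <= g)%N &
  forall i p, p <> None -> hdom i p -> coef w i (hmap i p) = q.[hx p] * dxy i (hmap i p).
Proof.
have [K [R0 hK]] := quot_growth.
have [|||q hq hE] := @hyp_function_polynomial _ es g es_uniq es_size (quot w) g.-1 K R0 _ _ _ hK.
- by rewrite prednK.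
- move=> p p0 y0; have hd := hdom_center Z es_uniq p.
  have E : hmap p p = hx p by case: p p0 y0 hd => // u _ y0 _; rewrite /Submission.hmap /chS (negbTE y0).
  apply: (@holomorphic_at_eq _ (fun s => coef w p s / dxy p s)); last by rewrite -E; exact: quot_holo.
  rewrite -E; have nf := hinv_near_dom es_size hd (near_fin p0).
  have nj := hinv_near_dom es_size hd (open_nbhs_nbhs (conj (@hdom_open _ es Z es_uniq p) hd)).
  apply: filterS3 nf nj (hinv_hmap_near es_size hd) => s s0 sj sE.
  by rewrite (quotE w s0 sj) sE expr1.
- move=> p p0 y0; have hd := hdom_center Z es_uniq p.
  apply: (@tcont_near _ _ (fun q => coef w p (hmap p q) / dxy p (hmap p q))).
    apply: filterS2 (near_fin p0) (open_nbhs_nbhs (conj (@hdom_open _ es Z es_uniq p) hd)) => q q0 hq /=.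
    by rewrite (quotE w q0 hq) expr1.
  apply: (@tcont_comp _ _ _ (fun s => coef w p s / dxy p s)).
    by apply/tcontP; exact: (hmap_continuous es_size hd).
  exact: holomorphic_at_ccont (quot_holo p0 hd).
exists q; first by rewrite prednK in hq.
move=> i p p0 hi; rewrite -hE // (quotE w p0 hi) expr1 divfK //.
exact: (dxy_neq0 g (hmap_regular es_size p0 hi)).
Qed.

End Coordinates.

(** By [coordinates] a holomorphic form is q(x) dx/y with deg q < g, so the forms x^l dx/y with l <
    g are a basis and the coordinates are the coefficients of q. *)
Lemma hyp_genus : has_genus S g.
Proof.
exists form; split=> [l|w w_holo]; first exact: form_holo.
have [q hq hE] := coordinates w_holo.
have formE i p l : p <> None -> hdom i p -> coef (form l) i (hmap i p) = hx p ^+ l * dxy i (hmap i p).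
  by move=> p0 hi; rewrite /= (hcoef_fin es_size _ _ _ p0 hi) expr1.
have sumE (c : 'rV[C]_g) i p : p <> None -> hdom i p ->
    \sum_(l < g) c ord0 l * coef (form l) i (hmap i p) = (rVpoly c).[hx p] * dxy i (hmap i p).
  move=> p0 hi; rewrite (horner_coef_wide _ (size_poly _ _ : (size (rVpoly c) <= g)%N)) mulr_suml; apply: eq_bigr => l _.
  by rewrite formE // mulrA coef_rVpoly_ord.
exists (poly_rV q); split.
  move=> i p hi; change (coef w i (hmap i p) = \sum_(l < g) poly_rV q ord0 l * coef (form l) i (hmap i p)).
  have [pN|p0] := pselect (p = None); last first.
    by rewrite (sumE _ _ _ p0 hi) poly_rV_K // (hE _ _ p0 hi).
  subst p; have ei := hdom_marked hi (erefl : marked Z None); subst i.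
  (* At infinity the identity follows from the nearby finite points by continuity. *)
  pose G s := \sum_(l < g) poly_rV q ord0 l * coef (form l) None s.
  have hG : holomorphic_at G (hmap (None : X) (None : X)).
    apply: (@holomorphic_at_sum R 'I_g (index_enum 'I_g) (fun l s => poly_rV q ord0 l * coef (form l) None s)) => l; apply: holomorphic_atM; first exact: holomorphic_at_cst.
    exact: (form_holo l hi).
  apply: (@holomorphic_punctured_eq R (coef w (None : X)) G (hmap (None : X) (None : X)) (w_holo _ _ hi) hG).
  have d0 := hmap_disc es_size hi.
  apply: near_imp (disc_open d0) => s hs s0; have rg : regular None s by split; [|right].
  have [n1 n2 n3] := hdom_hinv es_size rg.
  by have := sumE (poly_rV q) None _ n1 n2; rewrite poly_rV_K // -hE // n3 => /esym.
move=> c Hc; apply: (can_inj rVpolyK); rewrite poly_rV_K //.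
apply/eqP; rewrite -subr_eq0; apply/eqP/horner_eq0_poly => x.
have yE : csqrt f.[x] ^+ 2 = f.[x] by exact: csqrtK.
pose p := pt es x (csqrt f.[x]); have p0 : p <> None := pt_fin yE.
have hd := hdom_center Z es_uniq p; have np := dxy_neq0 g (hmap_regular es_size p0 hd).
apply/eqP; rewrite hornerD hornerN subr_eq0 -(hx_pt yE) -/p; apply/eqP/(mulIf np).
rewrite -(sumE _ _ _ p0 hd) -hE //; exact: (Hc p p hd).
Qed.

End HypGenus.

                                              

(** * Uniqueness of the order, and reversed polynomials *)

Section OrderUniqueness.
Variable R : realType.
Local Notation C := (Cplx R).
Implicit Types (f h : C -> C) (a z : C).

Lemma has_order_le f a (m n : int) : has_order_at f a m -> has_order_at f a n -> n <= m.
Proof.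
move=> [h [h1 h2 h3]] [u [u1 u2 u3]]; rewrite leNgt; apply/negP => mn.
have [l lE] : exists l : nat, n - m = l.+1%:Z.
  have : 0 < n - m by rewrite subr_gt0.
  by case: (n - m) => [[|l]|l] // _; exists l.
have E : h a = u a * (a - a) ^+ l.+1.
  apply: (@holomorphic_punctured_eq _ h (fun z => u z * (z - a) ^+ l.+1)); first exact: h1.
    apply: holomorphic_atM; first exact: u1.
    exact: (holomorphic_atX _ (holomorphic_atB (holomorphic_at_id a) (holomorphic_at_cst a a))).
  apply: filterS2 h3 u3 => z E1 E2 za; have z0 : z - a != 0 by rewrite subr_eq0.
  have zm : (z - a) ^ m != 0 by rewrite expfz_neq0.
  apply: (mulIf zm); rewrite -E1 E2 -mulrA; congr (_ * _).
  by rewrite exprnP -expfzDr // -lE subrK.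
by move: h2; rewrite E subrr exprS mul0r mulr0 eqxx.
Qed.

Lemma has_order_uniq f a (m n : int) : has_order_at f a m -> has_order_at f a n -> m = n.
Proof. by move=> h1 h2; apply/le_anti; rewrite !(@has_order_le f a). Qed.

Definition prev (m : nat) (p : {poly C}) : {poly C} := \sum_(i < m) p`_i *: 'X^(m.-1 - i).

Lemma prevE m (p : {poly C}) x : (size p <= m)%N -> x != 0 ->
  p.[x] = x ^+ m.-1 * (prev m p).[x^-1].
Proof.
move=> pm x0; rewrite (horner_coef_wide _ pm) /prev horner_sum mulr_sumr.
apply: eq_bigr => i _; rewrite hornerZ hornerXn mulrCA; congr (_ * _).
have -> : x ^+ m.-1 = x ^+ i * x ^+ (m.-1 - i).
  by rewrite -exprD subnKC //; have := ltn_ord i; clear; lia.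
by rewrite exprVn mulfK // expf_neq0.
Qed.

Lemma prev0 m (p : {poly C}) : (prev m.+1 p).[0] = p`_m.
Proof.
rewrite /prev horner_sum big_ord_recr /= big1 ?add0r => [|i _].
  by rewrite subnn expr0 hornerZ hornerC mulr1.
rewrite hornerZ hornerXn expr0n subn_eq0 leqNgt ltn_ord /= mulr0 //.
Qed.

End OrderUniqueness.

(** * The k-differential built from a solution of the norm equation *)

Section Construction.
Variables (R : realType) (es : seq (Cplx R)) (g d k n : nat).
Local Notation C := (Cplx R).
Local Notation X := (hyp es).
Local Notation f := (hf es).
Variables (xs : 'I_n -> C) (a : 'I_n -> int) (A B : {poly C}) (lam : C).
Let Z : seq C := es ++ codom xs.
Hypothesis es_uniq : uniq es.
Hypothesis es_size : size es = (2 * g).+1.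
Hypothesis g_gt0 : (0 < g)%N.
Hypothesis xs_inj : injective xs.
Hypothesis xs_es : forall i, xs i \notin es.
Hypothesis a_neq0 : forall i, a i != 0.
Hypothesis a_abs : (\sum_(i < n) absz (a i) = 2 * (g + d))%N.
Hypothesis a_sum : \sum_(i < n) a i = k%:Z * (2%:Z * g%:Z - 2%:Z).
Hypothesis A_size : size A = (g + d).+1.
Hypothesis B_size : (size B <= d)%N.
Hypothesis d_gt0 : (0 < d)%N.
Hypothesis lam_neq0 : lam != 0.
Hypothesis A_neq0 : forall i, A.[xs i] != 0.
Hypothesis eqAB : A ^+ 2 - lam *: \prod_(i < n) ('X - (xs i)%:P) ^+ absz (a i) = B ^+ 2 * f.
Implicit Types (x y z w s : C) (p q : X).
Local Notation hdom := (hdom Z es_uniq).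
Local Notation hmap := (hmap g).
Local Notation regular := (regular Z es_uniq).
Local Notation chDisc := (chDisc Z es_uniq).
Local Notation dxy := (@dxy R es g).
Local Notation hcoef := (@hcoef R es g).
Local Notation S := (hsurf Z es_uniq es_size g_gt0).

Lemma es_Z : {subset es <= Z}. Proof. by move=> x h; rewrite mem_cat h. Qed.
Lemma xs_Z i : xs i \in Z. Proof. by rewrite mem_cat codom_f orbT. Qed.

(** [nF] and [nFi] are conjugate under y -> -y, and their product is the norm given by [eqAB]. *)
Definition nF x y := A.[x] + B.[x] * y.
Definition nFi x y := A.[x] - B.[x] * y.
Definition rootP (D : pred 'I_n) x := \prod_(i < n | D i) (x - xs i) ^+ absz (a i).
Definition neg : pred 'I_n := fun i => a i < 0.
Definition pos : pred 'I_n := fun i => ~~ (a i < 0).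
                                                                                                     
(** The function (A + By) / prod over a_i < 0 of (x - x_i)^|a_i|. The second expression, equal to
    the first by the norm relation, is taken where [nF] vanishes: it gives the correct value where
    the first would be 0/0. *)
Definition Phi x y :=
  if nF x y != 0 then nF x y / rootP neg x else lam * rootP pos x / nFi x y.

Lemma nFFi x y : y ^+ 2 = f.[x] -> nF x y * nFi x y = lam * (rootP neg x * rootP pos x).
Proof.
move=> yE; have -> : nF x y * nFi x y = A.[x] ^+ 2 - B.[x] ^+ 2 * f.[x] by rewrite /nF /nFi -yE; ring.
have := congr1 (fun p : {poly C} => p.[x]) eqAB => /=.
rewrite hornerD hornerN hornerZ horner_exp [(B ^+ 2 * f).[x]]hornerM !horner_exp horner_prod => <-.
rewrite opprB addrC subrK; congr (_ * _); rewrite (bigID neg) /=.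
by congr (_ * _); apply: eq_bigr => i _; rewrite horner_exp hornerXsubC.
Qed.

Lemma rootP_neq0 (D : pred 'I_n) x : (forall i, D i -> x != xs i) -> rootP D x != 0.
Proof. by move=> H; apply/prodf_neq0 => i /H h; rewrite expf_neq0 // subr_eq0. Qed.

Lemma rootP_rem (D : pred 'I_n) l x : D l ->
  rootP D x = (x - xs l) ^+ absz (a l) * rootP (fun i => D i && (i != l)) x.
Proof. by move=> Dl; rewrite /rootP (bigD1 l). Qed.

Lemma rem_neq0 (D : pred 'I_n) l : rootP (fun i => D i && (i != l)) (xs l) != 0.
Proof. by apply: rootP_neq0 => i /andP[_]; rewrite (inj_eq xs_inj) eq_sym. Qed.

Lemma rootP_holo (D : pred 'I_n) (h : C -> C) s : holomorphic_at h s -> holomorphic_at (fun w => rootP D (h w)) s.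
Proof.
move=> Hh; apply: (@holomorphic_at_eq _ (fun w => \prod_(i <- index_enum 'I_n) (if D i then (h w - xs i) ^+ absz (a i) else 1))).
  by apply: near_all => w; rewrite -big_mkcond.
apply: (@holomorphic_at_prod _ _ _ (fun i w => if D i then (h w - xs i) ^+ absz (a i) else 1)) => i.
case: (D i); last exact: holomorphic_at_cst.
apply: (holomorphic_atX _ (holomorphic_atB Hh (holomorphic_at_cst (xs i) s))).
Qed.

Lemma horner_holo (p : {poly C}) (h : C -> C) s : holomorphic_at h s -> holomorphic_at (fun w => p.[h w]) s.
Proof. by move=> Hh; apply: (holomorphic_at_comp Hh); exact: holomorphic_at_horner. Qed.

Lemma nF_holo p s : regular p s -> holomorphic_at (fun w => nF (chX p w) (chY g p w)) s /\
  holomorphic_at (fun w => nFi (chX p w) (chY g p w)) s.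
Proof.
move=> rg; have hX := chX_holo rg.2; have hY := chY_holo g rg.
have hB := holomorphic_atM (horner_holo B hX) hY.
by split; [exact: (holomorphic_atD (horner_holo A hX) hB)|exact: (holomorphic_atB (horner_holo A hX) hB)].
Qed.

Lemma has_order_unitM (h u : C -> C) s (m : int) : has_order_at h s m -> holomorphic_at u s ->
  u s != 0 -> has_order_at (fun w => h w * u w) s m.
Proof.
move=> [h' [h1 h2 h3]] u1 u2; exists (fun w => h' w * u w); split.
- exact: holomorphic_atM.
- exact: mulf_neq0.
- by apply: near_imp h3 => w ->; rewrite mulrAC.
Qed.

Lemma hcoef_order v i q (m : int) : q <> None -> hdom i q ->
  has_order_at (fun w => Phi (chX i w) (chY g i w)) (hmap i q) m ->
  has_order_at (hcoef k Phi v i) (hmap i q) m.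
Proof.
move=> q0 hi H; have rg := hmap_regular es_size q0 hi.
apply: has_order_near (hcoef_near g k Phi v rg) _.
apply: (has_order_unitM H); first exact: (holomorphic_atX k (dxy_holo g rg.1)).
by rewrite expf_neq0 // (dxy_neq0 g rg).
Qed.

Lemma order_generic i q : q <> None -> hdom i q -> (forall l, hx q != xs l) ->
  has_order_at (fun w => Phi (chX i w) (chY g i w)) (hmap i q) 0%N.
Proof.
move=> q0 hi Hq; have rg := hmap_regular es_size q0 hi; have [hX hY] := hmap_chX es_size q0 hi.
have [hF hFi] := nF_holo rg.
have nD (D : pred 'I_n) : rootP D (hx q) != 0 by apply: rootP_neq0 => l _; exact: Hq.
have F0 : nF (chX i (hmap i q)) (chY g i (hmap i q)) != 0.
  have := nFFi (hyE q0); rewrite hX hY => /eqP; apply: contraTneq => ->.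
  by rewrite mul0r eq_sym !mulf_neq0.
have hN := rootP_holo neg (chX_holo rg.2).
have hV := holomorphic_atV (f := fun w => rootP neg (chX i w)) _ hN.
rewrite hX in hV.
apply: (@has_order_near _ (fun w => nF (chX i w) (chY g i w) * (rootP neg (chX i w))^-1)).
  by apply: near_imp (near_neq0 (holomorphic_at_ccont hF) F0) => w wF; rewrite /Phi wF.
apply: has_order0; first exact: (holomorphic_atM hF (hV (nD neg))).
by rewrite mulf_neq0 ?invr_eq0 // hX nD.
Qed.

Lemma chX_ord p s : p <> None -> hy p != 0 -> chX p s = s.
Proof. by case: p => // u _ y0; rewrite /chX (negbTE y0). Qed.

(** Since A does not vanish at x_l, [nF] and [nFi] are not both 0 above it. Where [nF] is nonzero
    the denominator yields a pole if a_l < 0; where [nF] is 0 the second expression yields a zero if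
    a_l > 0. The other combinations give units. *)
Lemma order_special q l : q <> None -> hx q = xs l ->
  hy q != 0 /\
  has_order_at (fun w => Phi (chX q w) (chY g q w)) (hmap q q)
    (if (a l < 0) == (nF (hx q) (hy q) != 0) then a l else 0%N).
Proof.
move=> q0 qx; have hq0 := hdom_center Z es_uniq q.
have y0 : hy q != 0 by rewrite -sqrf_eq0 hyE // hf_eq0 qx.
split => //; have rg := hmap_regular es_size q0 hq0; have [hX hY] := hmap_chX es_size q0 hq0.
have XE := chX_ord _ q0 y0.
have s0E : hmap q q = xs l by rewrite -qx -hX XE.
have [hF hFi] := nF_holo rg; have hId := holomorphic_at_id (hmap q q).
have hr (D : pred 'I_n) l' := rootP_holo (fun i => D i && (i != l')) hId.
have FFi := nFFi (hyE q0).
have absN : a l < 0 -> a l = - (absz (a l))%:Z by move=> /ltz0_abs ->; rewrite opprK.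
have absP : ~~ (a l < 0) -> a l = (absz (a l))%:Z by rewrite -leNgt => /gez0_abs ->.
have a0 : (absz (a l) != 0)%N by rewrite absz_eq0 a_neq0.
have F2 : nF (hx q) (hy q) + nFi (hx q) (hy q) = A.[xs l] + A.[xs l].
  by rewrite /nF /nFi qx; ring.
have FFi0 : nF (hx q) (hy q) * nFi (hx q) (hy q) = 0.
  rewrite FFi -(mulr0 lam); congr (_ * _); have [al|al] := boolP (neg l).
    by rewrite (rootP_rem _ al) qx subrr expr0n (negbTE a0) !mul0r.
  by rewrite (rootP_rem (D := pos) _ al) qx subrr expr0n (negbTE a0) !mul0r mulr0.
have [Fq|Fq] := eqVneq (nF (hx q) (hy q)) 0; last first.
  have E : \forall w \near hmap q q, nF w (chY g q w) / rootP neg w = Phi (chX q w) (chY g q w).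
    rewrite -[in hmap q q]/(hmap q q); have c := near_neq0 (holomorphic_at_ccont hF).
    rewrite hX hY in c; apply: near_imp (c Fq) => w; rewrite /Phi XE => -> //.
  apply: has_order_near E _.
  have hF' : holomorphic_at (fun w => nF w (chY g q w)) (hmap q q).
    by apply: holomorphic_at_eq hF; apply: near_all => w; rewrite XE.
  have Fs : nF (hmap q q) (chY g q (hmap q q)) != 0 by rewrite hY s0E -qx.
  rewrite eqb_id; case: ifPn => al.
    have hV := holomorphic_atV (f := fun w => rootP (fun i => neg i && (i != l)) w) _ (hr neg l).
    rewrite s0E in hV; have {}hV := hV (rem_neq0 neg l); rewrite -s0E in hV.
    exists (fun w => nF w (chY g q w) * (rootP (fun i => neg i && (i != l)) w)^-1); split.
    - exact: (holomorphic_atM hF' hV).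
    - by rewrite mulf_neq0 ?invr_eq0 // s0E rem_neq0.
    - apply: near_all => w; rewrite (rootP_rem (D := neg) w al) invfM s0E [in RHS](absN al).
      by rewrite -invr_expz -exprnP mulrA mulrAC.
  have nl : rootP neg (hmap q q) != 0.
    rewrite s0E; apply: rootP_neq0 => i hi; rewrite (inj_eq xs_inj).
    by apply: contraNneq al => ->.
  apply: has_order0; first exact: (holomorphic_atM hF' (holomorphic_atV nl (rootP_holo neg hId))).
  by rewrite mulf_neq0 ?invr_eq0.
have Fiq : nFi (hx q) (hy q) != 0.
  by move: F2; rewrite Fq add0r => ->; rewrite -mulr2n mulrn_eq0 negb_or A_neq0.
have hFi' : holomorphic_at (fun w => nFi w (chY g q w)) (hmap q q).
  by apply: holomorphic_at_eq hFi; apply: near_all => w; rewrite XE.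
have Fis : nFi (hmap q q) (chY g q (hmap q q)) != 0 by rewrite hY s0E -qx.
(* Where [nF] is nonzero, x differs from all the x_i, and the norm relation turns the first
   expression into the second. *)
have E : \forall w \near hmap q q, lam * rootP pos w / nFi w (chY g q w) = Phi (chX q w) (chY g q w).
  have c := near_neq0 (holomorphic_at_ccont hFi') Fis.
  apply: filterS3 c (regular_open rg) (near_avoid (hmap q q) (codom xs)) => w cw rw av.
  rewrite /Phi XE; case: ifPn => // Fw.
  have [k1 _ _] := chart_param es_size rw; have := nFFi k1; rewrite XE => FE.
  have wx i : w != xs i.
    apply: contraNneq Fw => wi; have := av _; rewrite {1}wi codom_f => /(_ isT) ws.
    by rewrite ws hY s0E -qx Fq.
  have nN : rootP neg w != 0 by apply: rootP_neq0.
  apply: (mulIf cw); rewrite divfK // mulrAC FE.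
  by rewrite [rootP neg w * _]mulrC mulrA mulfK.
apply: has_order_near E _.
rewrite /= eqbF_neg.
have hVi := @holomorphic_atV R (fun w => nFi w (chY g q w)) (hmap q q) Fis hFi'.
case: ifPn => al.
  exists (fun w => lam * rootP (fun i => pos i && (i != l)) w * (nFi w (chY g q w))^-1); split.
  - exact: (holomorphic_atM (holomorphic_atM (holomorphic_at_cst lam _) (hr pos l)) hVi).
  - by rewrite mulf_neq0 ?invr_eq0 // mulf_neq0 // s0E rem_neq0.
  - apply: near_all => w; rewrite (rootP_rem (D := pos) w al) s0E [in RHS](absP al) -exprnP.
    by rewrite mulrCA -!mulrA mulrC -!mulrA.
have nl : rootP pos (hmap q q) != 0.
  rewrite s0E; apply: rootP_neq0 => i hi; rewrite (inj_eq xs_inj).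
  by apply: contraNneq al => ->.
apply: has_order0.
  exact: (holomorphic_atM (holomorphic_atM (holomorphic_at_cst lam _) (rootP_holo pos hId)) hVi).
by rewrite mulf_neq0 ?invr_eq0 // mulf_neq0.
Qed.

(** The sign of y makes [nF] equal to 2A, hence nonzero, for a pole, and 0 for a zero. *)
Definition pl l : X :=
  pt es (xs l) (if a l < 0 then A.[xs l] / B.[xs l] else - (A.[xs l] / B.[xs l])).

Let N : nat := (\sum_(i < n | neg i) absz (a i))%N.

(** At infinity A + By has a pole of order 2(g+d), the denominator one of order 2N, and (dx/y)^k a
    zero of order k(2g-2): these cancel. *)
Lemma infinity_balance : (2 * (g + d) = 2 * N + 2 * g.-1 * k)%N.
Proof.
have absE (D : pred 'I_n) (c : int) : (forall i, D i -> a i = c * (absz (a i))%:Z) ->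
    \sum_(i < n | D i) a i = c * (\sum_(i < n | D i) absz (a i))%N%:Z.
  move=> H; rewrite -[(\sum_(i < n | D i) _)%N%:Z]natz natr_sum mulr_sumr.
  by apply: eq_bigr => i Di; rewrite natz; exact: H.
have E1 := a_abs; rewrite (bigID neg) /= -/N in E1.
have E2 := a_sum; rewrite (bigID neg) /= (absE neg (-1)) in E2; last first.
  by move=> i h; rewrite mulN1r (ltz0_abs h) opprK.
rewrite (absE (fun i => ~~ neg i) 1) -/N in E2; last first.
  by move=> i h; rewrite mul1r gez0_abs // leNgt.
move: E1 E2; set P := (\sum_(i < n | ~~ neg i) _)%N; clearbody P N; clear -g_gt0.
by case: g g_gt0 => // g' _ /=; nia.
Qed.

Let revn : {poly C} := \prod_(i < n | neg i) (1 - xs i *: 'X) ^+ absz (a i).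

Lemma rootP_inf s : s != 0 -> rootP neg (s ^+ 2)^-1 = (s ^+ (2 * N))^-1 * revn.[s ^+ 2].
Proof.
move=> s0; have s2 : s ^+ 2 != 0 by rewrite expf_neq0.
rewrite /revn horner_prod [s ^+ (2 * N)]exprM; move: s2; set e := s ^+ 2 => e0.
rewrite -[(e ^+ N)^-1]exprVn -prodrXr.
transitivity (\prod_(i < n | neg i) (e^-1 ^+ absz (a i) * ((1 - xs i *: 'X) ^+ absz (a i)).[e])).
  apply: eq_bigr => i _; rewrite horner_exp -exprMn; congr (_ ^+ _).
  rewrite hornerD hornerN hornerZ hornerX hornerC.
  by rewrite mulrBr mulr1 mulrCA (mulVf e0) mulr1.
by rewrite big_split.
Qed.

Let H s := (prev (g + d).+1 A).[s ^+ 2] + s * (prev d B).[s ^+ 2] * rt (None : X) (s ^+ 2).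

(** The term By has a pole of order at most 2g+2d-1, less than the order 2(g+d) of A; this is the
    factor s in [H], whose value at 0 is the leading coefficient of A. *)
Lemma nF_inf s : s != 0 -> nF (chX (None : X) s) (chY g (None : X) s) = (s ^+ (2 * (g + d)))^-1 * H s.
Proof.
move=> s0; rewrite /nF /chX /chY.
have x0 : (s ^+ 2)^-1 != 0 by rewrite invr_eq0 expf_neq0.
rewrite (prevE (m := (g + d).+1)) ?A_size // (prevE B_size x0) invrK -[(g + d).+1.-1]/(g + d)%N !exprVn -!exprM /H.
set pA := _.[_]; set pB := _.[_]; set r := rt _ _.
have -> : s ^+ (2 * (g + d)) = s ^+ (2 * d.-1) * s ^+ (2 * g).+1 * s.
  by rewrite -!exprD -exprSr; congr (_ ^+ _); clear -d_gt0; lia.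
have u0 : s ^+ (2 * d.-1) != 0 by rewrite expf_neq0.
have w0 : s ^+ (2 * g).+1 != 0 by rewrite expf_neq0.
move: u0 w0; set u := s ^+ (2 * d.-1); set w := s ^+ (2 * g).+1 => u0 w0.
by field; rewrite u0 w0 s0.
Qed.

Lemma order_infinity : exists v, has_order_at (hcoef k Phi v (None : X)) 0 0%N.
Proof.
have d0 : chDisc None 0 by rewrite /Submission.chDisc expr0n cabs0 chR_gt0.
have [rt0 rth] := disc_rt d0; have [_ rtv] := rt_inf_holo d0.
have sq : holomorphic_at (fun s : C => s ^+ 2) 0 := holomorphic_atX 2 (holomorphic_at_id 0).
have hr : holomorphic_at (fun s => rt (None : X) (s ^+ 2)) 0 := holomorphic_at_comp sq rth.
have hH : holomorphic_at H 0.
  exact: (holomorphic_atD (horner_holo _ sq)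
    (holomorphic_atM (holomorphic_atM (holomorphic_at_id 0) (horner_holo _ sq)) hr)).
have E0 : (0 : C) ^+ 2 = 0 by rewrite expr0n.
have H0 : H 0 != 0.
  rewrite /H E0 prev0 mul0r mul0r addr0; have := lead_coef_eq0 A.
  by rewrite lead_coefE A_size /= => ->; rewrite -size_poly_eq0 A_size.
have hn : holomorphic_at (fun s => revn.[s ^+ 2]) 0 := horner_holo _ sq.
have n0 : revn.[0 ^+ 2] != 0.
  rewrite E0 /revn horner_prod big1 ?oner_neq0 // => i _.
  by rewrite horner_exp hornerD hornerN hornerZ hornerX hornerC mulr0 subr0 expr1n.
pose W s := H s * (revn.[s ^+ 2])^-1 * (- 2 * (rt (None : X) (s ^+ 2))^-1) ^+ k.
have hW : holomorphic_at W 0.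
  have hv := @holomorphic_atV R (fun s => revn.[s ^+ 2]) 0 n0 hn.
  exact: (holomorphic_atM (holomorphic_atM hH hv) (holomorphic_atX k (holomorphic_atM (holomorphic_at_cst (- 2) 0) rtv))).
have W0 : W 0 != 0.
  rewrite /W mulf_neq0 //; first by rewrite mulf_neq0 ?invr_eq0.
  by rewrite expf_neq0 // mulf_neq0 ?oppr_eq0 ?pnatr_eq0 // invr_eq0.
exists (W 0); apply: has_order_near (has_order0 hW W0).
have nH := near_neq0 (holomorphic_at_ccont hH) H0.
have nN := near_neq0 (holomorphic_at_ccont hn) n0.
apply: filterS3 nH nN (disc_open d0) => s Hs Ns hs; have [->|s0] := eqVneq s 0.
  by rewrite /Submission.hcoef !eqxx.
have rg : regular None s by split; [|right].
rewrite (hcoef_regular g k Phi (W 0) rg) /Phi nF_inf //.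
have sM : s ^+ (2 * (g + d)) = s ^+ (2 * N) * s ^+ (2 * g.-1 * k) by rewrite -exprD -infinity_balance.
rewrite mulf_neq0 ?invr_eq0 ?expf_neq0 // [rootP _ _]rootP_inf // sM /W /Submission.dxy.
have r0 := (rt_inf_holo rg.1).1; set r := rt _ _ in r0 *; set h := H s; set u := revn.[_] in Ns *.
have -> : (- 2 * s ^+ (2 * g.-1) / r) ^+ k = (- 2 / r) ^+ k * s ^+ (2 * g.-1 * k).
  by rewrite mulrAC exprMn [s ^+ (2 * g.-1 * k)]exprM.
set D := (_ / r) ^+ k.
have a0 : s ^+ (2 * N) != 0 by rewrite expf_neq0.
have b0 : s ^+ (2 * g.-1 * k) != 0 by rewrite expf_neq0.
move: a0 b0; set sa := s ^+ (2 * N); set sb := s ^+ (2 * g.-1 * k) => a0 b0.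
by field; rewrite a0 b0 Ns.
Qed.

Lemma B_neq0 l : B.[xs l] != 0.
Proof.
have := congr1 (fun p : {poly C} => p.[xs l]) eqAB => /=.
rewrite hornerD hornerN hornerZ horner_exp [(B ^+ 2 * f).[_]]hornerM !horner_exp.
rewrite (bigD1 l) //= hornerM horner_exp hornerXsubC subrr expr0n absz_eq0 (negbTE (a_neq0 l)).
rewrite mul0r mulr0 subr0 => E; apply: contraTneq (A_neq0 l) => B0.
by rewrite -sqrf_eq0 E B0 expr0n mul0r eqxx.
Qed.

Lemma plE l : (if a l < 0 then A.[xs l] / B.[xs l] else - (A.[xs l] / B.[xs l])) ^+ 2 = f.[xs l].
Proof.
have := congr1 (fun p : {poly C} => p.[xs l]) eqAB => /=.
rewrite hornerD hornerN hornerZ horner_exp [(B ^+ 2 * f).[_]]hornerM !horner_exp.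
rewrite (bigD1 l) //= hornerM horner_exp hornerXsubC subrr expr0n absz_eq0 (negbTE (a_neq0 l)).
rewrite mul0r mulr0 subr0 => E; have -> b (z : C) : (if b then z else - z) ^+ 2 = z ^+ 2 by case: b; rewrite ?sqrrN.
rewrite expr_div_n E.
by rewrite mulrAC mulfV ?mul1r // expf_neq0 // B_neq0.
Qed.

(** Identifies which of the two points above x_l carries the order a_l in [order_special]. *)
Lemma pl_char q l : q <> None -> hx q = xs l ->
  (a l < 0) == (nF (hx q) (hy q) != 0) <-> q = pl l.
Proof.
move=> q0 qx; have B0 := B_neq0 l; have plx := hx_pt (plE l); have ply := hy_pt (plE l).
split=> [h|->].
  apply: hyp_ext => //; rewrite ?plx ?ply //; first exact: pt_fin (plE l).
  have := nFFi (hyE q0); have [al|al] := boolP (neg l).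
    rewrite (rootP_rem _ al) qx subrr expr0n absz_eq0 (negbTE (a_neq0 l)) !(mul0r, mulr0).
    have al' : a l < 0 by []; rewrite al' in h *; move: h; rewrite qx => /eqP/esym h /eqP.
    rewrite mulf_eq0 (negbTE h) /= /nFi subr_eq0 => /eqP->.
    by rewrite mulrAC mulfV ?mul1r.
  move=> _; have al' : (a l < 0) = false by apply/negbTE.
  rewrite al' in h *; move: h; rewrite eq_sym eqbF_neg negbK qx /nF addr_eq0 => /eqP->.
  by rewrite mulNr opprK mulrAC mulfV ?mul1r.
rewrite plx ply /nF; case: ifP => al.
  by rewrite mulrCA mulfV // mulr1 -mulr2n mulrn_eq0 /= A_neq0.
by rewrite mulrN mulrCA mulfV // mulr1 subrr eqxx.
Qed.

Lemma kdiff_construction : exists xi : kDifferential k S,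
  [/\ (forall i p, p <> None -> hdom i p -> coef xi i (hmap i p) = Phi (hx p) (hy p) * dxy i (hmap i p) ^+ k),
    kdiff_nonzero xi & exists p : 'I_n -> S,
    [/\ injective p, forall l, kdiff_order xi (p l) (a l)
      & forall (q : S) m, kdiff_order xi q m -> m != 0 -> exists l, q = p l]].
Proof.
have [v hv] := order_infinity.
have special i q l : q <> None -> hx q = xs l -> hdom i q -> i = q.
  by move=> q0 qx /hdom_marked -> //; rewrite marked_fin // qx xs_Z.
have generic i q : q <> None -> hdom i q -> (forall l, hx q != xs l) ->
    has_order_at (hcoef k Phi v i) (hmap i q) 0%N.
  by move=> q0 hi h; apply: hcoef_order => //; exact: order_generic.
have cases q : q <> None -> (exists l, hx q = xs l) \/ (forall l, hx q != xs l).
  move=> _; have [[l h]|h] := pselect (exists l, hx q = xs l); [by left; exists l|right => l].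
  by apply/eqP => E; apply: h; exists l.
have atinf i : hdom i None -> has_order_at (hcoef k Phi v i) (hmap i None) 0%N.
  by move=> hi; rewrite -(hdom_marked hi (erefl : marked Z (None : X))).
have mer i q : hdom i q -> meromorphic_at (hcoef k Phi v i) (hmap i q).
  move=> hi; have [qN|q0] := pselect (q = None).
    by subst q; exact: has_order_meromorphic (atinf _ hi).
  have [[l h]|h] := cases q q0; last exact: has_order_meromorphic (generic _ _ q0 hi h).
  rewrite (special _ _ _ q0 h hi); have [_ o] := order_special q0 h.
  exact: has_order_meromorphic (hcoef_order v q0 (hdom_center Z es_uniq q) o).
exists (hdiff es_size es_Z g_gt0 mer); split.
- by move=> i p p0 hi; exact: (hcoef_fin es_size k Phi v p0 hi).
- exists (None : X), (None : X); split; first exact: hdom_center.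
  have [h [_ h0 /near_at E]] := atinf None (hdom_center Z es_uniq None).
  change (hcoef k Phi v None (hmap (None : X) (None : X)) != 0).
  by rewrite E expr0z mulr1.
exists pl; have plx l := hx_pt (plE l); have pl0 l := pt_fin (plE l); split.
- by move=> l l' E; apply: xs_inj; rewrite -(plx l) -/(pl l) E /pl plx.
- move=> l; exists (pl l); first exact: hdom_center.
  have [_ o] := order_special (pl0 l) (plx l).
  have := hcoef_order v (pl0 l) (hdom_center Z es_uniq (pl l)) o.
  by rewrite (proj2 (pl_char (pl0 l) (plx l)) erefl).
move=> q m [i hi om] m0; have [qN|q0] := pselect (q = None).
  subst q; have m00 := has_order_uniq om (atinf _ hi).
  by rewrite m00 eqxx in m0.
have [[l h]|h] := cases q q0; last first.
  have m00 := has_order_uniq om (generic _ _ q0 hi h).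
  by rewrite m00 eqxx in m0.
exists l; apply/(pl_char q0 h).
have ei := special _ _ _ q0 h hi; subst i.
have [_ o] := order_special q0 h.
have E := has_order_uniq om (hcoef_order v q0 (hdom_center Z es_uniq q) o).
by move: E m0; case: ifP => // _ ->; rewrite eqxx.
Qed.

End Construction.

                    

(** * The winding obstruction to continuous m-th roots *)

Section Band.
Variable R : realType.
Local Notation C := (Cplx R).

Lemma real_ivt (h : R -> R) (a b c : R) : a <= b ->
  (forall t e, 0 < e -> nbhs t (fun u => `|h u - h t| < e)) ->
  Num.min (h a) (h b) <= c <= Num.max (h a) (h b) -> exists2 t, a <= t <= b & h t = c.
Proof.
move=> ab hc cc; have [|t] := @IVT R h a b c ab _ cc; last by rewrite in_itv /= => tab <-; exists t.
apply: continuous_subspaceT => t; apply/cvgrPdist_lt => e e0; apply: filterS (hc t e e0) => u.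
by rewrite distrC.
Qed.

Definition functional (L : C -> R) := forall z w, `|L z - L w| <= cabs (z - w).

Lemma functional_Re : functional (@cRe R).
Proof. by move=> z w; rewrite -cReN -cReD cRe_le. Qed.
Lemma functional_Im : functional (@cIm R).
Proof. by move=> z w; rewrite -cImN -cImD cIm_le. Qed.

Lemma functional_ivt (L : C -> R) (w : R -> C) (a b c : R) : functional L ->
  (forall t, tcont w t) -> a <= b ->
  Num.min (L (w a)) (L (w b)) <= c <= Num.max (L (w a)) (L (w b)) ->
  exists2 t, a <= t <= b & L (w t) = c.
Proof.
move=> fL wc ab; apply: real_ivt => // t e e0; apply: filterS (wc t e e0) => u.
exact: le_lt_trans (fL _ _).
Qed.

(** Otherwise L would take, along the path, the infinitely many intermediate values [c j], producing
    more than m roots of unity of order dividing m. *)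
Lemma finite_functional (L : C -> R) (w : R -> C) (a b : R) m : functional L -> (0 < m)%N ->
  (forall t, tcont w t) -> a <= b -> (forall t, w t ^+ m = 1) -> L (w a) = L (w b).
Proof.
move=> fL m0 wc ab wm; apply/eqP/contraT => ne; set al := L (w a) in ne *; set be := L (w b) in ne *.
pose c (j : nat) : R := al + (be - al) / j.+1%:R.
have step j : exists t, L (w t) = c j.
  have [|t _ <-] := @functional_ivt L w a b (c j) fL wc ab; last by exists t.
  rewrite -/al -/be /c; have j0 : 0 < j.+1%:R :> R by rewrite ltr0n.
  have j1 : 1 <= j.+1%:R :> R by rewrite ler1n.
  have q0 : 0 < (j.+1%:R)^-1 :> R by rewrite invr_gt0.
  have q1 : (j.+1%:R)^-1 <= 1 :> R by rewrite invf_le1.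
  move: q0 q1; set q := (j.+1%:R)^-1 => q0 q1.
  by rewrite ge_min le_max; have [le|le] := leP al be; apply/andP; split; apply/orP; [left|right|right|left]; nra.
have [T HT] := boolp.choice step.
suff /eqP : ('X^m - 1%:P : {poly C}) = 0 by rewrite -size_poly_eq0 size_XnsubC.
apply: (roots_geq_poly_eq0 (rs := [seq w (T j) | j <- iota 0 m.+1])).
- by apply/allP => z /mapP[j _ ->]; rewrite rootE !hornerE wm subrr.
- rewrite map_inj_uniq ?iota_uniq // => i j E.
  have : c i = c j by rewrite -!HT E.
  move=> /addrI /mulfI; rewrite subr_eq0 eq_sym => /(_ ne) /invr_inj /eqP.
  by rewrite eqr_nat => /eqP[].
- by rewrite size_map size_iota size_XnsubC.
Qed.

Lemma finite_const (w : R -> C) (a b : R) m : (0 < m)%N ->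
  (forall t, tcont w t) -> a <= b -> (forall t, w t ^+ m = 1) -> w a = w b.
Proof.
move=> m0 wc ab wm; apply: complex_eq.
  exact: (finite_functional functional_Re m0 wc ab wm).
exact: (finite_functional functional_Im m0 wc ab wm).
Qed.

(** The principal root [m.-root] of -1 is neither nonnegative nor negative. *)
Lemma root_neg1 m : (1 < m)%N -> exists2 z : C, z ^+ m = -1 & cIm z != 0.
Proof.
move=> m1; have m0 := ltnW m1; pose z : R[i] := m.-root (-1); exists z; first exact: rootCK.
apply/negP => /eqP z0; have zE : z = cofr (cRe z) by apply: complex_eq => //; rewrite z0.
have [h|h] := leP 0 (cRe z).
  have : (0 : R[i]) <= z by rewrite zE -(cofr0 R) cofr_le.
  by rewrite rootC_ge0 // oppr_ge0 lt_geF // ltr01.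
have : z < 0 by rewrite zE -(cofr0 R) cofr_lt.
by rewrite rootC_lt0.
Qed.

Lemma ccont_unit (z : C) : z != 0 -> ccont (fun z => z / cofr (cabs z)) z.
Proof.
move=> z0; have za : cofr (cabs z) != 0 by rewrite -cabs_eq0 cabs_cofr normr_eq0 cabs_eq0.
apply/ccontP/tcontP.
have c1 : tcont (fun z : C => cofr (cabs z)) z.
  move=> e e0; apply/nbhsCP; exists e => // w hw; rewrite -cofrB cabs_cofr.
  have := cabsDl w (- z); have := cabsDl z (- w); rewrite !cabsN (cabsB z w) => h1 h2.
  by rewrite ltr_norml; apply/andP; split; lra.
have c0 : tcont (fun z : C => z) z by move=> e e0; apply/nbhsCP; exists e.
apply: tcontM => //; apply: (@tcont_comp _ _ _ (fun w => w^-1)) => //.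
by apply: holomorphic_at_ccont; exact: holomorphic_at_inv.
Qed.

                                                                                         
                                                                                     
                                                                     
(** The closed path that follows (al + i be)/nu and returns along (al - i be)/nu winds once around
    0, so it has no continuous m-th root. The argument uses only intermediate values: v v' has
    constant direction, which makes v b / v a real; its m-th power is negative, so it is a negative
    real; then v, turned by a root of -1, must cross the real line in the interior. *)
Lemma band_contradiction (v v' : R -> C) (a b : R) (al be nu : R -> R) m : (1 < m)%N -> a <= b ->
  (forall t, tcont v t) -> (forall t, tcont v' t) -> v a = v' a -> v b = v' b ->
  (forall t, v t ^+ m = (cofr (al t) + cI * cofr (be t)) / cofr (nu t)) ->
  (forall t, v' t ^+ m = (cofr (al t) - cI * cofr (be t)) / cofr (nu t)) ->
  (forall t, 0 < nu a * nu t) -> al a * al b < 0 -> be a = 0 -> be b = 0 ->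
  (forall t, a < t < b -> be t != 0) -> (forall t, 0 < al t ^+ 2 + be t ^+ 2) -> False.
Proof.
move=> m1 ab vc vc' va vb vE vE' nu0 alab bea beb bei abpos; have m0 := ltnW m1.
have nun t : nu t != 0 by apply: contraTneq (nu0 t) => ->; rewrite mulr0 ltxx.
pose rho t := (al t ^+ 2 + be t ^+ 2) / nu t ^+ 2.
have sqp (y : R) : y != 0 -> 0 < y ^+ 2 by move=> y0; rewrite exprn_even_gt0.
have rho0 t : 0 < rho t by rewrite divr_gt0 // sqp.
have cI2 : (cI : C) * cI = -1 by apply: complex_eq; rewrite ?cReM ?cImM ?cReN ?cImN /=; ring.
pose x t := v t * v' t.
have xE t : x t ^+ m = cofr (rho t).
  rewrite /x exprMn vE vE' /rho cofrM cofrV cofrD !cofrX.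
  have n0 : cofr (nu t) != 0 by rewrite -cabs_eq0 cabs_cofr normr_eq0.
  move: n0; set p := cofr (al t); set q := cofr (be t); set n := cofr (nu t) => n0.
  rewrite mulrACA -invfM -!expr2; congr (_ / _).
  have -> : p ^+ 2 + q ^+ 2 = p ^+ 2 - (cI * cI) * q ^+ 2 by rewrite cI2 mulN1r opprK.
  by ring.
have x0 t : x t != 0.
  apply: contraTneq (rho0 t) => xt; have := xE t; rewrite xt expr0n gtn_eqF // => E.
  by rewrite (cofr_inj (esym E : cofr (rho t) = cofr 0)) ltxx.
(* Since x^m is a positive real, the direction of x is an m-th root of unity, hence constant along
   the path. *)
pose w t := x t / cofr (cabs (x t)).
have ax t : cofr (cabs (x t)) != 0 by rewrite -cabs_eq0 cabs_cofr normr_eq0 cabs_eq0.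
have wm t : w t ^+ m = 1.
  rewrite /w expr_div_n -cofrX -[cabs _ ^+ m]cabsX xE cabs_cofr gtr0_norm //.
  by rewrite mulfV // -cabs_eq0 cabs_cofr normr_eq0 gt_eqF.
have wc t : tcont w t.
  apply: (@tcont_comp _ _ x (fun z => z / cofr (cabs z))); first exact: tcontM.
  exact: ccont_unit.
have wab := finite_const m0 wc ab wm.
have v0 t : v t != 0 by have := x0 t; rewrite /x mulf_eq0 negb_or => /andP[].
pose r := v b / v a.
have r2 : r ^+ 2 = cofr (cabs (x b) / cabs (x a)).
  have E : x b / x a = cofr (cabs (x b)) / cofr (cabs (x a)).
    apply: (mulIf (x0 a)); rewrite divfK //; apply: (mulIf (invr_neq0 (ax b))).
    rewrite -/(w b) -wab /w; have axb := ax b; have axa := ax a.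
    by move: axb axa; set p := cofr _; set q := cofr _ => p0 q0; field; rewrite p0 q0.
  rewrite cofrM cofrV -E /r /x -va -vb expr_div_n expr2 expr2 //.
have cpos : 0 < cabs (x b) / cabs (x a) by rewrite divr_gt0 // cabs_gt0.
pose s := Num.sqrt (cabs (x b) / cabs (x a)).
have s0 : 0 < s by rewrite sqrtr_gt0.
have rs : r = cofr s \/ r = - cofr s.
  have : r ^+ 2 = cofr s ^+ 2 by rewrite r2 -cofrX sqr_sqrtr // ltW.
  by move/eqP; rewrite eqf_sqr => /orP[] /eqP; [left|right].
have alan : al a != 0 by apply: contraTneq alab => ->; rewrite mul0r ltxx.
have um t : (v t / v a) ^+ m = cofr (nu a / (nu t * al a)) * (cofr (al t) + cI * cofr (be t)).
  rewrite expr_div_n !vE bea cofr0 mulr0 addr0 cofrM cofrV (cofrM (nu t)).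
  have n0 : cofr (nu t) != 0 by rewrite -cabs_eq0 cabs_cofr normr_eq0.
  have n1 : cofr (nu a) != 0 by rewrite -cabs_eq0 cabs_cofr normr_eq0.
  have n2 : cofr (al a) != 0 by rewrite -cabs_eq0 cabs_cofr normr_eq0.
  move: n0 n1 n2; set A := cofr (nu t); set B := cofr (nu a); set D := cofr (al a).
  by move=> n0 n1 n2; set N := _ + _; field; rewrite n0 n1 n2.
have rm : r ^+ m = cofr (nu a / (nu b * al a) * al b).
  by rewrite /r um beb cofr0 mulr0 addr0 -cofrM.
have rneg : nu a / (nu b * al a) * al b < 0.
  have -> : nu a / (nu b * al a) * al b = (nu a * nu b) * (al a * al b) / (nu b ^+ 2 * al a ^+ 2).
    by field; rewrite nun alan.
  have dp : 0 < nu b ^+ 2 * al a ^+ 2 by apply: mulr_gt0; exact: sqp.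
  by rewrite pmulr_llt0 ?invr_gt0 // pmulr_rlt0.
have rs' : r = - cofr s.
  have [E|//] := rs; have sm : 0 < s ^+ m by rewrite exprn_gt0.
  have E2 : s ^+ m = nu a / (nu b * al a) * al b by apply: cofr_inj; rewrite cofrX -E rm.
  by have := lt_trans sm (eq_ind_r (fun y => y < 0) rneg E2); rewrite ltxx.
have [z zm zi] := root_neg1 m1.
(* The imaginary part goes from Im z to -s Im z, so it vanishes at an interior t. There u is real,
   and so is (v t / v a)^m, whose imaginary part is a nonzero multiple of [be t]. *)
pose u t := v t / v a * z.
have uc t : tcont u t.
  apply: (@tcont_comp _ _ v (fun y => y / v a * z)) => //; apply: holomorphic_at_ccont.
  exact: (holomorphic_atM (holomorphic_atM (holomorphic_at_id _) (holomorphic_at_cst _ _)) (holomorphic_at_cst _ _)).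
have ua : cIm (u a) = cIm z by rewrite /u mulfV // mul1r.
have ub : cIm (u b) = - s * cIm z.
  by rewrite /u -/r rs' -cofrN cImM /= mul0r addr0.
have [|t tab ut] := @functional_ivt (@cIm R) u a b 0 functional_Im uc ab.
  by rewrite ua ub ge_min le_max; have [h|h] := leP 0 (cIm z); apply/andP; split; apply/orP; [right|left|left|right]; nra.
have ta : a != t by apply/eqP => E; move: ut; rewrite -E ua; apply/eqP.
have tb : t != b.
  by apply/eqP => E; move: ut; rewrite E ub; apply/eqP/mulf_neq0 => //; rewrite oppr_eq0 gt_eqF.
have tin : a < t < b by rewrite !lt_neqAle ta tb.
have uR : u t = cofr (cRe (u t)) by apply: complex_eq => //; rewrite ut.
have uE : (v t / v a) ^+ m = cofr (- cRe (u t) ^+ m).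
  have : u t ^+ m = - (v t / v a) ^+ m by rewrite /u exprMn zm mulrN1.
  by rewrite {1}uR -cofrX cofrN => ->; rewrite opprK.
have := congr1 (@cIm R) uE; rewrite um /= => /eqP.
rewrite !mul0r !mul1r !addr0 ?add0r ?mulr0 ?addr0.
apply/negP; rewrite mulf_neq0 ?bei //.
by rewrite mulf_neq0 ?invr_eq0 // mulf_neq0.
Qed.

End Band.

(** By the convention 0^-1 = 0 the value at a pole is 0, so a nonzero value excludes poles. *)
Lemma meromorphic_holomorphic (R : realType) (h : Cplx R -> Cplx R) a :
  meromorphic_at h a -> h a != 0 -> holomorphic_at h a.
Proof.
move=> [[n [u [u1 u2 u3]]]|/near_at h0]; last by move=> /eqP[]; exact: h0.
have E : h a = u a * (a - a) ^ n := near_at u3.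
have [n0 _|n0] := eqVneq n 0; last first.
  have z0 : (a - a) ^ n = 0 by rewrite subrr exp0rz (negbTE n0).
  by move=> /eqP[]; rewrite E z0 mulr0.
apply: holomorphic_at_eq u1; apply: near_imp u3 => z ->; rewrite n0 expr0z mulr1.
by [].
Qed.

(** * Primitivity of the constructed differential *)

Section Primitivity.
Variables (R : realType) (es Z : seq (Cplx R)) (g k : nat).
Local Notation C := (Cplx R).
Local Notation X := (hyp es).
Local Notation f := (hf es).
Hypothesis es_uniq : uniq es.
Hypothesis es_size : size es = (2 * g).+1.
Hypothesis es_Z : {subset es <= Z}.
Hypothesis g_gt0 : (0 < g)%N.
Local Notation hdom := (hdom Z es_uniq).
Local Notation hmap := (hmap g).
Local Notation dxy := (@dxy R es g).
Local Notation S := (hsurf Z es_uniq es_size g_gt0).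
Variables (B : {poly C}) (Ar Er : {poly R}) (nu : R -> R) (a b : R) (Phi : C -> C -> C).
Hypothesis k_gt0 : (0 < k)%N.
Hypothesis ab : a < b.
Hypothesis a_es : cofr a \in es.
Hypothesis b_es : cofr b \in es.
Hypothesis BE : forall t, B.[cofr t] ^+ 2 * f.[cofr t] = cofr Er.[t].
Hypothesis E_lt0 : forall t, a < t < b -> Er.[t] < 0.
Hypothesis PhiE : forall t y, a <= t <= b -> y ^+ 2 = f.[cofr t] ->
  Phi (cofr t) y = (cofr Ar.[t] + B.[cofr t] * y) / cofr (nu t).
Hypothesis nu_sign : forall t, a <= t <= b -> 0 < nu a * nu t.
Hypothesis A_sign : Ar.[a] * Ar.[b] < 0.
Variable xi : kDifferential k S.
Hypothesis xiE : forall (i p : X), p <> None -> hdom i p ->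
  coef xi i (hmap i p) = Phi (hx p) (hy p) * dxy i (hmap i p) ^+ k.

(** Clamping to [a, b] makes the paths defined and continuous on the whole line. *)
Let cl t : R := Num.max a (Num.min t b).
Let x_ t : C := cofr (cl t).
Let s_ t : R := Num.sqrt (- Er.[cl t]).
(** A lift of the segment to the curve with By = i s. At the two ends s = 0, so the lifts y and -y
    meet there. *)
Let y_ t : C := cI * cofr (s_ t) / B.[x_ t].

Let cl_in t : a <= cl t <= b.
Proof. by rewrite /cl le_max lexx ge_max (ltW ab) ge_min lexx orbT. Qed.

Let cl_id t : a <= t <= b -> cl t = t.
Proof. by move=> /andP[h1 h2]; rewrite /cl (min_idPl h2) (max_idPr h1). Qed.

Let x_cont t : tcont x_ t.
Proof.
move=> e e0; apply/nbhs_ballP; exists e => // u; rewrite /ball /= distrC => h.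
change (cabs (x_ u - x_ t) < e); rewrite /x_ -cofrB cabs_cofr; apply: le_lt_trans h.
have h1 := ler_norm (u - t); have h2 := ler_norm (t - u); rewrite distrC in h2.
rewrite ler_norml /cl; have abl := ab.
by case: (leP u b) => ?; case: (leP t b) => ?; do 2?[case: (leP a _) => ?]; apply/andP; split; lra.
Qed.

Let fE t : (f.[x_ t] = 0 /\ s_ t = 0) \/ (a < cl t < b /\ f.[x_ t] != 0 /\ B.[x_ t] != 0 /\ 0 < s_ t).
Proof.
have ends e : cofr e \in es -> cl t = e -> f.[x_ t] = 0 /\ s_ t = 0.
  move=> ee te; have f0 : f.[x_ t] = 0 by apply/eqP; rewrite /x_ te hf_eq0.
  split => //; rewrite /s_; have : cofr Er.[cl t] = 0 by rewrite -BE -/(x_ t) f0 mulr0.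
  by move/(@cofr_inj R _ 0) => ->; rewrite oppr0 sqrtr0.
have [ta|ta] := eqVneq (cl t) a; first by left; exact: ends ta.
have [tb|tb] := eqVneq (cl t) b; first by left; exact: ends tb.
right; have tin : a < cl t < b by rewrite !lt_neqAle eq_sym ta tb; exact: cl_in.
have En := E_lt0 tin; have : cofr Er.[cl t] != 0.
  by rewrite -cabs_eq0 cabs_cofr normr_eq0 lt_eqF.
rewrite -BE mulf_eq0 negb_or expf_eq0 /= => /andP[h1 h2]; split => //; split => //; split => //.
by rewrite sqrtr_gt0 oppr_gt0.
Qed.

Let By t : B.[x_ t] * y_ t = cI * cofr (s_ t).
Proof.
by rewrite /y_; case: (fE t) => [[_ ->]|[_ [_ [B0 _]]]]; [rewrite cofr0 mulr0 mul0r mulr0|rewrite mulrCA mulfV // mulr1].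
Qed.

Let cI2 : (cI : C) ^+ 2 = -1.
Proof. by rewrite expr2; apply: complex_eq; rewrite ?cReM ?cImM ?cReN ?cImN /=; ring. Qed.

Let yE t : y_ t ^+ 2 = f.[x_ t].
Proof.
case: (fE t) => [[f0 s0]|[tin [_ [B0 _]]]].
  by rewrite /y_ s0 cofr0 mulr0 mul0r expr0n f0.
have B2 : B.[x_ t] ^+ 2 != 0 by rewrite expf_neq0.
apply: (mulfI B2); rewrite -exprMn By BE exprMn cI2 -cofrX sqr_sqrtr.
  by rewrite cofrN mulN1r opprK.
by rewrite oppr_ge0 ltW // E_lt0.
Qed.

Let yNE t : (- y_ t) ^+ 2 = f.[x_ t]. Proof. by rewrite sqrrN yE. Qed.

Let horner_cont (p : {poly C}) t : tcont (fun t => p.[x_ t]) t.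
Proof.
apply: (@tcont_comp _ _ x_ (fun z => p.[z])); first exact: x_cont.
by apply: holomorphic_at_ccont; exact: holomorphic_at_horner.
Qed.

Let s_cont t : tcont (fun t => cofr (s_ t) : C) t.
Proof.
move=> e e0; have e2 : 0 < e ^+ 2 by rewrite exprn_gt0.
apply: filterS (horner_cont (B ^+ 2 * f) t e2) => u.
change (cabs ((B ^+ 2 * f).[x_ u] - (B ^+ 2 * f).[x_ t]) < e ^+ 2 ->
  cabs (cofr (s_ u) - cofr (s_ t) : C) < e).
rewrite ![(B ^+ 2 * f).[_]]hornerM !horner_exp !BE -!cofrB !cabs_cofr => h.
have En w : 0 <= - Er.[cl w].
  case: (fE w) => [[f0 _]|[tin _]]; last by rewrite oppr_ge0 ltW // E_lt0.
  have : cofr Er.[cl w] = 0 by rewrite -BE -/(x_ w) f0 mulr0.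
  by move/(@cofr_inj R _ 0) => ->; rewrite oppr0.
have [su st] : s_ u ^+ 2 = - Er.[cl u] /\ s_ t ^+ 2 = - Er.[cl t] by rewrite !sqr_sqrtr.
have [su0 st0] : 0 <= s_ u /\ 0 <= s_ t by rewrite !sqrtr_ge0.
have {}h : `|s_ u ^+ 2 - s_ t ^+ 2| < e ^+ 2.
  by rewrite su st opprK [- _ + _]addrC distrC.
(* For nonnegative reals (s - s')^2 <= |s^2 - s'^2|. *)
rewrite -(@ltr_pXn2r _ 2) ?nnegrE ?normr_ge0 ?(ltW e0) //; apply: le_lt_trans h.
rewrite subr_sqr normrM [leLHS]expr2; apply: ler_wpM2l; first exact: normr_ge0.
by rewrite [leRHS]ger0_norm ?addr_ge0 // ler_norml; apply/andP; split; lra.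
Qed.

Let y_cont t : tcont y_ t.
Proof.
case: (fE t) => [[f0 s0]|[_ [_ [B0 _]]]].
  have y0 : y_ t = 0 by rewrite /y_ s0 cofr0 mulr0 mul0r.
  move=> e e0; have e2 : 0 < e ^+ 2 by rewrite exprn_gt0.
  apply: filterS (horner_cont f t e2) => u.
  change (cabs (f.[x_ u] - f.[x_ t]) < e ^+ 2 -> cabs (y_ u - y_ t) < e).
  rewrite y0 f0 !subr0 -yE cabsX ltr_pXn2r ?nnegrE ?cabs_ge0 ?(ltW e0) //.
apply: tcontM.
  apply: tcontM; last exact: s_cont.
  by move=> e e0; apply: filterE => u; rewrite subrr cabs0.
apply: (@tcont_comp _ _ (fun t => B.[x_ t]) (fun z => z^-1)); first exact: horner_cont.
by apply: holomorphic_at_ccont; exact: holomorphic_at_inv.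
Qed.

Let yN_cont t : tcont (fun t => - y_ t) t.
Proof. by move=> e e0; apply: filterS (y_cont t e0) => u; rewrite -opprD cabsN. Qed.

Let path_cont (F : X -> C) (y : R -> C) t : (forall t, y t ^+ 2 = f.[x_ t]) -> tcont y t ->
  tcont F (pt es (x_ t) (y t)) -> tcont (fun u => F (pt es (x_ u) (y u))) t.
Proof.
move=> yy yc Fc e e0; have [d d0 H] := proj1 (nbhs_finP _ (pt_fin (yy t))) (Fc e e0).
apply: filterS2 (x_cont t d0) (yc d d0) => u h1 h2; apply: H; first exact: pt_fin.
  by rewrite !hx_pt.
by rewrite !hy_pt.
Qed.

(** If xi is the m-th power of eta, then eta/(dx/y)^d is an m-th root of Phi, continuous at finite
    points where Phi is nonzero, in particular along both lifts of the segment; [band_contradiction]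
    excludes it. *)
Lemma primitive_of_band : kdiff_primitive xi.
Proof.
move=> d eta dk ddk pw; pose m := (k %/ d)%N.
have d0 : (0 < d)%N by apply: dvdn_gt0 ddk.
have mk : (d * m = k)%N by rewrite mulnC divnK.
have m1 : (1 < m)%N by move: dk mk; clear -d0; clearbody m; nia.
have Gm p : p <> None -> quot eta p ^+ m = Phi (hx p) (hy p).
  move=> p0; have hd := hdom_center Z es_uniq p.
  have n0 := dxy_neq0 g (hmap_regular es_size p0 hd).
  rewrite /quot expr_div_n -exprM mk.
  have := pw p p hd; rewrite -/m => <-; rewrite (xiE p0 hd) mulfK //.
  by rewrite expf_neq0.
have Gc p : p <> None -> Phi (hx p) (hy p) != 0 -> tcont (quot eta) p.
  move=> p0 P0; have hd := hdom_center Z es_uniq p.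
  have rg := hmap_regular es_size p0 hd; have n0 := dxy_neq0 g rg.
  apply: (@tcont_near _ _ (fun q => coef eta p (hmap p q) / dxy p (hmap p q) ^+ d)).
    apply: filterS2 (near_fin p0) (open_nbhs_nbhs (conj (@hdom_open _ es Z es_uniq p) hd)) => q q0 hq /=.
    by rewrite (quotE es_Z eta q0 hq).
  apply: (@tcont_comp _ _ _ (fun s => coef eta p s / dxy p s ^+ d)).
    by apply/tcontP; exact: (hmap_continuous es_size hd).
  apply: holomorphic_at_ccont; apply: holomorphic_atM.
    apply: meromorphic_holomorphic; first exact: (@coef_meromorphic _ _ _ eta p p hd).
    have := Gm p p0; rewrite /quot; apply: contra_eq_neq => ->.
    by rewrite mul0r expr0n gtn_eqF ?(ltnW m1) // eq_sym.
  apply: (@holomorphic_atV _ (fun s => dxy p s ^+ d)); first by rewrite expf_neq0.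
  exact: (holomorphic_atX d (dxy_holo g rg.1)).
have nu0 t : cofr (nu (cl t)) != 0.
  rewrite -cabs_eq0 cabs_cofr normr_eq0; apply: contraTneq (nu_sign (cl_in t)) => ->.
  by rewrite mulr0 ltxx.
have [A0 A1] : Ar.[a] != 0 /\ Ar.[b] != 0.
  by split; apply: contraTneq A_sign => ->; rewrite ?mul0r ?mulr0 ltxx.
have pos t : 0 < Ar.[cl t] ^+ 2 + s_ t ^+ 2.
  have sq (y : R) : 0 <= y ^+ 2 by exact: sqr_ge0.
  have sqp (y : R) : y != 0 -> 0 < y ^+ 2 by move=> y0; rewrite exprn_even_gt0.
  case: (fE t) => [[f0 _]|[_ [_ [_ sp]]]]; last by rewrite ltr_wpDl // sqp // gt_eqF.
  rewrite ltr_wpDr // sqp //; have [->//|ta] := eqVneq (cl t) a.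
  have [->//|tb] := eqVneq (cl t) b.
  have tin : a < cl t < b by rewrite !lt_neqAle eq_sym ta tb; exact: cl_in.
  have := E_lt0 tin; have : cofr Er.[cl t] = 0 by rewrite -BE -/(x_ t) f0 mulr0.
  by move/(@cofr_inj R _ 0) => ->; rewrite ltxx.
have num0 (e : C) t : e = 1 \/ e = -1 -> cofr Ar.[cl t] + e * (cI * cofr (s_ t)) != 0.
  move=> he; apply: contraTneq (pos t) => E; have E1 := congr1 (@cRe R) E; have E2 := congr1 (@cIm R) E.
  case: he E1 E2 => -> E1 E2.
    have h1 : Ar.[cl t] = 0 by move: E1; rewrite mul1r cReD cReM /= => h; lra.
    have h2 : s_ t = 0 by move: E2; rewrite mul1r cImD cImM /= => h; lra.
    by rewrite h1 h2 expr0n addr0 ltxx.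
  have h1 : Ar.[cl t] = 0 by move: E1; rewrite mulN1r cReD cReN cReM /= => h; lra.
  have h2 : s_ t = 0 by move: E2; rewrite mulN1r cImD cImN cImM /= => h; lra.
  by rewrite h1 h2 expr0n addr0 ltxx.
have P1 t : Phi (x_ t) (y_ t) = (cofr Ar.[cl t] + cI * cofr (s_ t)) / cofr (nu (cl t)).
  by rewrite (PhiE (cl_in t) (yE t)) By.
have P2 t : Phi (x_ t) (- y_ t) = (cofr Ar.[cl t] - cI * cofr (s_ t)) / cofr (nu (cl t)).
  by rewrite (PhiE (cl_in t) (yNE t)) mulrN By.
have aa : cl a = a by rewrite cl_id // lexx ltW.
have bb : cl b = b by rewrite cl_id // lexx ltW.
have sab t : cl t = a \/ cl t = b -> s_ t = 0.
  move=> h; case: (fE t) => [[]//|[/andP[h1 h2] _]].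
  by case: h => h; [rewrite h ltxx in h1|rewrite h ltxx in h2].
have ya t : s_ t = 0 -> y_ t = 0 by move=> h; rewrite /y_ h cofr0 mulr0 mul0r.
have sa := sab a (or_introl aa); have sb := sab b (or_intror bb).
pose v t := quot eta (pt es (x_ t) (y_ t)); pose v' t := quot eta (pt es (x_ t) (- y_ t)).
apply: (@band_contradiction R v v' a b (fun t => Ar.[cl t]) s_ (fun t => nu (cl t)) m m1 (ltW ab)).
- move=> t; apply: (@path_cont (quot eta) y_ t yE); first exact: y_cont.
  apply: Gc; first exact: pt_fin (yE t).
  rewrite (hx_pt (yE t)) (hy_pt (yE t)) P1 mulf_neq0 ?invr_eq0 //.
  by have := num0 1 t (or_introl erefl); rewrite mul1r.
- move=> t; apply: (@path_cont (quot eta) (fun t => - y_ t) t yNE); first exact: yN_cont.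
  apply: Gc; first exact: pt_fin (yNE t).
  rewrite (hx_pt (yNE t)) (hy_pt (yNE t)) P2 mulf_neq0 ?invr_eq0 //.
  by have := num0 (-1) t (or_intror erefl); rewrite mulN1r.
- by rewrite /v /v' ya // oppr0.
- by rewrite /v /v' ya // oppr0.
- by move=> t; rewrite /v Gm ?(hx_pt (yE t)) ?(hy_pt (yE t)) ?P1 //; exact: pt_fin (yE t).
- by move=> t; rewrite /v' Gm ?(hx_pt (yNE t)) ?(hy_pt (yNE t)) ?P2 //; exact: pt_fin (yNE t).
- by move=> t; rewrite aa nu_sign.
- by rewrite aa bb.
- exact: sa.
- exact: sb.
- move=> t tin; have ct : cl t = t by rewrite cl_id //; case/andP: tin => h1 h2; rewrite !ltW.
  case: (fE t) => [[f0 _]|[_ [_ [_ sp]]]]; last by rewrite gt_eqF.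
  have := E_lt0 tin; have : cofr Er.[cl t] = 0 by rewrite -BE -/(x_ t) f0 mulr0.
  by rewrite ct => /(@cofr_inj R _ 0) ->; rewrite ltxx.
- exact: pos.
Qed.

End Primitivity.

                              

(** * Uniqueness for linear differential equations, and factorisation at a zero *)

Section LocalTools.
Variable R : realType.
Local Notation C := (Cplx R).
Implicit Types (F G : C -> C) (a z w p v : C).

(** After n bisections of the segment the quadratic errors add up to K |v|^2 2^-n. *)
Lemma mean_value_bound F a (d K S0 : R) :
  (forall w, cabs (w - a) < d -> forall h, cabs (w + h - a) < d ->
     cabs (F (w + h) - F w - h * derive1 F w) <= K * cabs h ^+ 2) ->
  (forall w, cabs (w - a) < d -> cabs (derive1 F w) <= S0) ->
  forall p v, cabs (p - a) < d -> cabs (p + v - a) < d -> cabs (F (p + v) - F p) <= cabs v * S0.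
Proof.
move=> HK HS.
have step n : forall p v, cabs (p - a) < d -> cabs (p + v - a) < d ->
    cabs (F (p + v) - F p) <= cabs v * S0 + K * cabs v ^+ 2 * (2^-1) ^+ n.
  elim: n => [|n IH] p v hp hv.
    rewrite expr0 mulr1.
    have -> : F (p + v) - F p = v * derive1 F p + (F (p + v) - F p - v * derive1 F p) by ring.
    apply: le_trans (cabsD _ _) _; apply: lerD; last exact: HK.
    by rewrite (cabsM v _); apply: ler_wpM2l; [exact: cabs_ge0|exact: HS].
  have two : cabs (2 : C) = 2 by exact: cabs_nat.
  pose u := v / 2; have uE : cabs u = cabs v / 2 by rewrite /u (cabsM v _) cabsV two.
  have pu : p + v = p + u + u by rewrite /u; field.
  have hm : cabs (p + u - a) < d.
    have -> : p + u - a = ((p - a) + (p + v - a)) / 2 by rewrite /u; field.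
    rewrite (cabsM _ _) cabsV two ltr_pdivrMr //; apply: le_lt_trans (cabsD _ _) _; lra.
  have h1 := IH p u hp hm; have h2 : cabs (F (p + v) - F (p + u)) <= cabs u * S0 + K * cabs u ^+ 2 * (2^-1) ^+ n.
    by rewrite pu; apply: IH => //; rewrite -pu.
  have := cabs_triangle (F (p + v)) (F p) (F (p + u)).
  rewrite uE in h1 h2; rewrite [_ ^+ n.+1]exprSr; set q := (2^-1) ^+ n in h1 h2 *.
  move=> h3; have {}h3 := le_trans h3 (lerD h2 h1); apply: le_trans h3 _; clear; set V := cabs v.
  have -> : V / 2 * S0 + K * (V / 2) ^+ 2 * q + (V / 2 * S0 + K * (V / 2) ^+ 2 * q) = V * S0 + K * V ^+ 2 * (q / 2) by field.
  exact: lexx.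
move=> p v hp hv; rewrite leNgt; apply/negP => lt.
pose e := cabs (F (p + v) - F p) - cabs v * S0; have e0 : 0 < e by rewrite subr_gt0.
pose Q := `|K * cabs v ^+ 2| + 1; have Q0 : 0 < Q by rewrite ltr_wpDl.
have [n hn] := half_pow_small (divr_gt0 e0 Q0); have := hn n (leqnn n); have := step n p v hp hv.
rewrite ltr_pdivlMr //; have := half_pow_gt0 R n; set q := _ ^+ n => q0 h1 h2.
have h3 : K * cabs v ^+ 2 * q <= Q * q.
  by apply: ler_wpM2r; [exact: ltW|rewrite /Q; have := ler_norm (K * cabs v ^+ 2); lra].
have h4 : e <= K * cabs v ^+ 2 * q by rewrite /e; lra.
by have := le_lt_trans (le_trans h4 h3) (eq_ind _ (fun y => y < e) h2 _ (mulrC _ _)); rewrite ltxx.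
Qed.

                                                                                
                                                                   
(** On a disc of radius at most 1/(2L) where |G| <= L, a bound 2^-n for |F| improves to 2^-(n+1) by
    [mean_value_bound] from the centre; so F = 0 there. *)
Lemma ode_zero F G a : holomorphic_at F a -> ccont G a ->
  (\forall z \near a, derive1 F z = F z * G z) -> F a = 0 -> \forall z \near a, F z = 0.
Proof.
move=> HF HG ode Fa; have [d [K d0 [K0 HK]]] := holomorphic_regularity HF.
have Fc := holomorphic_at_ccont HF.
have [d1 d10 H1] := HG 1 ltr01; have [d2 d20 H2] := Fc 1 ltr01.
move/nbhsCP: ode => [d3 d30 H3].
pose L := cabs (G a) + 1; have L0 : 0 < L by rewrite ltr_wpDl // cabs_ge0.
pose r := Num.min (Num.min d (2 * L)^-1) (Num.min d1 (Num.min d2 d3)).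
have r0 : 0 < r by rewrite !lt_min d0 invr_gt0 mulr_gt0 // d10 d20.
have rs w : cabs (w - a) < r -> [/\ cabs (w - a) < d, cabs (w - a) < (2 * L)^-1,
    cabs (w - a) < d1, cabs (w - a) < d2 & cabs (w - a) < d3].
  by rewrite !lt_min => /andP[/andP[-> ->] /and3P[-> -> ->]].
have halving n w : cabs (w - a) < r -> cabs (F w) <= (2^-1) ^+ n.
  elim: n w => [|n IH] w hw; have [w1 w2 w3 w4 w5] := rs w hw.
    rewrite expr0; have := H2 _ w4; rewrite [a + _]addrC subrK Fa subr0; exact: ltW.
  have := @mean_value_bound F a r K ((2^-1) ^+ n * L).
  have aw : a + (w - a) = w by rewrite addrC subrK.
  move=> /(_ _ _ a (w - a)); rewrite aw Fa subr0 => h.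
  apply: le_trans (h _ _ _ hw) _.
  - move=> z /rs[z1 _ _ _ _] k /rs[k1 _ _ _ _]; by have [_] := HK z z1; apply.
  - move=> z hz; have [z1 z2 z3 z4 z5] := rs z hz; rewrite (H3 z z5) (cabsM _ _).
    apply: ler_pM; rewrite ?cabs_ge0 ?IH //.
    have := H1 _ z3; rewrite [a + _]addrC subrK => h1.
    by have := cabsD (G z - G a) (G a); rewrite subrK /L; lra.
  - by rewrite subrr cabs0.
  rewrite exprSr mulrCA; apply: ler_wpM2l; first by rewrite ltW // half_pow_gt0.
  by move: w2; rewrite invfM => /ltW; rewrite -ler_pdivlMr.
apply/nbhsCP; exists r => // w hw; apply/eqP; rewrite -cabs_eq0; apply/eqP/le_anti.
rewrite cabs_ge0 andbT leNgt; apply/negP => Fw; have [n /(_ n (leqnn n))] := half_pow_small Fw.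
by rewrite ltNge halving.
Qed.

Lemma holomorphic_factor F a : holomorphic_at F a -> F a = 0 ->
  exists2 G, holomorphic_at G a & \forall z \near a, F z = (z - a) * G z.
Proof.
move=> HF Fa; pose G z := if z == a then derive1 F a else F z / (z - a); exists G.
  apply: removable.
    move=> e e0; have e2 : 0 < e / 2 by rewrite divr_gt0.
    have [d d0 hd] := holomorphic_at_cderiv HF e2; exists d => // h hh.
    rewrite /G eqxx; case: eqVneq => [_|ha]; first by rewrite subrr cabs0.
    have h0 : h != 0 by apply: contraNneq ha => ->; rewrite addr0.
    rewrite [a + h - a]addrAC subrr add0r.
    have -> : F (a + h) / h - derive1 F a = (F (a + h) - F a - derive1 F a * h) / h.
      by rewrite Fa subr0 mulrBl mulfK.
    rewrite (cabsM _ _) cabsV ltr_pdivrMr ?cabs_gt0 //; apply: le_lt_trans (hd h hh) _.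
    by rewrite ltr_pM2r ?cabs_gt0 //; lra.
  have [r r0 H] := proj1 (holomorphic_atP _ _) HF; apply/nbhsCP; exists r => // z hz za.
  have [l hl] := H z hz; have za0 : z - a != 0 by rewrite subr_eq0.
  apply/derivableCP; exists (l * (z - a)^-1 + F z * (- ((z - a)^-1 * (z - a)^-1) * (1 - 0))).
  have ne : \forall w \near z, F w * (w - a)^-1 = G w.
    by apply: near_imp (near_neq za) => w wa; rewrite /G (negbTE wa).
  apply: (has_cderiv_near ne); apply: has_cderivM hl _.
  apply: (@has_cderivV _ (fun w => w - a)) => //.
  exact: (has_cderivB (has_cderiv_id z) (has_cderiv_cst a z)).
apply: near_all => z; rewrite /G; case: eqVneq => [->|za]; first by rewrite Fa subrr mul0r.
by rewrite mulrCA mulfV ?mulr1 // subr_eq0.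
Qed.

End LocalTools.

(** * Global arguments on a compact Riemann surface *)

Section SurfaceTools.
Variables (R : realType) (S : compactRiemannSurface R).
Local Notation C := (Cplx R).

Lemma clopen_all (B : set S) x0 : B x0 -> (forall x, B x -> nbhs x B) ->
  (forall x, ~ B x -> nbhs x (~` B)) -> forall x, B x.
Proof.
move=> B0 oB cB x; have BT : B = [set: S]; last by rewrite BT.
apply: (@surface_connected R S B); first by exists x0.
  by exists B; [rewrite openE => y /oB|rewrite setTI].
exists B; last by rewrite setTI.
by rewrite -[B]setCK; apply: open_closedC; rewrite openE => y /cB.
Qed.

Lemma cdom_nbhs (i : chart_index S) (x : S) : cdom (atlas i) x -> nbhs x (cdom (atlas i)).
Proof. by move=> h; apply: open_nbhs_nbhs; split => //; exact: cdom_open. Qed.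

Lemma cmap_near (i : chart_index S) (x : S) (P : C -> Prop) : cdom (atlas i) x ->
  (\forall z \near cmap (atlas i) x, P z) -> nbhs x (fun y => P (cmap (atlas i) y)).
Proof. by move=> h; apply: (cmap_continuous h). Qed.

Lemma cinv_near (i : chart_index S) (x : S) (A : set S) : cdom (atlas i) x ->
  nbhs x A -> \forall z \near cmap (atlas i) x, A (cinv (atlas i) z).
Proof. by move=> h nA; apply: (cinv_continuous h); rewrite (cmapK h). Qed.

Lemma cmap_cinv_near (i : chart_index S) (x : S) : cdom (atlas i) x ->
  \forall z \near cmap (atlas i) x, cmap (atlas i) (cinv (atlas i) z) = z.
Proof.
move=> h; have : (cmap (atlas i) @` cdom (atlas i)) (cmap (atlas i) x) by exists x.
have := @cimg_open _ _ (atlas i); rewrite openE => H /H.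
by apply: filterS => z [y hy <-]; rewrite cmapK.
Qed.

Lemma tcont_local (F : S -> C) (i : chart_index S) (x : S) : cdom (atlas i) x ->
  ccont (fun z => F (cinv (atlas i) z)) (cmap (atlas i) x) -> tcont F x.
Proof.
move=> h hF e e0; have [d d0 hd] := hF e e0.
have n : \forall z \near cmap (atlas i) x, cabs (F (cinv (atlas i) z) - F x) < e.
  apply/nbhsCP; exists d => // z /hd; rewrite [cmap _ x + _]addrC subrK.
  by rewrite (cmapK h).
by apply: filterS2 (cmap_near h n) (cdom_nbhs h) => y h1 h2; rewrite (cmapK h2) in h1.
Qed.

(** |F| attains its maximum by compactness; the set where F takes that extremal value is open by
    [strong_maximum] and closed by continuity. *)
Lemma holo_const (F : S -> C) : (forall x, exists i, cdom (atlas i) x /\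
    holomorphic_at (fun z => F (cinv (atlas i) z)) (cmap (atlas i) x)) ->
  forall x y, F x = F y.
Proof.
move=> HF; have Fc x : tcont F x.
  by have [i [h1 h2]] := HF x; apply: (tcont_local h1); exact: holomorphic_at_ccont.
have absc : continuous (fun x => cabs (F x)).
  move=> x; apply/cvgrPdist_lt => e e0; apply: filterS (Fc x e e0) => y hy.
  have := cabsDl (F x) (- F y); have := cabsDl (F y) (- F x); rewrite !cabsN (cabsB (F x) (F y)) => h1 h2.
  by rewrite ltr_norml; apply/andP; split; lra.
have [c _ cmax] : exists2 c, c \in [set: S] & forall t, t \in [set: S] -> cabs (F t) <= cabs (F c).
  apply: compact_EVT_max; [exact: surface_nonempty|exact: surface_compact|exact: continuous_subspaceT].
have cm t : cabs (F t) <= cabs (F c) by apply: cmax; rewrite inE.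
suff all x : F x = F c by move=> x y; rewrite !all.
apply: (@clopen_all (fun x => F x = F c) c) => // {}x Fx.
  have [i [h1 h2]] := HF x.
  have n : \forall z \near cmap (atlas i) x, F (cinv (atlas i) z) = F x.
    have := strong_maximum h2; rewrite (cmapK h1); apply; apply: near_all => z.
    by rewrite Fx.
  by apply: filterS2 (cmap_near h1 n) (cdom_nbhs h1) => y k1 k2; rewrite -Fx -k1 (cmapK k2).
have e0 : 0 < cabs (F x - F c) by rewrite cabs_gt0 subr_eq0; apply/eqP.
by apply: filterS (Fc x _ e0) => y hy Fy; rewrite Fy cabsB ltxx in hy.
Qed.

(** The transition the other way is a local inverse, so the product of the two derivatives is 1. *)
Lemma transition_neq0 (i j : chart_index S) (x : S) : cdom (atlas i) x -> cdom (atlas j) x ->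
  derive1 (local_rep (atlas i) id (atlas j)) (cmap (atlas i) x) != 0.
Proof.
move=> hi hj; have h1 := holomorphic_at_cderiv (atlas_compat hi hj).
have h2 := holomorphic_at_cderiv (atlas_compat hj hi).
have E : local_rep (atlas i) id (atlas j) (cmap (atlas i) x) = cmap (atlas j) x.
  by rewrite /local_rep (cmapK hi).
rewrite -E in h2; have h3 := has_cderiv_comp h1 h2.
have n : \forall z \near cmap (atlas i) x,
    local_rep (atlas j) id (atlas i) (local_rep (atlas i) id (atlas j) z) = id z.
  apply: filterS2 (cinv_near hi (cdom_nbhs hj)) (cmap_cinv_near hi) => z k1 k2.
  by rewrite /local_rep (cmapK k1) k2.
have := has_cderiv_uniq (has_cderiv_near n h3) (has_cderiv_id _).
by move=> /eqP; apply: contraTneq => ->; rewrite mulr0 eq_sym oner_neq0.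
Qed.

(** The points near which the coefficient vanishes identically form a clopen set, which is empty
    because xi is nonzero somewhere. *)
Lemma nonzero_order k (xi : kDifferential k S) : kdiff_nonzero xi ->
  forall i (x : S), cdom (atlas i) x -> exists m, has_order_at (coef xi i) (cmap (atlas i) x) m.
Proof.
move=> [i0 [x0 [h0 n0]]].
pose B (x : S) := exists2 i, cdom (atlas i) x & \forall z \near cmap (atlas i) x, coef xi i z = 0.
have Bval x i : B x -> cdom (atlas i) x -> coef xi i (cmap (atlas i) x) = 0.
  by move=> [j hj /near_at E] hi; rewrite (coef_change xi hi hj) E mul0r.
suff nB x : ~ B x.
  move=> i x hi; have [//|z0] := coef_meromorphic xi hi.
  by case: (nB x); exists i.
apply: (@clopen_all (fun x => ~ B x) x0) => [Bx0|{}x nBx|{}x nnBx].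
- by move: n0; rewrite (Bval _ _ Bx0 h0) eqxx.
- have [i hi] := atlas_cover x; have [[m [u [u1 u2 u3]]]|z0] := coef_meromorphic xi hi; last first.
    by case: nBx; exists i.
  have n : \forall z \near cmap (atlas i) x, z != cmap (atlas i) x -> coef xi i z != 0.
    apply: filterS2 u3 (near_neq0 (holomorphic_at_ccont u1) u2) => z -> uz za.
    by rewrite mulf_neq0 // expfz_neq0 // subr_eq0.
  apply: filterS2 (cmap_near hi n) (cdom_nbhs hi) => y k1 k2 By.
  have [E|E] := eqVneq (cmap (atlas i) y) (cmap (atlas i) x).
    by apply: nBx; rewrite -(cmapK hi) -E (cmapK k2).
  by have := k1 E; rewrite (Bval _ _ By k2) eqxx.
have Bx : B x := contrapT nnBx; case: Bx => i hi zi.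
apply: filterS2 (cmap_near hi (near_near zi)) (cdom_nbhs hi) => y k1 k2 nBy.
by apply: nBy; exists i.
Qed.

End SurfaceTools.

Lemma has_cderiv_pow (R : realType) (f : Cplx R -> Cplx R) z l n : has_cderiv f z l ->
  has_cderiv (fun w => f w ^+ n.+1) z (n.+1%:R * f z ^+ n * l).
Proof.
move=> H; elim: n => [|n IH].
  by rewrite expr0 !mul1r; apply: has_cderiv_ext H => w; rewrite expr1.
apply: has_cderiv_ext (fun w => esym (exprS (f w) n.+1)) _.
apply: has_cderiv_eq (has_cderivM H IH) _.
by rewrite [f z ^+ n.+1]exprS -[n.+2]addn1 natrD; set p := f z ^+ n; ring.
Qed.

(** * Emptiness of the two exceptional strata in genus one *)

Section GenusOne.
Variables (R : realType) (S : compactRiemannSurface R) (k' : nat).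
Local Notation C := (Cplx R).
Local Notation k := (k'.+3).
Hypothesis genus1 : has_genus S 1.
Variable xi : kDifferential k S.
Hypothesis xi_nz : kdiff_nonzero xi.

(** Were the basis form zero, every scalar would be a coordinate of it, against uniqueness. *)
Lemma genus1_form : exists2 w : kDifferential 1 S, kdiff_holomorphic w & kdiff_nonzero w.
Proof.
have [b [bh bu]] := genus1; exists (b ord0) => //; apply: contrapT => nz.
have z0 i (x : S) : cdom (atlas i) x -> coef (b ord0) i (cmap (atlas i) x) = 0.
  by move=> hi; apply: contrapT => h; apply: nz; exists i, x; split => //; apply/eqP.
have [c [_ cu]] := bu (b ord0) (bh ord0).
have h (c' : 'rV[C]_1) : c = c'.
  by apply: cu => i x hi; rewrite big_ord1 z0 // mulr0.
have := congr1 (fun A : 'rV[C]_1 => A ord0 ord0) (eq_trans (esym (h 0)) (h (const_mx 1))).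
by rewrite !mxE => /esym/eqP; rewrite oner_eq0.
Qed.

Section Form.
Variable w : kDifferential 1 S.
Hypothesis w_holo : kdiff_holomorphic w.
Hypothesis w_nz : kdiff_nonzero w.

(** With v = 1/xi, [fi] is the local expression of the function f = w^k/xi; numerator and
    denominator transform alike, so f is well defined on the surface. *)
Let v i z : C := (coef xi i z)^-1.
Let fi i z : C := coef w i z ^+ k * v i z.
Let ch (x : S) : chart_index S := sval (cid (atlas_cover x)).
Let chP x : cdom (atlas (ch x)) x. Proof. exact: (svalP (cid (atlas_cover x))). Qed.
Let fX (x : S) : C := fi (ch x) (cmap (atlas (ch x)) x).

Let fi_change i j (x : S) : cdom (atlas i) x -> cdom (atlas j) x ->
  fi i (cmap (atlas i) x) = fi j (cmap (atlas j) x).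
Proof.
move=> hi hj; rewrite /fi /v (coef_change w hi hj) (coef_change xi hi hj) expr1.
have := transition_neq0 hi hj; set T := derive1 _ _ => T0.
have Tk := expf_neq0 k T0; rewrite exprMn invfM mulrACA mulfV ?mulr1 //.
Qed.

Let fXE i (x : S) : cdom (atlas i) x -> fX x = fi i (cmap (atlas i) x).
Proof. by move=> hi; exact: fi_change. Qed.

Let fX_near i (x : S) : cdom (atlas i) x ->
  \forall z \near cmap (atlas i) x, fi i z = fX (cinv (atlas i) z).
Proof.
move=> hi; apply: filterS2 (cinv_near hi (cdom_nbhs hi)) (cmap_cinv_near hi) => z h1 h2.
by rewrite (fXE h1) h2.
Qed.

Let fi_holo i z : holomorphic_at (coef w i) z -> holomorphic_at (v i) z -> holomorphic_at (fi i) z.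
Proof. by move=> h1 h2; exact: (holomorphic_atM (holomorphic_atX k h1) h2). Qed.

(** Then w^k/xi is holomorphic, hence a nonzero constant c, and xi = (e w)^k for any e with e^k =
    1/c. *)
Lemma no_order_free : (forall (x : S) m, kdiff_order xi x m -> m = 0) -> kdiff_primitive xi -> False.
Proof.
move=> ord0 prim.
have unit i (x : S) : cdom (atlas i) x ->
    holomorphic_at (coef xi i) (cmap (atlas i) x) /\ coef xi i (cmap (atlas i) x) != 0.
  move=> hi; have [m hm] := nonzero_order xi_nz hi.
  have m0 : m = 0 by apply: (ord0 x); exists i.
  subst m; split; first exact: (@has_order_holomorphic _ _ _ 0 hm).
  by have [u [_ u0 /near_at ->]] := hm; rewrite expr0z mulr1.
have fc : forall x y, fX x = fX y.
  apply: holo_const => x; exists (ch x); split; first exact: chP.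
  apply: (holomorphic_at_eq (fX_near (chP x))); have [h1 h2] := unit _ _ (chP x).
  by apply: fi_holo; [exact: w_holo (chP x)|exact: holomorphic_atV].
have [i0 [x0 [h0 n0]]] := w_nz; pose c := fX x0.
have c0 : c != 0.
  by rewrite /c (fXE h0) /fi /v mulf_neq0 ?expf_neq0 // invr_eq0; case: (unit _ _ h0).
pose e : C := (k.-root (c^-1 : R[i])); have ek : e ^+ k = c^-1 by exact: rootCK.
have e0 : e != 0.
  by apply: contraTneq c0 => E; rewrite -[c]invrK -ek E expr0n invr0 eqxx.
have mer i (x : S) : cdom (atlas i) x -> meromorphic_at (fun z => e * coef w i z) (cmap (atlas i) x).
  move=> hi; have [[n [u [u1 u2 u3]]]|z0] := coef_meromorphic w hi; [left; exists n|right].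
    exists (fun z => e * u z); split.
    - exact: (holomorphic_atM (holomorphic_at_cst e _) u1).
    - exact: mulf_neq0.
    - by apply: near_imp u3 => z ->; rewrite mulrA.
  by apply: near_imp z0 => z ->; rewrite mulr0.
have change i j (x : S) : cdom (atlas i) x -> cdom (atlas j) x ->
    e * coef w i (cmap (atlas i) x) = e * coef w j (cmap (atlas j) x) *
      (derive1 (local_rep (atlas i) id (atlas j)) (cmap (atlas i) x)) ^+ 1.
  by move=> hi hj; rewrite (coef_change w hi hj) mulrA.
pose eta := @KDifferential R 1 S (fun i z => e * coef w i z) mer change.
apply: (prim 1%N eta) => // i x hi /=; rewrite divn1 exprMn ek.
have E : fX x = c by exact: fc.
have [_ xn] := unit _ _ hi.
have -> : coef w i (cmap (atlas i) x) ^+ k = c * coef xi i (cmap (atlas i) x).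
  by rewrite -E (fXE hi) /fi /v divfK.
by rewrite mulrA mulVf // mul1r.
Qed.

Section SimplePole.
Variables (P Q : S).
Hypothesis PQ : P <> Q.
Hypothesis Q_order : kdiff_order xi Q 1.
Hypothesis P_order : kdiff_order xi P (-1).
Hypothesis only : forall (x : S) m, kdiff_order xi x m -> m != 0 -> x = P \/ x = Q.

(** At the pole P both conventions, value 0 at a pole and 0^-1 = 0, conspire to give the inverse its
    correct value 0. *)
Let v_good (x : S) : x <> Q -> exists2 i, cdom (atlas i) x & holomorphic_at (v i) (cmap (atlas i) x).
Proof.
move=> xQ; have [->|xP] := pselect (x = P).
  have [i hi [u [u1 u2 u3]]] := P_order; exists i; first exact: hi.
  apply: (@holomorphic_at_eq _ (fun z => (z - cmap (atlas i) P) * (u z)^-1)).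
    by apply: near_imp u3 => z E; rewrite /v E -invr_expz expr1z invfM invrK mulrC.
  apply: holomorphic_atM; last exact: (holomorphic_atV u2 u1).
  exact: (holomorphic_atB (holomorphic_at_id _) (holomorphic_at_cst _ _)).
have hi := chP x; have [m hm] := nonzero_order xi_nz hi; exists (ch x); first exact: hi.
have [m0|m0] := eqVneq m 0; last by have [] := only (ex_intro2 _ _ (ch x) hi hm) m0.
subst m; have [u [_ u0 /near_at E]] := hm; apply: holomorphic_atV.
  by rewrite E expr0z mulr1.
exact: (@has_order_holomorphic _ _ _ 0 hm).
Qed.

Let T i j := local_rep (atlas (c := S) i) id (atlas j).

Let v_holo i (x : S) : x <> Q -> cdom (atlas i) x -> holomorphic_at (v i) (cmap (atlas i) x).
Proof.
move=> xQ hi; have [j hj vj] := v_good xQ; have hT := atlas_compat hi hj.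
have TE : T i j (cmap (atlas i) x) = cmap (atlas j) x by rewrite /T /local_rep (cmapK hi).
have Tn := transition_neq0 hi hj; have hT' := holomorphic_at_derive1 hT.
have hTk := @holomorphic_atV R (fun z => derive1 (T i j) z ^+ k) (cmap (atlas i) x) (expf_neq0 k Tn) (holomorphic_atX k hT').
have hv : holomorphic_at (fun z => v j (T i j z)) (cmap (atlas i) x).
  by apply: (@holomorphic_at_comp R (T i j) (v j)); [exact: hT|rewrite TE; exact: vj].
apply: (@holomorphic_at_eq R (fun z => v j (T i j z) * (derive1 (T i j) z ^+ k)^-1)); last exact: (holomorphic_atM hv hTk).
apply: filterS3 (cinv_near hi (cdom_nbhs hi)) (cinv_near hi (cdom_nbhs hj)) (cmap_cinv_near hi) => z h1 h2 h3.
have X := coef_change xi h1 h2; rewrite h3 in X.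
by rewrite /v X; exact: esym (invfM _ _).
Qed.

                                                                                        
(** The function df/w for f = w^k v, with one factor w divided out of the product rule, so that it
    is holomorphic also at possible zeros of w. *)
Let E i z : C := k%:R * coef w i z ^+ k'.+1 * derive1 (coef w i) z * v i z + coef w i z ^+ k'.+2 * derive1 (v i) z.

Let E_holo i z : holomorphic_at (coef w i) z -> holomorphic_at (v i) z -> holomorphic_at (E i) z.
Proof.
move=> h1 h2; have d1 := holomorphic_at_derive1 h1; have d2 := holomorphic_at_derive1 h2.
exact: (holomorphic_atD (holomorphic_atM (holomorphic_atM (holomorphic_atM (holomorphic_at_cst k%:R z) (holomorphic_atX k'.+1 h1)) d1) h2)
  (holomorphic_atM (holomorphic_atX k'.+2 h1) d2)).
Qed.

Let E_deriv i z : holomorphic_at (coef w i) z -> holomorphic_at (v i) z ->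
  derive1 (fi i) z = coef w i z * E i z.
Proof.
move=> h1 h2; have d1 := holomorphic_at_cderiv h1; have d2 := holomorphic_at_cderiv h2.
rewrite (has_cderiv_derive1 (has_cderivM (has_cderiv_pow k'.+2 d1) d2)) /E.
set a := coef w i z; set a' := derive1 _ _; set b := derive1 _ _; set m := k%:R.
by rewrite [a ^+ k]exprS [a ^+ k'.+2]exprS; set p := a ^+ k'.+1; ring.
Qed.

Let E_zero i z : coef w i z = 0 -> E i z = 0.
Proof.
rewrite /E => ->; set a' := derive1 _ _; set b := derive1 _ _; set vv := v i z; set m := k%:R.
move: a' b vv m => a' b vv m; have Z0 n : (0 : C) ^+ n.+1 = 0 by rewrite exprS mul0r.
by rewrite Z0 [0 ^+ k'.+2]Z0 mulr0 !mul0r addr0.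
Qed.

(** Where w is nonzero this is the chain rule for f divided by w; where w vanishes both sides are
    0. *)
Let E_change i j (x : S) : x <> Q -> cdom (atlas i) x -> cdom (atlas j) x ->
  E i (cmap (atlas i) x) = E j (cmap (atlas j) x).
Proof.
move=> xQ hi hj; have Tn := transition_neq0 hi hj; have wc := coef_change w hi hj; rewrite expr1 in wc.
have wi := w_holo hi; have wj := w_holo hj; have vi := v_holo xQ hi; have vj := v_holo xQ hj.
have [w0|w0] := eqVneq (coef w i (cmap (atlas i) x)) 0.
  have wj0 : coef w j (cmap (atlas j) x) = 0.
    by move/eqP: wc; rewrite w0 eq_sym mulf_eq0 (negbTE Tn) orbF => /eqP.
  by rewrite (E_zero w0) (E_zero wj0).
have alg (di dj ai aj ei ej t : C) : di = ai * ei -> dj = aj * ej -> di = dj * t -> ai = aj * t ->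
    ai != 0 -> ei = ej.
  by move=> -> -> H1 H2 n; apply: (mulfI n); rewrite H1 H2 mulrAC.
apply: (alg _ _ _ _ _ _ _ (E_deriv wi vi) (E_deriv wj vj) _ wc w0).
have TE : T i j (cmap (atlas i) x) = cmap (atlas j) x by rewrite /T /local_rep (cmapK hi).
have fj := holomorphic_at_cderiv (fi_holo wj vj); rewrite -TE in fj.
have hT := holomorphic_at_cderiv (atlas_compat hi hj).
have := has_cderiv_comp hT fj; rewrite TE => hc; apply: has_cderiv_derive1.
apply: (@has_cderiv_near R (fun z => fi j (T i j z))); last exact: hc.
apply: filterS3 (cinv_near hi (cdom_nbhs hi)) (cinv_near hi (cdom_nbhs hj)) (cmap_cinv_near hi) => z h1 h2 h3.
by rewrite -[in RHS]h3 (fi_change h1 h2).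
Qed.

Let off_Q i (x : S) : x <> Q -> cdom (atlas i) x -> \forall z \near cmap (atlas i) x, cinv (atlas i) z <> Q.
Proof.
move=> xQ hi; have [hQ|hQ] := pselect (cdom (atlas i) Q).
  have ne : cmap (atlas i) x != cmap (atlas i) Q.
    by apply/eqP => h; apply: xQ; rewrite -(cmapK hi) h (cmapK hQ).
  by apply: filterS2 (near_neq ne) (cmap_cinv_near hi) => z h1 h2 h3; move: h1; rewrite -h2 h3 eqxx.
by apply: near_imp (cinv_near hi (cdom_nbhs hi)) => z h1 h2; apply: hQ; rewrite -h2.
Qed.

Let EX (x : S) : C := E (ch x) (cmap (atlas (ch x)) x).

Let regular_near i (x : S) : x <> Q -> cdom (atlas i) x -> \forall z \near cmap (atlas i) x,
  [/\ cinv (atlas i) z <> Q, EX (cinv (atlas i) z) = E i z & fX (cinv (atlas i) z) = fi i z].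
Proof.
move=> xQ hi; have n := near_and (off_Q xQ hi) (fX_near hi).
apply: filterS3 n (cinv_near hi (cdom_nbhs hi)) (cmap_cinv_near hi) => z [h1 h2] h3 h4.
split; [exact: h1| |exact: esym h2].
by rewrite /EX (E_change h1 (chP _) h3) h4.
Qed.

Let fX_P : fX P = 0.
Proof.
have [i hi [u [_ _ /near_at E0]]] := P_order.
by rewrite (fXE hi) /fi /v E0 subrr exp0rz mulr0 invr0 mulr0.
Qed.

Let fX_cont (x : S) : x <> Q -> tcont fX x.
Proof.
move=> xQ; apply: (tcont_local (chP x)); apply: holomorphic_at_ccont.
apply: (holomorphic_at_eq (fX_near (chP x))).
by apply: fi_holo; [exact: w_holo (chP x)|exact: v_holo].
Qed.

(** If w vanished at Q, f would be holomorphic on the whole surface, hence constantly f P = 0; but w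
    and xi are both nonzero at some nearby point. *)
Lemma form_neq0_at_pole q : cdom (atlas q) Q -> has_order_at (coef xi q) (cmap (atlas q) Q) 1 ->
  coef w q (cmap (atlas q) Q) != 0.
Proof.
move=> hq [h1 [h1h h10 h1E]]; apply/negP => /eqP w0; set z0 := cmap (atlas q) Q in h1h h10 h1E w0.
have [w1 w1h w1E] := holomorphic_factor (w_holo hq) w0.
have fc : forall x y, fX x = fX y.
  apply: holo_const => x; have [->|xQ] := pselect (x = Q); last first.
    exists (ch x); split; first exact: chP.
    apply: (holomorphic_at_eq (fX_near (chP x))).
    by apply: fi_holo; [exact: w_holo (chP x)|exact: v_holo].
  exists q; split; first exact: hq.
  apply: (holomorphic_at_eq (fX_near hq)); rewrite -/z0.
  have zh := holomorphic_atB (holomorphic_at_id z0) (holomorphic_at_cst z0 z0).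
  apply: holomorphic_at_eq (holomorphic_atM (holomorphic_atM (holomorphic_atX k'.+2 zh) (holomorphic_atX k w1h)) (holomorphic_atV h10 h1h)).
  apply: filterS3 w1E h1E (near_neq0 (holomorphic_at_ccont h1h) h10) => z E1 E2 E3; rewrite /fi /v E1 E2 expr1z.
  have [->|za] := eqVneq z z0; first by rewrite subrr exprS !mul0r exprS !mul0r.
  have zn : z - z0 != 0 by rewrite subr_eq0.
  have hn : h1 z != 0 by apply: E3.
  rewrite exprMn [(z - z0) ^+ k]exprSr; move: zn hn; set y := z - z0; set b := h1 z => zn hn.
  set p := y ^+ k'.+2; set s := w1 z ^+ _.
  by field; rewrite zn hn.
have [i0 [x0 [hx0 n0]]] := w_nz; have [m [u [u1 u2 u3]]] := nonzero_order xi_nz hx0.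
have n1 := near_neq0 (holomorphic_at_ccont (w_holo hx0)) n0.
have n2 := near_neq0 (holomorphic_at_ccont u1) u2.
have [z za [[z1 z2] [z3 z4]]] := near_punctured (near_and (near_and n1 n2) (near_and u3 (fX_near hx0))).
move: z4; rewrite (fc _ P) fX_P => /eqP; apply/negP.
rewrite /fi /v z3 mulf_neq0 ?expf_neq0 // invr_eq0 mulf_neq0 //.
by rewrite expfz_neq0 // subr_eq0.
Qed.

                                                                                            
                                                                                        
                                                                                        
                                  
(** f has a single simple pole, at Q, and df/w a double one. Subtracting a suitable quadratic
    polynomial in f removes it, so df/w is a quadratic polynomial in f. A root u of that polynomial
    is a constant solution of the equation, so f omits u, and the function 1/(f-u) is holomorphic
    with a zero at Q, hence 0 also at P. *)
Lemma no_simple_pole : False.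
Proof.
have [q hq o1] := Q_order; have w00 := form_neq0_at_pole hq o1.
have [h1 [h1h h10 h1E]] := o1; set z0 := cmap (atlas q) Q in w00 h1h h10 h1E.
pose wq := coef w q; have wh : holomorphic_at wq z0 := w_holo hq.
pose h z := wq z ^+ k * (h1 z)^-1.
have hh : holomorphic_at h z0 := holomorphic_atM (holomorphic_atX k wh) (holomorphic_atV h10 h1h).
have h0 : h z0 != 0 by rewrite /h mulf_neq0 ?invr_eq0 ?expf_neq0.
have fE : \forall z \near z0, fi q z = h z / (z - z0).
  by apply: near_imp h1E => z Ez; rewrite /fi /v Ez expr1z invfM mulrA.
have h'h := holomorphic_at_derive1 hh; have zh := holomorphic_atB (holomorphic_at_id z0) (holomorphic_at_cst z0 z0).
(* With this r the double poles of df/w and f^2/r at Q cancel; [N0] is the numerator of the sum over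
   (z - z0)^2. *)
pose r := h z0 * wq z0; have r0 : r != 0 by rewrite mulf_neq0.
pose N0 z := (derive1 h z * (z - z0) - h z) * (wq z)^-1 + h z ^+ 2 * r^-1.
have N0h : holomorphic_at N0 z0 :=
  holomorphic_atD (holomorphic_atM (holomorphic_atB (holomorphic_atM h'h zh) hh) (holomorphic_atV w00 wh))
    (holomorphic_atM (holomorphic_atX 2 hh) (holomorphic_at_cst r^-1 z0)).
have N00 : N0 z0 = 0.
  rewrite /N0 subrr mulr0 add0r /r; move: h0 w00; rewrite -/(wq z0); set a := h z0; set b := wq z0 => a0 b0.
  by field; rewrite a0 b0.
have [N1 N1h N1E] := holomorphic_factor N0h N00.
(* The remaining simple pole is a multiple of that of f. *)
pose al := N1 z0 / h z0.
have N2h := holomorphic_atB N1h (holomorphic_atM (holomorphic_at_cst al z0) hh).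
have N20 : N1 z0 - al * h z0 = 0 by rewrite /al divfK // subrr.
have [M Mh ME] := holomorphic_factor N2h N20.
(* df/w + f^2/r - al f, extended over Q; it is holomorphic everywhere, hence constant. *)
pose FX (x : S) : C := if pselect (x = Q) then M z0 else EX x + fX x ^+ 2 / r - al * fX x.
have FX_Q : FX Q = M z0 by rewrite /FX; case: pselect.
have FX_off (x : S) : x <> Q -> FX x = EX x + fX x ^+ 2 / r - al * fX x by move=> xQ; rewrite /FX; case: pselect.
have cinv0 : cinv (atlas q) z0 = Q by exact: cmapK hq.
have offQ z : z != z0 -> cmap (atlas q) (cinv (atlas q) z) = z -> cinv (atlas q) z <> Q.
  by move=> za zE zQ; move: za; rewrite -zE zQ eqxx.
have wn := near_neq0 (holomorphic_at_ccont wh) w00; have h1n := near_neq0 (holomorphic_at_ccont h1h) h10.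
have domQ := near_and (cinv_near hq (cdom_nbhs hq)) (cmap_cinv_near hq).
have FXc : forall x y, FX x = FX y.
  apply: holo_const => x; have [->|xQ] := pselect (x = Q); last first.
    exists (ch x); split; first exact: chP.
    have fh := fi_holo (w_holo (chP x)) (v_holo xQ (chP x)).
    have Eh := E_holo (w_holo (chP x)) (v_holo xQ (chP x)).
    apply: holomorphic_at_eq (holomorphic_atB (holomorphic_atD Eh (holomorphic_atM (holomorphic_atX 2 fh) (holomorphic_at_cst r^-1 _)))
      (holomorphic_atM (holomorphic_at_cst al _) fh)).
    by apply: near_imp (regular_near xQ (chP x)) => z [k1 k2 k3]; rewrite (FX_off _ k1) k2 k3.
  exists q; split; first exact: hq.
  apply: holomorphic_at_eq Mh.
  have nn := near_and (near_and N1E ME) (near_and (near_near fE) (near_and wn domQ)).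
  apply: filterS2 nn (near_and (holomorphic_at_near hh) (holomorphic_at_near wh)).
  move=> z [[zN1 zM] [zf [zw [zd zE]]]] [zh1 zwh]; have [->|za] := eqVneq z z0; first by rewrite cinv0 FX_Q.
  have zQ := offQ z za zE; have zn : z - z0 != 0 by rewrite subr_eq0.
  have vh : holomorphic_at (v q) z by rewrite -zE; exact: v_holo.
  rewrite (FX_off _ zQ) /EX (E_change zQ (chP _) zd) (fXE zd) zE.
  have Ed := E_deriv zwh vh.
  have fd : derive1 (fi q) z = derive1 h z * (z - z0)^-1 + h z * (- ((z - z0)^-1 * (z - z0)^-1) * (1 - 0)).
    apply: has_cderiv_derive1; have ne : \forall y \near z, h y * (y - z0)^-1 = fi q y by apply: near_imp zf => y ->.
    apply: (has_cderiv_near ne); apply: has_cderivM (holomorphic_at_cderiv zh1) _.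
    apply: (@has_cderivV _ (fun y => y - z0)); first exact: zn.
    exact: (has_cderivB (has_cderiv_id z) (has_cderiv_cst z0 z)).
  have Ev : E q z = derive1 (fi q) z / wq z by rewrite Ed mulrC mulKf.
  rewrite Ev fd (near_at zf); apply: (mulfI zn); rewrite -zM; apply: (mulfI zn); rewrite mulrBr -zN1 /N0.
  move: zn zw; rewrite -/(wq z); set y := z - z0; set b := wq z; set a := h z; set a' := derive1 h z => y0 b0.
  by field; rewrite y0 b0 r0.
(* [de] is a root of the discriminant of f^2 - r al f - r be, whose roots are [u] and [u']. *)
pose be := FX Q; pose de := csqrt ((r * al) ^+ 2 + 4 * r * be).
have de2 : de ^+ 2 = (r * al) ^+ 2 + 4 * r * be by exact: csqrtK.
pose u := (r * al + de) / 2; pose u' := (r * al - de) / 2.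
have riccati (x : S) : x <> Q -> EX x = (fX x - u) * (- (fX x - u') / r).
  move=> xQ; have := FXc x Q; rewrite (FX_off _ xQ) -/be => Eb.
  have -> : EX x = be - fX x ^+ 2 / r + al * fX x by rewrite -Eb; ring.
  have beE : be = (de ^+ 2 - (r * al) ^+ 2) / (4 * r) by rewrite de2; field.
  by rewrite beE /u /u'; field.
(* The set is open by continuity off Q and because f is infinite at Q. Its complement is open by
   [ode_zero] applied to f - u, so connectedness applies. *)
have avoid : forall x : S, x = Q \/ fX x <> u.
  apply: (@clopen_all R S (fun x => x = Q \/ fX x <> u) Q); first by left.
    move=> x hx; have [xQ|xQ] := pselect (x = Q).
      subst x; pose D z := h z - u * (z - z0).
      have Dh : holomorphic_at D z0 := holomorphic_atB hh (holomorphic_atM (holomorphic_at_cst u z0) zh).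
      have D0 : D z0 != 0 by rewrite /D subrr mulr0 subr0.
      have nD := near_and (near_neq0 (holomorphic_at_ccont Dh) D0) fE.
      apply: filterS2 (cmap_near hq nD) (cdom_nbhs hq) => y [y1 y2] yd.
      have [->|yQ] := pselect (y = Q); [by left|right => fy].
      have yn : cmap (atlas q) y - z0 != 0.
        by rewrite subr_eq0; apply/eqP => Ey; apply: yQ; rewrite -(cmapK yd) Ey (cmapK hq).
      by move/eqP: y1; apply; rewrite /D -fy (fXE yd) y2 divfK // subrr.
    have fx : fX x <> u by case: hx.
    have e0 : 0 < cabs (fX x - u) by rewrite cabs_gt0 subr_eq0; apply/eqP.
    by apply: filterS (fX_cont xQ e0) => y hy; right => fy; rewrite fy cabsB ltxx in hy.
  move=> x nx; have xQ : x <> Q by move=> h'; apply: nx; left.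
  have fx : fX x = u by apply: contrapT => h'; apply: nx; right.
  have hi := chP x; have wi := w_holo hi; have vi := v_holo xQ hi; have fh := fi_holo wi vi.
  pose F z := fi (ch x) z - u; pose G z := coef w (ch x) z * (- (fi (ch x) z - u') * r^-1).
  have Fh : holomorphic_at F (cmap (atlas (ch x)) x) := holomorphic_atB fh (holomorphic_at_cst u _).
  have Gh : holomorphic_at G (cmap (atlas (ch x)) x).
    apply: holomorphic_atM; first exact: wi.
    apply: holomorphic_at_eq (holomorphic_atM (holomorphic_atB (holomorphic_at_cst u' _) fh) (holomorphic_at_cst r^-1 _)).
    by apply: near_all => z; rewrite opprB.
  have ode : \forall z \near cmap (atlas (ch x)) x, derive1 F z = F z * G z.
    apply: filterS3 (regular_near xQ hi) (holomorphic_at_near wi) (holomorphic_at_near vi) => z [k1 k2 k3] k4 k5.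
    have -> : derive1 F z = derive1 (fi (ch x)) z.
      have k6 := holomorphic_at_cderiv (fi_holo k4 k5).
      by rewrite (has_cderiv_derive1 (has_cderivB k6 (has_cderiv_cst u z))) subr0.
    by rewrite (E_deriv k4 k5) -k2 (riccati _ k1) k3 /F /G mulrCA.
  have F0 : F (cmap (atlas (ch x)) x) = 0 by rewrite /F -/(fX x) fx subrr.
  have nF := near_and (ode_zero Fh (holomorphic_at_ccont Gh) ode F0) (off_Q xQ hi).
  apply: filterS2 (cmap_near hi nF) (cdom_nbhs hi) => y [y1 y2] yd [yQ|fy].
    by apply: y2; rewrite (cmapK yd).
  by apply: fy; rewrite (fXE yd); apply/eqP; rewrite -subr_eq0; apply/eqP.
(* 1/(f-u), with its limit 0 at the pole Q. *)
pose HX (x : S) : C := if pselect (x = Q) then 0 else (fX x - u)^-1.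
have HX_off (x : S) : x <> Q -> HX x = (fX x - u)^-1 by move=> xQ; rewrite /HX; case: pselect.
have HX_Q : HX Q = 0 by rewrite /HX; case: pselect.
have HXc : forall x y, HX x = HX y.
  apply: holo_const => x; have [->|xQ] := pselect (x = Q); last first.
    exists (ch x); split; first exact: chP.
    have fh := fi_holo (w_holo (chP x)) (v_holo xQ (chP x)).
    have fh2 := holomorphic_atB fh (holomorphic_at_cst u (cmap (atlas (ch x)) x)).
    have ne : fi (ch x) (cmap (atlas (ch x)) x) - u != 0.
      by rewrite subr_eq0; apply/eqP; case: (avoid x).
    apply: (@holomorphic_at_eq R (fun z => (fi (ch x) z - u)^-1)); last exact: (@holomorphic_atV R (fun z => fi (ch x) z - u) _ ne fh2).
    by apply: near_imp (regular_near xQ (chP x)) => z [k1 k2 k3]; rewrite (HX_off _ k1) k3.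
  exists q; split; first exact: hq.
  pose D z := h z - u * (z - z0).
  have Dh : holomorphic_at D z0 := holomorphic_atB hh (holomorphic_atM (holomorphic_at_cst u z0) zh).
  have D0 : D z0 != 0 by rewrite /D subrr mulr0 subr0.
  apply: (@holomorphic_at_eq R (fun z => (z - z0) * (D z)^-1)); last exact: (holomorphic_atM zh (@holomorphic_atV R D z0 D0 Dh)).
  have nn := near_and (near_neq0 (holomorphic_at_ccont Dh) D0) (near_and fE domQ).
  apply: near_imp nn => z [zD [zf [zd zE]]]; have [->|za] := eqVneq z z0.
    by rewrite cinv0 HX_Q subrr mul0r.
  have zn : z - z0 != 0 by rewrite subr_eq0.
  rewrite (HX_off _ (offQ z za zE)) (fXE zd) zE zf.
  have -> : h z / (z - z0) - u = D z / (z - z0) by rewrite /D mulrBl mulfK.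
  by rewrite invfM invrK mulrC.
have := HXc P Q; rewrite HX_Q (HX_off _ PQ) => /eqP; rewrite invr_eq0 subr_eq0 => /eqP fP.
by case: (avoid P).
Qed.

End SimplePole.
End Form.
End GenusOne.

                                           

(** * Existence of extremal nodes *)

Section Nodes.
Variable R : realType.

Lemma closed_lefun (T : topologicalType) (f g : T -> R) :
  continuous f -> continuous g -> closed [set x | f x <= g x].
Proof.
move=> cf cg.
rewrite (_ : [set x | f x <= g x] = (fun x => g x - f x) @^-1` [set y | 0 <= y]); last first.
  by apply/seteqP; split => x /=; rewrite subr_ge0.
by apply: closed_comp; [move=> x _; apply: cvgB; [exact: cg|exact: cf]|exact: closed_ge].
Qed.

Section RealContinuity.
Variable T : topologicalType.
Implicit Types f g : T -> R.

Lemma continuous_funM f g : continuous f -> continuous g -> continuous (fun x => f x * g x).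
Proof. by move=> cf cg x; apply: cvgM; [exact: cf|exact: cg]. Qed.

Lemma continuous_funB f g : continuous f -> continuous g -> continuous (fun x => f x - g x).
Proof. by move=> cf cg x; apply: cvgB; [exact: cf|exact: cg]. Qed.

Lemma continuous_funD f g : continuous f -> continuous g -> continuous (fun x => f x + g x).
Proof. by move=> cf cg x; apply: cvgD; [exact: cf|exact: cg]. Qed.

Lemma continuous_fun_norm f : continuous f -> continuous (fun x => `|f x|).
Proof. by move=> cf x; apply: cvg_norm; exact: cf. Qed.

Lemma continuous_funV f : (forall x, f x != 0) -> continuous f -> continuous (fun x => (f x)^-1).
Proof. by move=> f0 cf x; apply: cvgV; [exact: f0|exact: cf]. Qed.

Lemma continuous_fun_max f g : continuous f -> continuous g -> continuous (fun x => Num.max (f x) (g x)).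
Proof. by move=> cf cg x; exact: (continuous_max (cf x) (cg x)). Qed.

Lemma continuous_fun_comp f (h : R -> R) : continuous f -> continuous h -> continuous (fun x => h (f x)).
Proof. by move=> cf ch x; apply: (cvg_comp _ _ (cf x)); exact: ch. Qed.

Lemma continuous_fun_cst (c : R) : continuous (fun _ : T => c).
Proof. by move=> x; exact: cvg_cst. Qed.

Lemma continuous_fun_sum (I : Type) (r : seq I) (P : pred I) (F : I -> T -> R) :
  (forall i, P i -> continuous (F i)) -> continuous (fun x => \sum_(i <- r | P i) F i x).
Proof.
move=> cF; elim: r => [|i r IH].
  rewrite (_ : (fun x => _) = (fun=> 0)); first exact: continuous_fun_cst.
  by apply/funext => x; rewrite big_nil.
have [Pi|Pi] := boolP (P i); last first.
  rewrite (_ : (fun x => _) = (fun x => \sum_(j <- r | P j) F j x)) //.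
  by apply/funext => x; rewrite big_cons (negbTE Pi).
rewrite (_ : (fun x => _) = (fun x => F i x + \sum_(j <- r | P j) F j x)).
  by apply: continuous_funD => //; exact: cF.
by apply/funext => x; rewrite big_cons Pi.
Qed.

Lemma continuous_fun_prod (I : Type) (r : seq I) (P : pred I) (F : I -> T -> R) :
  (forall i, P i -> continuous (F i)) -> continuous (fun x => \prod_(i <- r | P i) F i x).
Proof.
move=> cF; elim: r => [|i r IH].
  rewrite (_ : (fun x => _) = (fun=> 1)); first exact: continuous_fun_cst.
  by apply/funext => x; rewrite big_nil.
have [Pi|Pi] := boolP (P i); last first.
  rewrite (_ : (fun x => _) = (fun x => \prod_(j <- r | P j) F j x)) //.
  by apply/funext => x; rewrite big_cons (negbTE Pi).
rewrite (_ : (fun x => _) = (fun x => F i x * \prod_(j <- r | P j) F j x)).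
  by apply: continuous_funM => //; exact: cF.
by apply/funext => x; rewrite big_cons Pi.
Qed.

End RealContinuity.

Section Minimiser.
Variables (d : nat) (sig : R -> R).
Hypothesis d_gt0 : (0 < d)%N.
Hypothesis sig_cont : continuous sig.
Hypothesis sig_gt0 : forall u, 0 <= u <= 1 -> 0 < sig u.

Definition node_config (u : 'I_d.+1 -> R) :=
  [/\ u ord0 = 0, u ord_max = 1 & forall i j : 'I_d.+1, (i < j)%N -> u i < u j].

Definition node_coef (u : 'I_d.+1 -> R) i : R := sig (u i) * \prod_(j | j != i) `|u i - u j|^-1.
(** By Lagrange's formula for the leading coefficient, the inverse of the energy is the amplitude of
    the monic polynomial of degree d alternating, relative to the weight, at these nodes. *)
Definition node_energy u := \sum_i node_coef u i.

Lemma node_itv u i : node_config u -> 0 <= u i <= 1.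
Proof.
move=> [u0 u1 um]; apply/andP; split.
  have [->|i0] := eqVneq i ord0; first by rewrite u0.
  by rewrite -u0 ltW // um //= lt0n.
have [->|i0] := eqVneq i ord_max; first by rewrite u1.
by rewrite -u1 ltW // um //= ltn_neqAle -ltnS ltn_ord andbT.
Qed.

Lemma node_neq u i j : node_config u -> i != j -> u i != u j.
Proof.
move=> [_ _ um]; rewrite neq_ltn => /orP[/um h|/um h]; first by rewrite lt_eqF.
by rewrite gt_eqF.
Qed.

Lemma node_dist u i j : node_config u -> i != j -> 0 < `|u i - u j| <= 1.
Proof.
move=> H ij; rewrite normr_gt0 subr_eq0 node_neq //= ler_norml.
by have := node_itv i H; have := node_itv j H; lra.
Qed.

Lemma node_coef_gt0 u i : node_config u -> 0 < node_coef u i.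
Proof.
move=> H; rewrite mulr_gt0 //; first by apply: sig_gt0; exact: node_itv.
rewrite prodr_gt0 // => j ji; rewrite invr_gt0.
by rewrite eq_sym in ji; have /andP[] := node_dist H ji.
Qed.

Lemma node_coef_lower u i j s : node_config u -> i != j -> s <= sig (u i) -> 0 <= s ->
  s / `|u i - u j| <= node_coef u i.
Proof.
move=> H ij hs s0; rewrite /node_coef (bigD1 j) //= 1?eq_sym // mulrA.
have /andP[h1 h2] := node_dist H ij.
apply: (@le_trans _ _ (sig (u i) / `|u i - u j|)).
  by rewrite ler_wpM2r // invr_ge0 ltW.
rewrite ler_peMr ?divr_ge0 // ?(le_trans s0 hs) //.
apply: (big_ind (fun x => 1 <= x)) => // [x y x1 y1|l /andP[li _]].
  by rewrite -[1]mulr1 ler_pM.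
by rewrite eq_sym in li; have /andP[h3 h4] := node_dist H li; rewrite invf_ge1.
Qed.

Lemma node_energy_ge0 u i : node_config u -> node_coef u i <= node_energy u.
Proof.
move=> H; rewrite /node_energy (bigD1 i) //= lerDl sumr_ge0 // => j _.
by rewrite ltW // node_coef_gt0.
Qed.

(** The energy blows up when two nodes approach each other, so it suffices to minimise over the
    compact set of configurations with gaps at least [del]. *)
Lemma node_minimiser : exists2 u, node_config u &
  forall u', node_config u' -> node_energy u <= node_energy u'.
Proof.
pose ref (i : 'I_d.+1) : R := i%:R / d%:R.
have dR : 0 < d%:R :> R by rewrite ltr0n.
have ref_conf : node_config ref.
  split; rewrite /ref /= ?mul0r ?divff ?gt_eqF // => i j ij.
  by rewrite ltr_pM2r ?invr_gt0 // ltr_nat.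
have [m m01 Hm] := @EVT_min R sig 0 1 ler01 (continuous_subspaceT sig_cont).
have m0 : 0 < sig m by apply: sig_gt0; move: m01; rewrite in_itv.
have {}Hm u : 0 <= u <= 1 -> sig m <= sig u by move=> h; apply: Hm; rewrite in_itv.
have e0 : 0 <= node_energy ref.
  by rewrite /node_energy sumr_ge0 // => i _; rewrite ltW // node_coef_gt0.
(* The second bound makes a pair of nodes closer than [del] cost more than the reference
   configuration; the first keeps that configuration admissible. *)
pose del := Num.min (d%:R^-1) (sig m / (node_energy ref + 1)).
have del0 : 0 < del by rewrite lt_min invr_gt0 dR divr_gt0 // ltr_wpDl.
pose gap (u : 'I_d.+1 -> R) := forall i j : 'I_d.+1, (i < j)%N -> u i + del <= u j.
have nogap u : node_config u -> ~ gap u -> node_energy ref <= node_energy u.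
  move=> Hu /existsNP[i /existsNP[j /not_implyP[ij /negP]]]; rewrite -ltNge => hij.
  have ijn : i != j by rewrite neq_ltn ij.
  apply: le_trans (node_energy_ge0 i Hu).
  apply: le_trans (node_coef_lower Hu ijn (Hm _ (node_itv i Hu)) (ltW m0)).
  have /andP[h1 h2] := node_dist Hu ijn.
  rewrite ler_pdivlMr //.
  have : `|u i - u j| <= sig m / (node_energy ref + 1).
    have [_ _ um] := Hu; have := um i j ij => lij.
    rewrite ltr0_norm ?subr_lt0 // opprB; apply: (@le_trans _ _ del); first lra.
    by rewrite ge_min lexx orbT.
  rewrite ler_pdivlMr ?ltr_wpDl //; nra.
(* The energy with distances truncated below at [del]: continuous everywhere, and unchanged on the
   compact set. *)
pose Phi (v : 'rV[R]_d.+1) := \sum_i (sig (v ord0 i) *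
   \prod_(j | j != i) (Num.max `|v ord0 i - v ord0 j| del)^-1).
have PhiE (v : 'rV[R]_d.+1) : gap (fun i => v ord0 i) -> Phi v = node_energy (fun i => v ord0 i).
  move=> gv; apply: eq_bigr => i _; congr (_ * _); apply: eq_bigr => j ji.
  congr (_^-1); apply/max_idPl; move: ji; rewrite neq_ltn => /orP[/gv h|/gv h].
    by rewrite (le_trans _ (ler_norm _)) //; lra.
  by rewrite distrC (le_trans _ (ler_norm _)) //; lra.
have cc i : continuous (fun v : 'rV[R]_d.+1 => v ord0 i) by exact: coord_continuous.
have cPhi : continuous Phi.
  apply: continuous_fun_sum => i _; apply: continuous_funM.
    exact: (continuous_fun_comp (cc i) sig_cont).
  apply: continuous_fun_prod => j _; apply: continuous_funV.
    by move=> v; rewrite gt_eqF // lt_max del0 orbT.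
  apply: continuous_fun_max; last exact: continuous_fun_cst.
  by apply: continuous_fun_norm; apply: continuous_funB.
pose K : set 'rV[R]_d.+1 := [set v | v ord0 ord0 <= 0] `&` [set v | 1 <= v ord0 ord_max] `&`
   (\bigcap_(p in [set p : 'I_d.+1 * 'I_d.+1 | (p.1 < p.2)%N]) [set v | v ord0 p.1 + del <= v ord0 p.2]).
pose cube := [set v : 'rV[R]_d.+1 | forall i, `[0 : R, 1]%classic (v ord0 i)].
have ccube : compact cube by apply: (@rV_compact _ _ (fun=> `[0 : R, 1]%classic)) => i; exact: segment_compact.
have clK : closed K.
  apply: closedI; first apply: closedI.
  - by apply: closed_lefun; [exact: cc|exact: continuous_fun_cst].
  - by apply: closed_lefun; [exact: continuous_fun_cst|exact: cc].
  - apply: closed_bigI => -[i j] _; apply: closed_lefun => /=; last exact: cc.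
    by apply: continuous_funD; [exact: cc|exact: continuous_fun_cst].
have cK : compact (cube `&` K) by exact: compact_closedI.
have refgap : gap ref.
  move=> i j ij; rewrite /ref; have : del <= d%:R^-1 by rewrite ge_min lexx.
  have : (i.+1)%:R / d%:R <= j%:R / d%:R :> R by rewrite ler_pM2r ?invr_gt0 // ler_nat.
  by rewrite -natr1 mulrDl mul1r; lra.
have memK u : node_config u -> gap u -> (cube `&` K) (\row_i u i).
  move=> Hu gu; split.
    by move=> i; rewrite mxE /= in_itv; exact: node_itv.
  have [u0 u1 um] := Hu; split; first by split; rewrite /= mxE ?u0 ?u1.
  by move=> [i j] /= ij; rewrite !mxE; exact: gu.
have [v vK Hv] := @EVT_min_rV R _ Phi (cube `&` K) (ex_intro _ _ (memK _ ref_conf refgap)) cK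
   (continuous_subspaceT cPhi).
move: vK; rewrite inE => -[vc [[/= v0 v1] vg]].
have vgap : gap (fun i => v ord0 i) by move=> i j ij; exact: (vg (i, j)).
have vconf : node_config (fun i => v ord0 i).
  split.
  - by apply/le_anti; rewrite v0; have := vc ord0; rewrite /= in_itv => /andP[].
  - by apply/le_anti; rewrite v1 andbT; have := vc ord_max; rewrite /= in_itv => /andP[].
  - by move=> i j /vgap; apply: lt_le_trans; rewrite ltrDl.
have vmin u : node_config u -> gap u -> node_energy (fun i => v ord0 i) <= node_energy u.
  move=> Hu gu; rewrite -PhiE //.
  have := Hv (\row_i u i); rewrite inE => /(_ (memK u Hu gu)).
  rewrite [in X in _ <= X -> _]PhiE.
    by rewrite (_ : (fun i => _) = u) //; apply/funext => i; rewrite mxE.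
  by move=> i j ij; rewrite !mxE; exact: gu.
exists (fun i => v ord0 i) => // u Hu.
have [gu|ngu] := pselect (gap u); first exact: vmin.
exact: le_trans (vmin _ ref_conf refgap) (nogap u Hu ngu).
Qed.

End Minimiser.
End Nodes.

(** * Lagrange interpolation and the leading coefficient *)

Section Lagrange.
Variables (F : fieldType) (d : nat).
Implicit Types (v : 'I_d.+1 -> F) (Q : {poly F}).

Definition lagr_poly v i : {poly F} := \prod_(j | j != i) ('X - (v j)%:P).

Lemma lagr_poly_monic v i : lagr_poly v i \is monic.
Proof. exact: monic_prod_XsubC. Qed.

Lemma size_lagr_poly v i : size (lagr_poly v i) = d.+1.
Proof.
rewrite /lagr_poly -big_filter size_prod_XsubC.
congr _.+1; have := cardC1 i; rewrite card_ord cardE /enum_mem /= => h.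
by rewrite -[RHS]h !size_filter [index_enum _]unlock; apply: eq_count.
Qed.

Lemma lagr_poly_eval v i l : injective v ->
  (lagr_poly v i).[v l] = if l == i then \prod_(j | j != i) (v i - v j) else 0.
Proof.
move=> vi; rewrite horner_prod; case: eqVneq => [->|li].
  by apply: eq_bigr => j _; rewrite !hornerE.
by rewrite (bigD1 l) //= !hornerE subrr mul0r.
Qed.

Definition interpol v (y : 'I_d.+1 -> F) : {poly F} :=
  \sum_i (y i * \prod_(j | j != i) (v i - v j)^-1) *: lagr_poly v i.

Lemma size_interpol v y : (size (interpol v y) <= d.+1)%N.
Proof.
apply: (leq_trans (size_sum _ _ _)); apply/bigmax_leqP => i _.
by rewrite (leq_trans (size_scale_leq _ _)) // size_lagr_poly.
Qed.

Lemma interpol_eval v y i : injective v -> (interpol v y).[v i] = y i.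
Proof.
move=> vi; rewrite horner_sum (bigD1 i) //= [X in _ + X]big1 => [|j ji].
  rewrite addr0 hornerZ lagr_poly_eval // eqxx /= -mulrA prodfV mulVf ?mulr1 //.
  by apply/prodf_neq0 => j ji; rewrite subr_eq0 (inj_eq vi) eq_sym.
by rewrite hornerZ lagr_poly_eval // eq_sym (negbTE ji) mulr0.
Qed.

Lemma interpol_lead v y : (interpol v y)`_d = \sum_i y i * \prod_(j | j != i) (v i - v j)^-1.
Proof.
rewrite coef_sum; apply: eq_bigr => i _; rewrite coefZ.
have := lagr_poly_monic v i; rewrite monicE lead_coefE size_lagr_poly /= => /eqP ->.
by rewrite mulr1.
Qed.

Lemma interpol_uniq v Q : injective v -> (size Q <= d.+1)%N -> Q = interpol v (fun i => Q.[v i]).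
Proof.
move=> vi sQ; apply/eqP; rewrite -subr_eq0; apply/eqP.
apply: (@roots_geq_poly_eq0 _ _ (map v (enum 'I_d.+1))).
- apply/allP => _ /mapP[i _ ->].
  by rewrite rootE !hornerE interpol_eval // subrr.
- by rewrite map_inj_uniq // enum_uniq.
- rewrite size_map size_enum_ord; apply: (leq_trans (size_polyD _ _)).
  by rewrite size_polyN geq_max sQ size_interpol.
Qed.

Lemma lagrange_lead v Q : injective v -> (size Q <= d.+1)%N ->
  Q`_d = \sum_i Q.[v i] * \prod_(j | j != i) (v i - v j)^-1.
Proof. by move=> vi sQ; rewrite {1}(interpol_uniq vi sQ) interpol_lead. Qed.

End Lagrange.

Lemma sum_ltn i n : (\sum_(j < n) (i < j)%N = n - i.+1)%N.
Proof.
elim: n => [|n IH]; first by rewrite big_ord0.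
by rewrite big_ord_recr /= IH; case: ltnP => h /=; lia.
Qed.

(** * Weighted equioscillating polynomials *)

Section Equioscillation.
Variable R : realType.
Variables (d : nat) (sig : R -> R).
Hypothesis d_gt0 : (0 < d)%N.
Hypothesis sig_cont : continuous sig.
Hypothesis sig_gt0 : forall u, 0 <= u <= 1 -> 0 < sig u.

Lemma node_inj (u : 'I_d.+1 -> R) : node_config u -> injective u.
Proof.
move=> H i j; apply: contra_eq => ij; exact: node_neq.
Qed.

(** Exactly the d - i nodes to the right of u_i give negative factors. *)
Lemma node_sign (u : 'I_d.+1 -> R) i : node_config u ->
  \prod_(j | j != i) (u i - u j)^-1 = (-1) ^+ (d - i) * \prod_(j | j != i) `|u i - u j|^-1.
Proof.
move=> [_ _ um].
have -> : (d - i)%N = (\sum_(j < d.+1 | j != i) (i < j)%N)%N.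
  by have := sum_ltn i d.+1; rewrite (bigD1 i) //= ltnn subSS => <-.
rewrite expr_sum -big_split /=; apply: eq_bigr => j; rewrite neq_ltn => /orP[ji|ij].
  rewrite ltnNge (ltnW ji) /= expr0 mul1r gtr0_norm ?subr_gt0 //; exact: um.
by rewrite ij expr1 ltr0_norm ?subr_lt0 ?um // invrN mulN1r opprK.
Qed.

(** Q interpolates alternating values of size eps times the weight at the minimising nodes, with eps
    the inverse of the energy, so it is monic. If an inner node is moved to v, Lagrange's formula at
    the new nodes and minimality of the energy bound |Q v| by eps sig v. *)
Lemma equioscillation : exists (u : 'I_d.+1 -> R) (Q : {poly R}) (eps : R),
  [/\ node_config u, 0 < eps, Q \is monic & size Q = d.+1] /\
  (forall i : 'I_d.+1, Q.[u i] = (-1) ^+ (d - i) * (eps * sig (u i))) /\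
  (forall i : 'I_d.+1, (0 < i < d)%N -> exists2 r, 0 < r &
     forall v, `|v - u i| < r -> Q.[v] ^+ 2 <= (eps * sig v) ^+ 2).
Proof.
have [u Hu umin] := node_minimiser d_gt0 sig_cont sig_gt0.
set Phi := node_energy sig u in umin.
have Phi0 : 0 < Phi.
  apply: lt_le_trans (node_energy_ge0 sig_gt0 ord0 Hu); exact: node_coef_gt0.
pose eps := Phi^-1; have eps0 : 0 < eps by rewrite invr_gt0.
pose y (i : 'I_d.+1) := (-1) ^+ (d - i) * (eps * sig (u i)).
pose Q := interpol u y.
have Qe i : Q.[u i] = y i by apply: interpol_eval; exact: node_inj.
have ss n (a b : R) : ((-1) ^+ n * a) * ((-1) ^+ n * b) = a * b.
  by rewrite mulrACA -exprMn mulrNN mulr1 expr1n mul1r.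
have Ql : Q`_d = 1.
  rewrite interpol_lead -[RHS](mulVf (lt0r_neq0 Phi0)) [in RHS]/Phi /node_energy mulr_sumr.
  by apply: eq_bigr => i _; rewrite (node_sign i Hu) /y ss mulrA.
have sQ : size Q = d.+1.
  apply/anti_leq; rewrite size_interpol /= ltnNge; apply/negP => h.
  by move: Ql; rewrite nth_default // => /eqP; rewrite eq_sym oner_eq0.
have mQ : Q \is monic by rewrite monicE lead_coefE sQ /= Ql.
exists u, Q, eps; split; first by split.
split=> [//|i /andP[i0 id]].
have [r r0 Hr] : exists2 r, 0 < r & forall j, j != i -> r <= `|u i - u j|.
  exists (\big[Num.min/1]_(j | j != i) `|u i - u j|).
    apply: (big_ind (fun x => 0 < x)) => // [a b a0 b0|j ji]; first by rewrite lt_min a0.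
    by rewrite normr_gt0 subr_eq0 node_neq // eq_sym.
  by move=> j ji; apply: bigmin_le_cond.
(* The variational argument bounds a signed value from above; knowing that it is nonnegative near
   the node gives the bound on the square. *)
have Qpos : exists2 r', 0 < r' & forall v, `|v - u i| < r' -> 0 <= (-1) ^+ (d - i) * Q.[v].
  have sp : 0 < (-1) ^+ (d - i) * Q.[u i].
    rewrite Qe /y mulrA -exprD addnn -mul2n exprM sqrrN expr1n expr1n mul1r.
    by rewrite mulr_gt0 // sig_gt0 // node_itv.
  have c : continuous (fun v => (-1) ^+ (d - i) * Q.[v]).
    by apply: continuous_funM; [exact: continuous_fun_cst|exact: continuous_horner].
  have /cvgrPdist_lt /(_ _ sp) /nbhs_ballP[r' r'0 H] := c (u i).
  exists r' => // v hv; have := H v; rewrite /ball /= distrC => /(_ hv).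
  by rewrite ltr_norml => /andP[_ h]; lra.
have [r' r'0 Hr'] := Qpos.
exists (Num.min r r'); first by rewrite lt_min r0.
move=> v; rewrite lt_min => /andP[hv hv'].
pose u' j := if j == i then v else u j.
have u'c : node_config u'.
  have [u0 u1 um] := Hu; split; rewrite /u'.
  - by rewrite ifN // neq_ltn /= i0.
  - by rewrite ifN // neq_ltn /= id orbT.
  move=> j l jl; move: hv; rewrite ltr_norml => /andP[hv1 hv2].
  case: (eqVneq j i) => [ji|ji]; case: (eqVneq l i) => [li|li]; last exact: um.
  - by move: jl; rewrite ji li ltnn.
  - have := Hr l li; rewrite ji in jl; have := um _ _ jl => h.
    by rewrite ltr0_norm ?subr_lt0 //; lra.
  - have := Hr j ji; rewrite li in jl; have := um _ _ jl => h.
    by rewrite gtr0_norm ?subr_gt0 //; lra.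
have E := lagrange_lead (node_inj u'c) (eq_leq sQ).
have v01 : 0 <= v <= 1 by have := node_itv i u'c; rewrite /u' eqxx.
(* The nodes other than i keep their interpolated values. The energy at the new nodes is at least
   1/eps, so the last quotient is at most eps. *)
have {}E : 1 = eps * (node_energy sig u' - node_coef sig u' i)
    + ((-1) ^+ (d - i) * Q.[v]) / sig v * node_coef sig u' i.
  rewrite -{1}Ql E (bigD1 i) //= addrC; congr (_ + _).
    rewrite /node_energy [in RHS](bigD1 i) //= [X in X - _]addrC addrK mulr_sumr.
    apply: eq_bigr => j ji; rewrite (node_sign j u'c) {1}/u' (negbTE ji) Qe /y ss mulrA.
    by rewrite /node_coef; congr (_ * sig _ * _); rewrite /u' (negbTE ji).
  have u'i : u' i = v by rewrite /u' eqxx.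
  rewrite (node_sign i u'c) /node_coef; set p := \prod_(_ | _) _; set sg := (-1) ^+ _.
  by rewrite u'i; field; rewrite gt_eqF // sig_gt0.
have c0 := node_coef_gt0 sig_gt0 i u'c.
have sv := sig_gt0 v01.
have kk : (-1) ^+ (d - i) * Q.[v] <= eps * sig v.
  rewrite -ler_pdivrMr // -subr_ge0 -(pmulr_lge0 _ c0).
  have := umin _ u'c; rewrite -/Phi -(ler_pM2l eps0) mulVf ?lt0r_neq0 //.
  lra.
have := Hr' v hv'; set q := _ * Q.[v] in kk * => q0.
have -> : Q.[v] ^+ 2 = q ^+ 2.
  by rewrite /q exprMn -exprM mulnC exprM sqrrN expr1n expr1n mul1r.
by rewrite lerXn2r // nnegrE // mulr_ge0 // ltW.
Qed.

End Equioscillation.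

From mathcomp Require polyrcf.

(** * Real polynomials: sign changes and reversal *)

Section PolyFacts.
Variable R : rcfType.
Implicit Types p q : {poly R}.

Lemma sign_change_root p a b : a < b -> p.[a] * p.[b] < 0 ->
  exists2 x, a < x < b & root p x.
Proof.
by move=> ab h; have [x hx rx] := polyrcf.poly_ivtoo (ltW ab) h; exists x; rewrite ?in_itv in hx *.
Qed.

Lemma poly_eq_off0 p q : (forall x, x != 0 -> p.[x] = q.[x]) -> p = q.
Proof.
move=> H; apply/eqP; rewrite -subr_eq0; apply/eqP.
apply: (@roots_geq_poly_eq0 _ _ [seq i.+1%:R | i <- iota 0 (size (p - q))]).
- apply/allP => _ /mapP[i _ ->]; have i0 : i.+1%:R != 0 :> R by rewrite pnatr_eq0.
  by rewrite rootE hornerD hornerN H // subrr.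
- by rewrite map_inj_uniq ?iota_uniq // => i j /eqP; rewrite eqr_nat => /eqP[].
- by rewrite size_map size_iota.
Qed.

Definition revp N p : {poly R} := \poly_(i < N.+1) p`_(N - i).

Lemma revpE N p x : (size p <= N.+1)%N -> x != 0 -> (revp N p).[x] = x ^+ N * p.[x^-1].
Proof.
move=> sp x0; rewrite horner_poly (horner_coef_wide _ sp) mulr_sumr.
rewrite (reindex_inj rev_ord_inj) /=; apply: eq_bigr => i _.
have iN : (i <= N)%N by rewrite -ltnS.
rewrite subSS subKn // mulrCA; congr (_ * _).
by rewrite -[X in _ = x ^+ X * _](subnK iN) exprD exprVn mulfK // expf_neq0.
Qed.

End PolyFacts.

(** * Real solutions of the norm equation *)

Section AlternationPolys.
Variable R : realType.
Variables (g d n : nat) (b : 'I_n -> nat).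
Hypothesis g_gt0 : (0 < g)%N.
Hypothesis d_gt0 : (0 < d)%N.
Hypothesis b_sum : (\sum_i b i = 2 * (g + d))%N.

Let M := (g + d)%N.
(** The roots of W are spread geometrically along the negative axis, so that between them |W| is
    still comparable with its value at 0. *)
Let t (j : nat) : R := - 9 ^+ j.+1.
Let W : {poly R} := \prod_(j < g) ('X - (t j)%:P).
(** The roots of P lie so far to the right that P at most doubles from 0 to -2 9^g. *)
Let X0 : R := 8 * M%:R * 9 ^+ g.
Let xi (i : 'I_n) : R := X0 + i.+1%:R.
Let P : {poly R} := \prod_(i < n) ((xi i)%:P - 'X) ^+ b i.

Let M_gt0 : 0 < M%:R :> R. Proof. by rewrite ltr0n addn_gt0 g_gt0. Qed.
Let p9_gt0 k : 0 < 9 ^+ k :> R. Proof. by rewrite exprn_gt0. Qed.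
Let X0_gt0 : 0 < X0. Proof. by rewrite !mulr_gt0. Qed.
Let xi_gt1 i : 1 < xi i.
Proof. by rewrite /xi -natr1; have : 0 <= i%:R :> R by []; have := X0_gt0; lra. Qed.
Let WE x : W.[x] = \prod_(j < g) (x + 9 ^+ j.+1).
Proof. by rewrite horner_prod; apply: eq_bigr => j _; rewrite !hornerE /t opprK. Qed.
Let PE x : P.[x] = \prod_(i < n) (xi i - x) ^+ b i.
Proof. by rewrite horner_prod; apply: eq_bigr => j _; rewrite horner_exp !hornerE. Qed.
Let P_gt0 x : x <= 1 -> 0 < P.[x].
Proof.
move=> x1; rewrite PE prodr_gt0 // => i _; rewrite exprn_gt0 // subr_gt0.
exact: le_lt_trans (xi_gt1 i).
Qed.
Let W0_gt0 : 0 < W.[0].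
Proof. by rewrite WE prodr_gt0 // => j _; rewrite add0r. Qed.
Let W_ge x : 0 <= x -> W.[0] <= W.[x].
Proof.
by move=> x0; rewrite !WE; apply: ler_prod => j _; rewrite add0r ltW //= lerDr.
Qed.

(** Factors with j < i only help. The others are 9^(j+1)(1 - 2 9^(i-j-1)), and the term 9^-(m-i)/4
    carried in the induction keeps their product above 3/4. *)
Let W_sep i : (3 / 4) * W.[0] <= `|W.[- 2 * 9 ^+ i]|.
Proof.
rewrite !WE normr_prod.
suff H m : (if (m <= i)%N then 1 else 3 / 4 + 4^-1 * (9 ^+ (m - i))^-1) * (\prod_(j < m) (0 + 9 ^+ j.+1))
    <= \prod_(j < m) `|- 2 * 9 ^+ i + 9 ^+ j.+1| :> R.
  apply: le_trans (H g); rewrite ler_wpM2r //.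
    by rewrite prodr_ge0 // => j _; rewrite add0r ltW.
  by case: ifP => _; [lra|rewrite lerDl mulr_ge0 // invr_ge0 ltW].
elim: m => [|m IH]; first by rewrite !big_ord0 leq0n mulr1.
rewrite !big_ord_recr /= add0r.
set A := \prod_(i0 < m) _ in IH *; set B := \prod_(i0 < m) _ in IH *.
have A0 : 0 <= A by rewrite /A prodr_ge0 // => j _; rewrite add0r ltW.
have [mi|im] := ltnP m i.
  rewrite (ltnW mi) mul1r in IH; rewrite mul1r ler_pM //.
  rewrite -normrN; apply: le_trans (ler_norm _).
  have : 9 ^+ m.+1 <= 9 ^+ i :> R by rewrite ler_weXn2l // ler1n.
  by have := p9_gt0 i; lra.
have [k mE] : exists k, m = (i + k)%N by exists (m - i)%N; rewrite subnKC.
have e1 : (m.+1 - i)%N = k.+1 by rewrite mE -addnS addKn.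
set q := (9 ^+ k : R)^-1.
have q0 : 0 < q by rewrite invr_gt0.
have q1 : q <= 1 by rewrite invf_le1 // exprn_ege1 // ler1n.
have IH' : (3 / 4 + 4^-1 * q) * A <= B.
  move: IH; case: leqP => h.
    have k0 : k = 0%N by lia.
    by rewrite /q k0 expr0 invr1 mulr1 (_ : 3 / 4 + 4^-1 = 1) //; field.
  by rewrite (_ : (m - i)%N = k) // mE addKn.
have -> : (9 ^+ (m.+1 - i) : R)^-1 = q / 9 by rewrite e1 exprS invfM mulrC.
have -> : - 2 * 9 ^+ i + 9 ^+ m.+1 = 9 ^+ m.+1 * (1 - 2 * q / 9) :> R.
  rewrite mE -addnS exprD exprS /q; field; exact: lt0r_neq0.
rewrite ger0_norm; last by rewrite mulr_ge0 ?(ltW (p9_gt0 _)) //; lra.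
have B0 : 0 <= B by apply: le_trans IH'; rewrite mulr_ge0 //; lra.
have K : (3 / 4 + 4^-1 * (q / 9)) * A <= B * (1 - 2 * q / 9).
  apply: (@le_trans _ _ ((3 / 4 + 4^-1 * q) * A * (1 - 2 * q / 9))).
    rewrite mulrAC ler_wpM2r //; nra.
  by rewrite ler_wpM2r //; lra.
rewrite mulrA [leRHS](_ : _ = B * (1 - 2 * q / 9) * 9 ^+ m.+1); last by ring.
by rewrite ler_wpM2r // ltW.
Qed.

(** Each factor grows by at most 1 + 1/(4M), there are 2M of them, and (1 + 1/(4M))^(2M) <= 2. *)
Let P_sep x : - (2 * 9 ^+ g) <= x <= 0 -> P.[x] <= 2 * P.[0].
Proof.
move=> hx; set de : R := (4 * M%:R)^-1.
have de0 : 0 < de by rewrite invr_gt0 mulr_gt0.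
have H i : 0 <= xi i - x <= xi i * (1 + de).
  have h1 : X0 <= xi i by rewrite lerDl.
  have h2 : X0 * de = 2 * 9 ^+ g by rewrite /X0 /de; field; exact: lt0r_neq0.
  have h3 : X0 * de <= xi i * de by rewrite ler_wpM2r // ltW.
  by have := xi_gt1 i; lra.
apply: (@le_trans _ _ ((1 + de) ^+ (2 * M) * P.[0])); last first.
  rewrite ler_wpM2r ?(ltW (P_gt0 ler01)) //.
  suff B m : (m <= 2 * M)%N -> (1 + de) ^+ m <= 1 + 2 * m%:R * de.
    apply: le_trans (B _ (leqnn _)) _; rewrite natrM /de.
    by rewrite le_eqVlt; apply/orP; left; apply/eqP; field; exact: lt0r_neq0.
  elim: m => [|m IH] hm; first by rewrite expr0; lra.
  have {}IH := IH (ltnW hm); rewrite exprSr -natr1.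
  have k1 : 2 * m%:R * de <= 1.
    rewrite /de ler_pdivrMr ?mulr_gt0 // mul1r.
    have : m%:R <= (2 * M)%:R :> R by rewrite ler_nat ltnW.
    by rewrite natrM; lra.
  have : (1 + de) ^+ m * (1 + de) <= (1 + 2 * m%:R * de) * (1 + de).
    by rewrite ler_wpM2r //; lra.
  nra.
rewrite !PE -b_sum expr_sum -big_split /=.
apply: ler_prod => i _; have /andP[h1 h2] := H i.
rewrite exprn_ge0 //= subr0 -exprMn lerXn2r ?nnegrE //.
  by rewrite mulr_ge0 //; have := xi_gt1 i; lra.
by rewrite mulrC.
Qed.

(** Sample points at which (WQ)^2 - eps^2 P will alternate in sign: -2 9^i for m = 2i, and the root
    [t i] of W for m = 2i+1. *)
Let zs (m : nat) : R := - (if odd m then 9 else 2) * 9 ^+ m./2.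

Let zs_decr m : zs m.+1 < zs m.
Proof.
rewrite /zs /=; case: (boolP (odd m)) => om /=.
  rewrite uphalf_half om add1n exprS; have := p9_gt0 m./2; lra.
by rewrite uphalf_half (negbTE om) add0n; have := p9_gt0 m./2; lra.
Qed.

(** On [0,1] this is sqrt(P)/W; the maximum extends it continuously beyond. *)
Let sig (u : R) := Num.sqrt P.[u] / Num.max W.[u] W.[0].

Let sig_cont : continuous sig.
Proof.
have cP : continuous (fun u => P.[u]) by exact: continuous_horner.
have cW : continuous (fun u => W.[u]) by exact: continuous_horner.
apply: continuous_funM; first exact: (continuous_fun_comp cP (@sqrt_continuous R)).
apply: continuous_funV; first by move=> x; rewrite gt_eqF // lt_max W0_gt0 orbT.
by apply: continuous_fun_max => //; exact: continuous_fun_cst.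
Qed.

Let sig_gt0 u : 0 <= u <= 1 -> 0 < sig u.
Proof.
by move=> /andP[u0 u1]; rewrite divr_gt0 ?sqrtr_gt0 ?P_gt0 // lt_max W0_gt0 orbT.
Qed.

Let sigE u : 0 <= u <= 1 -> W.[u] ^+ 2 * sig u ^+ 2 = P.[u].
Proof.
move=> /andP[u0 u1]; rewrite /sig (max_idPl (W_ge u0)) -exprMn mulrC divfK.
  by rewrite sqr_sqrtr // ltW // P_gt0.
by rewrite gt_eqF // (lt_le_trans W0_gt0) // W_ge.
Qed.

(** E = (WQ)^2 - eps^2 P vanishes at every node, doubly at the d-1 inner ones where it stays
    nonpositive nearby, and between consecutive points [zs]. These 2 + 2(d-1) + 2g roots exhaust the
    degree 2(g+d). *)
Lemma alternation_factor : exists (Q B : {poly R}) (eps c : R) (e : nat -> R),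
  [/\ Q \is monic, size Q = d.+1, eps != 0, c != 0 & size B = d] /\
  [/\ forall m, (m < 2 * g)%N -> zs m.+1 < e m < zs m,
      forall x : R, x <= 0 \/ 1 <= x -> Q.[x] != 0,
      forall x y : R, x <= 0 -> y <= 0 -> 0 < Q.[x] * Q.[y],
      forall x : R, x < 0 -> B.[x] != 0 &
      (W * Q) ^+ 2 - eps ^+ 2 *: P =
        c *: ('X * ('X - 1%:P) * \prod_(m < 2 * g) ('X - (e m)%:P) * B ^+ 2)].
Proof.
have [u [Q [eps [[uc eps0 Qm sQ] [Qu Qloc]]]]] := equioscillation d_gt0 sig_cont sig_gt0.
have [u0 u1 umono] := uc.
pose E := (W * Q) ^+ 2 - eps ^+ 2 *: P.
have EE x : E.[x] = W.[x] ^+ 2 * Q.[x] ^+ 2 - eps ^+ 2 * P.[x].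
  by rewrite /E hornerD hornerN hornerZ horner_exp hornerM exprMn.
have Eu i : E.[u i] = 0.
  rewrite EE Qu exprMn -exprM mulnC exprM sqrrN expr1n expr1n mul1r exprMn.
  by rewrite mulrCA sigE ?subrr // node_itv.
have Eloc (i : 'I_d.+1) : (0 < i < d)%N -> exists2 r, 0 < r &
    forall v, `|v - u i| < r -> E.[v] <= 0.
  move=> id; have [r r0 H] := Qloc i id; case/andP: id => i0 id.
  have a0 : 0 < u i by rewrite -u0 umono.
  have a1 : u i < 1 by rewrite -u1 umono.
  exists (Num.min r (Num.min (u i) (1 - u i))); first by rewrite !lt_min r0 a0 subr_gt0.
  move=> v; rewrite !lt_min => /and3P[h1 h2 h3].
  have v01 : 0 <= v <= 1 by move: h2 h3; rewrite !ltr_norml; lra.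
  have := H v h1; rewrite exprMn => h.
  by rewrite EE -(sigE v01); have := ler_wpM2l (sqr_ge0 W.[v]) h; lra.
(* Q changes sign between consecutive nodes, so all its d roots lie in ]0,1[. *)
have Qr (i : 'I_d) : exists x, u (widen_ord (leqnSn d) i) < x < u (lift ord0 i) /\ root Q x.
  have lt_i : (widen_ord (leqnSn d) i < lift ord0 i)%N by rewrite /= /bump leq0n add1n.
  have [||x hx rx] := @sign_change_root R Q (u (widen_ord (leqnSn d) i)) (u (lift ord0 i)); last by exists x.
    exact: umono.
  rewrite !Qu /= /bump leq0n add1n -(subnSK (ltn_ord i)) exprS.
  set s := (-1) ^+ _; have ss : s * s = 1 by rewrite /s -exprD addnn -mul2n exprM sqrrN expr1n expr1n.
  set x := eps * _; set y := eps * _.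
  have x0 : 0 < x by rewrite mulr_gt0 // sig_gt0 // node_itv.
  have y0 : 0 < y by rewrite mulr_gt0 // sig_gt0 // node_itv.
  have -> : -1 * s * x * (s * y) = - (s * s * (x * y)) by ring.
  by rewrite ss mul1r oppr_lt0 mulr_gt0.
have [q Hq] := boolp.choice Qr.
have q01 i : 0 < q i < 1.
  have [/andP[h1 h2] _] := Hq i.
  have /andP[k1 _] := node_itv (widen_ord (leqnSn d) i) uc.
  have /andP[_ k2] := node_itv (lift ord0 i) uc.
  by rewrite (le_lt_trans k1) // (lt_le_trans h2).
have qmono (i j : 'I_d) : (i < j)%N -> q i < q j.
  move=> ij; have [/andP[_ h2] _] := Hq i; have [/andP[h1 _] _] := Hq j.
  apply: (lt_trans h2); apply: le_lt_trans h1.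
  have [->|ne] := eqVneq (lift ord0 i) (widen_ord (leqnSn d) j) => //.
  apply: ltW; apply: umono; rewrite ltn_neqAle /= /bump leq0n add1n ij andbT.
  by apply: contra ne => /eqP h; apply/eqP/val_inj; rewrite /= /bump leq0n add1n.
have QE : Q = \prod_(i < d) ('X - (q i)%:P).
  have := @all_roots_prod_XsubC R Q [seq q i | i <- enum 'I_d].
  rewrite size_map size_enum_ord sQ (eqP Qm) scale1r big_map big_enum => -> //.
    by apply/allP => _ /mapP[i _ ->]; have [] := Hq i.
  rewrite uniq_rootsE map_inj_uniq ?enum_uniq // => i j.
  by apply: contra_eq; rewrite neq_ltn => /orP[/qmono h|/qmono h]; [rewrite lt_eqF|rewrite gt_eqF].
have QEx x : Q.[x] = \prod_(i < d) (x - q i).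
  by rewrite QE horner_prod; apply: eq_bigr => i _; rewrite !hornerE.
have Qn0 x : x <= 0 \/ 1 <= x -> Q.[x] != 0.
  move=> hx; rewrite QEx; apply/prodf_neq0 => i _; rewrite subr_eq0.
  by have := q01 i; case: hx => h h'; [rewrite lt_eqF|rewrite gt_eqF]; lra.
have Qpos x y : x <= 0 -> y <= 0 -> 0 < Q.[x] * Q.[y].
  move=> x0 y0; rewrite !QEx -big_split /=; apply: prodr_gt0 => i _.
  by have := q01 i => h; rewrite nmulr_lgt0; lra.
have Q0 : Q.[0] ^+ 2 <= 1.
  rewrite QEx expr2 -big_split /=.
  suff /andP[] : 0 <= \prod_(i < d) ((0 - q i) * (0 - q i)) <= 1 by [].
  apply: (big_ind (fun x => 0 <= x <= 1)) => [|x y|i _]; first by lra.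
    by move=> /andP[x0 x1] /andP[y0 y1]; rewrite mulr_ge0 // mulr_ile1.
  by have := q01 i => h; nra.
have EP0 : eps ^+ 2 * P.[0] = W.[0] ^+ 2 * Q.[0] ^+ 2.
  by have := Eu ord0; rewrite u0 EE => /eqP; rewrite subr_eq0 => /eqP.
(* At -2 9^i one has W^2 >= (9/16) W(0)^2, Q^2 >= 4 and P <= 2 P(0), while eps^2 P(0) = W(0)^2
   Q(0)^2 <= W(0)^2; and 9/4 > 2. *)
have Es i : (i <= g)%N -> 0 < E.[zs (2 * i)].
  move=> ig; rewrite /zs mul2n odd_double doubleK EE subr_gt0.
  have pi := p9_gt0 i; have ge1 : 1 <= 9 ^+ i :> R by rewrite exprn_ege1 // ler1n.
  have gi : 9 ^+ i <= 9 ^+ g :> R by rewrite ler_weXn2l // ler1n.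
  have h1 := P_sep (x := - 2 * 9 ^+ i) ltac:(by lra).
  have h2 : W.[0] ^+ 2 * (9 / 16) <= W.[- 2 * 9 ^+ i] ^+ 2.
    have e1 : W.[0] ^+ 2 * (9 / 16) = ((3 / 4) * W.[0]) ^+ 2 by field.
    have ws := W_sep i; have p34 : 0 <= 3 / 4 * W.[0] by apply: mulr_ge0; [lra|exact: ltW].
    by rewrite -[leRHS]real_normK ?num_real // e1 lerXn2r ?nnegrE.
  have h3 : 4 <= Q.[- 2 * 9 ^+ i] ^+ 2.
    have e2 : 4 = 2 ^+ 2 :> R by ring.
    rewrite QEx -[leRHS]real_normK ?num_real // e2.
    rewrite lerXn2r ?nnegrE // normr_prod (bigD1 (Ordinal d_gt0)) //= -[2]mulr1 ler_pM //.
      have := q01 (Ordinal d_gt0) => hq; rewrite ltr0_norm; lra.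
    apply: (big_ind (fun x => 1 <= x)) => // [x y x1 y1|j _]; first by rewrite -[1]mulr1 ler_pM.
    by have := q01 j => hq; rewrite ltr0_norm; lra.
  have k1 : eps ^+ 2 * P.[- 2 * 9 ^+ i] <= eps ^+ 2 * (2 * P.[0]) by rewrite ler_wpM2l // sqr_ge0.
  have k2 : W.[0] ^+ 2 * Q.[0] ^+ 2 <= W.[0] ^+ 2 by rewrite ler_piMr // sqr_ge0.
  have k3 : W.[0] ^+ 2 * (9 / 16) * 4 <= W.[- 2 * 9 ^+ i] ^+ 2 * Q.[- 2 * 9 ^+ i] ^+ 2.
    by rewrite ler_pM // mulr_ge0 ?sqr_ge0.
  have k4 : 0 < W.[0] ^+ 2 by rewrite exprn_gt0.
  lra.
have Et j : (j < g)%N -> E.[zs (2 * j).+1] < 0.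
  move=> jg; rewrite /zs /= mul2n odd_double /= uphalf_double.
  have -> : - 9 * 9 ^+ j = t j by rewrite /t exprS mulNr.
  have -> : E.[t j] = - (eps ^+ 2 * P.[t j]).
    rewrite EE (_ : W.[t j] = 0) ?expr0n ?mul0r ?sub0r //.
    rewrite horner_prod (bigD1 (Ordinal jg)) //= !hornerE subrr mul0r //.
  have tneg : t j <= 1 by rewrite /t; have := p9_gt0 j.+1; lra.
  by rewrite oppr_lt0 mulr_gt0 // ?exprn_gt0 // P_gt0.
have Ealt m : (m < 2 * g)%N -> E.[zs m.+1] * E.[zs m] < 0.
  move=> mg; have := odd_double_half m; case: (boolP (odd m)) => om /= hm.
    have -> : m.+1 = (2 * m./2.+1)%N by rewrite -{1}hm -mul2n; lia.
    rewrite -[in E.[zs m]]hm add1n -mul2n pmulr_rlt0; first by apply: Et; lia.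
    by apply: Es; lia.
  rewrite -hm add0n -mul2n nmulr_rlt0; first by apply: Es; lia.
  by apply: Et; lia.
have er m : exists x, (m < 2 * g)%N -> zs m.+1 < x < zs m /\ root E x.
  case: (ltnP m (2 * g)) => mg; last by exists 0.
  by have [x h1 h2] := sign_change_root (zs_decr m) (Ealt m mg); exists x.
have [e He] := boolp.choice er.
have zs_le m l : (m <= l)%N -> zs l <= zs m.
  elim: l => [|l IH]; first by rewrite leqn0 => /eqP ->.
  rewrite leq_eqVlt => /orP[/eqP -> //|]; rewrite ltnS => /IH; apply: le_trans.
  exact/ltW/zs_decr.
have e_neg m : (m < 2 * g)%N -> e m < 0.
  move=> mg; have [/andP[_ h] _] := He m mg; have := zs_le 0%N m (leq0n _).
  have -> : zs 0%N = - 2 by rewrite /zs /= expr0 mulr1.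
  by lra.
have e_decr m l : (l < 2 * g)%N -> (m < l)%N -> e l < e m.
  move=> lg ml; have [/andP[_ h1] _] := He l lg; have [/andP[h2 _] _] := He m (ltn_trans ml lg).
  by apply: (lt_trans h1); apply: le_lt_trans h2; exact: zs_le.
pose un k := u (inord k).
have un_mono k l : (k < l <= d)%N -> un k < un l.
  by move=> /andP[kl ld]; apply: umono; rewrite !inordK // ltnS // ltnW // (leq_trans kl).
have un01 k : (0 < k < d)%N -> 0 < un k < 1.
  move=> /andP[k0 kd]; rewrite -u0 -u1; apply/andP; split; apply: umono; rewrite inordK //= ltnS ltnW //.
pose I := [seq un k | k <- iota 1 d.-1].
have memI z : z \in I -> exists2 k, (0 < k < d)%N & z = un k.
  by move=> /mapP[k]; rewrite mem_iota => hk ->; exists k => //; lia.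
have I01 z : z \in I -> 0 < z < 1 by move=> /memI[k /un01 h ->].
have uI : uniq I.
  rewrite map_inj_in_uniq ?iota_uniq // => k l; rewrite !mem_iota => hk hl.
  apply: contra_eq; rewrite neq_ltn => /orP[kl|kl].
    by rewrite lt_eqF // un_mono //; lia.
  by rewrite gt_eqF // un_mono //; lia.
pose J := [seq e m | m <- index_iota 0 (2 * g)].
have memJ z : z \in J -> exists2 m, (m < 2 * g)%N & z = e m.
  by move=> /mapP[m]; rewrite mem_index_iota /= => hm ->; exists m.
have uJ : uniq J.
  rewrite map_inj_in_uniq ?iota_uniq // => k l; rewrite !mem_index_iota /= => hk hl.
  apply: contra_eq; rewrite neq_ltn => /orP[kl|kl].
    by rewrite gt_eqF // e_decr.
  by rewrite lt_eqF // e_decr.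
pose B : {poly R} := \prod_(z <- I) ('X - z%:P).
pose f : {poly R} := 'X * ('X - 1%:P) * \prod_(m < 2 * g) ('X - (e m)%:P).
have fE x : f.[x] = x * (x - 1) * \prod_(m < 2 * g) (x - e m).
  rewrite !hornerE horner_prod; congr (_ * _); by apply: eq_bigr => m _; rewrite !hornerE.
have fn0 x : 0 < x < 1 -> f.[x] != 0.
  move=> hx; rewrite fE !mulf_neq0 //; [by rewrite gt_eqF; lra|by rewrite subr_eq0 lt_eqF; lra|].
  by apply/prodf_neq0 => m _; rewrite subr_eq0; have h := e_neg m (ltn_ord m); rewrite gt_eqF //; lra.
pose L := 0 :: 1 :: J ++ I.
have LE : \prod_(z <- L) ('X - z%:P) = f * B.
  rewrite /L !big_cons big_cat /= polyC0 subr0 /f /B !mulrA; congr (_ * _ * _).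
  by rewrite big_map big_mkord.
have [G EG] : exists G, E = G * (f * B).
  rewrite -LE; apply: uniq_roots_prod_XsubC.
    rewrite /= all_cat; apply/and4P; split.
    - by have := Eu ord0; rewrite u0 => h; rewrite rootE h.
    - by have := Eu ord_max; rewrite u1 => h; rewrite rootE h.
    - by apply/allP => _ /memJ[m hm ->]; have [] := He m hm.
    - by apply/allP => _ /memI[k hk ->]; rewrite rootE Eu.
  rewrite uniq_rootsE /= cat_uniq uJ uI /= andbT inE !mem_cat !negb_or.
  have nJ z : 0 <= z -> z \notin J.
    by move=> z0; apply: contraTN z0 => /memJ[m /e_neg h ->]; rewrite -ltNge.
  rewrite !nJ // ?ler01 // eq_sym oner_eq0 /=.
  have nI z : (z == 0) || (z == 1) -> z \notin I.
    by move=> hz; apply: contraTN hz => /I01 h; rewrite negb_or gt_eqF ?lt_eqF; lra.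
  rewrite !nI ?eqxx ?orbT //=; apply/hasPn => z /I01 h; apply: nJ; lra.
(* If the root were simple, E would change sign at z and be positive on one side of it, which
   contradicts [Eloc]. *)
have Gu z : z \in I -> root G z.
  move=> zI; apply: contraT => Gz; have [k hk zk] := memI z zI.
  have k_ord : (0 < (inord k : 'I_d.+1) < d)%N by rewrite inordK //; clear -hk; lia.
  have [r r0 Hr] := Eloc (inord k) k_ord.
  pose H := G * f * \prod_(x <- rem z I) ('X - x%:P).
  have EH v : E.[v] = (v - z) * H.[v].
    have -> : E = ('X - z%:P) * H by rewrite EG /B (big_rem z zI) /= /H; ring.
    by rewrite hornerM !hornerE.
  have Hz : H.[z] != 0.
    rewrite /H hornerM [(G * f).[z]]hornerM; apply: mulf_neq0.
      by apply: mulf_neq0; [exact: Gz|apply: fn0; exact: I01].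
    by rewrite -[_ == 0]/(root _ z) root_prod_XsubC mem_rem_uniq // inE eqxx.
  have nz : 0 < `|H.[z]| by rewrite normr_gt0.
  have cH : continuous (fun v => H.[v]) by exact: continuous_horner.
  have /cvgrPdist_lt /(_ _ nz) /nbhs_ballP[r' r'0 Hr'] := cH z.
  pose h := Num.min r r' / 2; have h0 : 0 < h by rewrite divr_gt0 // lt_min r0.
  have hr : h < r by rewrite /h ltr_pdivrMr // (le_lt_trans (_ : _ <= r)) ?ge_min ?lexx //; lra.
  have hr' : h < r' by rewrite /h ltr_pdivrMr // (le_lt_trans (_ : _ <= r')) ?ge_min ?lexx ?orbT //; move: r'0 => /=; lra.
  pose v := z + Num.sg H.[z] * h.
  have vz : `|v - z| = h by rewrite /v addrAC subrr add0r normrM normr_sg Hz mul1r gtr0_norm.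
  have := Hr v; rewrite -[u _]/(un k) -zk vz => /(_ hr).
  have := Hr' v; rewrite /ball /= distrC vz => /(_ hr') h1.
  rewrite EH /v addrAC subrr add0r -/v leNgt => /negP[].
  have [p|p|p] := ltgtP H.[z] 0; last by rewrite p eqxx in Hz.
    rewrite ltr0_sg // mulN1r mulNr oppr_gt0 pmulr_rlt0 //.
    by move: h1; rewrite (ltr0_norm p) ltr_norml => /andP[k1 k2]; lra.
  rewrite gtr0_sg // mul1r mulr_gt0 //.
  by move: h1; rewrite (gtr0_norm p) ltr_norml => /andP[k1 k2]; lra.
have [G2 GE] : exists G2, G = G2 * B.
  by apply: uniq_roots_prod_XsubC; [apply/allP => z /Gu|rewrite uniq_rootsE].
have EE2 : E = G2 * (f * B ^+ 2) by rewrite EG GE; ring.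
have En0 : E != 0.
  apply/negP => /eqP E0; have := Et 0%N g_gt0; rewrite E0 horner0; lra.
have Bm : B \is monic by exact: monic_prod_XsubC.
have fm : f \is monic.
  by rewrite /f !monicMl ?monicX ?monicXsubC // monic_prod_XsubC.
have sB : size B = d.
  by rewrite /B size_prod_XsubC size_map size_iota prednK.
have sf : size f = (2 * g).+3.
  rewrite /f size_monicM ?monicMl ?monicX ?monicXsubC //; last first.
    by rewrite -size_poly_eq0 -(big_mkord xpredT (fun m => 'X - (e m)%:P)) -(big_map e xpredT (fun z => 'X - z%:P)) size_prod_XsubC.
  rewrite size_monicM ?monicX ?polyXsubC_eq0 // size_polyX size_XsubC.
  rewrite -(big_mkord xpredT (fun m => 'X - (e m)%:P)) -(big_map e xpredT (fun z => 'X - z%:P)) size_prod_XsubC.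
  by rewrite size_map size_iota subn0.
have sfB : size (f * B ^+ 2) = (2 * M).+1.
  rewrite size_monicM ?monic_neq0 ?monic_exp // sf expr2 size_monicM ?monic_neq0 // sB /M.
  by clear -d_gt0; lia.
have sE : (size E <= (2 * M).+1)%N.
  rewrite /E (leq_trans (size_polyD _ _)) // geq_max size_polyN; apply/andP; split.
    have Wm : W \is monic by exact: monic_prod_XsubC.
    have sW : size W = g.+1.
      by rewrite /W -(big_mkord xpredT (fun j => 'X - (t j)%:P)) -(big_map t xpredT (fun z => 'X - z%:P)) size_prod_XsubC size_map size_iota subn0.
    have sWQ : size (W * Q) = M.+1 by rewrite size_monicM ?monic_neq0 // sW sQ /M; clear; lia.
    by rewrite expr2 (leq_trans (size_polyMleq _ _)) // sWQ; clear; lia.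
  rewrite (leq_trans (size_scale_leq _ _)) // /P (leq_trans (size_prod_leq _ _)) //.
  rewrite [#|_|](_ : _ = n); last by rewrite -[RHS]card_ord; apply: eq_card.
  have : (\sum_(i < n) size (((xi i)%:P - 'X) ^+ b i) <= \sum_(i < n) (b i + 1))%N.
    apply: leq_sum => i _; rewrite (leq_trans (size_poly_exp_leq _ _)) //.
    have -> : size ((xi i)%:P - 'X) = 2 by rewrite -size_polyN opprB size_XsubC.
    by rewrite mul1n addn1.
  by rewrite big_split /= b_sum sum1_card card_ord /M /= leq_subLR addnS ltnS [(n + _)%N]addnC.
have G20 : G2 != 0 by apply: contraNneq En0 => G20; rewrite EE2 G20 mul0r.
(* f B^2 already has degree 2(g+d), so the cofactor is a constant. *)
have /size_poly1P[c c0 cE] : size G2 == 1%N.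
  have : size E = (size G2 + (2 * M).+1).-1.
    by rewrite EE2 mulrC size_monicM ?sfB 1?addnC // monicMl // monic_exp.
  by move: sE; rewrite -size_poly_gt0 in G20; clear -G20; lia.
exists Q, B, eps, c, e; split; first by split => //; exact: lt0r_neq0.
split => //.
- by move=> m hm; have [] := He m hm.
- move=> x x0; rewrite -[_ == 0]/(root B x) root_prod_XsubC.
  by apply/negP => /I01; lra.
- by rewrite -/E EE2 cE mul_polyC.
Qed.

(** The substitution x -> 1/x in [alternation_factor] sends the root 0 of E to infinity, leaving the
    2g+1 branch points 1 and 1/e_m, and sends the roots of P into ]0,1[. The band is ]1/e_0, 1/e_1[:
    in the old coordinate E has no root between e_1 and e_0, and W changes sign there at -9. *)
Theorem alternation_polys : exists (xs : 'I_n -> R) (es : seq R) (A B : {poly R}) (lam c em ep : R),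
  [/\ [/\ injective xs, uniq es, size es = (2 * g).+1, lam != 0 & c != 0],
    [/\ size A = (g + d).+1, (size B <= d)%N,
      A ^+ 2 - lam *: \prod_(i < n) ('X - (xs i)%:P) ^+ b i =
        c *: (\prod_(e <- es) ('X - e%:P) * B ^+ 2) &
      forall i, xs i \notin es /\ A.[xs i] != 0],
    [/\ em \in es, ep \in es, em < ep & A.[em] * A.[ep] < 0] &
    (forall x, em < x < ep -> (A ^+ 2 - lam *: \prod_(i < n) ('X - (xs i)%:P) ^+ b i).[x] < 0) /\
    (forall i, ~~ (em <= xs i <= ep))].
Proof.
have [Q [B [eps [c [e [[Qm sQ eps0 c0 sB] [ez Qn0 Qpos Bn0 EE]]]]]]] := alternation_factor.
pose E := (W * Q) ^+ 2 - eps ^+ 2 *: P; rewrite -/E in EE.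
have EEx x : E.[x] = W.[x] ^+ 2 * Q.[x] ^+ 2 - eps ^+ 2 * P.[x].
  by rewrite /E hornerD hornerN hornerZ horner_exp hornerM exprMn.
have EFx x : E.[x] = c * (x * (x - 1) * (\prod_(m < 2 * g) (x - e m)) * B.[x] ^+ 2).
  rewrite EE hornerZ 3!hornerM horner_exp horner_prod hornerX hornerXsubC.
  by congr (_ * (_ * _ * _)); apply: eq_bigr => m _; rewrite hornerXsubC.
have zs0 : zs 0%N = - 2 by rewrite /zs /= expr0 mulr1.
have zs1 : zs 1%N = - 9 by rewrite /zs /= expr0 mulr1.
have zs2 : zs 2%N = - 18 by rewrite /zs /= expr1 mulNr -natrM.
have zs_le m l : (m <= l)%N -> zs l <= zs m.
  elim: l => [|l IH]; first by rewrite leqn0 => /eqP ->.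
  rewrite leq_eqVlt => /orP[/eqP -> //|]; rewrite ltnS => /IH; apply: le_trans.
  exact/ltW/zs_decr.
have e_neg m : (m < 2 * g)%N -> e m < - 2.
  by move=> mg; have /andP[_ h] := ez m mg; have := zs_le 0%N m (leq0n _); rewrite zs0; lra.
have e_decr m l : (l < 2 * g)%N -> (m < l)%N -> e l < e m.
  move=> lg ml; have /andP[_ h1] := ez l lg; have /andP[h2 _] := ez m (ltn_trans ml lg).
  by apply: (lt_trans h1); apply: le_lt_trans h2; exact: zs_le.
have g0 : (0 < 2 * g)%N by rewrite muln_gt0.
have g1 : (1 < 2 * g)%N by rewrite mul2n -addnn (leq_add g_gt0 g_gt0).
have he0 := ez 0%N g0; have he1 := ez 1%N g1; rewrite zs0 zs1 in he0; rewrite zs1 zs2 in he1.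
pose xs i := (xi i)^-1.
have xi0 i : 0 < xi i by have := xi_gt1 i; lra.
have xs01 i : 0 < xs i < 1 by rewrite invr_gt0 xi0 invf_lt1 // xi_gt1.
pose es := 1 :: [seq (e m)^-1 | m <- index_iota 0 (2 * g)].
have sWQ : (size (W * Q)%R <= M.+1)%N.
  have sW : size W = g.+1.
    by rewrite /W -(big_mkord xpredT (fun j => 'X - (t j)%:P)) -(big_map t xpredT (fun z => 'X - z%:P)) size_prod_XsubC size_map size_iota subn0.
  by rewrite (leq_trans (size_polyMleq _ _)) // sW sQ addSn addnS.
pose A := revp M (W * Q); pose B' := revp d.-1 B.
have AE x : x != 0 -> A.[x] = x ^+ M * (W.[x^-1] * Q.[x^-1]).
  by move=> x0; rewrite /A revpE // hornerM.
have BE x : x != 0 -> B'.[x] = x ^+ d.-1 * B.[x^-1].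
  by move=> x0; rewrite /B' revpE // sB prednK.
pose lam := eps ^+ 2 * \prod_(i < n) xi i ^+ b i.
have PpE x : x != 0 -> (lam *: \prod_(i < n) ('X - (xs i)%:P) ^+ b i).[x] = x ^+ (2 * M) * (eps ^+ 2 * P.[x^-1]).
  move=> x0; rewrite hornerZ horner_prod PE /lam; set ee := eps ^+ 2.
  rewrite -[LHS]mulrA [RHS]mulrCA; congr (_ * _).
  rewrite -b_sum expr_sum -!big_split /=; apply: eq_bigr => i _.
  rewrite horner_exp !hornerE -!exprMn; congr (_ ^+ _).
  by rewrite /xs; field; rewrite x0 /= lt0r_neq0.
have idE x : x != 0 -> (A ^+ 2 - lam *: \prod_(i < n) ('X - (xs i)%:P) ^+ b i).[x] = x ^+ (2 * M) * E.[x^-1].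
  move=> x0; rewrite hornerD hornerN PpE // horner_exp AE // EEx mulrBr.
  by rewrite exprMn -exprM [(M * 2)%N]mulnC exprMn.
pose c' := - c * \prod_(m < 2 * g) - e m.
have id2 : A ^+ 2 - lam *: \prod_(i < n) ('X - (xs i)%:P) ^+ b i =
    c' *: (\prod_(z <- es) ('X - z%:P) * B' ^+ 2).
  apply: poly_eq_off0 => x x0; rewrite idE // EFx.
  rewrite hornerZ hornerM horner_exp BE // /es big_cons hornerM.
  rewrite big_map big_mkord horner_prod hornerXsubC.
  under [in RHS]eq_bigr do rewrite hornerXsubC.
  have -> : x ^+ (2 * M) = x ^+ 2 * x ^+ (2 * g) * (x ^+ d.-1) ^+ 2.
    by rewrite -exprM -!exprD; congr (_ ^+ _); rewrite /M; clear -d_gt0; lia.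
  have -> : \prod_(i < 2 * g) (x - (e i)^-1) = x ^+ (2 * g) * \prod_(i < 2 * g) (x^-1 - e i) / \prod_(m < 2 * g) - e m.
    rewrite -[x ^+ (2 * g)](_ : \prod_(i < 2 * g) x = _); last by rewrite prodr_const card_ord.
    rewrite -prodfV -!big_split /=; apply: eq_bigr => i _; field.
    by have h := e_neg i (ltn_ord i); rewrite x0 /= lt_eqF //; lra.
  rewrite /c'; set p := \prod_(m < 2 * g) - e m; set s := \prod_(i < 2 * g) (_ - _).
  have p0 : p != 0.
    by apply/prodf_neq0 => i _; rewrite oppr_eq0; have h := e_neg i (ltn_ord i); rewrite lt_eqF //; lra.
  set y := x ^+ (2 * g); set w := x ^+ d.-1; set BB := B.[_].
  by field; rewrite p0 x0.
have c'0 : c' != 0.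
  rewrite mulf_neq0 ?oppr_eq0 //; apply/prodf_neq0 => i _; rewrite oppr_eq0.
  by have h := e_neg i (ltn_ord i); rewrite lt_eqF //; lra.
exists xs, es, A, B', lam, c', (e 0%N)^-1, (e 1%N)^-1.
have e0n : e 0%N < 0 by lra.
have e1n : e 1%N < 0 by lra.
have e10 : e 1%N < e 0%N by lra.
have inv_lt : (e 0%N)^-1 < (e 1%N)^-1 by rewrite ltf_nV2.
split.
- split => //.
  + move=> i j /invr_inj; rewrite /xi => /addrI /eqP; rewrite eqr_nat => /eqP [] /val_inj //.
  + rewrite /es /=; apply/andP; split.
      apply/negP => /mapP[m]; rewrite mem_index_iota /= => hm /esym /eqP.
      by have := e_neg m hm => h; rewrite invr_eq1 => /eqP; lra.
    rewrite map_inj_in_uniq ?iota_uniq // => k l; rewrite !mem_index_iota /= => hk hl /invr_inj.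
    apply: contra_eq; rewrite neq_ltn => /orP[kl|kl].
      by rewrite gt_eqF // e_decr.
    by rewrite lt_eqF // e_decr.
  + by rewrite /es /= size_map size_iota subn0.
  + rewrite mulf_neq0 ?expf_neq0 //; apply/prodf_neq0 => i _; rewrite expf_neq0 //.
    exact: lt0r_neq0.
- split => //.
  + apply: size_poly_eq; rewrite /= subnn -horner_coef0 hornerM; apply: mulf_neq0.
      exact: lt0r_neq0.
    by apply: Qn0; left.
  + by rewrite (leq_trans (size_poly _ _)) // prednK.
  + move=> i; have /andP[h1 h2] := xs01 i; split.
      rewrite /es inE negb_or lt_eqF //=; apply/negP => /mapP[m].
      rewrite mem_index_iota /= => hm; have := e_neg m hm => h h'.
      by move: h1; rewrite h' invr_gt0; lra.
    have xn := lt0r_neq0 h1; rewrite AE // invrK.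
    apply: mulf_neq0; first exact: expf_neq0.
    apply: mulf_neq0; last by apply: Qn0; right; exact: ltW.
    by apply/lt0r_neq0; apply: lt_le_trans W0_gt0 (W_ge _); exact: ltW.
- split => //.
  + by rewrite /es inE; apply/orP; right; apply/mapP; exists 0%N; rewrite ?mem_index_iota.
  + by rewrite /es inE; apply/orP; right; apply/mapP; exists 1%N; rewrite ?mem_index_iota.
  + rewrite !AE ?invr_eq0 ?lt_eqF // !invrK.
    (* Only the factor x + 9 separates e_0 from e_1; the other factors are positive at both, since
       both exceed -18. *)
    have Wn : W.[e 0%N] * W.[e 1%N] < 0.
      rewrite !WE -big_split (bigD1 (Ordinal g_gt0)) //= pmulr_llt0.
        by rewrite expr1 pmulr_rlt0; lra.
      apply: prodr_gt0 => j j0.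
      have : 9 ^+ 2 <= 9 ^+ j.+1 :> R by rewrite ler_weXn2l ?ler1n // ltnS lt0n.
      by rewrite expr2 => h; rewrite mulr_gt0 //; lra.
    have q0 := Qpos (e 0%N) (e 1%N) (ltW e0n) (ltW e1n).
    have k : 0 < (e 0%N)^-1 ^+ M * (e 1%N)^-1 ^+ M.
      by rewrite -exprMn exprn_gt0 // nmulr_rgt0 ?invr_lt0.
    rewrite (_ : _ * _ = ((e 0%N)^-1 ^+ M * (e 1%N)^-1 ^+ M) * (Q.[e 0%N] * Q.[e 1%N]) * (W.[e 0%N] * W.[e 1%N])); last by ring.
    by rewrite pmulr_rlt0 // mulr_gt0.
- split; last first.
    move=> i; have := xs01 i; have : (e 1%N)^-1 < 0 by rewrite invr_lt0.
    by move=> h1 /andP[h2 _]; apply/negP => /andP[_ h3]; have := le_lt_trans h3 (lt_trans h1 h2); rewrite ltxx.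
  move=> x /andP[x1 x2].
  have xneg : x < 0 by apply: (lt_trans x2); rewrite invr_lt0.
  have x0 : x != 0 by rewrite lt_eqF.
  have v1 : x^-1 < e 0%N by rewrite -[e 0%N]invrK ltf_nV2 ?qualifE //= invr_lt0.
  have v2 : e 1%N < x^-1 by rewrite -[e 1%N]invrK ltf_nV2 ?qualifE //= invr_lt0.
  have En v : e 1%N < v < e 0%N -> E.[v] != 0.
    move=> /andP[h1 h2]; have vn : v < 0 by lra.
    rewrite EFx; apply: mulf_neq0 => //; apply: mulf_neq0; last by rewrite expf_neq0 // Bn0.
    apply: mulf_neq0; first by apply: mulf_neq0; [rewrite lt_eqF|rewrite subr_eq0 lt_eqF //; lra].
    apply/prodf_neq0 => m _; rewrite subr_eq0; case: (posnP m) => hm.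
      by rewrite hm lt_eqF.
    have : e m <= e 1%N.
      have [->//|hm1] := eqVneq (m : nat) 1%N.
      by apply/ltW/e_decr => //; rewrite ltn_neqAle eq_sym hm1.
    by move=> k; rewrite gt_eqF //; lra.
  have Et : E.[- 9] < 0.
    rewrite EEx (_ : W.[- 9] = 0); last first.
      by rewrite WE (bigD1 (Ordinal g_gt0)) //= expr1 addNr mul0r.
    by rewrite expr0n mul0r sub0r oppr_lt0 mulr_gt0 ?P_gt0 ?exprn_even_gt0 //; lra.
  have xp : 0 < x ^+ (2 * M) by rewrite exprM exprn_gt0 // exprn_even_gt0.
  rewrite idE // pmulr_rlt0 //.
  (* E is negative at -9 and has no root in the interval, so a positive value would contradict the
     intermediate value theorem. *)
  have := En x^-1 ltac:(by rewrite v2); rewrite neq_lt => /orP[//|Ep].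
  have [k|k|k] := ltgtP x^-1 (- 9); last by move: Ep; rewrite k; lra.
    have [|r hr rr] := @sign_change_root R E x^-1 (- 9) k; first by rewrite pmulr_rlt0.
    by have := En r ltac:(lra); rewrite -[_ == 0]/(root E r) rr.
  have [|r hr rr] := @sign_change_root R E (- 9) x^-1 k; first by rewrite nmulr_rlt0.
  by have := En r ltac:(lra); rewrite -[_ == 0]/(root E r) rr.
Qed.

End AlternationPolys.

(** * Assembling the proof *)

Lemma cofr_zmod (R : realType) : zmod_morphism (@cofr R : R -> Cplx R). Proof. by move=> x y; exact: cofrB. Qed.
Lemma cofr_monoid (R : realType) : monoid_morphism (@cofr R : R -> Cplx R).
Proof. by split => // x y; exact: cofrM. Qed.
HB.instance Definition _ (R : realType) := GRing.isZmodMorphism.Build R (Cplx R) (@cofr R) (@cofr_zmod R).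
HB.instance Definition _ (R : realType) := GRing.isMonoidMorphism.Build R (Cplx R) (@cofr R) (@cofr_monoid R).

(** With N the sum of |a_i| over negative entries, half of sum |a_i| is N + k(g-1), which must
    exceed g. For g >= 2 this follows from k >= 3; for g = 1 it fails only when N <= 1, that is,
    when the type is empty or (1,-1). *)
Lemma order_budget (k g n : nat) (mu : n.-tuple int) : (3 <= k)%N -> (1 <= g)%N ->
  (forall i, tnth mu i != 0) -> \sum_(i < n) tnth mu i = k%:Z * (2%:Z * g%:Z - 2%:Z) ->
  ~ (g = 1%N /\ (perm_eq mu [:: 1; -1] \/ mu = [::] :> seq int)) ->
  exists2 d, (0 < d)%N & (\sum_(i < n) absz (tnth mu i) = 2 * (g + d))%N.
Proof.
move=> k3 g1 a0 aS ne.
have [N NE] : exists N : nat, (\sum_(i < n) absz (tnth mu i) = 2 * N + 2 * k * g.-1)%N.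
  have split_abs (c : int) : exists m : nat, (absz c)%:Z = 2%:Z * m%:Z + c.
    by exists (absz (Num.min c 0)); lia.
  have [F HF] := boolp.choice split_abs.
  exists (\sum_(i < n) F (tnth mu i))%N.
  have E : (\sum_(i < n) absz (tnth mu i))%N%:Z =
      2%:Z * (\sum_(i < n) F (tnth mu i))%N%:Z + k%:Z * (2%:Z * g%:Z - 2%:Z).
    rewrite -aS -[(\sum_(i < n) absz _)%N%:Z]natz -[(\sum_(i < n) F _)%N%:Z]natz !natr_sum mulr_sumr -big_split /=.
    by apply: eq_bigr => i _; rewrite !natz HF.
  by move: E; clear -g1; case: g g1 => // g' _ /=; nia.
have [le|gt] := leqP g.+1 (N + k * g.-1).
  by exists (N + k * g.-1 - g)%N; rewrite ?NE; move: le; clear; nia.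
have g1E : g = 1%N by move: gt k3 g1; clear; nia.
have Sle : (\sum_(i < n) absz (tnth mu i) <= 2)%N.
  by rewrite NE; move: gt; rewrite g1E /= !muln0 !addn0; clear; lia.
have nle : (n <= 2)%N.
  apply: leq_trans Sle; rewrite -[X in (X <= _)%N]muln1 -[X in (X * _ <= _)%N]card_ord -sum_nat_const.
  by apply: leq_sum => i _; rewrite lt0n absz_eq0.
exfalso; apply: ne; split => //; move: aS; rewrite g1E !mulr1 subrr mulr0 => aS.
case: n mu a0 aS Sle nle {NE} => [|[|[|n]]] mu a0 aS Sle // _.
- by right; rewrite tuple0.
- by move: aS; rewrite big_ord1 => E; have := a0 ord0; rewrite E eqxx.
left; case/tupleP: mu a0 aS Sle => x mu; case/tupleP: mu => y mu a0; rewrite (tuple0 mu).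
rewrite !big_ord_recl !big_ord0 !(tnth_nth 0) /= => aS Sle.
have := a0 ord0; rewrite (tnth_nth 0) /= => x0.
have [[-> ->]|[-> ->]] : (x = 1 /\ y = -1) \/ (x = -1 /\ y = 1) by move: aS Sle x0; clear; lia.
  exact: perm_refl.
by rewrite -[X in perm_eq X]cat1s perm_catC.
Qed.

(** The real polynomials of [alternation_polys] are transported to the complex numbers and fed to
    [kdiff_construction], [hyp_genus] and [primitive_of_band]. *)
Lemma stratum_nonempty (R : realType) (k g n : nat) (mu : n.-tuple int) : (3 <= k)%N -> (1 <= g)%N ->
  (forall i, tnth mu i != 0) -> \sum_(i < n) tnth mu i = k%:Z * (2%:Z * g%:Z - 2%:Z) ->
  ~ (g = 1%N /\ (perm_eq mu [:: 1; -1] \/ mu = [::] :> seq int)) ->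
  exists (S : compactRiemannSurface R) (xi : kDifferential k S),
  [/\ has_genus S g, kdiff_nonzero xi, kdiff_primitive xi & kdiff_type xi mu].
Proof.
move=> k3 g1 a0 aS ne; have [d d0 aA] := order_budget k3 g1 a0 aS ne.
pose a i := tnth mu i; pose C := Cplx R.
have [xs [es [A [B [lam [c [em [ep [H1 H2 H3 H4]]]]]]]]] :=
  @alternation_polys R g d n (fun i => absz (a i)) g1 d0 aA.
case: H1 => xs_inj es_uniq es_size lam0 c0; case: H2 => A_size B_size eqR Axs.
case: H3 => em_es ep_es emep Asign; case: H4 => Eneg xs_out.
pose cf : R -> C := @cofr R; pose xsC i : C := cofr (xs i); pose esC : seq C := map cf es.
(* A complex square root of c is absorbed into B, which turns c f B^2 into f B^2. *)
pose kap : C := csqrt (cofr c); pose AC : {poly C} := map_poly cf A; pose BC : {poly C} := kap *: map_poly cf B.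
pose Er := A ^+ 2 - lam *: \prod_(i < n) ('X - (xs i)%:P) ^+ absz (a i).
have cfi : injective cf := @cofr_inj R.
have cf0 x : x != 0 -> cf x != 0 by rewrite -(inj_eq cfi).
have esC_uniq : uniq esC by rewrite map_inj_uniq.
have esC_size : size esC = (2 * g).+1 by rewrite size_map.
have xsC_inj : injective xsC by move=> i j /cfi /xs_inj.
have xsC_es i : xsC i \notin esC by rewrite -[xsC i]/(cf (xs i)) (mem_map cfi); case: (Axs i).
have ACx t : AC.[cofr t] = cofr A.[t] by rewrite /AC horner_map.
have PE : map_poly cf Er = AC ^+ 2 - cofr lam *: \prod_(i < n) ('X - (xsC i)%:P) ^+ absz (a i).
  rewrite /Er rmorphB rmorphXn /= map_polyZ rmorph_prod; congr (_ - _ *: _).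
  by apply: eq_bigr => i _; rewrite rmorphXn /= rmorphB /= map_polyX map_polyC.
have eqC : AC ^+ 2 - cofr lam *: \prod_(i < n) ('X - (xsC i)%:P) ^+ absz (a i) = BC ^+ 2 * hf esC.
  rewrite -PE /Er eqR map_polyZ rmorphM rmorphXn /= rmorph_prod /BC exprZn csqrtK /hf /esC big_map.
  rewrite -scalerAl mulrC; congr (_ *: (_ * _)).
  by apply: eq_bigr => e _; rewrite rmorphB /= map_polyX map_polyC.
have AC_size : size AC = (g + d).+1 by rewrite size_map_inj_poly ?rmorph0 // A_size.
have BC_size : (size BC <= d)%N.
  by apply: leq_trans (size_scale_leq _ _) _; rewrite size_map_inj_poly ?rmorph0.
have lamC0 : cofr lam != 0 :> C by exact: cf0.
have ACx0 i : AC.[xsC i] != 0 by rewrite /xsC ACx; apply: cf0; case: (Axs i).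
have [xi [xiE xi0 xit]] := @kdiff_construction R esC g d k n xsC a AC BC (cofr lam) esC_uniq esC_size g1
  xsC_inj xsC_es a0 aA aS AC_size BC_size d0 lamC0 ACx0 eqC.
exists (hsurf (esC ++ codom xsC) esC_uniq esC_size g1), xi; split.
- by apply: hyp_genus => x h; rewrite mem_cat h.
- exact: xi0.
- pose nu t := \prod_(i < n | a i < 0) (t - xs i) ^+ absz (a i).
  have nuE t : rootP xsC a (neg a) (cofr t) = cofr (nu t).
    rewrite /rootP /nu (rmorph_prod cf); apply: eq_bigr => i _.
    by rewrite /xsC -cofrB -cofrX.
  have BE t : BC.[cofr t] ^+ 2 * (hf esC).[cofr t] = cofr Er.[t].
    by rewrite -horner_exp -hornerM -eqC -PE (horner_map cf).
  have sides t i : em <= t <= ep -> 0 < (em - xs i) * (t - xs i).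
    move=> /andP[t1 t2]; have := xs_out i; rewrite negb_and -!ltNge => /orP[] h.
      by rewrite mulr_gt0 // subr_gt0 //; lra.
    by rewrite nmulr_rgt0 subr_lt0; lra.
  apply: (@primitive_of_band R esC (esC ++ codom xsC) g k esC_uniq esC_size _ g1 BC A Er nu em ep
    (Phi xsC a AC BC (cofr lam))).
  + by move=> x h; rewrite mem_cat h.
  + by move: k3; clear; lia.
  + exact: emep.
  + exact: map_f.
  + exact: map_f.
  + exact: BE.
  + exact: Eneg.
  (* On the band x is none of the x_i, so the norm is nonzero and the first expression of [Phi]
     applies. *)
  + move=> t y tin yE; rewrite /Phi; case: ifPn => [_|]; first by rewrite /nF ACx nuE.
    have tx i : cofr t != xsC i.
      apply: contraTneq (sides t i tin) => /cfi ->.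
      by rewrite subrr mulr0 ltxx.
    have := nFFi eqC yE; rewrite negbK => FF /eqP F0; move: FF; rewrite F0 mul0r => /esym/eqP.
    by rewrite !mulf_eq0 (negbTE lamC0) !(negbTE (rootP_neq0 _ _)).
  + move=> t tin; rewrite /nu -big_split /=; apply: prodr_gt0 => i _.
    by rewrite -exprMn exprn_gt0 // sides.
  + exact: Asign.
  + exact: xiE.
- exact: xit.
Qed.

Theorem mainTheorem3 (R : realType) (k g n : nat) (mu : n.-tuple int)
    (hk : (3 <= k)%N) (hg : (1 <= g)%N)
    (mu_neq0 : forall i : 'I_n, tnth mu i != 0)
    (mu_sum : \sum_(i < n) tnth mu i = k%:Z * (2%:Z * g%:Z - 2%:Z))
    (mu_gt : forall i : 'I_n, - k%:Z < tnth mu i) :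
  stratum_empty R k g mu <->
  g = 1%N /\ (perm_eq mu [:: 1; -1] \/ mu = [::] :> seq int).
Proof.
split=> [empty|].
  apply: contrapT => ne.
  have [S [xi [h1 h2 h3 h4]]] := stratum_nonempty R hk hg mu_neq0 mu_sum ne.
  pose P := KPair xi; apply: (empty (fun Q => kpair_iso P Q)); exists P; split => //.
move=> [g1 type] A [[S xi] [/= hgen hnz hprim [p [p_inj p_ord p_only]] _]].
subst g; clear A; case: k hk mu_sum mu_gt xi hnz hprim p_ord p_only => [|[|[|k']]] // _ _ _ xi hnz hprim p_ord p_only.
have [w w_holo w_nz] := genus1_form hgen.
case: type => [pm|m0]; last first.
  apply: (no_order_free hnz w_holo w_nz _ hprim) => x m om; apply/eqP/contraT => mn0.
  have [l _] := p_only x m om mn0; have := ltn_ord l.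
  by rewrite -{2}(size_tuple mu) m0.
have sz : n = 2%N by rewrite -(size_tuple mu) (perm_size pm).
have find (a : int) : a \in [:: 1; -1] -> exists l, tnth mu l = a.
  by rewrite -(perm_mem pm) => /tnthP[l ->]; exists l.
have [l1 E1] : exists l, tnth mu l = 1 by apply: find; rewrite inE eqxx.
have [l2 E2] : exists l, tnth mu l = -1 by apply: find; rewrite !inE eqxx orbT.
have l12 : l2 != l1 by apply: contra_eq_neq E2 => ->; rewrite E1.
have lE l : l = l2 \/ l = l1.
  have c : (#|[set l2; l1]%SET| = n)%N by rewrite cards2 l12 sz.
  have full : [set l2; l1]%SET = [set: 'I_n]%SET.
    by apply/eqP; rewrite eqEcard finset.subsetT cardsT card_ord c leqnn.
  have : l \in [set l2; l1]%SET by rewrite full finset.in_setT.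
  by rewrite finset.in_set2 => /orP[] /eqP; [left|right].
apply: (@no_simple_pole _ _ _ _ hnz w w_holo w_nz (p l2) (p l1)).
- by move=> /p_inj /eqP; rewrite (negbTE l12).
- by rewrite -E1; exact: p_ord.
- by rewrite -E2; exact: p_ord.
- by move=> x m om /(p_only x m om)[l ->]; case: (lE l) => ->; [left|right].
Qed.
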